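(* Suppose that conditions (A), (B), (D) and (C$'$) of the context are fulfilled, that for all $h\in D(A)$ and $\alpha\in(0,1]$ the function $(t,x)\mapsto\langle h,F_\alpha(t,x)\rangle$ is continuous on $[0,T]\times H$, and that the function $V$ in (C$'$) satisfies $|x|^2\le V(t,x)$ for all $(t,x)\in D(F)$. Let $H_0=\{x\in H:\int_0^TV^2(t,x)dt<\infty\}$ and let $p_{s,t}(x,dy)$, $x\in H_0$, $0\le s\le t\le T$, $s<T$, be the probability measures defined in the context. Let $0\le r<t\le T$. Then for every $x\in H_0$ and every $s\in(r,t)$ such that $p_{r,s}(x,H_0)=1$ the Chapman--Kolmogorov equation $$\int_Hp_{s,t}(x',dy)\,p_{r,s}(x,dx')=p_{r,t}(x,dy)$$ holds, i.e. for all $f\in\mathcal B_b(H)$ $$\int_H\int_Hf(y)\,p_{s,t}(x',dy)\,p_{r,s}(x,dx')=\int_Hf(y)\,p_{r,t}(x,dy).$$ (The outer integral is over $x'\in H_0$, a set of full $p_{r,s}(x,\cdot)$-measure.)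
   Context: Setting. $H$ is a separable real Hilbert space with inner product $\langle\cdot,\cdot\rangle$ and norm $|\cdot|$; $L(H)$ is the space of bounded linear operators on $H$; $\mathcal B(H)$ is the Borel $\sigma$-algebra, $\mathcal B_b(H)$ the bounded Borel functions $H\to\mathbb R$, $\mathcal P(H)$ the Borel probability measures on $H$. $\tau_w$ is the weak topology of $H$; ''$\tau_w$-weak convergence'' of probability measures means convergence of integrals of bounded $\tau_w$-continuous functions. $T>0$ is fixed. $A:D(A)\subset H\to H$ generates a $C_0$-semigroup $e^{tA}$, $C\in L(H)$ is symmetric and nonnegative, $D(F)$ is a Borel subset of $[0,T]\times H$ and $F:D(F)\to H$ is measurable. For $t\in[0,T]$ put $D(F(t,\cdot))=\{x\in H:(t,x)\in D(F)\}$, and set $|F(t,x)|:=\infty$ for $(t,x)\notin D(F)$. Kolmogorov operator. $D(L_0)$ is the linear span of all real and imaginary parts of functions $u(t,x)=\phi(t)e^{i\langle x,h(t)\rangle}$, $t\in[0,T]$, $x\in H$, with $\phi\in C^1([0,T])$, $\phi(T)=0$, $h\in C^1([0,T];D(A^* ))$. For $u\in D(L_0)$, $$L_0u(t,x)=D_tu(t,x)+\tfrac12\mathrm{Tr}[CD_x^2u(t,x)]+\langle x,A^*D_xu(t,x)\rangle+\langle F(t,x),D_xu(t,x)\rangle .$$ Fokker--Planck equation (FP). A solution with initial time $s$ and initial condition $\zeta\in\mathcal P(H)$ is a measure $\mu(dt,dx)=\mu_t(dx)dt$ on $[s,T]\times H$, where $\mu_t\in\mathcal P(H)$ for all $t\in[s,T]$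 and $t\mapsto\mu_t(B)$ is measurable for all $B\in\mathcal B(H)$, such that $\int_s^T\int_H(|\langle y,A^*h(t)\rangle|+|F(t,y)|)\mu_t(dy)dt<\infty$ for all $h\in C^1([0,T];D(A^* ))$ and, for all $u\in D(L_0)$, $$\int_Hu(t,y)\mu_t(dy)=\int_Hu(s,y)\zeta(dy)+\int_s^tds'\int_HL_0u(s',y)\mu_{s'}(dy)\quad\text{for } dt\text{-a.e. } t\in[s,T].$$ The class $\mathcal M_{s,\zeta}$: all finite measures $\nu$ on $[s,T]\times H$ such that (i) $\nu(dt,dx)=\nu_t(dx)dt$ with $\nu_t(dx)$ a kernel from $([s,T],\mathcal B([s,T]))$ to $(H,\mathcal B(H))$, $\nu_t\in\mathcal P(H)$ for every $t\in[s,T]$, and $\nu_t(D(F(t,\cdot)))=1$ for $dt$-a.e. $t\in[s,T]$; (ii) $\int_s^T\int_H(|x|^2+|F(t,x)|+|x|^2|F(t,x)|)\nu_t(dx)dt<\infty$; (iii) $\nu_t(dx)dt$ satisfies the identity in (FP) for all $u\in D(L_0)$. (A) $A$ is self-adjoint and there is $\omega\in\mathbb R$ with $\langle Ax,x\rangle\le\omega|x|^2$ for $x\in D(A)$; $C\in L(H)$ is symmetric, nonnegative, with $C^{-1}\in L(H)$; $-A$ is positive with bounded inverse (so that its powers are defined) and there is $\delta\in(0,1/2)$ such that $(-A)^{-2\delta}$ is of trace class. (B) There are bounded measurable maps $F_\alpha:[0,T]\times H\to H$, $\alpha\in(0,1]$, such that for all $(t,x)\in D(F)$, $h\in D(A)$,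 $\alpha\in(0,1]$: $\lim_{\alpha\to0}\langle h,F_\alpha(t,x)\rangle=\langle h,F(t,x)\rangle$; $|F_\alpha(t,x)|\le|F(t,x)|$; and $|\langle h,F(t,x)-F_\alpha(t,x)\rangle|\le\alpha c(h)|F(t,x)|$ for some constant $c(h)>0$. Approximating equation. For $s\in[0,T]$, $x\in H$, $X_\alpha(\cdot,s,x)$ denotes the martingale (weak, mild) solution, which exists by Girsanov's theorem, of $dX_\alpha(t)=[AX_\alpha(t)+F_\alpha(t,X_\alpha(t))]dt+\sqrt C\,dW(t)$, $t\ge s$, $X_\alpha(s)=x$, with $W$ a cylindrical Wiener process on $H$; and $P^\alpha_{s,t}\varphi(x)=\mathbb E[\varphi(X_\alpha(t,s,x))]$ for $s\le t\le T$, for $\varphi\in\mathcal B_b(H)$ and also for measurable $\varphi\ge0$. (C$'$) There is a lower semicontinuous $V:[0,T]\times H\to[1,\infty]$ with $|F|\le V$ on $[0,T]\times H$ (with $|F|=\infty$ off $D(F)$) such that for every $s\in[0,T)$ there is $K>0$ with $$P^\alpha_{s,t}V^2(t,\cdot)(x)\le KV^2(t,x)<\infty\quad\text{for all }(t,x)\in D(F),\ t\in[s,T],\ \alpha\in(0,1].$$ (D) There is a family of $m$-quasi-dissipative maps $\bar F(t,\cdot):D(\bar F(t,\cdot))\subset H\to2^H$, $t\in[0,T]$, i.e. each $D(\bar F(t,\cdot))\in\mathcal B(H)$ and there is $K_0>0$ independent of $t$ such that $\langle u-v,x-y\rangle\le K_0|x-y|^2$ for all $x,y\in D(\bar F(t,\cdot))$,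 $u\in\bar F(t,x)$, $v\in\bar F(t,y)$, and $\bigcup_{x\in D(\bar F(t,\cdot))}(\lambda x-\bar F(t,x))=H$ for every $\lambda>K_0$; moreover, for every $t\in[0,T]$, $D(F(t,\cdot))=D(\bar F(t,\cdot))$ and for all $x\in D(\bar F(t,\cdot))$: $F(t,x)\in\bar F(t,x)$ and $|F(t,x)|=\min_{y\in\bar F(t,x)}|y|$. The measures $p_{s,t}(x,dy)$. Under these assumptions it is known that for every $s\in[0,T)$ and $x\in H_0$ there is a family $p_{s,t}(x,\cdot)\in\mathcal P(H)$, $t\in[s,T]$, such that $p_{s,t}(x,dy)dt$ is the unique element of $\mathcal M_{s,\delta_x}$ ($\delta_x$ the Dirac measure at $x$), $t\mapsto\int_Hu(t,y)p_{s,t}(x,dy)$ is continuous on $[s,T]$ for all $u\in D(L_0)$, the identity in (FP) with $\zeta=\delta_x$ holds for all $t\in[s,T]$, and for each $t\in[s,T]$ the law of $X_\alpha(t,s,x)$ converges $\tau_w$-weakly to $p_{s,t}(x,\cdot)$ as $\alpha\to0$ (the last property determines the family). *)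

(* Defs.v *)
From HB Require Import structures.
From mathcomp Require Import all_boot all_order all_algebra.
From mathcomp Require Import all_classical all_reals all_analysis.
From mathcomp Require Import measurable_realfun.
Import Order.TTheory GRing.Theory Num.Theory.
Import numFieldNormedType.Exports.

Set Implicit Arguments.
Unset Strict Implicit.
Unset Printing Implicit Defensive.

Local Open Scope classical_set_scope.
Local Open Scope ring_scope.

HB.mixin Record CompleteNormedModule_isHilbert (R : realType) (H : Type)
    & CompleteNormedModule R H := {
  dotp : {dot H for idfun} ;
  dotpp : forall x : H, dotp x x = `|x| ^+ 2
}.

#[short(type="hilbertType")]
HB.structure Definition Hilbert (R : realType) :=
  {H of CompleteNormedModule_isHilbert R H & CompleteNormedModule R H}.

Definition separable (X : topologicalType) :=
  exists2 E : set X, countable E & dense E.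

Definition borel (X : ptopologicalType) := g_sigma_algebraType (@open X).

(* R * H with the product of the Borel sigma-algebras; H being separable, this
   is the Borel sigma-algebra of the product. *)
Notation borel_prod R H := (measurableTypeR R * borel H)%type.

Section operators.
Context {R : realType} {H : hilbertType R}.
Implicit Types (D : set H) (A B C Q : H -> H).

(* An unbounded operator is a domain D together with A : H -> H, whose values
   outside D are irrelevant. *)

Definition adj_dom D A : set H :=
  [set y | exists z, forall x, D x -> dotp (A x) y = dotp x z].

Definition adj D A (y : H) : H :=
  xget 0 [set z | forall x, D x -> dotp (A x) y = dotp x z].

Definition self_adjoint D A :=
  [/\ dense D, adj_dom D A = D & forall x, D x -> adj D A x = A x].

Definition bounded_op B := linear B /\ continuous B.

Definition symmetric_op B := forall x y, dotp (B x) y = dotp x (B y).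

Definition nonneg_op B := forall x, 0 <= dotp (B x) x.

Definition op_sqrt C Q :=
  [/\ bounded_op Q, symmetric_op Q, nonneg_op Q & forall x, Q (Q x) = C x].

Definition bounded_inverse D A B :=
  [/\ bounded_op B, forall x, D x -> B (A x) = x
    & forall y, D (B y) /\ A (B y) = y].

Definition nuclear_rep B (a b : nat -> H) :=
  (\sum_(0 <= n <oo) (`|a n| * `|b n|)%:E < +oo)%E /\
  forall x, [series dotp x (a n) *: b n]_n @ \oo --> B x.

Definition trace_class B := exists a b, nuclear_rep B a b.

(* Zero vectors are allowed, so that sequences also index the bases of a
   finite-dimensional space. *)
Definition orthonormal_basis (e : nat -> H) :=
  [/\ forall i j, i != j -> dotp (e i) (e j) = 0,
      forall i, e i = 0 \/ `|e i| = 1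
    & forall x, [series dotp x (e n) *: e n]_n @ \oo --> x].

Definition trace B : R :=
  xget 0 [set c | forall e, orthonormal_basis e ->
                    [series dotp (B (e n)) (e n)]_n @ \oo --> c].

Definition C0_semigroup (S : R -> H -> H) :=
  [/\ forall t, 0 <= t -> bounded_op (S t),
      forall x, S 0 x = x,
      forall t r x, 0 <= t -> 0 <= r -> S (t + r) x = S t (S r x)
    & forall x, S t x @[t --> 0^'+] --> x].

Definition generates D A (S : R -> H -> H) :=
  [/\ C0_semigroup S,
      forall x, D x -> t^-1 *: (S t x - x) @[t --> 0^'+] --> A x
    & forall x (y : H), t^-1 *: (S t x - x) @[t --> 0^'+] --> y -> D x].

Definition Euler_Gamma (c : R) : R :=
  \int[lebesgue_measure]_(t in `]0, +oo[) (t `^ (c - 1) * expR (- t)).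

(* B = (-A)^(-c) for c > 0, where A generates the exponentially stable
   semigroup S: B is 1 / Gamma(c) times the (weak) integral over ]0, +oo[ of
   t^(c-1) S(t) dt. *)
Definition neg_power (S : R -> H -> H) (c : R) B :=
  bounded_op B /\
  forall x y, dotp (B x) y = (Euler_Gamma c)^-1 *
    \int[lebesgue_measure]_(t in `]0, +oo[) (t `^ (c - 1) * dotp (S t x) y).

End operators.

Section kolmogorov.
Context {R : realType} {H : hilbertType R}.
Variables (T : R) (DA : set H) (A C : H -> H) (F : R -> H -> H).

Definition C1_with {E : normedModType R} (g dg : R -> E) :=
  [/\ {within `[0, T], continuous g}, {within `[0, T], continuous dg}
    & forall t, t \in `]0, T[ -> is_derive t 1 g (dg t)].

(* C^1([0,T]; D(A^* )), where D(A^* ) carries the graph norm *)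
Definition C1_adj_dom (h : R -> H) := exists dh : R -> H,
  [/\ forall t, t \in `[0, T] -> adj_dom DA A (h t) /\ adj_dom DA A (dh t),
      C1_with h dh & C1_with (adj DA A \o h) (adj DA A \o dh)].

Definition exp_test (u : R -> H -> R) :=
  exists (phi dphi : R -> R) (h : R -> H),
  [/\ C1_with (phi : R -> R^o) (dphi : R -> R^o), phi T = 0, C1_adj_dom h
    & u = (fun t x => phi t * cos (dotp x (h t))) \/
      u = (fun t x => phi t * sin (dotp x (h t)))].

Definition D_L0 (u : R -> H -> R) :=
  exists (n : nat) (c : 'I_n -> R) (v : 'I_n -> R -> H -> R),
    (forall i, exp_test (v i)) /\
    u = (fun t x => \sum_(i < n) c i * v i t x).

Definition gradient (f : H -> R) (x : H) : H :=
  xget 0 [set g | differentiable (f : H -> R^o) x /\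
                  forall y, 'd (f : H -> R^o) x y = dotp g y].

Definition hessian (f : H -> R) (x : H) : H -> H := 'd (gradient f) x.

Definition L0 (u : R -> H -> R) (t : R) (x : H) : R :=
  'D_1 (fun r : R => u r x : R^o) t
  + 2^-1 * trace (C \o hessian (u t) x)
  + dotp x (adj DA A (gradient (u t) x))
  + dotp (F t x) (gradient (u t) x).

End kolmogorov.

Section fokker_planck.
Context {R : realType} {H : hilbertType R}.
Variables (T : R) (DA : set H) (A C : H -> H).
Variables (DF : set (R * H)) (F : R -> H -> H).

Definition cylinder : set (R * H) := `[0, T] `*` setT.

Definition slice (t : R) : set H := [set x | DF (t, x)].

Definition normF (t : R) (x : H) : \bar R :=
  if (t, x) \in DF then `|F t x|%:E else +oo%E.

Definition FP_at (s : R) (zeta : probability (borel H) R)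
    (nu : R -> probability (borel H) R) (u : R -> H -> R) (t : R) :=
  (\int[nu t]_y (u t y)%:E = \int[zeta]_y (u s y)%:E +
    \int[lebesgue_measure]_(r in `[s, t])
      \int[nu r]_y (L0 DA A C F u r y)%:E)%E.

(* N(dt,dx) = nu_t(dx)dt on [s,T] x H, with nu a kernel on [s,T] *)
Definition disintegration (s : R)
    (N : {finite_measure set (borel_prod R H) -> \bar R})
    (nu : R -> probability (borel H) R) :=
  (forall B : set (borel H), measurable B ->
     measurable_fun (`[s, T] : set (measurableTypeR R)) (fun t => nu t B)) /\
  (forall E : set (borel_prod R H), measurable E ->
     N E = \int[lebesgue_measure]_(t in `[s, T]) nu t (xsection E t))%E.

Definition M_class (s : R) (zeta : probability (borel H) R)
    (N : {finite_measure set (borel_prod R H) -> \bar R}) :=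
  exists nu : R -> probability (borel H) R,
  [/\ disintegration s N nu,
      {ae lebesgue_measure, forall t, t \in `[s, T] ->
         nu t (slice t) = 1%E},
      (\int[lebesgue_measure]_(t in `[s, T]) \int[nu t]_y
         ((`|y| ^+ 2)%:E + normF t y + (`|y| ^+ 2)%:E * normF t y) < +oo)%E
    & forall u, D_L0 T DA A u ->
        {ae lebesgue_measure, forall t, t \in `[s, T] -> FP_at s zeta nu u t}].

End fokker_planck.

(* A filtered probability space with a cylindrical process W on H (W t h plays
   the role of <W(t), h>) and an H-valued process X. *)
Record stoch_system (R : realType) (H : hilbertType R) := StochSystem {
  ss_disp : measure_display ;
  ss_space : measurableType ss_disp ;
  ss_prob : probability ss_space R ;
  ss_filt : R -> set (set ss_space) ;
  ss_W : R -> H -> ss_space -> R ;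
  ss_X : R -> ss_space -> H }.

Section stochastic.
Context {R : realType} {H : hilbertType R}.

Definition filtration d (Om : measurableType d) (G : R -> set (set Om)) :=
  [/\ forall t, 0 <= t -> sigma_algebra setT (G t),
      forall t, 0 <= t -> G t `<=` measurable
    & forall r t, 0 <= r -> r <= t -> G r `<=` G t].

Definition increment {Om : Type} (W : R -> H -> Om -> R) (r t : R) (h : H) :=
  fun w => W t h w - W r h w.

(* Linearity in h and the laws of the increments give the covariances
   E[W t h * W r k] = min(t,r) <h,k>. *)
Definition cylindrical_wiener d (Om : measurableType d) (P : probability Om R)
    (G : R -> set (set Om)) (W : R -> H -> Om -> R) :=
  [/\ forall t h (B : set (measurableTypeR R)), 0 <= t -> measurable B ->
        G t (W t h @^-1` B),
      forall t a h k, 0 <= t ->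
        {ae P, forall w, W t (a *: h + k) w = a * W t h w + W t k w},
      forall h, {ae P, forall w, W 0 h w = 0 /\
        {within `[0, +oo[, continuous (fun t => W t h w)}},
      forall r t h (B : set (measurableTypeR R)),
        0 <= r -> r < t -> h != 0 -> measurable B ->
        P (increment W r t h @^-1` B)
        = normal_prob 0 (Num.sqrt (t - r) * `|h|) B
    & forall r t h (B : set (measurableTypeR R)) (E : set Om),
        0 <= r -> r <= t -> measurable B -> G r E ->
        P (E `&` increment W r t h @^-1` B)
        = (P E * P (increment W r t h @^-1` B))%E].

Definition grid (a b : R) (n k : nat) : R := a + (b - a) * (k%:R / n%:R).

(* I is the Wiener integral over [a,b] of <g(r), dW(r)>, for a deterministic
   continuous g: the L^2 limit of the Riemann sums along the uniform grids. *)
Definition wiener_integral d (Om : measurableType d) (P : probability Om R)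
    (W : R -> H -> Om -> R) (a b : R) (g : R -> H) (I : Om -> R) :=
  measurable_fun setT I /\
  (\int[P]_w ((I w - \sum_(k < n)
       increment W (grid a b n k) (grid a b n k.+1) (g (grid a b n k)) w) ^+ 2)%:E)%E
    @[n --> \oo] --> 0%E.

(* Weak (in the probabilistic sense) mild solution on [s,T] of
   dX = (AX + G(t,X))dt + sqrt C dW, X(s) = x, S being the semigroup of A: the
   mild equation
     X(t) = S(t-s)x + int_s^t S(t-r)G(r,X(r))dr + int_s^t S(t-r) sqrt C dW(r)
   is tested against all h in H. *)
Definition mild_solution (T : R) (S : R -> H -> H) (C : H -> H)
    (G : R -> H -> H) (s : R) (x : H) (Y : stoch_system H) :=
  let P := ss_prob Y in
  let W := @ss_W _ _ Y in
  let X := @ss_X _ _ Y in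
  [/\ filtration (@ss_filt _ _ Y),
      cylindrical_wiener P (@ss_filt _ _ Y) W,
      forall t (B : set (borel H)), t \in `[s, T] -> measurable B ->
        ss_filt t (X t @^-1` B),
      measurable_fun (`[s, T] `*` setT : set (measurableTypeR R * ss_space Y))
        (fun z => X z.1 z.2 : borel H)
    & exists2 Q : H -> H, op_sqrt C Q &
      forall t h, t \in `[s, T] -> exists2 I : ss_space Y -> R,
        wiener_integral P W s t (fun r => Q (adj setT (S (t - r)) h)) I &
        {ae P, forall w, dotp (X t w) h = dotp (S (t - s) x) h
           + \int[lebesgue_measure]_(r in `[s, t])
               dotp (S (t - r) (G r (X r w))) h
           + I w}].

(* (P_{s,t} phi)(x), when Y carries the solution started from x at time s *)
Definition Psem (Y : stoch_system H) (t : R) (phi : H -> \bar R) : \bar R :=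
  (\int[ss_prob Y]_w phi (ss_X t w))%E.

Definition weak_space : Type :=
  initial_topology
    (fun x : H => (fun h : H => dotp x h) : prod_topology (fun _ : H => R)).
HB.instance Definition _ := Topological.on weak_space.

Definition weakly_continuous (g : H -> R) := continuous (g : weak_space -> R).

Definition bounded_fct {X : Type} (g : X -> R) :=
  exists M, forall y, `|g y| <= M.

End stochastic.

Section assumptions.
Context {R : realType} {H : hilbertType R}.
Variables (T : R) (DA : set H) (A : H -> H) (S : R -> H -> H) (C : H -> H).
Variables (DF : set (R * H)) (F : R -> H -> H) (Fa : R -> R -> H -> H).

Definition setting :=
  [/\ 0 < T,
      generates DA A S,
      [/\ bounded_op C, symmetric_op C & nonneg_op C],
      DF `<=` cylinder T /\ measurable (DF : set (borel_prod R H))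
    & measurable_fun (DF : set (borel_prod R H))
        (fun z => F z.1 z.2 : borel H)].

Definition condA :=
  [/\ self_adjoint DA A,
      exists omega : R, forall x, DA x -> dotp (A x) x <= omega * `|x| ^+ 2,
      [/\ bounded_op C, symmetric_op C, nonneg_op C
        & exists Ci, bounded_inverse setT C Ci],
      (forall x, DA x -> x != 0 -> 0 < dotp (- A x) x) /\
      (exists B, bounded_inverse DA (fun x => - A x) B)
    & exists2 delta : R, 0 < delta < 2^-1 &
        exists2 B, neg_power S (2 * delta) B & trace_class B].

Definition condB :=
  (forall al, 0 < al <= 1 ->
    (exists M : R, forall t x, t \in `[0, T] -> `|Fa al t x| <= M) /\
    measurable_fun (cylinder T : set (borel_prod R H))
      (fun z => Fa al z.1 z.2 : borel H)) /\
  [/\ forall t x h, DF (t, x) -> DA h ->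
        dotp h (Fa al t x) @[al --> 0^'+] --> dotp h (F t x),
      forall t x al, DF (t, x) -> 0 < al <= 1 -> `|Fa al t x| <= `|F t x|
    & forall h, DA h -> exists2 c : R, 0 < c &
        forall t x al, DF (t, x) -> 0 < al <= 1 ->
          `|dotp h (F t x - Fa al t x)| <= al * c * `|F t x|].

(* X al s x is the solution started from x at time s of the equation with
   drift F_al. *)
Definition approximations (X : R -> R -> H -> stoch_system H) :=
  forall al s x, 0 < al <= 1 -> s \in `[0, T] ->
    mild_solution T S C (Fa al) s x (X al s x).

Definition condC' (X : R -> R -> H -> stoch_system H) (V : R * H -> \bar R) :=
  [/\ lower_semicontinuous (V : subspace (cylinder T) -> \bar R),
      forall z, cylinder T z -> (1 <= V z)%E,
      forall t x, cylinder T (t, x) -> (normF DF F t x <= V (t, x))%E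
    & forall s, 0 <= s < T -> exists2 K : R, 0 < K &
        forall t x al, DF (t, x) -> t \in `[s, T] -> 0 < al <= 1 ->
          (Psem (X al s x) t (fun y => V (t, y) ^+ 2) <= K%:E * V (t, x) ^+ 2
             /\ V (t, x) ^+ 2 < +oo)%E].

(* The graph Fb t x is only relevant for x in Db t. *)
Definition condD :=
  exists (Db : R -> set H) (Fb : R -> H -> set H) (K0 : R),
  [/\ 0 < K0,
      forall t, t \in `[0, T] -> measurable (Db t : set (borel H)),
      forall t x y u v, t \in `[0, T] -> Db t x -> Db t y -> Fb t x u ->
        Fb t y v -> dotp (u - v) (x - y) <= K0 * `|x - y| ^+ 2,
      forall t lam z, t \in `[0, T] -> K0 < lam ->
        exists x u, [/\ Db t x, Fb t x u & z = lam *: x - u]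
    & forall t, t \in `[0, T] -> slice DF t = Db t /\
        forall x, Db t x -> Fb t x (F t x) /\
          forall y, Fb t x y -> `|F t x| <= `|y|].

Definition H0 (V : R * H -> \bar R) : set H :=
  [set x | (\int[lebesgue_measure]_(t in `[0%R, T]) (V (t, x) ^+ 2) < +oo)%E].

Definition transition_family (X : R -> R -> H -> stoch_system H)
    (V : R * H -> \bar R) (p : R -> R -> H -> probability (borel H) R) :=
  forall s x, 0 <= s < T -> H0 V x ->
  [/\ exists N : {finite_measure set (borel_prod R H) -> \bar R},
        [/\ disintegration T s N (fun t => p s t x),
            M_class T DA A C DF F s (dirac (x : borel H)) N
          & forall N', M_class T DA A C DF F s (dirac (x : borel H)) N' ->
              forall E, measurable E -> N' E = N E],
      forall u, D_L0 T DA A u ->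
        {within `[s, T], continuous (fun t => \int[p s t x]_y u t y)},
      forall u t, D_L0 T DA A u -> t \in `[s, T] ->
        FP_at DA A C F s (dirac (x : borel H)) (fun r => p s r x) u t
    & forall t (g : H -> R), t \in `[s, T] ->
        bounded_fct g -> weakly_continuous g ->
        \int[ss_prob (X al s x)]_w g (ss_X t w) @[al --> 0^'+]
          --> \int[p s t x]_y g y].

End assumptions.

(* Main.v *)
(* With u(T,.) = 0, an element of M_{s,delta_x} is characterized by the identities
   int L_0 u dN = -u(s,x) for u in D(L_0), which N restricted to [s,T] satisfies
   with delta_x replaced by zeta = p_{r,s}(x,.).  As D(L_0) is stable under
   polynomials without constant term, a convex one yields a Kato inequality
   int (-u(s,.))^+ dzeta <= int (L_0 u)^+ dmu for such a restriction mu.  By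
   Hahn-Banach, mu then splits into two measures with initial data zeta|_K and
   zeta|_{K^c}, for every Borel set K.  Replacing the first part by the mixture
   of the measures p_{s,q}(y,dz)dq, y in K, produces another element of
   M_{r,delta_x}; by uniqueness it is the same, so the mixture over H_0 is mu.  The
   mixture makes sense because the pairs (y, N) such that N is a solution from y
   are cut out by countably many equations, so that uniqueness and Lusin's
   separation theorem give the measurability of the solution in y.

   Testing against (T - q) cos(<y,h> + theta) and averaging in time gives the
   equation for every t < T.  At t = T all test functions vanish, and the
   approximating equations are used instead: for h in D(A), the increments of
   <X_alpha(q), S(T-q)^* h> between t and T tend to 0 in probability as t -> T,
   uniformly in alpha, since P^alpha V^2 <= K V^2 controls the drift and the
   Wiener integral has variance of order T - t. *)

Require Import Defs.
From HB Require Import structures.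
From mathcomp Require Import all_boot all_order all_algebra.
From mathcomp Require Import all_classical all_reals all_analysis.
From mathcomp Require Import measurable_realfun.
From mathcomp Require Import lra ring.
From mathcomp Require polyrcf.
Import Order.TTheory GRing.Theory Num.Theory.
Import numFieldNormedType.Exports.
Set Implicit Arguments.
Unset Strict Implicit.
Unset Printing Implicit Defensive.
Local Open Scope classical_set_scope.
Local Open Scope ring_scope.

(** * Souslin sets *)

(** Uniqueness is available only for Dirac initial data and only among measures integrating the
    weight [theta]. The mixture over H_0 may have an infinite [theta]-integral, so it cannot be
    compared with mu directly. This is why mu is split along K_n, the set of y whose solution has
    [theta]-integral at most n: the part of mu started from K_n is exchanged for a mixture of finite
    weight, while the rest of mu and the part of N before s stay as they are. Cancelling the common
    parts gives only that the mixture over K_n is at most mu. Letting n grow, the mixture over H_0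
    is at most mu, and both have mass T - s, hence they agree.

    Kato's inequality has a double role in the splitting. It dominates the functional sending L_0 u
    to - int_K u(s,.) dzeta by f |-> int f^+ dmu, and it implies that this functional is well
    defined, although u itself need not be determined by L_0 u on the support of mu.

    The space-time identity says nothing about a fixed t by itself; values at t are recovered from
    averages over shrinking time windows, by continuity in time. *)

Definition souslin (X : topologicalType) (A : set X) :=
  exists D : seq nat -> set X, (forall s, closed (D s)) /\
    A = [set x | exists b : nat -> nat, forall n, D (mkseq b n) x].

Lemma souslin_closed (X : topologicalType) (A : set X) : closed A -> souslin A.
Proof.
move=> cA; exists (fun _ => A); split=> //.
by apply/seteqP; split=> x /= => [Ax|[_ /(_ 0%N)]//]; exists (fun _ => 0%N).
Qed.

(** The first digit of a branch selects the member of the union; the empty sequence imposes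
    nothing. *)
Lemma souslin_bigcup (X : topologicalType) (A : nat -> set X) :
  (forall i, souslin (A i)) -> souslin (\bigcup_i A i).
Proof.
move=> /choice[D /all_and2[cD AE]].
exists (fun s => if s is i :: s' then D i s' else setT); split.
  by case=> [|i s] //; exact: closedT.
apply/seteqP; split=> x.
  move=> [i _]; rewrite AE => -[b bP].
  exists (fun n => if n is n'.+1 then b n' else i).
  case=> [|n] //=; have := bP n; congr (D i _ x).
  by rewrite /mkseq /= (iotaDl 1 0) -map_comp.
move=> [b bP]; exists (b 0%N) => //; rewrite AE; exists (fun n => b n.+1) => n.
rewrite (_ : mkseq _ n = [seq b i | i <- iota 1 n]); first exact: (bP n.+1).
by rewrite (iotaDl 1 0) -map_comp.
Qed.

(** Countably many branches are coded in one: digit [k] of branch [i] sits at place [pickle (i, k)].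
    A prefix [s] imposes the condition on the first [n] digits of branch [i] only once all of them
    lie within [s]. *)
Lemma souslin_bigcap (X : topologicalType) (A : nat -> set X) :
  (forall i, souslin (A i)) -> souslin (\bigcap_i A i).
Proof.
move=> /choice[D /all_and2[cD AE]].
exists (fun s => \bigcap_(p in [set p : nat * nat | forall k, (k < p.2)%N ->
    (pickle (p.1, k) < size s)%N])
  D p.1 (mkseq (fun k => nth 0%N s (pickle (p.1, k))) p.2)); split.
  by move=> s; apply: closed_bigI.
apply/seteqP; split=> x.
  move=> Ax.
  have /choice[b bP] : forall i, exists b : nat -> nat,
      forall n, D i (mkseq b n) x.
    by move=> i; have := Ax i I; rewrite AE.
  exists (fun m => if unpickle m is Some p then b p.1 p.2 else 0%N) => n [i m]/=.
  rewrite size_mkseq => sz; have := bP i m; congr (D i _ x).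
  apply/eq_in_map => k; rewrite mem_iota /= add0n => km.
  by rewrite nth_mkseq ?sz// pickleK.
move=> [b bP] i _; rewrite AE; exists (fun k => b (pickle (i, k))) => n.
pose N := (\max_(k < n) (pickle (i, k : nat)).+1)%N.
have NP k : (k < n)%N -> (pickle (i, k) < N)%N.
  by move=> kn; exact: (@leq_bigmax _ (fun k : 'I_n => (pickle (i, k : nat)).+1)
    (Ordinal kn)).
have /= := bP N (i, n); rewrite size_mkseq => /(_ NP); congr (D i _ x).
apply/eq_in_map => k; rewrite mem_iota /= add0n => kn.
by rewrite nth_mkseq ?NP.
Qed.

Lemma bi_souslin_sigma_algebra (X : topologicalType) :
  sigma_algebra setT [set A : set X | souslin A /\ souslin (~` A)].
Proof.
split.
- split; apply: souslin_closed; first exact: closed0.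
  by rewrite setC0; exact: closedT.
- by move=> A /= [sA sAc]; rewrite setTD setCK.
- move=> A sA /=; split; first by apply: souslin_bigcup => i; case: (sA i).
  by rewrite setC_bigcup; apply: souslin_bigcap => i; case: (sA i).
Qed.

(* Compactness of the segment: nested nonempty closed subsets of the fibre over
   x have a common point. *)
Lemma souslin_proj (R : realType) (X : topologicalType) (A : set (X * R)) :
  souslin A -> souslin [set x | exists2 z : R, z \in `[0, 1] & A (x, z)].
Proof.
move=> [D [cD AE]].
have cI : compact (`[0, 1]%classic : set R) by exact: segment_compact.
(* A scheme need not decrease along a branch. Intersecting over all prefixes makes it decrease
   without changing the resulting set. *)
pose K s : set (X * R) := \bigcap_m D (take m s).
have cK s : closed (K s) by exact: closed_bigI.
exists (fun s => [set x | exists2 z : R, z \in `[0, 1] & K s (x, z)]); split.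
  (* Tube lemma: the projection of a closed set along the compact segment is closed. *)
  move=> s; rewrite -[X in closed X]setCK; apply: open_closedC.
  rewrite openE => x /= nx.
  have [+ _] := compact_near_coveringP (`[0, 1]%classic : set R).
  move=> /(_ cI X (nbhs x) (fun x' z => ~ K s (x', z)) _).
  have cov z : (`[0, 1]%classic : set R) z ->
      \forall z' \near z & x' \near x, ~ K s (x', z').
    move=> z01.
    have oK : open (~` K s) by exact: closed_openC.
    have : nbhs (x, z) (~` K s).
      apply: open_nbhs_nbhs; split=> // Kxz; apply: nx; exists z => //.
    move=> [[U W] /= [Ux Wz] UW]; exists (W, U) => //= -[a b] /= [Wa Ub].
    exact: (UW (b, a)).
  move=> /(_ cov); apply: filterS => x' Kx' [z z01 Kxz].
  exact: (Kx' z).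
apply/seteqP; split=> x /=.
  move=> [z z01]; rewrite AE => -[b bP]; exists b => n; exists z => // m _.
  by rewrite /mkseq -map_take take_iota; exact: bP.
move=> [b bP].
pose C n : set R := [set z | z \in `[0, 1] /\ K (mkseq b n) (x, z)].
have Cdecr n m : (n <= m)%N -> C m `<=` C n.
  move=> nm z [z01 Kz]; split=> // k _.
  have := Kz (minn k n) I; rewrite /mkseq -!map_take !take_iota.
  rewrite (_ : minn (minn k n) m = minn k n)// -minnA.
  by congr minn; apply/minn_idPl.
have /choice[z /all_and2[z01 Kz]] : forall n, exists z : R,
    z \in `[0, 1] /\ K (mkseq b n) (x, z).
  by move=> n; have [z] := bP n; exists z.
(* The fibres over [x] are closed and decreasing, so a cluster point of the [z n] lies in all of
   them. *)
have [w [w01 wcl]] := cI (z @ \oo) _ (ltac:(by exists 0%N => // n _; exact: z01)).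
exists w => //; rewrite AE; exists b => n.
have clD : closed [set u | D (mkseq b n) (x, u)].
  rewrite (_ : [set u | _] = (fun u => (x, u)) @^-1` D (mkseq b n))//.
  apply: closed_comp => // u _.
  by apply: (@cvg_pair _ _ _ _ (nbhs x) (nbhs u)); [exact: cvg_cst|exact: cvg_id].
apply: clD => B /wcl - /(_ [set u | D (mkseq b n) (x, u)]).
apply; exists n => // m /= nm.
have [_ /(_ n I)] : C n (z m) by apply: (Cdecr n m nm); split.
by rewrite take_oversize// size_mkseq.
Qed.

(** * Lusin's separation theorem *)

Section lusin.
Variables (R : realType) (X : completeNormedModType R) (d : nat -> X).
Hypothesis dense_d : forall x e, 0 < e -> exists i, `|x - d i| < e.

Definition borel_separated (P Q : set X) :=
  exists M : set (borel X), [/\ measurable M, P `<=` M & Q `&` M = set0].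

(** Pairwise separators combine as the union over [i] of the intersections over [j]. *)
Lemma borel_separated_bigcup (I J : countType) (P : I -> set X) (Q : J -> set X) :
  (forall i j, borel_separated (P i) (Q j)) ->
  borel_separated (\bigcup_i P i) (\bigcup_j Q j).
Proof.
move=> PQ.
have /choice[M MP] : forall p : I * J, exists M : set (borel X),
    [/\ measurable M, P p.1 `<=` M & Q p.2 `&` M = set0] by move=> p; exact: PQ.
exists (\bigcup_i \bigcap_j M (i, j)); split.
- apply: countable_bigcupT_measurable => // i.
  rewrite -[X in measurable X]setCK setC_bigcap; apply: measurableC.
  by apply: countable_bigcupT_measurable => // j; apply: measurableC;
    case: (MP (i, j)).
- move=> x [i _ Px]; exists i => // j _; case: (MP (i, j)) => _ + _; exact.
- apply/seteqP; split=> // x [[j _ Qx] [i _ /(_ j Logic.I) Mx]].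
  by case: (MP (i, j)) => _ _ <-; split.
Qed.

Variables (D E : seq nat -> set X).

(** Each digit of [s] carries two data: the next digit of the branch, and the index of a dense point
    within [1/(i+1)] of [x]. The second datum makes the parts shrink along a branch. *)
Let part (D : seq nat -> set X) (s : seq (nat * nat)) : set X :=
  [set x | exists b : nat -> nat, (forall m, D (mkseq b m) x) /\
    forall i, (i < size s)%N -> b i = (nth (0, 0)%N s i).1 /\
      `|x - d (nth (0, 0)%N s i).2| <= i.+1%:R^-1].

Let part_rcons D' s : part D' s = \bigcup_c part D' (rcons s c).
Proof.
apply/seteqP; split=> x.
  move=> [b [bD bs]].
  have [|k kx] := dense_d x (e := (size s).+1%:R^-1).
    by rewrite invr_gt0.
  exists (b (size s), k) => //; exists b; split=> // i.
  rewrite size_rcons ltnS leq_eqVlt nth_rcons => /predU1P[->|si].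
    by rewrite ltnn eqxx; split=> //; exact: ltW.
  by rewrite si; exact: bs.
move=> [c _ [b [bD bs]]]; exists b; split=> // i si.
have := bs i; rewrite size_rcons ltnS => /(_ (ltnW si)).
by rewrite nth_rcons si.
Qed.

(* A pair of nonseparable Souslin sets contains ever smaller nonseparable parts,
   which shrink to a common point by completeness. *)
Lemma lusin_separation :
  [set x | exists b : nat -> nat, forall n, D (mkseq b n) x] `&`
  [set x | exists b : nat -> nat, forall n, E (mkseq b n) x] = set0 ->
  (forall s, closed (D s)) -> (forall s, closed (E s)) ->
  borel_separated [set x | exists b : nat -> nat, forall n, D (mkseq b n) x]
    [set x | exists b : nat -> nat, forall n, E (mkseq b n) x].
Proof.
have tri (a b1 b2 b3 b4 k : R) : b1 <= k -> b2 <= k -> b3 <= k -> b4 <= k ->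
  k < a / 4 -> a <= b1 + b4 + (b3 + b2) -> False by move=> *; lra.
move=> DE0 cD cE; apply: contrapT => nsep.
pose bad (p : seq (nat * nat) * seq (nat * nat)) :=
  ~ borel_separated (part D p.1) (part E p.2).
have bad0 : bad ([::], [::]).
  apply: contra_not nsep; congr borel_separated;
    by apply/seteqP; split=> x /= -[b]; [case=> bD _; exists b|
      move=> bD; exists b].
(* If all one-digit extensions of a nonseparated pair were separated, the countable union lemma
   would separate the pair itself. *)
have /choice[f fP] : forall p, exists c : (nat * nat) * (nat * nat),
    bad p -> bad (rcons p.1 c.1, rcons p.2 c.2).
  move=> p; have [badp|] := pselect (bad p); last by exists ((0, 0), (0, 0))%N.
  apply: contrapT => nex; apply: badp; rewrite part_rcons [part E _]part_rcons.
  apply: borel_separated_bigcup => i j; apply: contrapT => ns.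
  by apply: nex; exists (i, j).
pose st := fix st n := if n is n'.+1 then
  (rcons (st n').1 (f (st n')).1, rcons (st n').2 (f (st n')).2)
  else ([::], [::] : seq (nat * nat)).
have badst n : bad (st n) by elim: n => //= n /fP.
have sz1 n : size (st n).1 = n by elim: n => //= n IH; rewrite size_rcons IH.
have sz2 n : size (st n).2 = n by elim: n => //= n IH; rewrite size_rcons IH.
pose p i := (f (st i)).1; pose q i := (f (st i)).2.
have st1 n i : (i < n)%N -> nth (0, 0)%N (st n).1 i = p i.
  elim: n => //= n IH; rewrite ltnS leq_eqVlt nth_rcons sz1 => /predU1P[->|ni].
    by rewrite ltnn eqxx.
  by rewrite ni IH.
have st2 n i : (i < n)%N -> nth (0, 0)%N (st n).2 i = q i.
  elim: n => //= n IH; rewrite ltnS leq_eqVlt nth_rcons sz2 => /predU1P[->|ni].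
    by rewrite ltnn eqxx.
  by rewrite ni IH.
(* Points chosen in the successive parts form a Cauchy sequence, and the limit stays on the branch
   because the scheme is closed. *)
have limit (D' : seq nat -> set X) (r : nat -> nat * nat) (x : nat -> X) :
    (forall s, closed (D' s)) ->
    (forall n, exists b : nat -> nat, (forall m, D' (mkseq b m) (x n)) /\
      forall i, (i < n)%N -> b i = (r i).1 /\ `|x n - d (r i).2| <= i.+1%:R^-1) ->
    exists2 y, forall m, D' (mkseq (fst \o r) m) y &
      forall i, `|y - d (r i).2| <= i.+1%:R^-1.
  move=> cD' xP.
  have xd n i : (i < n)%N -> `|x n - d (r i).2| <= i.+1%:R^-1.
    by move=> ni; have [b [_ /(_ _ ni)[]]] := xP n.
  have cx : cvg (x @ \oo).
    apply/cauchy_cvgP/cauchy_exP => e e0.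
    have [i ie] : exists i, i.+1%:R^-1 < e.
      have [i _ iP] := near_infty_natSinv_lt (PosNum e0).
      by exists i; exact: (iP i (leqnn _)).
    exists (d (r i).2); exists i.+1 => // n /= ni.
    rewrite -ball_normE /= distrC; exact: le_lt_trans (xd _ _ ni) ie.
  exists (lim (x @ \oo)).
     move=> m; apply: (closed_cvg (D' (mkseq (fst \o r) m)) (cD' _) _ _ cx).
    exists m => // n /= mn; have [b [bD' br]] := xP n.
    rewrite (_ : mkseq _ m = mkseq b m)//; apply/eq_in_map => i.
    rewrite mem_iota add0n /= => im.
    by have [<-] := br i (leq_trans im mn).
  move=> i; have cxd : `|x n - d (r i).2| @[n --> \oo] -->
      `|lim (x @ \oo) - d (r i).2|.
    by apply: cvg_norm; apply: cvgB => //; exact: cvg_cst.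
  apply: (closed_cvg [set z : R | z <= i.+1%:R^-1] (@closed_le R _) _ _ cxd).
  by exists i.+1 => // n /= ni; exact: xd.
have /choice[x xP] : forall n, exists x, part D (st n).1 x.
  move=> n; apply: contrapT => nx; apply: (badst n).
  by exists set0; split=> //; [move=> z Pz; apply: nx; exists z|exact: setI0].
have /choice[y yP] : forall n, exists y, part E (st n).2 y.
  move=> n; apply: contrapT => nx; apply: (badst n).
  exists setT; split=> //; rewrite setIT; apply/seteqP; split=> // z Pz.
  by apply: nx; exists z.
have [|x' x'D x'p] := limit D p x cD.
  move=> n; have [b [bD bp]] := xP n; exists b; split=> // i ni.
  by have := bp i; rewrite sz1 st1//; apply.
have [|y' y'E y'q] := limit E q y cE.
  move=> n; have [b [bD bp]] := yP n; exists b; split=> // i ni.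
  by have := bp i; rewrite sz2 st2//; apply.
(* If the two limits differed, the ball around [d (p i)] would separate the parts at stage [i.+1]:
   four distances, each below a quarter of the gap, could not bridge it. *)
have xy : x' = y'.
  apply: contrapT => /eqP; rewrite -subr_eq0 -normr_gt0 => xy0.
  have [i ie] : exists i, i.+1%:R^-1 < `|x' - y'| / 4.
    have e0 : 0 < `|x' - y'| / 4 by rewrite divr_gt0.
    have [i _ iP] := near_infty_natSinv_lt (PosNum e0).
    by exists i; exact: (iP i (leqnn _)).
  apply: (badst i.+1).
  exists [set z | `|z - d (p i).2| <= i.+1%:R^-1]; split.
  - rewrite -[X in measurable X]setCK; apply: measurableC.
    apply: sub_sigma_algebra; apply: closed_openC.
    apply: (@closed_comp _ _ (fun z => `|z - d (p i).2|) [set r | r <= i.+1%:R^-1]).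
      move=> z _; apply: cvg_norm; apply: cvgB; [exact: cvg_id|exact: cvg_cst].
    exact: closed_le.
  - by move=> z [b [_ /(_ i)]]; rewrite sz1 st1// => /(_ (leqnn _))[].
  - apply/seteqP; split=> // z [[b [_ /(_ i)]]].
    rewrite sz2 st2// => /(_ (leqnn _))[_ zq] /= zp.
    have : `|x' - y'| <= `|x' - d (p i).2| + `|z - d (p i).2| +
        (`|z - d (q i).2| + `|y' - d (q i).2|).
      rewrite -[`|x' - d _| + _](_ : `|x' - d (p i).2| + `|d (p i).2 - z| = _).
        rewrite -[X in _ + (_ + X)]distrC.
        apply: le_trans (lerD (ler_normD _ _) (ler_normD _ _)).
        apply: le_trans (ler_normD _ _).
        by rewrite !addrA !subrK.
      by rewrite [`|d _ - z|]distrC.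
    exact: (tri _ _ _ _ _ _ (x'p i) (y'q i) zq zp ie).
have : ([set x | exists b : nat -> nat, forall n, D (mkseq b n) x] `&`
  [set x | exists b : nat -> nat, forall n, E (mkseq b n) x]) x'.
  by split; [exists (fst \o p)|rewrite xy; exists (fst \o q)].
by rewrite DE0.
Qed.

End lusin.

Lemma separable_dense_seq (R : realType) (X : normedModType R) : separable X ->
  exists d : nat -> X, forall x e, 0 < e -> exists i, `|x - d i| < e.
Proof.
move=> [A cA dA].
have near_A x e : 0 < e -> exists2 a, A a & `|x - a| < e.
  move=> e0; have [||a [xa Aa]] := dA (ball x e).
  - by exists x; exact: ballxx.
  - exact: ball_open.
  - by exists a => //; rewrite -ball_normE in xa.
have [a Aa _] := near_A 0 1 ltr01.
have /pfcard_geP[A0|[f]] : (A #<= [set: nat])%card by [].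
  by rewrite A0 in Aa.
exists f => x e /(near_A x)[b Ab xb].
by have [i _ fi] := 'surj_f Ab; exists i; rewrite fi.
Qed.

Lemma souslin_separation (R : realType) (X : completeNormedModType R)
    (P Q : set X) : separable X -> souslin P -> souslin Q -> P `&` Q = set0 ->
  borel_separated P Q.
Proof.
move=> /separable_dense_seq[d dP] [D [cD ->]] [E [cE ->]] PQ0.
exact: (@lusin_separation R X d).
Qed.

Lemma open_bigcup_closed (R : realType) (X : normedModType R) (A : set X) :
  open A -> exists F : nat -> set X, (forall n, closed (F n)) /\ A = \bigcup_n F n.
Proof.
move=> oA.
exists (fun n => [set x | forall y, ~ A y -> n.+1%:R^-1 <= `|x - y|]); split.
  move=> n; rewrite (_ : [set x | _] =
    \bigcap_(y in ~` A) [set x | n.+1%:R^-1 <= `|x - y|]); last first.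
    by apply/seteqP; split=> x xP y; exact: xP.
  apply: closed_bigI => y _.
  apply: (@closed_comp _ _ (fun z => `|z - y|) [set r | n.+1%:R^-1 <= r]).
    by move=> z _; apply: cvg_norm; apply: cvgB; [exact: cvg_id|exact: cvg_cst].
  exact: closed_ge.
apply/seteqP; split=> x.
  move=> Ax; have /nbhs_ballP[e /= e0 eA] : nbhs x A by exact: open_nbhs_nbhs.
  have [i _ iP] := near_infty_natSinv_lt (PosNum e0).
  exists i => // y nAy; rewrite leNgt; apply/negP => xy; apply: nAy; apply: eA.
  by rewrite -ball_normE /=; apply: (lt_trans xy); exact: (iP i (leqnn _)).
move=> [n _ nP]; apply: contrapT => /nP; rewrite subrr normr0.
by rewrite leNgt invr_gt0 ltr0n.
Qed.

(** The sets that are Souslin together with their complement form a sigma-algebra. It contains the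
    open sets, since an open set of a normed space is a countable union of closed ones. *)
Lemma borel_souslin (R : realType) (X : normedModType R) (Y : topologicalType)
    (f : Y -> X) (A : set (borel X)) : continuous f -> measurable A ->
  souslin (f @^-1` A) /\ souslin (~` (f @^-1` A)).
Proof.
move=> cf mA.
pose G := [set B : set X | souslin (f @^-1` B) /\ souslin (~` (f @^-1` B))].
suff : <<s @open X >> `<=` G by exact.
apply: smallest_sub.
  have [S0 SC SU] := bi_souslin_sigma_algebra Y; split.
  - by rewrite /G /= preimage_set0; exact: S0.
  - by move=> B /SC; rewrite !setTD.
  - by move=> B /(_ _)/=GB; rewrite /G /= preimage_bigcup; exact: SU.
move=> U oU; split.
  have [F [cF ->]] := open_bigcup_closed oU.
  rewrite preimage_bigcup; apply: souslin_bigcup => n; apply: souslin_closed.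
  by apply: closed_comp => // z _; exact: cf.
by apply/souslin_closed/open_closedC; apply: open_comp => // z _; exact: cf.
Qed.

Lemma measurable_borel (R : realType) (A : set (measurableTypeR R)) :
  measurable A -> measurable (A : set (borel R)).
Proof.
suff : <<s @ocitv R >> `<=` <<s @open R >> by exact.
apply: smallest_sub; first exact: smallest_sigma_algebra.
move=> _ [x _ <-]; rewrite (_ : `]x.1, x.2]%classic = `]x.1, +oo[ `&` ~` `]x.2, +oo[).
  apply: (@measurableI _ (borel R)); last apply: (@measurableC _ (borel R));
    by apply: sub_sigma_algebra; exact: interval_open.
apply/seteqP; split=> z /=; rewrite !in_itv/= !andbT.
  by move=> /andP[-> /le_gtF zx]; rewrite zx.
by move=> [-> /negP]; rewrite -leNgt.
Qed.

Lemma measurable_prod_souslin (R : realType) (X : normedModType R)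
    (A : set (borel X * measurableTypeR R)%type) :
  measurable A -> souslin (A : set (X * R)).
Proof.
move=> mA.
suff : @measurable _ (borel X * measurableTypeR R)%type `<=`
    [set B | souslin (B : set (X * R)) /\ souslin (~` B : set (X * R))].
  by move=> /(_ A mA)[].
apply: smallest_sub; first exact: bi_souslin_sigma_algebra.
move=> _ [] [B mB <-]; rewrite setTI.
  by apply: (@borel_souslin R X (X * R)%type fst) => // z; exact: cvg_fst.
by apply: (@borel_souslin R R^o (X * R)%type snd);
  [move=> z; exact: cvg_snd|exact: measurable_borel].
Qed.

(** * Coding by bit sequences *)

Section cantor_coding.
Context {R : realType}.

(** Base 3 with digits 0 and 2. The Cantor set is used rather than binary expansions so that the
    coding is injective: the remainders of a code lie in [[0, 1/3]] or [[2/3, 1]], and the threshold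
    [1/2] tells the two cases apart. *)
Fixpoint cantor_rem (z : R) n : R := if n is n'.+1 then
  3 * cantor_rem z n' - (if 2^-1 <= cantor_rem z n' then 2 else 0) else z.

Definition cantor_bit n (z : R) : bool := 2^-1 <= cantor_rem z n.

Fixpoint cantor_sum (b : nat -> bool) n : R := if n is n'.+1 then
  (if b 0%N then 2 / 3 else 0) + cantor_sum (b \o S) n' / 3 else 0.

Definition cantor_code (b : nat -> bool) : R := limn (cantor_sum b).

Lemma cantor_sum_itv b n : 0 <= cantor_sum b n <= 1.
Proof.
elim: n b => [b|n IH b] /=; first by rewrite lexx ler01.
have /andP[h1 h2] := IH (b \o S); move: h1 h2.
by move: (cantor_sum _ n) => c c0 c1; case: ifP => _; apply/andP; split; lra.
Qed.

Lemma cantor_sum_nd b : nondecreasing_seq (cantor_sum b).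
Proof.
apply/nondecreasing_seqP => n; elim: n b => [|n IH] b.
  by have /andP[] := cantor_sum_itv b 1.
by move: (IH (b \o S)) => /= h; rewrite lerD2l ler_pM2r// invr_gt0.
Qed.

Lemma cantor_sum_cvg b : cantor_sum b @ \oo --> cantor_code b.
Proof.
apply: nondecreasing_is_cvgn; first exact: cantor_sum_nd.
by exists 1 => _ [n _ <-]; case/andP: (cantor_sum_itv b n).
Qed.

Lemma cantor_code_itv b : 0 <= cantor_code b <= 1.
Proof.
have cb := @cantor_sum_cvg b.
by apply/andP; split; [apply: limr_ge|apply: limr_le];
  try (by apply/cvg_ex; exists (cantor_code b));
  apply: nearW => n; case/andP: (cantor_sum_itv b n).
Qed.

Lemma cantor_codeS b :
  cantor_code b = (if b 0%N then 2 / 3 else 0) + cantor_code (b \o S) / 3.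
Proof.
apply: (@cvg_unique _ (@Rhausdorff R)  (cantor_sum b n.+1 @[n --> \oo])).
  have := @cantor_sum_cvg b; rewrite -cvg_shiftS; exact.
rewrite /=; apply: cvgD; first exact: cvg_cst.
by apply: cvgMr_tmp; exact: cantor_sum_cvg.
Qed.

Lemma cantor_codeK b n : cantor_bit n (cantor_code b) = b n.
Proof.
have bit0 b' : (2^-1 <= cantor_code b') = b' 0%N.
  rewrite cantor_codeS; have /andP[] := cantor_code_itv (b' \o S).
  by move: (cantor_code _) => c c0 c1; case: (b' 0%N) => /=; [apply/idP|apply/negP]; lra.
have remE : cantor_rem (cantor_code b) n = cantor_code (fun k => b (n + k)%N).
  elim: n => [|n IH] //=; rewrite IH bit0 [in LHS]cantor_codeS addn0.
  rewrite (_ : _ \o S = fun k => b (n.+1 + k)%N); last first.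
    by apply/funext => k /=; rewrite addnS.
  by move: (cantor_code _) => c; case: ifP => _; lra.
by rewrite /cantor_bit remE bit0 addn0.
Qed.

Lemma measurable_cantor_bit n : measurable_fun setT (cantor_bit n).
Proof.
have mrem k : measurable_fun setT (cantor_rem ^~ k).
  elim: k => [|k IH] /=; first exact: measurable_id.
  apply: measurable_funB; first exact: measurable_funM.
  by apply: measurable_fun_ifT => //; exact: measurable_fun_ler.
exact: measurable_fun_ler.
Qed.

Lemma measurable_cantor_code d (T : measurableType d) (b : nat -> T -> bool) :
  (forall n, measurable_fun setT (b n)) ->
  measurable_fun setT (fun t => cantor_code (b ^~ t)).
Proof.
move=> mb; apply: (@measurable_fun_cvg _ _ _ _ (fun n t => cantor_sum (b ^~ t) n)).
  move=> n; elim: n b mb => [|n IH] b mb /=; first exact: measurable_cst.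
  apply: measurable_funD; first exact: measurable_fun_ifT.
  apply: measurable_funM => //; exact: (IH (fun n => b n.+1)).
by move=> t _; exact: cantor_sum_cvg.
Qed.

End cantor_coding.

(* The points of Y are encoded measurably by bit sequences; the bits are kept as
   a single real number. *)
Definition cantor_coded (R : realType) d (Y : measurableType d) :=
  exists (b : nat -> Y -> bool) (k : R -> Y),
  [/\ forall n, measurable_fun setT (b n), measurable_fun setT k
    & forall y, k (cantor_code (b ^~ y)) = y].

(** The bits are interleaved, even places for the first component and odd places for the second. *)
Lemma cantor_coded_prod (R : realType) d1 d2 (Y1 : measurableType d1)
    (Y2 : measurableType d2) :
  cantor_coded R Y1 -> cantor_coded R Y2 -> cantor_coded R (Y1 * Y2)%type.
Proof.
move=> [b1 [k1 [mb1 mk1 b1K]]] [b2 [k2 [mb2 mk2 b2K]]].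
exists (fun n y => if odd n then b2 n./2 y.2 else b1 n./2 y.1).
exists (fun z => (k1 (cantor_code (fun n => cantor_bit n.*2 z)),
                  k2 (cantor_code (fun n => cantor_bit n.*2.+1 z)))); split.
- by move=> n; case: odd; exact: measurableT_comp.
- have mc (g : nat -> nat) :
      measurable_fun setT (fun z : R => cantor_code (fun n => cantor_bit (g n) z) : R).
    apply: (@measurable_cantor_code R _ R (fun n => cantor_bit (g n))) => n.
    exact: measurable_cantor_bit.
  apply/measurable_fun_pairP; split.
    exact: (measurableT_comp mk1 (mc double)).
  exact: (measurableT_comp mk2 (mc (S \o double))).
- move=> [y1 y2] /=; congr pair.
  + rewrite -[RHS]b1K; congr (k1 (cantor_code _)); apply/funext => n.
    by rewrite cantor_codeK odd_double doubleK.
  + rewrite -[RHS]b2K; congr (k2 (cantor_code _)); apply/funext => n.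
    by rewrite cantor_codeK /= odd_double /= uphalf_double.
Qed.

Lemma measurable_fun_borel d (T : measurableType d) (R : realType)
    (X : normedModType R) (f : T -> X) :
  (forall C : set X, closed C -> measurable (f @^-1` C)) ->
  measurable_fun setT (f : T -> borel X).
Proof.
move=> mf; apply: (@measurability _ _ _ (borel X) setT f (@open X)) => //.
move=> _ [U oU <-]; rewrite setTI -(setCK (f @^-1` U)).
by apply: measurableC; apply: (mf (~` U)); exact: open_closedC.
Qed.

Lemma measurable_near_point (R : realType) (X : normedModType R) (c : X) (r : R) :
  measurable ([set y | `|y - c| < r] : set (borel X)).
Proof.
apply: sub_sigma_algebra.
apply: (@open_comp _ _ (fun y : X => `|y - c|) [set s | s < r]); last exact: open_lt.
by move=> y _; apply: cvg_norm; apply: cvgB; [exact: cvg_id|exact: cvg_cst].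
Qed.

Lemma near_inv_succ_lt (R : realType) (r : R) : 0 < r ->
  exists m, forall n, (m <= n)%N -> n.+1%:R^-1 < r.
Proof.
by move=> r0; have [m _ mP] := near_infty_natSinv_lt (PosNum r0); exists m.
Qed.

(** The bit indexed by [(n, i)] records whether [y] is within [1/(n+1)] of the dense point [d i].
    Decoding selects at each level [n] the first [i] whose bit is set, and takes the limit of the
    selected points. *)
Lemma cantor_coded_borel (R : realType) (X : completeNormedModType R) :
  separable X -> cantor_coded R (borel X).
Proof.
move=> /separable_dense_seq[d dP].
pose e n : R := n.+1%:R^-1.
have e0 n : 0 < e n by rewrite invr_gt0.
pose b n (y : borel X) : bool :=
  if unpickle n is Some p then `|(y : X) - d p.2| < e p.1 else false.
pose B (z : R) (n i : nat) : bool := cantor_bit (pickle (n, i)) z.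
pose A (n i : nat) : set R := [set z | B z n i /\ forall j, (j < i)%N -> ~~ B z n j].
have mB n i (c : bool) : measurable [set z | B z n i = c].
  by have := measurable_cantor_bit (R := R) (pickle (n, i)) measurableT
    (Logic.I : measurable [set c]); rewrite setTI.
have mA n i : measurable (A n i).
  rewrite (_ : A n i = [set z | B z n i = true] `&`
     \bigcap_j (if (j < i)%N then [set z | B z n j = false] else setT)).
    apply: measurableI => //; apply: bigcap_measurable => // j _.
    by case: ifP.
  apply/seteqP; split=> z [Bz zP]; split=> // j.
    by move=> _; case: ifP => // /zP /= /negbTE.
  by move=> ji; have := zP j Logic.I; rewrite ji /= => ->.
have Auniq n i j z : A n i z -> A n j z -> i = j.
  move=> [Bi iP] [Bj jP]; case: (ltngtP i j) => // [/jP|/iP]; first by rewrite Bi.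
  by rewrite Bj.
have Aex n z : (exists i, B z n i) -> exists i, A n i z.
  move=> Bz; exists (ex_minn Bz); case: ex_minnP => m Bm mP; split=> // j jm.
  by apply/negP => /mP; rewrite leqNgt jm.
(* The consistent codes: some point is selected at every level, and selected points are as close to
   each other as approximations of a common point must be. *)
pose G : set R := [set z | (forall n, exists i, A n i z) /\
  forall n m i j, A n i z -> A m j z -> `|d i - d j| <= e n + e m].
have mG : measurable G.
  pose bad (p : (nat * nat) * (nat * nat)) : set R :=
    if `|d p.1.2 - d p.2.2| <= e p.1.1 + e p.2.1 then set0
    else A p.1.1 p.1.2 `&` A p.2.1 p.2.2.
  rewrite (_ : G = (\bigcap_n \bigcup_i A n i) `&` ~` \bigcup_p bad p).
    apply: measurableI.
      by apply: bigcapT_measurable => n; apply: bigcupT_measurable.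
    apply: measurableC; apply: countable_bigcupT_measurable => // p.
    by rewrite /bad; case: ifP => _ //; exact: measurableI.
  apply/seteqP; split=> z [z1 z2]; split.
  - by move=> n _; have [i] := z1 n; exists i.
  - move=> [[[n i] [m j]] _]; rewrite /bad /=; case: ifPn => // /negP ij [Ai Aj].
    exact/ij/z2.
  - by move=> n; have [i _] := z1 n Logic.I; exists i.
  - move=> n m i j Ai Aj; apply: contrapT => /negP ij; apply: z2.
    by exists ((n, i), (m, j)) => //; rewrite /bad /= (negbTE ij).
pose a z n := xget 0%N [set i | A n i z].
(* Inconsistent codes are sent to the default value [0]; whether [0] belongs to the closed set under
   test is decided at the end. *)
pose k z : X := if pselect (G z) then lim (d (a z n) @[n --> \oo]) else 0.
have Aa z n : G z -> A n (a z n) z.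
  by move=> [/(_ n) zA _]; exact: (@xgetPex _ 0%N [set i | A n i z]).
have dk z n : G z -> `|d (a z n) - k z| <= e n.
  move=> Gz; have [_ zP] := Gz.
  have da m m' : `|d (a z m) - d (a z m')| <= e m + e m'.
    by apply: zP; exact: Aa.
  have cd : cvg (d (a z n) @[n --> \oo]).
    apply/cauchy_cvgP/cauchy_exP => r r0.
    have r20 : 0 < r / 2 by rewrite divr_gt0.
    have [m mP] := near_inv_succ_lt r20.
    exists (d (a z m)); exists m => // i mi; rewrite -ball_normE /=.
    apply: (le_lt_trans (da _ _)).
    by rewrite (splitr r) ltrD// /e mP.
  have -> : k z = lim (d (a z n) @[n --> \oo]) by rewrite /k; case: pselect.
  have cn : `|d (a z n) - d (a z m)| @[m --> \oo] -->
      `|d (a z n) - lim (d (a z n) @[n --> \oo])|.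
    by apply: cvg_norm; apply: cvgB => //; exact: cvg_cst.
  have ce : e n + e m @[m --> \oo] --> e n + 0.
    by apply: cvgD; [exact: cvg_cst|exact: cvg_harmonic].
  rewrite -[e n]addr0.
  by apply: (ler_cvg_to cn ce); apply: nearW => m; exact: da.
exists b, k; split.
- move=> n; rewrite /b; case: (unpickle n) => [p|]; last exact: measurable_cst.
  apply: (measurable_fun_bool true); rewrite setTI.
  exact: measurable_near_point.
- apply: measurable_fun_borel => C cC.
  (* For a consistent code the limit is within [e m] of the point selected at level [m]. It lies in
     the closed set [C] exactly when every selected point is within [2 * e m] of [C], which is a
     countable condition on the bits. *)
  pose P m i := `[< exists2 c, C c & `|d i - c| <= 2 * e m >].
  pose S : set R := \bigcap_m \bigcup_i (if P m i then A m i else set0).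
  have mS : measurable S.
    by apply: bigcapT_measurable => m; apply: bigcupT_measurable => i; case: ifP.
  have GS z : G z -> C (k z) <-> S z.
    move=> Gz; split=> [Ck m _|Sz].
      exists (a z m) => //; rewrite ifT; first exact: Aa.
      apply/asboolP; exists (k z) => //; apply: (le_trans (dk _ _ Gz)).
      by have := e0 m; lra.
    apply: contrapT => nCk.
    have /nbhs_ballP[r /= r0 rC] : nbhs (k z) (~` C).
      by apply: open_nbhs_nbhs; split=> //; exact: closed_openC.
    have r30 : 0 < r / 3 by rewrite divr_gt0.
    have [m /(_ _ (leqnn m)) em] := near_inv_succ_lt r30.
    have [i _] := Sz m Logic.I; case: ifP => // /asboolP[c Cc ic] Ai.
    apply: (rC c) => //; rewrite -ball_normE /=.
    have := dk _ m Gz; rewrite -(Auniq _ _ _ _ Ai (Aa _ _ Gz)) => dik.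
    rewrite -[k z - c](subrKA (d i)) (le_lt_trans (ler_normD _ _))//.
    rewrite distrC; move: dik ic em; rewrite -/(e m).
    by move: `|d i - k z| `|d i - c| (e m) => x y w *; lra.
  have kN z : ~ G z -> k z = 0 by move=> nG; rewrite /k; case: pselect.
  have [C0|nC0] := pselect (C 0).
    rewrite (_ : k @^-1` C = ~` G `|` (G `&` S)).
      by apply: measurableU; [exact: measurableC|exact: measurableI].
    apply/seteqP; split=> z /=.
      by move=> Ck; have [Gz|] := pselect (G z); [right; split=> //; exact/GS|left].
    by move=> [/kN -> //|[Gz /(GS _ Gz)]].
  rewrite (_ : k @^-1` C = G `&` S); first exact: measurableI.
  apply/seteqP; split=> z /=; last by move=> [Gz /(GS _ Gz)].
  by move=> Ck; have [Gz|/kN k0] := pselect (G z);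
    [split=> //; exact/GS|rewrite k0 in Ck].
- move=> y.
  have Bb n i : B (cantor_code (b ^~ y)) n i = (`|y - d i| < e n).
    by rewrite /B cantor_codeK /b pickleK.
  have Gy : G (cantor_code (b ^~ y)).
    split=> [n|n m i j [+ _] [+ _]].
      by apply: Aex; have [i yi] := dP y (e n) (e0 n); exists i; rewrite Bb.
    rewrite !Bb => yi yj.
    rewrite -(subrKA y) (le_trans (ler_normD _ _))// distrC.
    by move: yi yj; rewrite addrC => *; apply: lerD; exact: ltW.
  apply/eqP; rewrite eq_sym -subr_eq0 -normr_le0; apply/ler_addgt0Pl => r r0.
  have r20 : 0 < r / 2 by rewrite divr_gt0.
  have [m /(_ _ (leqnn m)) em] := near_inv_succ_lt r20.
  have [+ _] := Aa _ m Gy; rewrite Bb => yd.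
  rewrite -(subrKA (d (a (cantor_code (b ^~ y)) m))) (le_trans (ler_normD _ _))//.
  have := dk _ m Gy; move: yd em; rewrite -/(e m) addr0.
  by move: `|y - _| `|_ - k _| (e m) => u v w *; lra.
Qed.

(** * Disintegrations and mixtures *)

Section quantile.
Context {R : realType}.

Definition unit_law : set (measurableTypeR R) -> \bar R :=
  mrestr lebesgue_measure (measurable_itv `[0%R, 1%R]).

HB.instance Definition _ := Measure.on unit_law.

Let unit_lawT : unit_law setT = 1%E.
Proof.
by rewrite /unit_law /mrestr setTI lebesgue_measure_itv /= lte_fin ltr01 oppr0 adde0.
Qed.

HB.instance Definition _ := Measure_isProbability.Build _ _ _ unit_law unit_lawT.

(* The bit of z indexed by (q, q') says whether q' <= F q, F being the
   distribution function of a law on [0, 1]. *)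
Definition quantile (z w : R) : R := inf [set x | x = 1 \/ exists p : rat * rat,
  [/\ x = ratr p.1, 0 <= (ratr p.1 : R) <= 1, cantor_bit (pickle p) z & w <= ratr p.2]].

(** The element [1] makes the infimum one of a nonempty set bounded below by [0], at the price of
    the disjunct [1 < a]. What remains is a countable union of conditions on [z] and [w], hence
    joint measurability. *)
Lemma quantile_lt z w a : quantile z w < a <-> 1 < a \/ exists p : rat * rat,
  [/\ 0 <= (ratr p.1 : R) <= 1, ratr p.1 < a, cantor_bit (pickle p) z & w <= ratr p.2].
Proof.
have hi : has_inf [set x : R | x = 1 \/ exists p : rat * rat,
  [/\ x = ratr p.1, 0 <= (ratr p.1 : R) <= 1, cantor_bit (pickle p) z & w <= ratr p.2]].
  split; first by exists 1; left.
  by exists (0 : R) => _ [->|[p [-> /andP[p0 _] _ _]]].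
split.
  move=> /(inf_lt hi.1)[x [->|[p [-> p01 bp wp]]] xa]; [by left|right].
  by exists p.
move=> [a1|[p [p01 pa bp wp]]].
  by apply: le_lt_trans a1; apply: ge_inf; [case: hi|left].
by apply: le_lt_trans pa; apply: ge_inf; [case: hi|right; exists p].
Qed.

Lemma measurable_quantile :
  measurable_fun setT (fun zw : measurableTypeR R * measurableTypeR R =>
    quantile zw.1 zw.2).
Proof.
apply: (measurability _ (RGenInftyO.measurableE R)) => // _ [_ [a ->] <-].
rewrite setTI.
have [a1|a1] := boolP (1 < a).
  rewrite (_ : _ @^-1` _ = setT)//; apply/seteqP; split=> // x _ /=.
  by rewrite in_itv /=; apply/quantile_lt; left.
pose G (p : rat * rat) : set (measurableTypeR R * measurableTypeR R) :=
  if (0 <= (ratr p.1 : R) <= 1) && (ratr p.1 < a) then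
    [set zw | cantor_bit (pickle p) zw.1 && (zw.2 <= ratr p.2)] else set0.
rewrite (_ : _ @^-1` _ = \bigcup_p G p).
  apply: countable_bigcupT_measurable => // p; rewrite /G; case: ifP => _ //.
  rewrite -[X in measurable X]setTI; apply: measurable_and => //.
    exact: measurableT_comp (measurable_cantor_bit _) _.
  by apply: measurable_fun_ler => //; exact: measurable_snd.
apply/seteqP; split=> -[z w] /=; rewrite in_itv /=.
  move=> /quantile_lt [|[p [p01 pa bp wp]]]; first by move: a1 => /negP.
  by exists p => //; rewrite /G p01 pa /=; apply/andP.
move=> [p _]; rewrite /G; case: ifP => // /andP[p01 pa] /= /andP[bp wp].
by apply/quantile_lt; right; exists p.
Qed.

(** With [A] the set of values [F q] for [q < a], the event contains [[0, sup A[] and, within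
    [[0, 1]], is contained in [[0, sup A]]; both intervals have length [sup A]. *)
Lemma unit_law_quantile (F : rat -> R) (z a : R) : (forall q, 0 <= F q <= 1) ->
  (forall p : rat * rat, cantor_bit (pickle p) z = (ratr p.2 <= F p.1)) -> a <= 1 ->
  unit_law [set w | quantile z w < a] =
  (sup [set F q | q in [set q | 0 <= (ratr q : R) <= 1 /\ ratr q < a]])%:E.
Proof.
move=> F01 zF a1.
set A := [set F q | q in _].
have hA : has_ubound A by exists 1 => _ [q _ <-]; case/andP: (F01 q).
have supA0 : 0 <= sup A.
  have [[y Ay]|A0] := pselect (A !=set0).
    apply: (@le_trans _ _ y); last exact: ub_le_sup.
    by case: Ay => q _ <-; case/andP: (F01 q).
  by move/set0P/negP/negPn/eqP : A0 => ->; rewrite sup0.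
have supA1 : sup A <= 1.
  have [A0|A0] := pselect (A !=set0).
    by apply: sup_le_ub => // _ [q _ <-]; case/andP: (F01 q).
  by move/set0P/negP/negPn/eqP : A0 => ->; rewrite sup0.
have itvE b : lebesgue_measure (`[0, sup A] : set R) = (sup A)%:E /\
   lebesgue_measure ([set` Interval (BLeft 0) (BSide b (sup A))] : set R) = (sup A)%:E.
  rewrite !lebesgue_measure_itv /= lte_fin; case: ltP => sA.
    by rewrite oppr0 adde0.
  by have -> : sup A = 0 by apply/eqP; rewrite eq_le sA.
have [cE _] := itvE true; have [_ oE] := itvE true.
have mq : measurable ([set w | quantile z w < a] : set (measurableTypeR R)).
  have := measurableT_comp measurable_quantile (pair1_measurable (z : measurableTypeR R)).
  move=> /(_ measurableT _ (measurable_itv `]-oo, a[)); rewrite setTI.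
  by congr measurable; apply/seteqP; split=> w /=; rewrite in_itv.
apply/eqP; rewrite eq_le; apply/andP; split.
- rewrite -cE /unit_law /mrestr; apply: le_measure; rewrite ?inE//.
    by apply: measurableI.
  move=> w [/quantile_lt [|[p [p01 pa]]]]; first by rewrite ltNge a1.
  rewrite zF => pF wp /=; rewrite !in_itv /= => /andP[-> _] /=.
  by apply: (le_trans wp); apply: (le_trans pF); apply: ub_le_sup => //; exists p.1.
- rewrite -oE /unit_law /mrestr; apply: le_measure; rewrite ?inE//.
    by apply: measurableI.
  move=> w /=; rewrite !in_itv /= => /andP[w0 ws]; split; last first.
    by rewrite w0 (le_trans (ltW ws)).
  have A0 : A !=set0.
    apply/set0P/eqP => A0; move: ws; rewrite A0 sup0 => /(le_lt_trans w0).
    by rewrite ltxx.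
  have [|_ [q [q01 qa] <-] wq] := @sup_gt _ A w _ ws; first exact: A0.
  have [q' /andP[]] := rat_in_itvoo wq; rewrite bnd_simp => wq' q'F.
  apply/quantile_lt; right; exists (q, q'); split=> //=; last exact: ltW.
  by rewrite zF /= ltW.
Qed.

End quantile.

Lemma measurable_unit_law_section (R : realType) d1 d2 (Z : measurableType d1)
    (Y : measurableType d2) (f : Z * measurableTypeR R -> Y) (E : set Y) :
  measurable_fun setT f -> measurable E ->
  measurable_fun setT (fun z => unit_law ((fun w => f (z, w)) @^-1` E)).
Proof.
move=> mf mE.
have := measurable_fun_xsection (@unit_law R) (mf measurableT E mE).
by congr measurable_fun; apply/funext => z; rewrite setTI /= xsectionE.
Qed.

(** * Densities of dominated measures *)

Section densities.
Context d (T : measurableType d) (R : realType).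
Variable mu : {finite_measure set T -> \bar R}.

(** Testing on the set where [g < f] shows that the integral of [|f - g|] over it vanishes. *)
Lemma integral_le_ae (f g : T -> R) :
  mu.-integrable setT (EFin \o f) -> mu.-integrable setT (EFin \o g) ->
  (forall A, measurable A ->
    (\int[mu]_(x in A) (f x)%:E <= \int[mu]_(x in A) (g x)%:E)%E) ->
  {ae mu, forall x, f x <= g x}.
Proof.
move=> fi gi fg.
have /measurable_EFinP mf := measurable_int _ fi.
have /measurable_EFinP mg := measurable_int _ gi.
pose E := [set x | g x < f x].
have mE : measurable E.
  have := measurable_fun_ltr mg mf measurableT (Logic.I : measurable [set true]).
  by rewrite setTI; congr measurable.
have fEi : mu.-integrable E (EFin \o f) by apply: integrableS fi.
have gEi : mu.-integrable E (EFin \o g) by apply: integrableS gi.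
have mfg : measurable_fun E (fun x => (f x - g x)%:E).
  by apply: measurable_funTS; apply/measurable_EFinP; exact: measurable_funB.
have I0 : (\int[mu]_(x in E) `|(f x - g x)%:E| = 0)%E.
  apply/eqP; rewrite eq_le integral_ge0 ?andbT//.
  rewrite (eq_integral (fun x => (f x)%:E - (g x)%:E)%E); last first.
    by move=> x /[!inE] gfx; rewrite abse_EFin ger0_norm// subr_ge0 ltW.
  by rewrite integralB_EFin// sube_le0; exact: fg.
move/(ae_eq_integral_abs mu mE mfg) : I0; apply: filterS => x fgx.
by rewrite leNgt; apply/negP => gfx; have := fgx gfx => -[] /eqP;
  rewrite subr_eq0 => /eqP fgE; move: gfx; rewrite fgE ltxx.
Qed.

(** The Radon-Nikodym density is at most [1] almost everywhere; truncating it at [1] makes the bound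
    hold everywhere. *)
Lemma dominated_density (nu : {finite_measure set T -> \bar R}) :
  (forall A, measurable A -> nu A <= mu A)%E ->
  exists f : T -> R, [/\ measurable_fun setT f, forall x, 0 <= f x <= 1
    & forall A, measurable A -> nu A = (\int[mu]_(x in A) (f x)%:E)%E].
Proof.
move=> numu.
have dom : nu `<< mu.
  apply/null_content_dominatesP => A mA muA0; apply/eqP.
  by rewrite eq_le measure_ge0 andbT -muA0 numu.
pose h := Radon_Nikodym_SigmaFinite.f nu mu.
have h0 x : (0 <= h x)%E by exact: Radon_Nikodym_SigmaFinite.f_ge0.
have hfin x : h x \is a fin_num by exact: Radon_Nikodym_SigmaFinite.f_fin_num.
have hi : mu.-integrable setT h by exact: Radon_Nikodym_SigmaFinite.f_integrable.
have hE x : h x = (fine (h x))%:E by rewrite fineK.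
have hI A : measurable A -> nu A = (\int[mu]_(x in A) h x)%E.
  by move=> mA; exact: Radon_Nikodym_SigmaFinite.f_integral.
have mh : measurable_fun setT (fine \o h).
  by apply/measurable_EFinP; rewrite (_ : _ \o _ = h);
    [exact: measurable_int hi|apply/funext => x /=; rewrite -hE].
have h1 : {ae mu, forall x, fine (h x) <= 1}.
  apply: (@integral_le_ae (fine \o h) (cst 1)).
  - by rewrite (_ : _ \o _ = h)//; apply/funext => x /=; rewrite -hE.
  - exact: finite_measure_integrable_cst.
  - move=> A mA; rewrite [leRHS](eq_integral (cst 1%:E))// integral_cst// mul1e.
    rewrite (_ : (\int[mu]_(x in A) _ = nu A)%E); first exact: numu.
    by rewrite hI//; apply: eq_integral => x _ /=; rewrite -hE.
exists (fun x => Num.min (fine (h x)) 1); split.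
- exact: measurable_minr.
- by move=> x; rewrite le_min fine_ge0// ler01 /= ge_min lexx orbT.
- move=> A mA; rewrite hI//; apply: ae_eq_integral => //.
  + by apply: measurable_funTS; exact: measurable_int hi.
  + by apply: measurable_funTS; apply/measurable_EFinP; exact: measurable_minr.
  + by apply: filterS h1 => x hx _; rewrite hE /= min_l.
Qed.

End densities.

(** * Mixtures of measures along a kernel *)

Section mixture.
Local Open Scope ereal_scope.
Context (R : realType) d1 d2 (X : measurableType d1) (Y : measurableType d2).
Variables (m : {measure set X -> \bar R}) (D : set X).
Hypothesis mD : measurable D.
Variable k : X -> {measure set Y -> \bar R}.
Hypothesis mk : forall E, measurable E -> measurable_fun D (fun x => k x E).

Definition mixture (E : set Y) : \bar R := \int[m]_(x in D) k x E.

Let mixture0 : mixture set0 = 0.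
Proof. by rewrite /mixture integral0_eq// => x _; rewrite measure0. Qed.

Let mixture_ge0 E : 0 <= mixture E.
Proof. by apply: integral_ge0 => x _; exact: measure_ge0. Qed.

Let mixture_sigma_additive : semi_sigma_additive mixture.
Proof.
move=> F mF tF mUF.
rewrite [X in _ --> X](_ : _ = \sum_(n <oo) mixture (F n)).
  by apply: is_cvg_nneseries => n _ _; exact: mixture_ge0.
rewrite /mixture -integral_nneseries//; last by move=> n; exact: mk.
apply: eq_integral => x _; apply/esym/cvg_lim => //.
exact: measure_semi_sigma_additive.
Qed.

HB.instance Definition _ := isMeasure.Build _ _ _ mixture
  mixture0 mixture_ge0 mixture_sigma_additive.

Lemma mixture_ex : exists N : {measure set Y -> \bar R},
  forall E, N E = \int[m]_(x in D) k x E.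
Proof. by exists mixture. Qed.

Import HBNNSimple.

Lemma measurable_mixture_integral (f : Y -> \bar R) :
  measurable_fun setT f -> (forall y, 0 <= f y) ->
  measurable_fun D (fun x => \int[k x]_y f y).
Proof.
move=> mf f0; pose g := nnsfun_approx measurableT mf.
apply: (emeasurable_fun_cvg (fun n x => \int[k x]_y (g n y)%:E)).
  move=> n; under eq_fun do rewrite integralT_nnsfun sintegralE.
  apply: emeasurable_fsum => // r.
  by apply: measurable_funeM; exact: mk.
move=> x Dx.
rewrite [X in _ --> X](_ : _ = \int[k x]_y limn (fun n => (g n y)%:E)); last first.
  by apply: eq_integral => y _; apply/esym/cvg_lim => //; exact: cvg_nnsfun_approx.
apply: cvg_monotone_convergence => //.
- by move=> n; exact/measurable_EFinP.
- by move=> n y _; rewrite lee_fin.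
- by move=> y _ a b ab; rewrite lee_fin; exact/lefP/nd_nnsfun_approx.
Qed.

Lemma ge0_mixture_integral (N : {measure set Y -> \bar R}) (f : Y -> \bar R) :
  (forall E, measurable E -> N E = \int[m]_(x in D) k x E) ->
  measurable_fun setT f -> (forall y, 0 <= f y) ->
  \int[N]_y f y = \int[m]_(x in D) \int[k x]_y f y.
Proof.
move=> NE mf f0; pose g := nnsfun_approx measurableT mf.
have gf y : (g n y)%:E @[n --> \oo] --> f y by exact: cvg_nnsfun_approx.
have mg n : measurable_fun setT (fun y => (g n y)%:E) by exact/measurable_EFinP.
have mkg n : measurable_fun D (fun x => \int[k x]_y (g n y)%:E).
  by apply: measurable_mixture_integral => // y; rewrite lee_fin.
have cvgI (mu : {measure set Y -> \bar R}) :
    \int[mu]_y (g n y)%:E @[n --> \oo] --> \int[mu]_y f y.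
  rewrite [X in _ --> X](_ : _ = \int[mu]_y limn (fun n => (g n y)%:E)); last first.
    by apply: eq_integral => y _; apply/esym/cvg_lim => //; exact: gf.
  apply: cvg_monotone_convergence => //.
  - by move=> n y _; rewrite lee_fin.
  - by move=> y _ a b ab; rewrite lee_fin; exact/lefP/nd_nnsfun_approx.
have gE n : \int[N]_y (g n y)%:E = \int[m]_(x in D) \int[k x]_y (g n y)%:E.
  rewrite integralT_nnsfun sintegralE.
  under [RHS]eq_integral do rewrite integralT_nnsfun sintegralE.
  rewrite ge0_integral_fsum//; last 2 first.
    by move=> r; apply: measurable_funeM; exact: mk.
    by move=> r x _; exact: nnsfun_mulemu_ge0.
  apply: eq_fsbigr => r _; rewrite NE//.
  have [r0|r0] := leP 0%R r; first by rewrite ge0_integralZl//; exact: mk.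
  rewrite preimage_nnfun0// integral0_eq ?mule0.
    by rewrite integral0_eq// => x _; rewrite measure0 mule0.
  by move=> x _; rewrite measure0.
have c1 := cvgI N.
rewrite (_ : (fun n => \int[N]_y (g n y)%:E) =
  fun n => \int[m]_(x in D) \int[k x]_y (g n y)%:E) in c1; last exact/funext.
apply: (cvg_unique _ c1) => //=.
rewrite [X in _ --> X](_ : _ =
    \int[m]_(x in D) limn (fun n => \int[k x]_y (g n y)%:E)); last first.
  by apply: eq_integral => x _; apply/esym/cvg_lim => //; exact: cvgI.
apply: cvg_monotone_convergence => //.
- by move=> n x _; apply: integral_ge0 => y _; rewrite lee_fin.
- move=> x _ a b ab; apply: ge0_le_integral => //.
  + by move=> y _; rewrite lee_fin.
  + by move=> y _; rewrite lee_fin; exact/lefP/nd_nnsfun_approx.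
Qed.

Lemma mixture_integral (N : {measure set Y -> \bar R}) (f : Y -> R) :
  (forall E, measurable E -> N E = \int[m]_(x in D) k x E) ->
  N.-integrable setT (EFin \o f) ->
  [/\ {ae m, forall x, D x -> (k x).-integrable setT (EFin \o f)},
     m.-integrable D (fun x => \int[k x]_y (f y)%:E)
   & \int[N]_y (f y)%:E = \int[m]_(x in D) \int[k x]_y (f y)%:E].
Proof.
move=> NE Nf; have mf := measurable_int _ Nf.
have Ioo (g : Y -> \bar R) : measurable_fun setT g -> (forall y, 0 <= g y) ->
    \int[N]_y g y < +oo -> m.-integrable D (fun x => \int[k x]_y g y).
  move=> mg g0 goo; apply/integrableP; split.
    exact: measurable_mixture_integral.
  under eq_integral do rewrite gee0_abs ?integral_ge0//.
  by rewrite -(ge0_mixture_integral NE).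
have mabs : measurable_fun setT (fun y => `|(f y)%:E|) by exact: measurableT_comp.
have Iabs : m.-integrable D (fun x => \int[k x]_y `|(f y)%:E|).
  by apply: Ioo => //; case/integrableP : Nf.
have Ipos : m.-integrable D (fun x => \int[k x]_y (EFin \o f)^\+ y).
  apply: Ioo => //; first exact: measurable_funepos.
  exact: integral_funepos_lt_pinfty Nf.
have Ineg : m.-integrable D (fun x => \int[k x]_y (EFin \o f)^\- y).
  apply: Ioo => //; first exact: measurable_funeneg.
  exact: integral_funeneg_lt_pinfty Nf.
have fE : (fun x => \int[k x]_y (f y)%:E) =
    (fun x => \int[k x]_y (EFin \o f)^\+ y - \int[k x]_y (EFin \o f)^\- y).
  by apply/funext => x; rewrite integralE.
split.
- have := integrable_ae mD Iabs; apply: filterS => x kx Dx.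
  by apply/integrableP; split=> //; rewrite ltey_eq kx.
- apply: (le_integrable mD _ _ Iabs).
    rewrite fE; apply: emeasurable_funB;
      [exact: measurable_int Ipos|exact: measurable_int Ineg].
  move=> x Dx; rewrite [leRHS]gee0_abs ?integral_ge0//.
  exact: le_abse_integral.
- rewrite fE -[LHS]/(\int[N]_y (EFin \o f) y) integralE.
  rewrite (ge0_mixture_integral NE)//; last exact: measurable_funepos.
  rewrite (ge0_mixture_integral NE)//; last exact: measurable_funeneg.
  by rewrite -integralB.
Qed.

End mixture.

Lemma pushforward_ex (R : realType) d1 d2 (X : measurableType d1)
    (Y : measurableType d2) (mu : {measure set X -> \bar R}) (f : X -> Y) :
  measurable_fun setT f ->
  exists nu : {measure set Y -> \bar R}, forall B, nu B = mu (f @^-1` B).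
Proof. by move=> mf; unshelve eexists (pushforward mu f). Qed.

(** * Disintegration by conditional quantiles *)

Section disintegration.
Context (R : realType) d1 d2 (X : measurableType d1) (Y : measurableType d2).

Lemma finite_measure_ex (mu : {measure set X -> \bar R}) : (mu setT < +oo)%E ->
  exists nu : {finite_measure set X -> \bar R}, forall A, nu A = mu A.
Proof.
move=> muoo; exists (mfrestr measurableT muoo) => A.
by rewrite /= /mfrestr /mrestr setIT.
Qed.

(** For rational [q], the density [F q] of the measure [A |-> N (A x {j <= q})] serves as
    conditional distribution function of the code [j]. All its values are packed into the single
    real [z t], and [quantile (z t)] transports the uniform law to the conditional law of the
    code. *)
Lemma quantile_disintegration (k : R -> Y) (b : nat -> Y -> bool)
    (m : {finite_measure set X -> \bar R})
    (N : {finite_measure set (X * Y)%type -> \bar R}) :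
  (forall n, measurable_fun setT (b n)) -> measurable_fun setT k ->
  (forall y, k (cantor_code (b ^~ y)) = y) ->
  (forall A, measurable A -> N (A `*` setT) = m A) ->
  exists z : X -> R, [/\ measurable_fun setT z, forall t, 0 <= z t <= 1
    & forall A B, measurable A -> measurable B -> N (A `*` B) =
       (\int[m]_(t in A) unit_law [set w | B (k (quantile (z t) w))])%E].
Proof.
move=> mb mk bK Nm.
pose j y : R := cantor_code (b ^~ y).
have mj : measurable_fun setT j by exact: measurable_cantor_code.
have j01 y : 0 <= j y <= 1 by exact: cantor_code_itv.
have mle (q : rat) : measurable [set y | j y <= ratr q].
  have := measurable_fun_ler mj (measurable_cst (ratr q : R)) measurableT
    (Logic.I : measurable [set true]).
  by rewrite setTI.
have mS (q : rat) : measurable [set p : X * Y | j p.2 <= ratr q].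
  have mj2 : measurable_fun setT (fun p : X * Y => j p.2) by exact: measurableT_comp.
  have := measurable_fun_ler mj2 (measurable_cst (ratr q : R)) measurableT
    (Logic.I : measurable [set true]).
  by rewrite setTI.
have Noo (q : rat) : (N [set p : X * Y | j p.2 <= ratr q]%R < +oo)%E.
  by rewrite ltey_eq fin_num_measure.
have /choice[F FP] : forall q : rat, exists f : X -> R,
    [/\ measurable_fun setT f, forall x, 0 <= f x <= 1
    & forall A, measurable A ->
      N (A `*` [set y | j y <= ratr q]) = (\int[m]_(x in A) (f x)%:E)%E].
  move=> q.
  have AE A : fst @^-1` A `&` [set p : X * Y | j p.2 <= ratr q] =
      A `*` [set y | j y <= ratr q] by apply/seteqP; split=> -[].
  have [nu0 nu0E] := pushforward_ex (mfrestr (mS q) (Noo q)) (@measurable_fst _ _ X Y).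
  have nu0A A : nu0 A = N (A `*` [set y | j y <= ratr q]).
    by rewrite nu0E /= /mfrestr /mrestr AE.
  have [|nu nuE] := @finite_measure_ex nu0.
    by rewrite nu0A ltey_eq fin_num_measure//; exact: measurableX.
  have nuA A : nu A = N (A `*` [set y | j y <= ratr q]) by rewrite nuE nu0A.
  have [A mA|f [mf f01 fE]] := @dominated_density _ _ _ m nu.
    rewrite nuA -Nm//; apply: le_measure; rewrite ?inE//.
    - by rewrite -AE; apply: measurableI => //; rewrite -[X in measurable X]setTI;
        exact: measurable_fst.
    - exact: measurableX.
    - by move=> [x y] [].
  by exists f; split=> // A mA; rewrite -nuA fE.
have F01 q t : 0 <= F q t <= 1 by case: (FP q).
have Fm q : measurable_fun setT (F q) by case: (FP q).
have Fi q : m.-integrable setT (EFin \o F q).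
  apply: measurable_bounded_integrable => //; first by rewrite ltey_eq fin_num_measure.
  exists 1; split=> // M M1 t _; have /andP[F0 F1] := F01 q t.
  by rewrite /= ger0_norm// (le_trans F1)// ltW.
(* Each [F q] is determined only up to a null set, so monotonicity in [q] holds for almost every
   [t]; only countably many pairs of rationals are concerned. *)
have Fmono : {ae m, forall t, forall n, if unpickle n is Some p then
    (p.1 : rat) <= p.2 -> F p.1 t <= F p.2 t else True}.
  apply/ae_foralln => n; case: (unpickle n) => [[q q']|] /=; last exact: aeW.
  have [qq'|_] := boolP (q <= q'); last exact: aeW.
  apply: filterS (@integral_le_ae _ _ _ m (F q) (F q') (Fi _) (Fi _) _) => //.
  move=> A mA; have [_ _ <-//] := FP q; have [_ _ <-//] := FP q'.
  apply: le_measure; rewrite ?inE; try exact: measurableX.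
  by move=> [x y] [Ax /= yq]; split=> //=; rewrite (le_trans yq)// ler_rat.
pose bits t n := if unpickle n is Some p then (ratr p.2 : R) <= F p.1 t else false.
pose z t : R := cantor_code (bits t).
have zbit t (p : rat * rat) : cantor_bit (pickle p) (z t) = (ratr p.2 <= F p.1 t).
  by rewrite cantor_codeK /bits pickleK.
have mz : measurable_fun setT z.
  apply: (@measurable_cantor_code R _ X (fun n t => bits t n)) => n.
  by rewrite /bits; case: (unpickle n) => [p|]; [exact: measurable_fun_ler|exact: measurable_cst].
exists z; split=> // [t|A B mA mB]; first exact: cantor_code_itv.
have mqz t : measurable_fun setT (quantile (z t)).
  exact: measurableT_comp measurable_quantile (pair1_measurable (z t : measurableTypeR R)).
have /choice[kap kapE] : forall t, exists nu : {measure set (measurableTypeR R) -> \bar R},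
    forall S, nu S = unit_law (quantile (z t) @^-1` S).
  by move=> t; exact: (@pushforward_ex R _ _ (measurableTypeR R) (measurableTypeR R) unit_law _ (mqz t)).
have mkap S : measurable S -> measurable_fun A (fun t => kap t S).
  move=> mS'; under eq_fun do rewrite kapE; apply: measurable_funTS.
  apply: (measurableT_comp (f := fun u : measurableTypeR R =>
    unit_law (quantile u @^-1` S)) _ mz).
  exact: measurable_unit_law_section measurable_quantile mS'.
have [M2 M2E] := mixture_ex m mA mkap.
have [M1 M1E] := @pushforward_ex R _ _ _ (measurableTypeR R) (mfrestr (measurableX mA measurableT)
  (ltac:(by rewrite ltey_eq fin_num_measure//; exact: measurableX) : (N (A `*` setT) < +oo)%E))
  _ (measurableT_comp mj (@measurable_snd _ _ X Y)).
have {}M1E (S : set (measurableTypeR R)) : M1 S = N (A `*` (j @^-1` S)).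
  rewrite M1E /= /mfrestr /mrestr; congr (N _).
  by apply/seteqP; split=> -[x y] [] //= ? [].
(* [M1] is the law of the code over [A] and [M2] the mixture of the quantile laws. Decoding by [k]
   turns their equality into the claim, and half-lines suffice to compare them. *)
suff M12 (S : set (measurableTypeR R)) : measurable S -> M1 S = M2 S.
  have mkB : measurable (k @^-1` B) by rewrite -[X in measurable X]setTI; exact: mk.
  have := M12 _ mkB; rewrite M1E M2E (_ : j @^-1` (k @^-1` B) = B).
    by move=> ->; apply: eq_integral => t _; rewrite kapE.
  by apply/seteqP; split=> y /=; rewrite bK.
move=> mS'; pose G := [set `]-oo, a[%classic | a in [set: R]].
apply: (@measure_unique _ R (measurableTypeR R) (@RGenInftyO.G R)
  (fun n => `]-oo, n%:R[%classic) _ _ _ _ M1 M2) => //.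
- exact: RGenInftyO.measurableE.
- move=> _ _ [a ->] [c ->]; exists (Num.min a c).
  by apply/seteqP; split=> x /=; rewrite !in_itv /= lt_min; [case=> -> ->|case/andP].
- by move=> n; exists n%:R.
- apply/seteqP; split=> // x _; exists (Num.bound `|x : R|) => //=; rewrite in_itv /=.
  exact: le_lt_trans (ler_norm x) (archi_boundP (normr_ge0 _)).
- move=> _ [a ->]; rewrite M1E M2E.
  have qE t : kap t `]-oo, a[%classic = unit_law [set w | quantile (z t) w < a].
    by rewrite kapE; congr unit_law; apply/seteqP; split=> w /=; rewrite in_itv.
  under eq_integral do rewrite qE.
  have [a1|a1] := ltP 1 a.
    rewrite (eq_integral (cst 1%E)); last first.
      move=> t _; rewrite (_ : [set w | _] = setT) ?probability_setT//.
      by apply/seteqP; split=> // w _; apply/quantile_lt; left.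
    rewrite integral_cst// mul1e; apply: etrans (Nm _ mA); congr (N (A `*` _)).
    apply/seteqP; split=> // y _ /=; rewrite in_itv /=.
    by apply: le_lt_trans a1; case/andP: (j01 y).
  under eq_integral do rewrite (unit_law_quantile (F01 ^~ _) (zbit _) a1).
  have [a0|a0] := leP a 0.
    rewrite (eq_integral (cst 0%E)); last first.
      move=> t _; rewrite (_ : [set F q t | q in _] = set0) ?sup0//.
      apply/seteqP; split=> // y [q [/andP[q0 _] qa] _].
      by have := le_lt_trans q0 (lt_le_trans qa a0); rewrite ltxx.
    rewrite integral0 (_ : _ `*` _ = set0) ?measure0//.
    apply/seteqP; split=> // -[x y] [_ /=]; rewrite in_itv /= => ja.
    have /andP[j0 _] := j01 y.
    by have := le_lt_trans j0 (lt_le_trans ja a0); rewrite ltxx.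
  (* Rationals of [[0, 1]] tending to [a] from below. By monotonicity [F (q n) t] tends to the
     supremum over all rationals below [a], and both sides pass to the limit. *)
  have /choice[q qP] : forall n, exists q : rat,
      (ratr q : R) \in `]Num.max 0 (a - n.+1%:R^-1), a[.
    move=> n; apply: rat_in_itvoo.
    by rewrite gt_max a0 /= ltrBlDr ltrDl invr_gt0 ltr0Sn.
  have {}qP n : [/\ 0 < (ratr (q n) : R), a - n.+1%:R^-1 < ratr (q n) & ratr (q n) < a].
    by have := qP n; rewrite in_itv /= gt_max => /andP[/andP[]].
  set Sup := fun t => sup [set F q t | q in [set q | 0 <= (ratr q : R) <= 1 /\ ratr q < a]].
  have q01 n : 0 <= (ratr (q n) : R) <= 1.
    by have [h1 _ h2] := qP n; rewrite ltW//= (le_trans (ltW h2)).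
  have Sup_ub t n : F (q n) t <= Sup t.
    apply: ub_le_sup; first by exists 1 => _ [q' _ <-]; case/andP: (F01 q' t).
    by exists (q n) => //; split=> //; case: (qP n).
  have cF : {ae m, forall t, A t -> (F (q n) t)%:E @[n --> \oo] --> (Sup t)%:E}.
    apply: filterS Fmono => t tmono _.
    apply: cvg_EFin; first exact: nearW.
    apply/cvgrPdist_le => e e0 /=.
    have [||_ [q' [q'01 q'a] <-] q'e] := @sup_gt _ [set F q t |
        q in [set q | 0 <= (ratr q : R) <= 1 /\ ratr q < a]] (Sup t - e).
      by exists (F (q 0%N) t), (q 0%N) => //; split=> //; case: (qP 0%N).
      by rewrite ltrBlDr ltrDl.
    have aq0 : 0 < a - ratr q' by rewrite subr_gt0.
    have [N0 N0P] := near_inv_succ_lt aq0.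
    exists N0 => // n /= N0n; rewrite ger0_norm ?subr_ge0//.
    rewrite lerBlDr -lerBlDl (le_trans (ltW q'e))//.
    have := tmono (pickle (q', q n)); rewrite pickleK /=; apply.
    rewrite -(ler_rat R); have [_ + _] := qP n; have := N0P _ N0n.
    by move: (n.+1%:R^-1) (ratr q') (ratr (q n)) => u v w h1 h2; lra.
  have mSup : measurable_fun A (fun t => (Sup t)%:E).
    have := mkap _ (measurable_itv `]-oo, a[); congr measurable_fun.
    by apply/funext => t; rewrite qE (unit_law_quantile (F01 ^~ _) (zbit _) a1).
  have [|||_ _ cI] := @dominated_convergence _ _ _ m A mA
    (fun n t => (F (q n) t)%:E) (fun t => (Sup t)%:E) (cst 1%E) _ mSup cF _ _.
  - by move=> n; apply: measurable_funTS; apply/measurable_EFinP.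
  - exact: finite_measure_integrable_cst.
  - apply: aeW => t n _; have /andP[F0 F1] := F01 (q n) t.
    by rewrite gee0_abs lee_fin.
  rewrite -/(Sup _); apply/esym.
  have {}cI : N (A `*` [set y | j y <= ratr (q n)]) @[n --> \oo] -->
      (\int[m]_(t in A) (Sup t)%:E)%E.
    apply: cvg_trans cI; apply: near_eq_cvg; apply: nearW => n /=.
    by case: (FP (q n)) => _ _ ->.
  apply: (cvg_unique _ cI) => //=.
  have mja (c : R) : measurable (A `*` [set y | j y <= c]).
    apply: measurableX => //.
    have := measurable_fun_ler mj (measurable_cst c) measurableT
      (Logic.I : measurable [set true]).
    by rewrite setTI.
  have mjo : measurable (A `*` (j @^-1` `]-oo, a[)).
    by apply: measurableX => //; rewrite -[X in measurable X]setTI; exact: mj.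
  pose An n := A `*` [set y | j y <= a - n.+1%:R^-1].
  have AE : A `*` (j @^-1` `]-oo, a[) = \bigcup_n An n.
    apply/seteqP; split=> -[x y].
      move=> [Ax /=]; rewrite in_itv /= => ja.
      have aj0 : 0 < a - j y by rewrite subr_gt0.
      have [n /(_ _ (leqnn n)) nP] := near_inv_succ_lt aj0.
      by exists n => //; split=> //=; rewrite lerBrDl -lerBrDr ltW.
    move=> [n _ [Ax /= jn]]; split=> //=; rewrite in_itv /=.
    by rewrite (le_lt_trans jn)// ltrBlDr ltrDl invr_gt0 ltr0Sn.
  have cA : (N \o An) n @[n --> \oo] --> N (A `*` (j @^-1` `]-oo, a[)).
    rewrite AE; apply: nondecreasing_cvg_mu => //.
    - by move=> n; exact: mja.
    - by rewrite -AE.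
    - move=> n1 n2 n12; apply/subsetPset => -[x y] [Ax /= h]; split=> //=.
      by rewrite (le_trans h)// lerB// lef_pV2 ?posrE// ler_nat.
  apply: (@squeeze_cvge _ _ _ _ (N \o An) _ (cst (N (A `*` (j @^-1` `]-oo, a[))))) => //; last exact: cvg_cst.
  apply: nearW => n /=; have [_ q1 q2] := qP n; apply/andP; split.
    apply: le_measure; rewrite ?inE; [exact: mja|exact: mja|].
    by move=> [x y] [Ax /= h]; split=> //=; rewrite (le_trans h)// ltW.
  apply: le_measure; rewrite ?inE; [exact: mja|exact: mjo|].
  by move=> [x y] [Ax /= h]; split=> //=; rewrite in_itv /= (le_lt_trans h).
- move=> n; rewrite M1E ltey_eq fin_num_measure//.
  apply: measurableX => //; rewrite -[X in measurable X]setTI; exact: mj.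
Qed.

End disintegration.

(** On [D] the events [f x \in B] and its complement are both projections of Borel sets of pairs
    (point, code), hence both Souslin. They are disjoint because [f x] is the same for all codes of
    [x], so a Borel set separates them. The code need not be chosen measurably in [x]. *)
Lemma measurable_fun_unique_code (R : realType) (X : completeNormedModType R)
    (D : set (borel X)) (f : borel X -> \bar R)
    (G : set (borel X * measurableTypeR R)%type) (g : measurableTypeR R -> \bar R) :
  separable X -> measurable G -> measurable_fun setT g ->
  (forall x, D x -> exists2 z : R, z \in `[0, 1] & G (x, z)) ->
  (forall x z, D x -> z \in `[0, 1] -> G (x, z) -> f x = g z) ->
  measurable_fun D f.
Proof.
move=> sX mG mg Gex Gf mD B mB.
have mgB (S : set (\bar R)) : measurable S ->
    souslin [set x : X | exists2 z : R, z \in `[0, 1] & D x /\ G (x, z) /\ S (g z)].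
  move=> mS; apply: (@souslin_proj R X (fun p => D p.1 /\ G p /\ S (g p.2))).
  apply: (@measurable_prod_souslin R X).
  apply: measurableI.
    by have := @measurable_fst _ _ (borel X) (measurableTypeR R) measurableT D mD;
      rewrite setTI.
  apply: measurableI => //.
  have := measurableT_comp mg (@measurable_snd _ _ (borel X) (measurableTypeR R)).
  by move=> /(_ measurableT S mS); rewrite setTI.
have [|M [mM PM QM]] := souslin_separation sX (mgB B mB) (mgB (~` B) (measurableC mB)).
  apply/seteqP; split=> // x [[z z01 [Dx [Gxz Bz]]] [z' z'01 [_ [Gxz' nBz']]]].
  by apply: nBz'; rewrite /= -(Gf _ _ Dx z'01 Gxz') (Gf _ _ Dx z01 Gxz).
rewrite (_ : D `&` f @^-1` B = D `&` M); first exact: measurableI.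
apply/seteqP; split=> x [Dx].
  move=> Bfx; split=> //; apply: PM; have [z z01 Gxz] := Gex x Dx.
  by exists z => //; rewrite -(Gf _ _ Dx z01 Gxz).
move=> Mx; split=> //=; apply: contrapT => nB.
have : set0 x; last by [].
rewrite -QM; split=> //; have [z z01 Gxz] := Gex x Dx.
by exists z => //; rewrite /= -(Gf _ _ Dx z01 Gxz).
Qed.

Lemma eq_measure_prod (R : realType) d1 d2 (X : measurableType d1)
    (Y : measurableType d2) (m1 m2 : {measure set (X * Y)%type -> \bar R}) :
  (m1 setT < +oo)%E ->
  (forall A B, measurable A -> measurable B -> m1 (A `*` B) = m2 (A `*` B)) ->
  forall E, measurable E -> m1 E = m2 E.
Proof.
move=> m1oo m12 E mE.
apply: (measure_unique [set A `*` B | A in measurable & B in measurable]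
  (fun=> setT)) => //.
- exact: measurable_prod_measurableType.
- move=> _ _ [A1 mA1 [B1 mB1 <-]] [A2 mA2 [B2 mB2 <-]]; rewrite -setXI.
  exists (A1 `&` A2); first exact: measurableI.
  by exists (B1 `&` B2) => //; exact: measurableI.
- by move=> _; exists setT => //; exists setT => //; rewrite setXTT.
- by rewrite bigcup_const//; exists 0%N.
- by move=> _ [A mA [B mB <-]]; exact: m12.
Qed.

Lemma measurable_fun_xsection_prob (R : realType) d1 d2 (X : measurableType d1)
    (Y : measurableType d2) (D : set X) (nu : X -> probability Y R) :
  measurable D -> (forall B, measurable B -> measurable_fun D (fun t => nu t B)) ->
  forall E, measurable E -> measurable_fun D (fun t => nu t (xsection E t)).
Proof.
move=> mD mnu E mE.
pose C : set (set (X * Y)) := [set A | measurable A /\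
  measurable_fun D (fun t => nu t (xsection A t))].
suff : @measurable _ (X * Y)%type `<=` C by move=> /(_ E mE)[].
rewrite measurable_prod_measurableType; apply: lambda_system_subset => //.
- move=> _ _ [A1 mA1 [B1 mB1 <-]] [A2 mA2 [B2 mB2 <-]]; rewrite -setXI.
  exists (A1 `&` A2); first exact: measurableI.
  by exists (B1 `&` B2) => //; exact: measurableI.
- split=> //.
  + split=> //; rewrite (_ : (fun _ => _) = cst 1%E)//; apply/funext => t.
    by rewrite xsectionE preimage_setT probability_setT.
  + move=> B A AB [mB fB] [mA fA]; split; first exact: measurableD.
    rewrite (_ : (fun _ => _) =
      (fun t => nu t (xsection B t) - nu t (xsection A t))%E).
      exact: emeasurable_funB.
    apply/funext => t; rewrite xsectionD measureD ?setIidr//.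
    * exact: le_xsection.
    * exact: measurable_xsection.
    * exact: measurable_xsection.
    * by rewrite (le_lt_trans (probability_le1 _ _)) ?ltry//; exact: measurable_xsection.
  + move=> F ndF CF; have mF n : measurable (F n) by case: (CF n).
    split; first exact: bigcupT_measurable.
    apply: (emeasurable_fun_cvg (fun n t => nu t (xsection (F n) t))).
      by move=> n; case: (CF n).
    move=> t Dt; rewrite xsection_bigcup; apply: nondecreasing_cvg_mu.
    * by move=> n; exact: measurable_xsection.
    * by apply: bigcupT_measurable => n; exact: measurable_xsection.
    * move=> n1 n2 n12; apply/subsetPset; apply: le_xsection.
      exact/subsetPset/ndF.
- move=> _ [A mA [B mB <-]]; split; first exact: measurableX.
  rewrite (_ : (fun _ => _) = (fun t => nu t B * (\1_A t)%:E)%E).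
    apply: emeasurable_funM; first exact: mnu.
    by apply/measurable_EFinP; exact: measurable_indic.
  apply/funext => t; rewrite indicE; have [tA|tA] := boolP (t \in A).
    by rewrite in_xsectionX// mule1.
  by rewrite notin_xsectionX// measure0 mule0.
Qed.

Section law_of_code.
Context (R : realType) d (Y : measurableType d).

(** A law is a disintegration over a one-point space, so one real of [[0, 1]] encodes it. The joint
    measurability of [Psi] is what makes the passage from codes to laws measurable. *)
Lemma cantor_coded_law : cantor_coded R Y ->
  exists2 Psi : R -> R -> Y,
    measurable_fun setT (fun zw : measurableTypeR R * measurableTypeR R => Psi zw.1 zw.2)
  & forall Q : probability Y R, exists2 z : R, z \in `[0, 1] &
      forall B, measurable B -> Q B = unit_law [set w | B (Psi z w)].
Proof.
move=> [b [k [mb mk bK]]]; exists (fun z w => k (quantile z w)).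
  exact: measurableT_comp mk measurable_quantile.
move=> Q; pose m : {finite_measure set unit -> \bar R} := dirac tt.
have mp : measurable_fun setT (pair tt : Y -> unit * Y)%type by exact: pair1_measurable.
have [N0 N0E] := pushforward_ex Q mp.
have [|N NE] := @finite_measure_ex R _ _ N0.
  by rewrite N0E preimage_setT (le_lt_trans (probability_le1 _ _)) ?ltry.
have [|z [_ z01 zP]] := quantile_disintegration mb mk bK (m := m) (N := N).
  move=> A mA; rewrite NE N0E /= diracE.
  have [At|At] := boolP (tt \in A).
    rewrite (_ : _ @^-1` _ = setT) ?probability_setT//.
    by apply/seteqP; split=> // y _; split=> //=; exact/set_mem.
  rewrite (_ : _ @^-1` _ = set0) ?measure0//.
  by apply/seteqP; split=> // y [/= /mem_set]; rewrite (negbTE At).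
exists (z tt); first by rewrite in_itv /= z01.
move=> B mB; have := zP setT B measurableT mB.
rewrite NE N0E integral_dirac// diracT mul1e => <-.
by congr (Q _); apply/seteqP; split=> y => [|[]].
Qed.

Lemma cantor_coded_disintegration dX (X : measurableType dX)
    (m : {finite_measure set X -> \bar R}) (N : {finite_measure set (X * Y)%type -> \bar R}) :
  cantor_coded R Y -> (forall A, measurable A -> N (A `*` setT) = m A) ->
  exists2 nu : X -> probability Y R,
    forall B, measurable B -> measurable_fun setT (fun t => nu t B)
  & forall E, measurable E -> N E = (\int[m]_t nu t (xsection E t))%E.
Proof.
move=> [b [k [mb mk bK]]] Nm.
have [z [mz z01 zP]] := quantile_disintegration mb mk bK Nm.
have mkq t : measurable_fun setT (fun w : measurableTypeR R => k (quantile (z t) w)).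
  apply: measurableT_comp mk _.
  exact: measurableT_comp measurable_quantile (pair1_measurable (z t : measurableTypeR R)).
pose f t : {mfun (measurableTypeR R) >-> Y} := mfun_Sub (mem_set (mkq t)).
pose nu t : probability Y R := distribution (@unit_law R) (f t).
have nuE t B : nu t B = unit_law [set w | B (k (quantile (z t) w))] by [].
have mnu B : measurable B -> measurable_fun setT (fun t => nu t B).
  move=> mB; under eq_fun do rewrite nuE.
  apply: (measurableT_comp (f := fun u : measurableTypeR R =>
    unit_law [set w | B (k (quantile u w))]) _ mz).
  by apply: (measurable_unit_law_section (measurableT_comp mk measurable_quantile)).
exists nu => // E mE.
have /choice[kap kapE] : forall t, exists mu : {measure set (X * Y)%type -> \bar R},
    forall S, mu S = nu t (pair t @^-1` S).
  by move=> t; apply: pushforward_ex; exact: pair1_measurable.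
have mkap S : measurable S -> measurable_fun setT (fun t => kap t S).
  move=> mS; under eq_fun do rewrite kapE.
  under eq_fun do rewrite nuE.
  apply: (@measurable_unit_law_section R _ _ X (X * Y)%type
    (fun tw => (tw.1, k (quantile (z tw.1) tw.2))) S) => //.
  have mp : measurable_fun setT (fun tw : X * measurableTypeR R =>
      (z tw.1, tw.2) : measurableTypeR R * measurableTypeR R)%type.
    apply/measurable_fun_pairP; split; last exact: measurable_snd.
    exact: (measurableT_comp mz (@measurable_fst _ _ X (measurableTypeR R))).
  apply/measurable_fun_pairP; split; first exact: measurable_fst.
  exact: (measurableT_comp mk (measurableT_comp measurable_quantile mp)).
have [M ME] := mixture_ex m measurableT mkap.
rewrite (@eq_measure_prod R _ _ X Y N M)//.
- by rewrite ME; apply: eq_integral => t _; rewrite kapE xsectionE.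
- by rewrite ltey_eq fin_num_measure.
- move=> A B mA mB; rewrite ME; apply: (etrans (zP _ _ mA mB)).
  rewrite [LHS]integral_mkcond; apply: eq_integral => t _; rewrite kapE patchE.
  case: ifPn => tA.
    rewrite -nuE; congr (nu t _); apply/seteqP; split=> y /=; last by case.
    by move=> By; split=> //; exact: set_mem.
  rewrite (_ : _ @^-1` _ = set0) ?measure0//.
  by apply/seteqP; split=> // y [/= /mem_set]; rewrite (negbTE tA).
Qed.

End law_of_code.

(** * Functionals dominated by an integral *)

Section hahn_banach.
Context (R : realType) (V : lmodType R) (S : V -> Prop).
Hypothesis SD : forall f g, S f -> S g -> S (f + g).
Hypothesis SZ : forall (a : R) f, S f -> S (a *: f).

Definition sublinear_on (q : V -> R) :=
  (forall f g, S f -> S g -> q (f + g) <= q f + q g) /\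
  (forall (a : R) f, 0 <= a -> S f -> q (a *: f) = a * q f).

Let SN f : S f -> S (- f). Proof. by rewrite -scaleN1r; exact: SZ. Qed.

Let sub_opp q f : sublinear_on q -> S f -> - q (- f) <= q f.
Proof.
move=> [qD qZ] Sf; have := qD _ _ Sf (SN Sf).
by rewrite subrr -(scale0r f) qZ// mul0r => h; lra.
Qed.

Let homogeneous_of_le (r : V -> R) : r 0 = 0 ->
  (forall (a : R) f, 0 < a -> S f -> r (a *: f) <= a * r f) ->
  forall (a : R) f, 0 <= a -> S f -> r (a *: f) = a * r f.
Proof.
move=> r0 rZ a f; rewrite le_eqVlt => /predU1P[<- _|a0 Sf].
  by rewrite scale0r mul0r.
apply/eqP; rewrite eq_le rZ//=.
have := rZ a^-1 (a *: f); rewrite invr_gt0 => /(_ a0 (SZ a Sf)).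
by rewrite scalerA mulVf ?gt_eqF// scale1r mulrC ler_pdivlMr// mulrC.
Qed.

(* A minimal sublinear functional is additive, since
   f |-> inf_(t >= 0) q (f + t h) - t q h is again sublinear and below q. *)
Lemma minimal_sublinear_additive q : sublinear_on q ->
  (forall r, sublinear_on r -> (forall f, S f -> r f <= q f) ->
     forall f, S f -> q f <= r f) ->
  forall f g, S f -> S g -> q (f + g) = q f + q g.
Proof.
move=> qs qmin f h Sf Sh; have [qD qZ] := qs.
pose A g := [set q (g + t *: h) - t * q h | t in [set t : R | 0 <= t]].
have SA g t : S g -> S (g + t *: h) by move=> Sg; apply: SD => //; exact: SZ.
have Alb g : S g -> lbound (A g) (- q (- g)).
  move=> Sg _ [t /= t0 <-]; have := qD _ _ (SA g t Sg) (SN Sg).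
  rewrite addrAC subrr add0r qZ//.
  by move: (t * q h) (q (_ + _)) (q (- g)) => x y z hx; lra.
have Ai g : S g -> has_inf (A g).
  move=> Sg; split; last by exists (- q (- g)); exact: Alb.
  by exists (q (g + 0 *: h) - 0 * q h), 0 => //=.
pose r g := inf (A g).
have rle g t : S g -> 0 <= t -> r g <= q (g + t *: h) - t * q h.
  by move=> Sg t0; apply: ge_inf; [exact: (Ai g Sg).2|exists t].
have rge g c : S g -> (forall t, 0 <= t -> c <= q (g + t *: h) - t * q h) -> c <= r g.
  move=> Sg cP; apply: lb_le_inf; first exact: (Ai g Sg).1.
  by move=> _ [t t0 <-]; exact: cP.
have rq g : S g -> r g <= q g.
  by move=> Sg; have := rle g 0 Sg (lexx 0); rewrite scale0r addr0 mul0r subr0.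
have rs : sublinear_on r.
  split=> [g1 g2 S1 S2|a g a0 Sg].
    rewrite -lerBlDr; apply: (rge _ _ _) => // t t0; rewrite lerBlDl -lerBlDr.
    apply: (rge _ _ _) => // u u0; rewrite lerBlDr.
    apply: (le_trans (rle _ (u + t) (SD S1 S2) (addr_ge0 u0 t0))).
    have := qD _ _ (SA g2 u S2) (SA g1 t S1).
    rewrite addrACA -scalerDl [g2 + g1]addrC.
    by move: (q (_ + _)) (q (g1 + _)) (q (g2 + _)) (q h) => x y z w hx; lra.
  move: a g a0 Sg; apply: homogeneous_of_le.
    have S0 : S 0 by rewrite -(scale0r h); exact: SZ.
    have q0 : q 0 = 0 by rewrite -(scale0r h) qZ// mul0r.
    apply/eqP; rewrite eq_le; apply/andP; split; first by rewrite -[leRHS]q0; exact: rq.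
    apply: (rge _ _ _) => // t t0.
    by rewrite add0r qZ// subrr.
  move=> a g a0 Sg; rewrite mulrC -ler_pdivrMr//; apply: (rge _ _ _) => // t t0.
  rewrite ler_pdivrMr//.
  have := rle (a *: g) (a * t) (SZ a Sg) (mulr_ge0 (ltW a0) t0).
  rewrite -scalerA -scalerDr qZ//; [|exact: ltW|exact: SA].
  by rewrite mulrBl -mulrA [q _ * a]mulrC [_ * a]mulrC.
have := qmin r rs rq f Sf => qr.
apply/eqP; rewrite eq_le qD//=.
have := rle f 1 Sf ler01; rewrite scale1r mul1r => rf1.
by rewrite -lerBrDr (le_trans qr).
Qed.

(** Zorn's lemma yields a minimal sublinear functional below [p], and minimal ones are linear. No
    subspace is extended: constraints on a subspace are to be built into [p] beforehand. *)
Lemma hahn_banach_sublinear p : sublinear_on p ->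
  exists l : V -> R, [/\ forall f g, S f -> S g -> l (f + g) = l f + l g,
     forall a f, S f -> l (a *: f) = a * l f & forall f, S f -> l f <= p f].
Proof.
move=> ps.
pose T := {q : V -> R | sublinear_on q /\ forall f, S f -> q f <= p f}.
pose t0 : T := exist _ p (conj ps (fun f _ => lexx _)).
(* The order is reversed, so that a maximal element is a minimal functional. *)
pose rel_q (q1 q2 : T) := `[< forall f, S f -> proj1_sig q2 f <= proj1_sig q1 f >].
have [|||[q [qs qp]] qmin] := @ZL_preorder T t0 rel_q.
- by move=> q; apply/asboolP.
- move=> q1 q2 q3 /asboolP h1 /asboolP h2; apply/asboolP => f Sf.
  by rewrite (le_trans (h2 _ Sf))// h1.
- move=> A Atot.
  have [A0|/set0P[q0 Aq0]] := eqVneq A set0; first by exists t0 => q; rewrite A0.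
  (* The infimum over a chain stays subadditive because, of any two members, the smaller one bounds
     both terms. *)
  pose B f := [set proj1_sig q f | q in A].
  have Bi f : S f -> has_inf (B f).
    move=> Sf; split; first by exists (proj1_sig q0 f), q0.
    exists (- p (- f)) => _ [[q [qs qp]] Aq <-] /=.
    by apply: le_trans (sub_opp qs Sf); rewrite lerN2 qp//; exact: SN.
  pose r f := inf (B f).
  have rle f q : S f -> A q -> r f <= proj1_sig q f.
    by move=> Sf Aq; apply: ge_inf; [exact: (Bi f Sf).2|exists q].
  have rge f c : S f -> (forall q, A q -> c <= proj1_sig q f) -> c <= r f.
    move=> Sf cP; apply: lb_le_inf; first exact: (Bi f Sf).1.
    by move=> _ [q Aq <-]; exact: cP.
  have rs : sublinear_on r.
    split=> [f g Sf Sg|a f a0 Sf].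
      rewrite -lerBlDr; apply: (rge _ _ _) => // q1 A1; rewrite lerBlDl -lerBlDr.
      apply: (rge _ _ _) => // q2 A2; rewrite lerBlDr [leRHS]addrC.
      have [/asboolP q21|/asboolP q12] := Atot q1 q2 A1 A2.
        case: q2 A2 q21 => q2 [[q2D q2Z] q2p] A2 /= q21.
        apply: (le_trans (rle _ _ (SD Sf Sg) A2)); apply: (le_trans (q2D _ _ Sf Sg)).
        by rewrite lerD// q21.
      case: q1 A1 q12 => q1 [[q1D q1Z] q1p] A1 /= q12.
      apply: (le_trans (rle _ _ (SD Sf Sg) A1)); apply: (le_trans (q1D _ _ Sf Sg)).
      by rewrite lerD// q12.
    have S0' := Sf; move: a f a0 Sf S0'.
    suff h0 f : S f -> forall (a : R) g, 0 <= a -> S g -> r (a *: g) = a * r g.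
      by move=> a f a0 Sf _; exact: (h0 f).
    move=> Sf; apply: homogeneous_of_le.
      have S0 : S 0 by rewrite -(scale0r f); exact: SZ.
      have q00 q : A q -> proj1_sig q 0 = 0.
        by move=> _; case: q => q' [[_ qZ] _] /=; rewrite -(scale0r f) qZ// mul0r.
      apply/eqP; rewrite eq_le; apply/andP; split.
        by rewrite -[leRHS](q00 _ Aq0); exact: rle.
      by apply: (rge _ _ _) => // q Aq; rewrite q00.
    move=> a g a0 Sg; rewrite mulrC -ler_pdivrMr//; apply: (rge _ _ _) => // q Aq.
    rewrite ler_pdivrMr//; apply: (le_trans (rle _ _ (SZ a Sg) Aq)).
    case: q {Aq} => q' [[q'D q'Z] q'p] /=; rewrite q'Z; [by rewrite mulrC|exact: ltW|by []].
  have rp f : S f -> r f <= p f.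
    move=> Sf; apply: (le_trans (rle _ _ Sf Aq0)).
    by case: (q0) => q [_ qp] /=; exact: qp.
  exists (exist _ r (conj rs rp)) => q Aq; apply/asboolP => f Sf /=.
  exact: rle.
have qadd : forall f g, S f -> S g -> q (f + g) = q f + q g.
  apply: minimal_sublinear_additive => // r rs rq f Sf.
  have rp g : S g -> r g <= p g by move=> Sg; rewrite (le_trans (rq _ Sg))// qp.
  have /asboolP := qmin (exist _ r (conj rs rp)) (asboolT rq).
  exact.
exists q; split=> // a f Sf; have [_ qZ] := qs.
have [a0|a0] := leP 0 a; first exact: qZ.
have q0 : q 0 = 0 by rewrite -(scale0r f) qZ// mul0r.
have qN g : S g -> q (- g) = - q g.
  move=> Sg; have := qadd _ _ Sg (SN Sg); rewrite subrr q0 => /esym/eqP.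
  by rewrite addrC addr_eq0 => /eqP.
rewrite -[a]opprK scaleNr qN; last exact: SZ.
by rewrite qZ// ?mulNr// oppr_ge0 ltW.
Qed.

End hahn_banach.

Section dominated_functional.
Context (R : realType) d (Y : measurableType d) (mu : {finite_measure set Y -> \bar R}).
Import HBNNSimple.

Let S (f : Y -> R) := mu.-integrable setT (EFin \o f).
Let I (f : Y -> R) : R := fine (\int[mu]_y (f y)%:E).

Let SD f g : S f -> S g -> S (f + g).
Proof.
move=> Sf Sg; rewrite /S (_ : _ \o _ = (EFin \o f) \+ (EFin \o g))%E//.
exact: integrableD.
Qed.

Let SZ (a : R) f : S f -> S (a *: f).
Proof.
move=> Sf; rewrite /S (_ : _ \o _ = (fun y => a%:E * (EFin \o f) y))%E//.
exact: integrableZl.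
Qed.

Let SB f g : S f -> S g -> S (f - g).
Proof.
move=> Sf Sg; rewrite /S (_ : _ \o _ = (EFin \o f) \- (EFin \o g))%E//.
exact: integrableB.
Qed.

Let Spos f : S f -> S (fun y => Num.max (f y) 0).
Proof.
move=> Sf; rewrite /S (_ : _ \o _ = (EFin \o f)^\+)%E.
  exact: integrable_funepos.
by apply/funext => y; rewrite funeposE /= -EFin_max.
Qed.

Let IE f : S f -> (\int[mu]_y (f y)%:E = (I f)%:E)%E.
Proof. by move=> Sf; rewrite /I fineK//; exact: integrable_fin_num. Qed.

Let ID f g : S f -> S g -> I (f + g) = I f + I g.
Proof.
move=> Sf Sg; apply: EFin_inj; rewrite EFinD -!IE//; last exact: SD.
exact: integralD_EFin.
Qed.

Let IZ (a : R) f : S f -> I (a *: f) = a * I f.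
Proof.
move=> Sf; apply: EFin_inj; rewrite EFinM -!IE//; last exact: SZ.
rewrite (_ : (fun y => _) = (fun y => a%:E * (f y)%:E))%E//; exact: integralZl.
Qed.

Let IB f g : S f -> S g -> I (f - g) = I f - I g.
Proof. by move=> Sf Sg; rewrite -scaleN1r ID ?IZ ?mulN1r//; exact: SZ. Qed.

Let Ile f g : S f -> S g -> (forall y, f y <= g y) -> I f <= I g.
Proof.
move=> Sf Sg fg; rewrite -lee_fin -!IE//; apply: le_integral => // y _.
by rewrite lee_fin fg.
Qed.

Let Sindic A : measurable A -> S (\1_A).
Proof. by move=> mA; exact: integrable_indic. Qed.

Variable l : (Y -> R) -> R.
Hypothesis lD : forall f g, S f -> S g -> l (f + g) = l f + l g.
Hypothesis lZ : forall (a : R) f, S f -> l (a *: f) = a * l f.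
Hypothesis lI : forall f, S f -> l f <= I (fun y => Num.max (f y) 0).

Let S0 : S (0 : Y -> R).
Proof. by rewrite /S (_ : _ \o _ = cst 0%E)//; exact: integrable0. Qed.

Let l0 : l 0 = 0.
Proof. by rewrite -(scale0r (0 : Y -> R)) lZ// mul0r. Qed.

Let lB f g : S f -> S g -> l (f - g) = l f - l g.
Proof.
by move=> Sf Sg; rewrite -scaleN1r lD ?lZ ?mulN1r//; exact: SZ.
Qed.

Let l_ge0 f : S f -> (forall y, 0 <= f y) -> 0 <= l f.
Proof.
move=> Sf f0; rewrite -oppr_le0 -mulN1r -lZ//.
apply: (le_trans (lI (SZ _ Sf))).
have -> : (fun y => Num.max ((-1 *: f) y) 0) = 0 :> (Y -> R).
  apply/funext => y; rewrite /= max_r// /GRing.scale /=.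
  by rewrite scaleN1r oppr_le0 f0.
by rewrite -(scale0r (0 : Y -> R)) IZ// mul0r.
Qed.

Let l_le f : S f -> (forall y, 0 <= f y) -> l f <= I f.
Proof.
move=> Sf f0; apply: (le_trans (lI Sf)); apply: Ile => // [|y]; first exact: Spos.
by rewrite max_l.
Qed.

(** The value on nonmeasurable sets is a dummy; [0] keeps [m] nonnegative everywhere. *)
Let m (A : set Y) : \bar R := if `[< measurable A >] then (l (\1_A))%:E else 0%E.

Let mE A : measurable A -> m A = (l (\1_A))%:E.
Proof. by move=> mA; rewrite /m asboolT. Qed.

Let m0 : m set0 = 0%E.
Proof. by rewrite mE// indic0 l0. Qed.

Let m_ge0 A : (0 <= m A)%E.
Proof. by rewrite /m; case: asboolP => // mA; rewrite lee_fin l_ge0//; exact: Sindic. Qed.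

Let Iindic A : measurable A -> (I (\1_A))%:E = mu A.
Proof. by move=> mA; rewrite -IE ?integral_indic ?setIT//; exact: Sindic. Qed.

Let m_le A : measurable A -> (m A <= mu A)%E.
Proof. by move=> mA; rewrite mE// -Iindic// lee_fin l_le//; exact: Sindic. Qed.

(** On the remainder [\1_U - g n] the functional lies between [0] and the integral, which tends to
    [0]: domination upgrades additivity to sigma-additivity. *)
Let m_sigma_additive : semi_sigma_additive m.
Proof.
move=> F mF tF mUF.
set U := \bigcup_n F n in mUF *.
pose g n : Y -> R := \sum_(0 <= i < n) \1_(F i).
have Sg n : S (g n).
  by rewrite /g; apply: (big_ind S) => // i _; exact: Sindic.
have [lg Ig] : (forall n, l (g n) = \sum_(0 <= i < n) l (\1_(F i))) /\
    (forall n, I (g n) = \sum_(0 <= i < n) I (\1_(F i))).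
  have I0 : I 0 = 0 by rewrite -(scale0r (0 : Y -> R)) IZ// mul0r.
  split; (elim=> [|n ih]; first by rewrite /g !big_geq).
  - by rewrite [RHS]big_nat_recr//= -ih -lD//; [rewrite /g big_nat_recr|exact: Sindic].
  - by rewrite [RHS]big_nat_recr//= -ih -ID//; [rewrite /g big_nat_recr|exact: Sindic].
have gU n y : 0 <= (\1_U - g n) y.
  rewrite /= subr_ge0 -lee_fin indic_bigcup// /g fct_sumE -sumEFin.
  apply: (@nneseries_lim_ge R (fun i => (\1_(F i) y)%:E) predT) => i _ _.
  by rewrite lee_fin.
have SU : S (\1_U) by exact: Sindic.
have hI : I (g n) @[n --> \oo] --> I (\1_U).
  apply: (@fine_cvg _ _ _ _ (fun n => (I (g n))%:E)).
  rewrite Iindic//; under eq_fun do rewrite Ig -sumEFin.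
  under eq_fun do under eq_bigr do rewrite Iindic//.
  exact: measure_semi_sigma_additive.
have hl : l (g n) @[n --> \oo] --> l (\1_U).
  have -> : (fun n => l (g n)) = (fun n => l (\1_U) - (l (\1_U) - l (g n))).
    by apply/funext => n; rewrite subKr.
  rewrite -[X in _ --> X]subr0; apply: cvgB; first exact: cvg_cst.
  apply: (@squeeze_cvgr _ _ _ _ (cst 0) (fun n => I (\1_U) - I (g n))).
  - near=> n; rewrite -lB// -IB//.
    by rewrite l_ge0 ?l_le//; exact: SB.
  - exact: cvg_cst.
  - by rewrite -[X in _ --> X](subrr (I (\1_U))); apply: cvgB => //; exact: cvg_cst.
under eq_fun do under eq_bigr do rewrite mE//.
have -> : (fun n => \sum_(0 <= i < n) (l (\1_(F i)))%:E)%E = (fun n => (l (g n))%:E).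
  by apply/funext => n; rewrite sumEFin -lg.
by rewrite mE//; apply: cvg_EFin; [near=> n|exact: hl].
Unshelve. all: by end_near.
Qed.

HB.instance Definition _ := isMeasure.Build _ _ _ m m0 m_ge0 m_sigma_additive.

(** The same squeeze, now for [f - g n] with simple [g n] below [f], extends the identity from
    simple to nonnegative functions; the general case follows by splitting [f] into positive and
    negative parts. *)
Lemma dominated_functional_measure : exists m1 : {measure set Y -> \bar R},
  (forall A, measurable A -> (m1 A <= mu A)%E) /\
  forall f, S f -> m1.-integrable setT (EFin \o f) /\
    (\int[m1]_y (f y)%:E = (l f)%:E)%E.
Proof.
exists m; split=> [A mA|]; first exact: m_le.
have Sm f : S f -> m.-integrable setT (EFin \o f).
  move=> /integrableP[mf fi]; apply/integrableP; split=> //; apply: le_lt_trans fi.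
  apply: ge0_le_measure_integral => //; exact: measurableT_comp.
pose E f := (\int[m]_y (f y)%:E = (l f)%:E)%E.
have ED f g : S f -> S g -> E f -> E g -> E (f + g).
  move=> Sf Sg; rewrite /E lD// EFinD => <- <-.
  by rewrite -integralD_EFin//; exact: Sm.
have EZ (a : R) f : S f -> E f -> E (a *: f).
  move=> Sf; rewrite /E lZ// EFinM => <-.
  by rewrite -integralZl//; exact: Sm.
have Ei A : measurable A -> E (\1_A).
  by move=> mA; rewrite /E integral_indic// setIT; exact: mE.
have Esf (f : {nnsfun Y >-> R}) : S f /\ E f.
  have -> : f = (\sum_(i < size (finmap.enum_fset (fset_set (range f))))
      (finmap.enum_fset (fset_set (range f)))`_i *: \1_(f @^-1` [set (finmap.enum_fset (fset_set (range f)))`_i])) :> (Y -> R).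
    by apply/funext => y; rewrite fct_sumE fimfunEord.
  apply: (big_ind (fun f => S f /\ E f)) => [|f1 f2 [S1 E1] [S2 E2]|i _].
  - split=> //; rewrite /E l0 -[RHS](integral0 m setT); exact: eq_integral.
  - by split; [exact: SD|exact: ED].
  - have mi : measurable (f @^-1` [set (finmap.enum_fset (fset_set (range f)))`_i]).
      by apply: measurable_funPTI => //; exact: measurable_set1.
    by split; [apply: SZ; exact: Sindic|apply: EZ; [exact: Sindic|exact: Ei]].
have Epos f : S f -> (forall y, 0 <= f y) -> E f.
  move=> Sf f0.
  have mf : measurable_fun setT (EFin \o f) by case/integrableP: (Sf).
  pose g := nnsfun_approx measurableT mf.
  have ndg : nondecreasing_seq (g : (Y -> R)^nat) by exact: nd_nnsfun_approx.
  have gf y : EFin \o g^~ y @ \oo --> (f y)%:E.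
    by apply: (cvg_nnsfun_approx measurableT mf) => // z _; rewrite lee_fin.
  have ndgE y : {homo (fun n => (g n y)%:E) : a b / (a <= b)%N >-> (a <= b)%E}.
    by move=> a b ab; rewrite lee_fin; move/lefP : (ndg _ _ ab); exact.
  have gle n y : g n y <= f y.
    have fE : g^~ y @ \oo --> f y by exact: (fine_cvg (gf y)).
    rewrite -(cvg_lim _ fE)//; apply: (nondecreasing_cvgn_le (u_ := g^~ y)).
      by move=> a b /(@ndgE y); rewrite lee_fin.
    by apply/cvg_ex; exists (f y).
  have gd n y : 0 <= (f - (g n : Y -> R)) y by rewrite /= subr_ge0.
  have Sg n := (Esf (g n)).1.
  have hmu (nu : {measure set Y -> \bar R}) :
      (\int[nu]_y (g n y)%:E)%E @[n --> \oo] --> (\int[nu]_y (f y)%:E)%E.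
    have -> : (\int[nu]_y (f y)%:E = \int[nu]_y limn (fun n => (g n y)%:E))%E.
      by apply: eq_integral => y _; rewrite (cvg_lim _ (gf y)).
    apply: (@cvg_monotone_convergence _ _ _ nu _ measurableT (fun n y => (g n y)%:E)) => //.
    - by move=> n; apply/measurable_EFinP.
    - by move=> n y _; rewrite lee_fin.
  have hI : I (g n) @[n --> \oo] --> I f.
    apply: (@fine_cvg _ _ _ _ (fun n => (I (g n))%:E)).
    by rewrite -IE//; under eq_fun do rewrite -IE//; exact: hmu.
  have hl : l (g n) @[n --> \oo] --> l f.
    have -> : (fun n => l (g n)) = (fun n => l f - (l f - l (g n))).
      by apply/funext => n; rewrite subKr.
    rewrite -[X in _ --> X]subr0; apply: cvgB; first exact: cvg_cst.
    apply: (@squeeze_cvgr _ _ _ _ (cst 0) (fun n => I f - I (g n))).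
    - near=> n; rewrite -lB// -IB//.
      by rewrite l_ge0 ?l_le//; exact: SB.
    - exact: cvg_cst.
    - by rewrite -[X in _ --> X](subrr (I f)); apply: cvgB => //; exact: cvg_cst.
  have h : (l (g n))%:E @[n --> \oo] --> (\int[m]_y (f y)%:E)%E.
    have -> : (fun n => (l (g n))%:E) = (fun n => \int[m]_y (g n y)%:E)%E.
      by apply/funext => n; rewrite (Esf (g n)).2.
    exact: hmu.
  apply: (cvg_unique _ h) => //; apply: cvg_EFin; first by near=> n.
  exact: hl.
move=> f Sf; split; first exact: Sm.
have Sf1 := Spos Sf; have Sf2 := Spos (SZ (-1) Sf).
have -> : f = (fun y => Num.max (f y) 0) + (-1) *: (fun y => Num.max ((-1 *: f) y) 0).
  apply/funext => y; rewrite /= [in RHS]/GRing.add/= [(_ *: _) y]scaleN1r scaleN1r.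
  have -> : (- f) y = - f y by [].
  by case: (leP (f y) 0) => h; case: leP => h'; lra.
apply: ED => //; first exact: SZ.
- by apply: Epos => // y; rewrite le_max lexx orbT.
- by apply: EZ => //; apply: Epos => // y; rewrite le_max lexx orbT.
Unshelve. all: by end_near.
Qed.

End dominated_functional.

(** * Hilbert space *)

Section inner_product.
Context {R : realType} {H : hilbertType R}.
Implicit Types x y z : H.

Lemma dotpC x y : dotp x y = dotp y x.
Proof. by have := hermC dotp x y; rewrite expr0 mul1r. Qed.

Lemma dotpDl x y z : dotp (x + y) z = dotp x z + dotp y z.
Proof. exact: linearDl. Qed.

Lemma dotpDr x y z : dotp x (y + z) = dotp x y + dotp x z.
Proof. by rewrite dotpC dotpDl ![dotp _ x]dotpC. Qed.

Lemma dotpZl (a : R) x y : dotp (a *: x) y = a * dotp x y.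
Proof. exact: linearZl. Qed.

Lemma dotpZr (a : R) x y : dotp x (a *: y) = a * dotp x y.
Proof. by rewrite dotpC dotpZl dotpC. Qed.

Lemma dotpNl x y : dotp (- x) y = - dotp x y.
Proof. by rewrite -scaleN1r dotpZl mulN1r. Qed.

Lemma dotpNr x y : dotp x (- y) = - dotp x y.
Proof. by rewrite -scaleN1r dotpZr mulN1r. Qed.

Lemma dotpBl x y z : dotp (x - y) z = dotp x z - dotp y z.
Proof. by rewrite dotpDl dotpNl. Qed.

Lemma dotpBr x y z : dotp x (y - z) = dotp x y - dotp x z.
Proof. by rewrite dotpDr dotpNr. Qed.

Lemma dotp0l y : dotp 0 y = 0.
Proof. by rewrite -(scale0r (0 : H)) dotpZl mul0r. Qed.

Lemma dotp0r y : dotp y 0 = 0.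
Proof. by rewrite dotpC dotp0l. Qed.

Lemma dotp_suml (I : Type) (r : seq I) (P : pred I) (f : I -> H) y :
  dotp (\sum_(i <- r | P i) f i) y = \sum_(i <- r | P i) dotp (f i) y.
Proof. by apply: (big_morph (dotp ^~ y)) => [a b|]; [exact: dotpDl|exact: dotp0l]. Qed.

Lemma dotp_sumr (I : Type) (r : seq I) (P : pred I) (f : I -> H) y :
  dotp y (\sum_(i <- r | P i) f i) = \sum_(i <- r | P i) dotp y (f i).
Proof. by rewrite dotpC dotp_suml; apply: eq_bigr => i _; exact: dotpC. Qed.

Lemma normB_sqr x y : `|x - y| ^+ 2 = `|x| ^+ 2 - 2 * dotp x y + `|y| ^+ 2.
Proof. by rewrite -!dotpp dotpBl !dotpBr (dotpC y x); ring. Qed.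

(** Cauchy-Schwarz, by expanding the squared norm of [|y|^2 x - <x,y> y]. *)
Lemma dotp_le x y : `|dotp x y| <= `|x| * `|y|.
Proof.
have [->|y0] := eqVneq y 0; first by rewrite dotp0r !normr0 mulr0.
rewrite -(@ler_pXn2r _ 2) ?nnegrE ?mulr_ge0// exprMn real_normK ?num_real//.
have y2 : 0 < `|y| ^+ 2 by rewrite exprn_gt0// normr_gt0.
have := sqr_ge0 `| (`|y| ^+ 2) *: x - dotp x y *: y|.
rewrite normB_sqr !normrZ dotpZl dotpZr !exprMn !real_normK ?num_real//.
rewrite -(pmulr_rge0 _ y2); move: (dotp x y) (`|x| ^+ 2) (`|y| ^+ 2) y2 => d a b b0 h.
have : 0 <= b * b * (b * a - d ^+ 2) by rewrite (le_trans h)//; lra.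
by rewrite pmulr_rge0 ?mulr_gt0// subr_ge0 mulrC.
Qed.

Lemma cvg_dotp (T : Type) (F : set_system T) {FF : Filter F} (f g : T -> H) x y :
  f @ F --> x -> g @ F --> y -> (fun t => dotp (f t) (g t)) @ F --> dotp x y.
Proof.
move=> fx gy.
have key (u v : T -> H) (a b : R) : `|u t| @[t --> F] --> a -> `|v t| @[t --> F] --> b ->
    a * b = 0 -> dotp (u t) (v t) @[t --> F] --> 0.
  move=> ua vb ab; apply/norm_cvg0P.
  apply: (@squeeze_cvgr _ _ _ _ (cst 0) (fun t => `|u t| * `|v t|)).
  - by near=> t; rewrite normr_ge0 dotp_le.
  - exact: cvg_cst.
  - by rewrite -ab; exact: cvgM.
have u0 : `|f t - x| @[t --> F] --> 0.
  by rewrite -(normr0 H) -(subrr x); apply: cvg_norm; apply: cvgB => //; exact: cvg_cst.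
have v0 : `|g t - y| @[t --> F] --> 0.
  by rewrite -(normr0 H) -(subrr y); apply: cvg_norm; apply: cvgB => //; exact: cvg_cst.
rewrite (_ : (fun t => _) = fun t => dotp (f t - x) (g t - y) + dotp (f t - x) y
    + dotp x (g t - y) + dotp x y); last first.
  by apply/funext => t; rewrite !(dotpBr, dotpBl); ring.
rewrite -[X in _ --> X]add0r -[X in X + _]addr0 -[X in X + _ + _]addr0.
apply: cvgD; last exact: cvg_cst.
apply: cvgD; first apply: cvgD.
- by apply: key u0 v0 _; rewrite mul0r.
- by apply: (key _ _ _ _ u0 (cvg_cst _)); rewrite mul0r.
- by apply: (key _ _ _ _ (cvg_cst _) v0); rewrite mulr0.
Unshelve. all: by end_near.
Qed.

Lemma continuous_dotpl y : continuous (dotp ^~ y : H -> R).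
Proof. by move=> x; apply: cvg_dotp; [exact: cvg_id|exact: cvg_cst]. Qed.

Lemma dense_dotp_eq0 (D : set H) y : dense D -> (forall x, D x -> dotp x y = 0) -> y = 0.
Proof.
move=> dD h; apply/eqP; rewrite -normr_eq0; apply/negPn/negP => y0.
have y1 : 0 < `|y| by rewrite lt_neqAle eq_sym y0 normr_ge0.
have [x [xy Dx]] : (ball y `|y| `&` D) !=set0.
  by apply: dD; [exists y; exact: ballxx|exact: ball_open].
have := normB_sqr y x; rewrite dotpC h// mulr0 subr0.
move: xy; rewrite -ball_normE /= => xy e.
have : `|y - x| ^+ 2 < `|y| ^+ 2 by rewrite ltr_pXn2r ?nnegrE.
by rewrite e ltNge lerDl sqr_ge0.
Qed.

Definition proj_sum (e : nat -> H) (n : nat) x := \sum_(k < n) dotp x (e k) *: e k.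

Definition orthonormal (e : nat -> H) :=
  (forall i j, i != j -> dotp (e i) (e j) = 0) /\ forall i, e i = 0 \/ `|e i| = 1.

Lemma orthonormal_sum_sqr e (c : nat -> R) (A : pred nat) n : orthonormal e ->
  (forall i, e i = 0 -> c i = 0) ->
  `|\sum_(0 <= k < n | A k) c k *: e k| ^+ 2 = \sum_(0 <= k < n | A k) c k ^+ 2.
Proof.
move=> [eo e1] c0; elim: n => [|n ih]; first by rewrite !big_geq// normr0 expr0n.
rewrite !(big_mkcond A) /= in ih *.
rewrite !big_nat_recr//= -ih; case: ifPn => An; last by rewrite !addr0.
rewrite -[LHS]dotpp dotpDl !dotpDr.
have o : dotp (\sum_(0 <= i < n) (if A i then c i *: e i else 0)) (c n *: e n) = 0.
  rewrite big_nat dotp_suml big1// => i /andP[_ i_n]; case: ifPn => _; last exact: dotp0l.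
  by rewrite dotpZl dotpZr eo ?mulr0// ltn_eqF.
rewrite [X in _ + (X + _)]dotpC o addr0 add0r !dotpp normrZ exprMn real_normK ?num_real//.
have [en|->] := e1 n; last by rewrite expr1n mulr1.
by rewrite c0// en normr0 expr0n/= mulr0.
Qed.

Lemma proj_sum_sqr e n x : orthonormal e ->
  `|x - proj_sum e n x| ^+ 2 = `|x| ^+ 2 - \sum_(0 <= k < n) dotp x (e k) ^+ 2.
Proof.
move=> oe; rewrite normB_sqr /proj_sum -(big_mkord predT (fun k => dotp x (e k) *: e k)).
rewrite orthonormal_sum_sqr//; last by move=> i ->; rewrite dotp0r.
rewrite dotp_sumr; under eq_bigr do rewrite dotpZr -expr2.
by ring.
Qed.

Lemma proj_sum_le e n x : orthonormal e -> `|x - proj_sum e n x| <= `|x|.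
Proof.
move=> oe; rewrite -(@ler_pXn2r _ 2) ?nnegrE// proj_sum_sqr// gerBl.
by apply: sumr_ge0 => i _; exact: sqr_ge0.
Qed.

(** As the inverse of [0] is [0], the zero vector is sent to itself: a vector depending on its
    predecessors then contributes a zero vector to the Gram-Schmidt family. *)
Definition normalize x := `|x|^-1 *: x.

(** Stage [n] is a whole sequence, correct below [n], so that each step of the recursion sees all
    the earlier vectors. *)
Fixpoint gram_schmidt_seq (d : nat -> H) (n : nat) : nat -> H :=
  if n is m.+1 then fun k =>
    if k == m then normalize (d m - proj_sum (gram_schmidt_seq d m) m (d m))
    else gram_schmidt_seq d m k
  else fun=> 0.

Definition gram_schmidt d n := gram_schmidt_seq d n.+1 n.

Lemma gram_schmidt_seqE d n k : (k < n)%N -> gram_schmidt_seq d n k = gram_schmidt d k.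
Proof.
elim: n => [//|n ih]; rewrite ltnS leq_eqVlt => /predU1P[->//|kn] /=.
by rewrite ltn_eqF// ih.
Qed.

Lemma gram_schmidtE d n :
  gram_schmidt d n = normalize (d n - proj_sum (gram_schmidt d) n (d n)).
Proof.
rewrite {1}/gram_schmidt /= eqxx; congr (normalize (_ - _)); apply: eq_bigr => i _.
by rewrite !gram_schmidt_seqE.
Qed.

Lemma normalize_norm x : normalize x = 0 \/ `|normalize x| = 1.
Proof.
have [->|x0] := eqVneq x 0; first by left; rewrite /normalize scaler0.
by right; rewrite normrZ normfV normr_id mulVf// normr_eq0.
Qed.

Lemma gram_schmidt_orthonormal d : orthonormal (gram_schmidt d).
Proof.
set e := gram_schmidt d.
have e1 i : e i = 0 \/ `|e i| = 1 by rewrite /e gram_schmidtE; exact: normalize_norm.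
split=> //.
suff h n : forall i, (i < n)%N -> dotp (e i) (e n) = 0.
  by move=> i j; rewrite neq_ltn => /orP[|] ij; [|rewrite dotpC]; exact: h.
elim/ltn_ind: n => n ih i i_n.
rewrite {2}/e gram_schmidtE -/e /normalize dotpZr dotpBr dotp_sumr.
rewrite (bigD1 (Ordinal i_n))//= big1 => [|j /negP ji].
  rewrite dotpZr; have [->|ei] := e1 i; first by rewrite !dotp0l mulr0 addr0 subrr mulr0.
  by rewrite dotpp ei expr1n mulr1 addr0 dotpC subrr mulr0.
rewrite dotpZr; have : (nat_of_ord j != i).
  by apply/eqP => jE; apply: ji; apply/eqP/val_inj.
rewrite neq_ltn => /orP[|] h; first by rewrite dotpC ih ?mulr0.
by rewrite ih ?mulr0.
Qed.

Lemma gram_schmidt_proj d n : proj_sum (gram_schmidt d) n.+1 (d n) = d n.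
Proof.
set e := gram_schmidt d; have [eo e1] := gram_schmidt_orthonormal d.
rewrite /proj_sum big_ord_recr /= -/(proj_sum e n (d n)).
set v := d n - proj_sum e n (d n).
have eE : e n = normalize v by rewrite /e gram_schmidtE.
have dv : dotp (d n) (e n) = dotp v (e n).
  rewrite dotpBl /proj_sum dotp_suml big1 ?subr0// => i _.
  by rewrite dotpZl eo ?mulr0// ltn_eqF.
rewrite dv eE /normalize dotpZr dotpp scalerA mulrAC.
have [v0|v0] := eqVneq v 0.
  by rewrite v0 scaler0 addr0; apply/esym/eqP; rewrite -subr_eq0 -/v v0.
have vv : `|v|^-1 * `|v|^-1 * `|v| ^+ 2 = 1.
  by rewrite expr2 mulrACA mulVf ?mulr1// normr_eq0.
by rewrite vv scale1r /v addrC subrK.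
Qed.

(** The squared distance from [x] to its projection decreases with the number of vectors, so once
    zero it stays zero. *)
Lemma proj_sum_stable e n m x : orthonormal e -> (n <= m)%N ->
  proj_sum e n x = x -> proj_sum e m x = x.
Proof.
move=> oe nm h; apply/eqP; rewrite eq_sym -subr_eq0 -normr_eq0 -sqrf_eq0.
rewrite eq_le sqr_ge0 andbT proj_sum_sqr// (@big_cat_nat _ _ _ n)//=.
have := proj_sum_sqr n x oe; rewrite h subrr normr0 expr0n/= => /esym/eqP.
rewrite subr_eq0 => /eqP ->; rewrite opprD addrA subrr add0r oppr_le0.
by apply: sumr_ge0 => i _; exact: sqr_ge0.
Qed.

Lemma orthonormal_basis_ex : separable H -> exists e : nat -> H, orthonormal_basis e.
Proof.
move=> sH; have [d dd] := separable_dense_seq sH.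
exists (gram_schmidt d); have oe := gram_schmidt_orthonormal d; have [eo e1] := oe.
split=> // x; set e := gram_schmidt d.
have -> : [series dotp x (e n) *: e n]_n = (proj_sum e)^~ x.
  by apply/funext => n; rewrite /proj_sum /series /= big_mkord.
apply/cvgrPdist_lt => r r0.
have [m xm] : exists m, `|x - d m| < r.
  exact: dd.
near=> n.
have dm : proj_sum e n (d m) = d m.
  by apply: (@proj_sum_stable _ m.+1) => //; [near: n; exact: nbhs_infty_ge|exact: gram_schmidt_proj].
apply: le_lt_trans xm.
have -> : x - proj_sum e n x = (x - d m) - proj_sum e n (x - d m).
  have -> : proj_sum e n (x - d m) = proj_sum e n x - proj_sum e n (d m).
    by rewrite /proj_sum -sumrB; apply: eq_bigr => i _; rewrite dotpBl scalerBl.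
  by rewrite dm opprB addrA subrK.
exact: proj_sum_le.
Unshelve. all: by end_near.
Qed.

(** The partial sums [z n] of [l (e k) *: e k] satisfy [l (z n) = |z n|^2], so [|z n| <= M]. This is
    Bessel's bound, which makes the series converge to the representing vector. *)
Lemma riesz (l : H -> R) (M : R) : separable H -> linear l -> (forall x, `|l x| <= M * `|x|) ->
  exists z, forall x, l x = dotp x z.
Proof.
move=> sH ll lM; have [e [eo e1 eb]] := orthonormal_basis_ex sH.
have oe : orthonormal e by [].
have l0 : l 0 = 0 by have := ll (-1) 0 0; rewrite scaler0 addr0 [_ *: _]mulN1r addNr.
have lD x y : l (x + y) = l x + l y by have := ll 1 x y; rewrite !scale1r.
have lZ a x : l (a *: x) = a * l x by have := ll a x 0; rewrite !addr0 l0 addr0.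
have lsum (I : Type) (r : seq I) (P : pred I) f :
    l (\sum_(i <- r | P i) f i) = \sum_(i <- r | P i) l (f i) by exact: (big_morph l).
pose z n := \sum_(0 <= k < n) l (e k) *: e k.
pose s n := \sum_(0 <= k < n) l (e k) ^+ 2.
have zs m n : `|\sum_(m <= k < n) l (e k) *: e k| ^+ 2 = \sum_(m <= k < n) l (e k) ^+ 2.
  rewrite !(@big_nat_widenl _ _ _ m 0%N)//.
  by apply: orthonormal_sum_sqr => // i ->.
have sM n : s n <= M ^+ 2.
  have zn : l (z n) = s n by rewrite lsum; apply: eq_bigr => i _; rewrite lZ expr2.
  have := lM (z n); rewrite zn; have s0 : 0 <= s n by apply: sumr_ge0 => i _; exact: sqr_ge0.
  rewrite ger0_norm// => h.
  have := zs 0%N n; rewrite -/(z n) -/(s n) => hz.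
  rewrite -hz in h *; have [->|z0] := eqVneq (z n) 0.
    by rewrite normr0 expr0n sqr_ge0.
  suff zM : `|z n| <= M by rewrite ler_pXn2r ?nnegrE// (le_trans _ zM).
  by move: h; rewrite expr2 ler_pM2r// normr_gt0.
have cs : cvgn s.
  apply: nondecreasing_is_cvgn; last by exists (M ^+ 2) => _ [n _ <-]; exact: sM.
  by apply/nondecreasing_seqP => n; rewrite /s big_nat_recr//= lerDl sqr_ge0.
have cz : cvgn z.
  apply/cauchy_cvgP/cauchy_seriesP => r r0.
  have /cauchy_cvgP/cauchy_seriesP/(_ (r ^+ 2) (exprn_gt0 _ r0)) := cs.
  apply: filterS => -[m n] /=.
  rewrite /= -zs => h; rewrite -(@ltr_pXn2r _ 2) ?nnegrE// ?ltW//.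
  by rewrite (le_lt_trans _ h)// ler_norm.
exists (limn z) => x.
have h1 : (fun n => dotp x (z n)) @ \oo --> dotp x (limn z).
  by apply: cvg_dotp; [exact: cvg_cst|exact: cz].
have h2 : (fun n => dotp x (z n)) @ \oo --> l x.
  have -> : (fun n => dotp x (z n)) = (fun n => l ([series dotp x (e k) *: e k]_k n)).
    apply/funext => n; rewrite /z dotp_sumr /series /= lsum; apply: eq_bigr => i _.
    by rewrite dotpZr lZ mulrC.
  have hx : `|x - [series dotp x (e k) *: e k]_k n| @[n --> \oo] --> 0.
    rewrite -(normr0 H) -(subrr x); apply: cvg_norm; apply: cvgB; first exact: cvg_cst.
    exact: eb.
  apply: (@squeeze_cvgr _ _ _ _ (fun n => l x - M * `|x - [series dotp x (e k) *: e k]_k n|)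
      (fun n => l x + M * `|x - [series dotp x (e k) *: e k]_k n|)).
  - near=> n; set y := (X in `|x - X|).
    have := lM (x - y); rewrite -[in X in `|X|]scaleN1r addrC ll [_ *: _]mulN1r ler_norml => /andP[h1' h2'].
    by apply/andP; split; lra.
  - rewrite -[X in _ --> X]subr0; apply: cvgB; first exact: cvg_cst.
    by rewrite -(mulr0 M); apply: cvgM; [exact: cvg_cst|exact: hx].
  - rewrite -[X in _ --> X]addr0; apply: cvgD; first exact: cvg_cst.
    by rewrite -(mulr0 M); apply: cvgM; [exact: cvg_cst|exact: hx].
exact: (cvg_unique _ h2 h1).
Unshelve. all: by end_near.
Qed.

Lemma trace_unique (B : H -> H) (e : nat -> H) (c : R) : orthonormal_basis e ->
  (forall e, orthonormal_basis e -> [series dotp (B (e n)) (e n)]_n @ \oo --> c) ->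
  trace B = c.
Proof.
move=> eb h; rewrite /trace; case: xgetP => [y -> /= hy|/(_ c)]; last by move/(_ h).
exact: (cvg_unique _ (hy e eb) (h e eb)).
Qed.

(** Exchanging the sums leaves the basis expansion of each [b i] paired with [a i]. The value is the
    same for every basis, as [trace], defined by choice, demands. *)
Lemma trace_finite_rank (I : Type) (r : seq I) (a b : I -> H) : separable H ->
  trace (fun y => \sum_(i <- r) dotp y (a i) *: b i) = \sum_(i <- r) dotp (b i) (a i).
Proof.
move=> sH; have [e0 e0b] := orthonormal_basis_ex sH.
apply: (trace_unique e0b) => e [eo e1 eb].
have -> : [series dotp (\sum_(i <- r) dotp (e n) (a i) *: b i) (e n)]_n =
    (fun n => \sum_(i <- r) dotp ([series dotp (b i) (e k) *: e k]_k n) (a i)).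
  apply/funext => n; rewrite /series /=.
  under eq_bigr do rewrite dotp_suml.
  rewrite exchange_big /=; apply: eq_bigr => i _; rewrite dotp_suml; apply: eq_bigr => k _.
  by rewrite !dotpZl mulrC.
elim: r => [|i r ih]; first by rewrite big_nil; under eq_fun do rewrite big_nil; exact: cvg_cst.
rewrite big_cons; under eq_fun do rewrite big_cons.
apply: cvgD; last exact: ih.
by apply: cvg_dotp; [exact: eb|exact: cvg_cst].
Qed.

End inner_product.

(** * Trigonometric test functions *)

Section waves.
Context {R : realType} {H : hilbertType R}.
Variables (T : R) (DA : set H) (A C : H -> H) (F : R -> H -> H).

(* The test function (t,x) |-> phi(t) cos(<x,h(t)> + theta). *)
Record wave := Wave {
  wave_amp : R -> R; wave_damp : R -> R;
  wave_dir : R -> H; wave_ddir : R -> H; wave_adir : R -> H; wave_phase : R }.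

Implicit Types (w : wave) (s : seq wave) (u Lu : R -> H -> R) (Gu : R -> H -> H).

Definition wave_good w :=
  [/\ C1_with T (wave_amp w : R -> R^o) (wave_damp w : R -> R^o), wave_amp w T = 0,
      forall t, t \in `[0, T] ->
        [/\ adj_dom DA A (wave_dir w t), adj_dom DA A (wave_ddir w t)
          & wave_adir w t = adj DA A (wave_dir w t)],
      C1_with T (wave_dir w) (wave_ddir w)
    & C1_with T (adj DA A \o wave_dir w) (adj DA A \o wave_ddir w)].

Definition wave_arg w t x := dotp x (wave_dir w t) + wave_phase w.

Definition wave_fun w t x := wave_amp w t * cos (wave_arg w t x).

Definition wave_grad w t x := - (wave_amp w t * sin (wave_arg w t x)) *: wave_dir w t.

Definition wave_dt w t x := wave_damp w t * cos (wave_arg w t x)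
  - wave_amp w t * dotp x (wave_ddir w t) * sin (wave_arg w t x).

Definition wave_hess w t x y :=
  - (wave_amp w t * cos (wave_arg w t x) * dotp y (wave_dir w t)) *: wave_dir w t.

Definition wave_L w t x := wave_dt w t x
  - 2^-1 * wave_amp w t * dotp (C (wave_dir w t)) (wave_dir w t) * cos (wave_arg w t x)
  - wave_amp w t * (dotp x (wave_adir w t) + dotp (F t x) (wave_dir w t))
    * sin (wave_arg w t x).

(** The expressions for [L_0 u] and the gradient are carried along with [u], so that products and
    powers are handled by algebraic identities rather than by derivatives and choices. [test_fun_L0]
    relates [Lu] to the operator. *)
Inductive test_fun : (R -> H -> R) -> (R -> H -> R) -> (R -> H -> H) -> Prop :=
| test_fun0 : test_fun (fun _ _ => 0) (fun _ _ => 0) (fun _ _ => 0)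
| test_fun_cons w u Lu Gu : wave_good w -> test_fun u Lu Gu ->
    test_fun (fun t x => wave_fun w t x + u t x) (fun t x => wave_L w t x + Lu t x)
      (fun t x => wave_grad w t x + Gu t x).

Lemma test_fun_seq u Lu Gu : test_fun u Lu Gu -> exists s,
  [/\ all (fun w => `[< wave_good w >]) s,
     u = (fun t x => \sum_(w <- s) wave_fun w t x),
     Lu = (fun t x => \sum_(w <- s) wave_L w t x)
   & Gu = (fun t x => \sum_(w <- s) wave_grad w t x)].
Proof.
elim=> [|w u' Lu' Gu' gw _ [s [gs -> -> ->]]].
  by exists [::]; split=> //; apply/funext => t; apply/funext => x; rewrite big_nil.
exists (w :: s); split; rewrite /= ?gs ?andbT; first exact/asboolP.
all: by apply/funext => t; apply/funext => x; rewrite big_cons.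
Qed.

Lemma test_fun_wave w : wave_good w ->
  test_fun (wave_fun w) (wave_L w) (wave_grad w).
Proof.
move=> gw; have := test_fun_cons gw test_fun0.
by congr test_fun; apply/funext => t; apply/funext => x; rewrite addr0.
Qed.

Lemma test_funD u Lu Gu v Lv Gv : test_fun u Lu Gu -> test_fun v Lv Gv ->
  test_fun (fun t x => u t x + v t x) (fun t x => Lu t x + Lv t x)
    (fun t x => Gu t x + Gv t x).
Proof.
move=> tu tv; elim: tu => [|w u' Lu' Gu' gw _ ih].
  by congr test_fun: tv; apply/funext => t; apply/funext => x; rewrite add0r.
have := test_fun_cons gw ih.
by congr test_fun; apply/funext => t; apply/funext => x; rewrite addrA.
Qed.

Lemma C1_with_eq {E : normedModType R} (f df g dg : R -> E) :
  (forall t, t \in `[0, T] -> f t = g t) -> (forall t, t \in `[0, T] -> df t = dg t) ->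
  C1_with T f df -> C1_with T g dg.
Proof.
move=> fg dfg [cf cdf fd]; split.
- have h : {in `[0, T]%classic, f =1 g} by move=> t /set_mem; exact: fg.
  exact: (subspace_eq_continuous h cf).
- have h : {in `[0, T]%classic, df =1 dg} by move=> t /set_mem; exact: dfg.
  exact: (subspace_eq_continuous h cdf).
- move=> t tT; rewrite -dfg; last by move: t tT; exact: subset_itv_oo_cc.
  apply: near_eq_is_derive (fd t tT).
  near=> s; apply: fg; apply: subset_itv_oo_cc.
  by near: s; exact: near_in_itvoo.
Unshelve. all: by end_near.
Qed.

Lemma C1_withZ {E : normedModType R} (c : R) (g dg : R -> E) :
  C1_with T g dg -> C1_with T (fun t => c *: g t) (fun t => c *: dg t).
Proof.
move=> [cg cdg gd]; split=> [t|t|t tT].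
- by apply: cvgZr; exact: cg.
- by apply: cvgZr; exact: cdg.
- have := gd t tT => ?; exact: is_deriveZ.
Qed.

Lemma C1_withD {E : normedModType R} (g dg f df : R -> E) :
  C1_with T g dg -> C1_with T f df ->
  C1_with T (fun t => g t + f t) (fun t => dg t + df t).
Proof.
move=> [cg cdg gd] [cf cdf fd]; split=> [t|t|t tT].
- by apply: cvgD; [exact: cg|exact: cf].
- by apply: cvgD; [exact: cdg|exact: cdf].
- have := gd t tT => ?; have := fd t tT => ?; exact: is_deriveD.
Qed.

Lemma C1_withM (f df g dg : R -> R^o) : C1_with T f df -> C1_with T g dg ->
  C1_with T (fun t => f t * g t : R^o) (fun t => df t * g t + f t * dg t : R^o).
Proof.
move=> [cf cdf fd] [cg cdg gd]; split=> [t|t|t tT].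
- by apply: cvgM; [exact: cf|exact: cg].
- by apply: cvgD; apply: cvgM; [exact: cdf|exact: cg|exact: cf|exact: cdg].
- have ? := gd t tT; have ? := fd t tT.
  have h : is_derive t 1 (f * g) (f t *: dg t + g t *: df t) by exact: is_deriveM.
  by congr is_derive: h; rewrite addrC [df t * _]mulrC.
Qed.

Hypothesis dDA : dense DA.

Lemma adjE y : adj_dom DA A y -> forall x, DA x -> dotp (A x) y = dotp x (adj DA A y).
Proof. by move=> [z zP]; rewrite /adj; case: xgetP => [z' -> //|/(_ z)] /(_ zP). Qed.

Lemma adj_unique y z : (forall x, DA x -> dotp (A x) y = dotp x z) -> adj DA A y = z.
Proof.
move=> h; have yd : adj_dom DA A y by exists z.
apply/eqP; rewrite -subr_eq0; apply/eqP; apply: (dense_dotp_eq0 dDA) => x Dx.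
by rewrite dotpBr -adjE// h// subrr.
Qed.

Lemma adj_lin (a b : R) y z : adj_dom DA A y -> adj_dom DA A z ->
  adj_dom DA A (a *: y + b *: z) /\
  adj DA A (a *: y + b *: z) = a *: adj DA A y + b *: adj DA A z.
Proof.
move=> dy dz.
have h x : DA x -> dotp (A x) (a *: y + b *: z) = dotp x (a *: adj DA A y + b *: adj DA A z).
  by move=> Dx; rewrite !dotpDr !dotpZr !adjE.
by split; [exists (a *: adj DA A y + b *: adj DA A z)|exact: adj_unique].
Qed.

(* cos a cos b = (cos (a + b) + cos (a - b)) / 2 *)
Definition wave_mul (e : R) w1 w2 := Wave
  (fun t => 2^-1 * (wave_amp w1 t * wave_amp w2 t))
  (fun t => 2^-1 * (wave_damp w1 t * wave_amp w2 t + wave_amp w1 t * wave_damp w2 t))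
  (fun t => wave_dir w1 t + e *: wave_dir w2 t)
  (fun t => wave_ddir w1 t + e *: wave_ddir w2 t)
  (fun t => wave_adir w1 t + e *: wave_adir w2 t)
  (wave_phase w1 + e * wave_phase w2).

Lemma wave_mul_good e w1 w2 : wave_good w1 -> wave_good w2 -> wave_good (wave_mul e w1 w2).
Proof.
move=> [a1 z1 d1 h1 k1] [a2 z2 d2 h2 k2].
have dirE t : t \in `[0, T] ->
    [/\ adj_dom DA A (wave_dir (wave_mul e w1 w2) t),
      adj_dom DA A (wave_ddir (wave_mul e w1 w2) t),
      wave_adir (wave_mul e w1 w2) t = adj DA A (wave_dir (wave_mul e w1 w2) t),
      adj DA A (wave_dir w1 t) + e *: adj DA A (wave_dir w2 t) =
        adj DA A (wave_dir (wave_mul e w1 w2) t)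
    & adj DA A (wave_ddir w1 t) + e *: adj DA A (wave_ddir w2 t) =
        adj DA A (wave_ddir (wave_mul e w1 w2) t)].
  move=> tT; have [d1t dd1 E1] := d1 t tT; have [d2t dd2 E2] := d2 t tT.
  have [e1 e2] := adj_lin 1 e d1t d2t; have [e3 e4] := adj_lin 1 e dd1 dd2.
  by move: e1 e2 e3 e4; rewrite /= !scale1r E1 E2 => ? -> ? ->.
split=> /=.
- by apply: (@C1_withZ R^o); exact: C1_withM.
- by rewrite z1 mul0r mulr0.
- by move=> t /dirE[].
- by apply: C1_withD => //; exact: C1_withZ.
- apply: (C1_with_eq _ _ (C1_withD k1 (C1_withZ e k2))) => t /dirE[] //.
Qed.

Definition wave_scale (c : R) w := Wave (fun t => c * wave_amp w t)
  (fun t => c * wave_damp w t) (wave_dir w) (wave_ddir w) (wave_adir w)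
  (wave_phase w).

Lemma wave_scale_good c w : wave_good w -> wave_good (wave_scale c w).
Proof.
by move=> [a z d h k]; split=> //=; [exact: (@C1_withZ R^o)|rewrite z mulr0].
Qed.

Lemma test_funZ c u Lu Gu : test_fun u Lu Gu ->
  test_fun (fun t x => c * u t x) (fun t x => c * Lu t x) (fun t x => c *: Gu t x).
Proof.
elim=> [|w u' Lu' Gu' gw _ ih].
  have := test_fun0.
  by congr test_fun; apply/funext => t; apply/funext => x; rewrite ?mulr0 ?scaler0.
have := test_fun_cons (wave_scale_good c gw) ih.
congr test_fun; apply/funext => t; apply/funext => x.
- by rewrite /wave_fun /wave_arg /=; ring.
- by rewrite /wave_L /wave_dt /wave_arg /=; ring.
- by rewrite /wave_grad /wave_arg /= scalerDr scalerA mulrN mulrA.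
Qed.

Hypothesis Cl : linear C.
Hypothesis Cs : symmetric_op C.

Let CD x y : C (x + y) = C x + C y.
Proof. by have := Cl 1 x y; rewrite !scale1r. Qed.

Let C0 : C 0 = 0.
Proof. by have := Cl (-1) 0 0; rewrite scaler0 addr0 scaleN1r addNr. Qed.

Let CN x : C (- x) = - C x.
Proof. by have := Cl (-1) x 0; rewrite !addr0 C0 addr0 !scaleN1r. Qed.

Let CZ a x : C (a *: x) = a *: C x.
Proof. by have := Cl a x 0; rewrite !addr0 C0 addr0. Qed.

(** The product rule of a second-order operator, with the carre du champ term [<C Du, Dv>]. The
    product of two cosines splits into the waves with directions [h1 + h2] and [h1 - h2]. *)
Lemma test_fun_wave_mul w1 w2 : wave_good w1 -> wave_good w2 ->
  test_fun (fun t x => wave_fun w1 t x * wave_fun w2 t x)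
    (fun t x => wave_fun w1 t x * wave_L w2 t x + wave_fun w2 t x * wave_L w1 t x
       + dotp (C (wave_grad w1 t x)) (wave_grad w2 t x))
    (fun t x => wave_fun w1 t x *: wave_grad w2 t x + wave_fun w2 t x *: wave_grad w1 t x).
Proof.
move=> g1 g2.
have := test_funD (test_fun_wave (wave_mul_good 1 g1 g2)) (test_fun_wave (wave_mul_good (-1) g1 g2)).
have cosP (a b : R) : cos (a + b) = cos a * cos b - sin a * sin b by exact: cosD.
have argE e t x : wave_arg (wave_mul e w1 w2) t x = wave_arg w1 t x + e * wave_arg w2 t x.
  by rewrite /wave_arg /= dotpDr dotpZr; ring.
congr test_fun; apply/funext => t; apply/funext => x.
- by rewrite /wave_fun !argE /= !(mul1r, mulN1r) !(cosD, cosN, sinN); field.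
- rewrite /wave_fun /wave_L /wave_dt /wave_grad !argE /= !(mul1r, mulN1r).
  rewrite !(cosD, sinD, cosN, sinN) !(scale1r, scaleN1r).
  rewrite !(CD, CN, dotpDr, dotpDl, dotpNr, dotpNl, CZ, dotpZr, dotpZl).
  have -> : dotp (C (wave_dir w2 t)) (wave_dir w1 t) = dotp (C (wave_dir w1 t)) (wave_dir w2 t).
    by rewrite Cs dotpC.
  move: (dotp x _) (dotp x _) (dotp x _) (dotp x _) (dotp (F t x) _) (dotp (F t x) _).
  move: (dotp (C _) _) (dotp (C _) _) (dotp (C _) _) (cos _) (sin _) (cos _) (sin _).
  move: (wave_amp w1 t) (wave_damp w1 t) (wave_amp w2 t) (wave_damp w2 t).
  by move=> *; field.
- rewrite /wave_grad /wave_fun !argE /= !(mul1r, mulN1r).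
  move: (wave_arg w1 t x) (wave_arg w2 t x) => z1 z2.
  rewrite !(sinD, cosN, sinN) scale1r scaleN1r !(scalerDr, scalerN) !scalerA.
  have comb (p q : R) (h1 h2 : H) :
      p *: h1 + p *: h2 + (q *: h1 - q *: h2) = (p - q) *: h2 + (p + q) *: h1.
    by rewrite addrACA -scalerDl -scalerBl addrC.
  by rewrite comb; congr (_ *: _ + _ *: _); field.
Qed.

Lemma test_funM u Lu Gu v Lv Gv : test_fun u Lu Gu -> test_fun v Lv Gv ->
  test_fun (fun t x => u t x * v t x)
    (fun t x => u t x * Lv t x + v t x * Lu t x + dotp (C (Gu t x)) (Gv t x))
    (fun t x => u t x *: Gv t x + v t x *: Gu t x).
Proof.
move=> tu tv; elim: tu => [|w u' Lu' Gu' gw _ ih].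
  have := test_fun0.
  congr test_fun; apply/funext => t; apply/funext => x.
  - by rewrite mul0r.
  - by rewrite mul0r mulr0 C0 dotp0l !addr0.
  - by rewrite scale0r scaler0 addr0.
suff h : test_fun (fun t x => wave_fun w t x * v t x)
    (fun t x => wave_fun w t x * Lv t x + v t x * wave_L w t x + dotp (C (wave_grad w t x)) (Gv t x))
    (fun t x => wave_fun w t x *: Gv t x + v t x *: wave_grad w t x).
  have := test_funD h ih.
  congr test_fun; apply/funext => t; apply/funext => x.
  - by ring.
  - by rewrite CD dotpDl; ring.
  - by rewrite scalerDl scalerDr addrACA.
elim: tv => [|w' v' Lv' Gv' gw' _ ih'].
  have := test_fun0.
  congr test_fun; apply/funext => t; apply/funext => x.
  - by rewrite mulr0.
  - by rewrite mul0r mulr0 dotp0r !addr0.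
  - by rewrite scale0r scaler0 addr0.
have := test_funD (test_fun_wave_mul gw gw') ih'.
congr test_fun; apply/funext => t; apply/funext => x.
- by ring.
- by rewrite dotpDr; ring.
- by rewrite scalerDl scalerDr addrACA.
Qed.

Lemma test_fun_pow u Lu Gu n : test_fun u Lu Gu ->
  test_fun (fun t x => u t x ^+ n.+1)
    (fun t x => n.+1%:R * u t x ^+ n * Lu t x
       + 2^-1 * (n.+1 * n)%:R * u t x ^+ n.-1 * dotp (C (Gu t x)) (Gu t x))
    (fun t x => (n.+1%:R * u t x ^+ n) *: Gu t x).
Proof.
move=> tu; elim: n => [|n ih].
  congr test_fun: tu; apply/funext => t; apply/funext => x.
  - by rewrite expr0 muln0; ring.
  - by rewrite expr0 mulr1 scale1r.
have := test_funM tu ih.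
congr test_fun; apply/funext => t; apply/funext => x.
- rewrite dotpZr.
  move: (dotp (C _) _) (u t x) (Lu t x) => c a l.
  case: n {ih} => [|n].
    by rewrite expr0 expr1 muln0 muln1 /=; field.
  by rewrite /= !natrM -!natr1 !exprS; field.
- by rewrite scalerA -scalerDl; congr (_ *: _); rewrite -!natr1 exprS; ring.
Qed.

(** Chain rule. The condition [p.[0] = 0] keeps the test function zero at time [T]. *)
Lemma test_fun_horner u Lu Gu (p : {poly R}) : p.[0] = 0 -> test_fun u Lu Gu ->
  test_fun (fun t x => p.[u t x])
    (fun t x => p^`().[u t x] * Lu t x
       + 2^-1 * p^`()^`().[u t x] * dotp (C (Gu t x)) (Gu t x))
    (fun t x => p^`().[u t x] *: Gu t x).
Proof.
move=> p0 tu; have [q ->] : exists q, p = \sum_(i < size q) q`_i *: 'X^(i.+1).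
  have /factor_theorem[q pq] : root p 0 by apply/rootP.
  exists q; rewrite pq subr0 -[in LHS](coefK q) poly_def mulr_suml.
  by apply: eq_bigr => i _; rewrite -scalerAl -exprSr.
elim: (size q) => [|n ih].
  have := test_fun0; congr test_fun; apply/funext => t; apply/funext => x.
  - by rewrite big_ord0 horner0.
  - by rewrite big_ord0 !deriv0 horner0 !(mul0r, mulr0) addr0.
  - by rewrite big_ord0 deriv0 horner0 scale0r.
have := test_funD ih (test_funZ q`_n (test_fun_pow n tu)).
congr test_fun; apply/funext => t; apply/funext => x; rewrite big_ord_recr /=.
- by rewrite !hornerE.
- rewrite !derivD !derivZ !derivXn /= !derivMn !derivXn !hornerE /= ?hornerMn ?hornerXn.
  rewrite -[u t x ^+ n *+ n.+1]mulr_natl -mulrnA -[_ *+ (n * n.+1)]mulr_natl mulnC natrM.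
  move: (_.[u t x]) (_.[u t x]) (dotp _ _) (u t x ^+ n.-1) => *.
  by ring.
- rewrite derivD derivZ derivXn /= !hornerE /= ?hornerMn ?hornerXn.
  by rewrite [RHS]scalerDl scalerA mulr_natl.
Qed.

Lemma is_derive_dotp (h : R -> H) (dh x : H) (t : R) : is_derive t 1 h dh ->
  is_derive t 1 (fun r => dotp x (h r) : R^o) (dotp x dh).
Proof.
move=> [ex eq].
have hd : (fun r : R => r^-1 *: (h (r + t) - h t)) @ 0^' --> dh.
  by rewrite -eq; move/cvg_ex : ex => [l hl]; have := cvg_lim (@norm_hausdorff _ _) hl;
     rewrite /derive => ->; under eq_fun do rewrite -[X in h (X + _)]mulr1.
have hd2 : (fun r : R => r^-1 *: (dotp x (h (r + t)) - dotp x (h t)) : R^o) @ 0^' --> dotp x dh.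
  have : (fun r : R => dotp x (r^-1 *: (h (r + t) - h t))) @ 0^' --> dotp x dh.
    by apply: cvg_dotp => //; exact: cvg_cst.
  by under eq_fun do rewrite dotpZr dotpBr.
have hd3 : (fun r : R => r^-1 *: (dotp x (h (r *: 1 + t)) - dotp x (h t)) : R^o) @ 0^' --> dotp x dh.
  by under eq_fun do rewrite [_ *: 1]mulr1.
split; first by apply/cvg_ex; exists (dotp x dh).
exact: cvg_lim hd3.
Qed.

Lemma wave_dtP w t x : wave_good w -> t \in `]0, T[ ->
  is_derive t 1 (fun r => wave_fun w r x : R^o) (wave_dt w t x).
Proof.
move=> [[_ _ da] _ _ [_ _ dh] _] tT.
have ha := da t tT; have hh := is_derive_dotp x (dh t tT).
have hz : is_derive t 1 (fun r => wave_arg w r x : R^o) (dotp x (wave_ddir w t)).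
  have := is_deriveD hh (is_derive_cst (wave_phase w : R^o) t 1).
  by rewrite addr0.
have hc := @is_derive1_comp _ _ (fun r => wave_arg w r x) _ _ _ (is_derive_cos (wave_arg w t x)) hz.
have := is_deriveM ha hc.
congr is_derive.
by rewrite /wave_dt /= /GRing.scale /=; ring.
Qed.

Definition dotpl (h : H) : H -> R^o := dotp ^~ h.

Let dotpl_linear h : linear (dotpl h).
Proof. by move=> a x y; rewrite /dotpl dotpDl dotpZl. Qed.

HB.instance Definition _ h := GRing.isLinear.Build R H R^o *:%R (dotpl h) (dotpl_linear h).

Lemma is_diff_dotpl h x : is_diff x (dotpl h) (dotpl h).
Proof.
have cd : continuous (dotpl h) by exact: continuous_dotpl.
by apply: DiffDef; [exact: linear_differentiable|exact: diff_lin].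
Qed.

Lemma is_diff_wave_arg w t x : is_diff x (wave_arg w t : H -> R^o) (dotpl (wave_dir w t)).
Proof.
have h := is_diff_dotpl (wave_dir w t) x.
have := is_diffD h (is_diff_cst (wave_phase w : R^o) x).
by rewrite addr0.
Qed.

Lemma is_diff_ext {E E' : normedModType R} (f df g dg : E -> E') x :
  is_diff x f df -> f = g -> df = dg -> is_diff x g dg.
Proof. by move=> h <- <-. Qed.

Lemma is_diff_comp1 (f : R -> R) (df : R) (g : H -> R^o) (dg : H -> R^o) (x : H) :
  is_derive (g x) 1 f df -> is_diff x g dg ->
  is_diff x (f \o g : H -> R^o) (fun y => df * dg y : R^o).
Proof.
move=> [fd fe] gd.
have fdd : differentiable (f : R^o -> R^o) (g x) by exact/derivable1_diffP.
have h : is_diff (g x) (f : R^o -> R^o) (fun y => y *: df : R^o).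
  by apply: DiffDef => //; rewrite deriv1E// derive1E fe.
apply: (is_diff_ext (is_diff_comp gd h)) => //.
by apply/funext => y; rewrite /= mulrC.
Qed.

Lemma is_diff_wave_fun w t x :
  is_diff x (wave_fun w t : H -> R^o) (fun y => dotp (wave_grad w t x) y).
Proof.
have hc := is_diff_comp1 (is_derive_cos _) (is_diff_wave_arg w t x).
have := is_diffZ (wave_amp w t) hc.
move=> h; apply: (is_diff_ext h) => //.
apply/funext => y; rewrite /wave_grad dotpZl dotpC.
transitivity (wave_amp w t * (- sin (wave_arg w t x) * dotp y (wave_dir w t))); first by [].
by ring.
Qed.

Lemma is_diff_wave_grad w t x : is_diff x (wave_grad w t) (wave_hess w t x).
Proof.
have hc := is_diff_comp1 (is_derive_sin _) (is_diff_wave_arg w t x).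
have h := is_diffZ (- wave_amp w t) hc.
have := is_diff_comp h (is_diff_scalel _ (wave_dir w t)).
move=> h2; apply: (is_diff_ext h2); apply/funext => y.
  by rewrite /wave_grad /= /GRing.scale /= -mulNr.
rewrite /wave_hess /=; congr (_ *: _).
transitivity (- wave_amp w t * (cos (wave_arg w t x) * dotp y (wave_dir w t))); first by [].
by ring.
Qed.

Lemma is_diff_sum_seq {E : normedModType R} s (f : wave -> H -> E) (df : wave -> H -> E) x :
  (forall w, is_diff x (f w) (df w)) ->
  is_diff x (fun y => \sum_(w <- s) f w y) (fun y => \sum_(w <- s) df w y).
Proof.
move=> fd; elim: s => [|w s ih].
  have := is_diff_cst (0 : E) x.
  by congr is_diff_def; apply/funext => y; rewrite big_nil.
have := is_diffD (fd w) ih.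
by congr is_diff_def; apply/funext => y; rewrite big_cons.
Qed.

Lemma gradientE (f : H -> R^o) x g : is_diff x f (fun y => dotp g y) -> gradient f x = g.
Proof.
move=> [fd fg]; rewrite /gradient; case: xgetP => [g' -> /= [_ g'P]|/(_ g)]; last first.
  by move=> h; exfalso; apply: h; split=> // y; rewrite fg.
apply/eqP; rewrite -subr_eq0 -normr_eq0 -sqrf_eq0 -dotpp dotpBl -g'P fg subrr//.
Qed.

(** Time is restricted to the open interval, where [C1_with] provides the derivative. The Hessian
    has finite rank, so its trace is a finite sum. *)
Lemma L0_sum_wave s t x : separable H -> all (fun w => `[< wave_good w >]) s -> t \in `]0, T[ ->
  L0 DA A C F (fun t x => \sum_(w <- s) wave_fun w t x) t x = \sum_(w <- s) wave_L w t x.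
Proof.
move=> sH gs tT.
have tT' : t \in `[0, T] by exact: subset_itv_oo_cc.
have GE y : gradient (fun x => \sum_(w <- s) wave_fun w t x) y = \sum_(w <- s) wave_grad w t y.
  apply: gradientE; have := is_diff_sum_seq s (fun w => is_diff_wave_fun w t y).
  by congr is_diff_def; apply/funext => z; rewrite dotp_suml.
have GE' : gradient (fun x => \sum_(w <- s) wave_fun w t x) = fun y => \sum_(w <- s) wave_grad w t y.
  by apply/funext.
have [_ hessE] := is_diff_sum_seq s (fun w => is_diff_wave_grad w t x).
rewrite /L0 /hessian GE' hessE.
have -> : C \o (fun y => \sum_(w <- s) wave_hess w t x y) = fun y =>
    \sum_(w <- s) dotp y (wave_dir w t) *: (- (wave_amp w t * cos (wave_arg w t x)) *: C (wave_dir w t)).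
  apply/funext => y /=; rewrite (big_morph C CD C0); apply: eq_bigr => w _.
  by rewrite /wave_hess CZ scalerA; congr (_ *: _); ring.
rewrite trace_finite_rank//.
have -> : adj DA A (\sum_(w <- s) wave_grad w t x) =
    \sum_(w <- s) - (wave_amp w t * sin (wave_arg w t x)) *: wave_adir w t.
  elim: s gs {GE GE' hessE} => [_|w s ih /andP[/asboolP gw gs]].
    by rewrite !big_nil; apply: adj_unique => y _; rewrite !dotp0r.
  have adom : adj_dom DA A (\sum_(w <- s) wave_grad w t x).
    elim: s gs {ih} => [_|w' s' ih' /andP[/asboolP gw' gs']].
      by rewrite big_nil; exists 0 => y _; rewrite !dotp0r.
    rewrite big_cons -[X in _ + X]scale1r; apply: (adj_lin _ _ _ _).1; last exact: ih'.
    by have [_ _ /(_ t tT')[]] := gw'.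
  have [_ _ /(_ t tT')[wd _ wE] _ _] := gw.
  rewrite !big_cons -ih// wE -[X in _ + X]scale1r -[X in _ = _ + X]scale1r.
  exact: (adj_lin _ _ wd adom).2.
have -> : 'D_1 (fun r : R => \sum_(w <- s) wave_fun w r x : R^o) t = \sum_(w <- s) wave_dt w t x.
  have h : is_derive t 1 (fun r : R => \sum_(w <- s) wave_fun w r x : R^o) (\sum_(w <- s) wave_dt w t x).
    elim: s gs {GE GE' hessE} => [_|w s ih /andP[/asboolP gw gs]].
      rewrite big_nil (_ : (fun _ => _) = cst 0); first exact: is_derive_cst.
      by apply/funext => r; rewrite big_nil.
    rewrite big_cons (_ : (fun _ => _) = (fun r => wave_fun w r x : R^o) +
        (fun r => \sum_(w <- s) wave_fun w r x : R^o)); last first.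
      by apply/funext => r; rewrite big_cons.
    by apply: is_deriveD; [exact: wave_dtP|exact: ih].
  by have [_ ->] := h.
rewrite !dotp_sumr mulr_sumr -!big_split /=; apply: eq_bigr => w _.
rewrite /wave_L /wave_grad !dotpZl !dotpZr; ring.
Qed.

Lemma test_fun_L0 u Lu Gu t x : separable H -> test_fun u Lu Gu -> t \in `]0, T[ ->
  L0 DA A C F u t x = Lu t x.
Proof. by move=> sH /test_fun_seq[s [gs -> -> _]] tT; exact: L0_sum_wave. Qed.

(** A sine is a cosine of phase [-pi/2], so waves with a phase cover both kinds of exponential test
    functions. *)
Lemma D_L0_test_fun u : D_L0 T DA A u -> exists Lu Gu, test_fun u Lu Gu.
Proof.
move=> [n [c [v [vP ->]]]].
elim: n c v vP => [|n ih] c v vP.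
  exists (fun _ _ => 0), (fun _ _ => 0); have := test_fun0.
  by congr test_fun; apply/funext => t; apply/funext => x; rewrite big_ord0.
have [Lu [Gu tu]] := ih (fun i => c (widen_ord (leqnSn n) i)) _ (fun i => vP (widen_ord (leqnSn n) i)).
have [Lv [Gv tv]] : exists Lv Gv, test_fun (v ord_max) Lv Gv.
  have [phi [dphi [h [phiC phiT [dh [hd hC ahC]] vE]]]] := vP ord_max.
  pose w th := Wave phi dphi h dh (fun t => adj DA A (h t)) th.
  have gw th : wave_good (w th) by split=> //= t tT; have [] := hd t tT.
  case: vE => ->.
    exists (wave_L (w 0)), (wave_grad (w 0)); have := test_fun_wave (gw 0).
    by congr test_fun; apply/funext => t; apply/funext => x; rewrite /wave_fun /wave_arg /= addr0.
  exists (wave_L (w (- (pi / 2)))), (wave_grad (w (- (pi / 2)))).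
  have := test_fun_wave (gw (- (pi / 2))).
  by congr test_fun; apply/funext => t; apply/funext => x; rewrite /wave_fun /wave_arg /= cosBpihalf.
exists (fun t x => Lu t x + c ord_max * Lv t x), (fun t x => Gu t x + c ord_max *: Gv t x).
have := test_funD tu (test_funZ (c ord_max) tv).
by congr test_fun; apply/funext => t; apply/funext => x; rewrite big_ord_recr.
Qed.

Lemma test_fun_D_L0 u Lu Gu : test_fun u Lu Gu -> D_L0 T DA A u.
Proof.
elim=> [|w u' _ _ gw _ [n [c [v [vP ->]]]]].
  exists 0%N, (fun=> 0), (fun _ _ _ => 0); split; first by case.
  by apply/funext => t; apply/funext => x; rewrite big_ord0.
have [aC aT hP hC ahC] := gw.
have dom : C1_adj_dom T DA A (wave_dir w).
  by exists (wave_ddir w); split=> // t /hP[].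
pose f0 t x := wave_amp w t * cos (dotp x (wave_dir w t)).
pose f1 t x := wave_amp w t * sin (dotp x (wave_dir w t)).
exists n.+2, (fun i => if unlift ord0 i is Some j then if unlift ord0 j is Some k then c k
    else - sin (wave_phase w) else cos (wave_phase w)),
  (fun i => if unlift ord0 i is Some j then if unlift ord0 j is Some k then v k
    else f1 else f0); split.
  move=> i; case: (unlift ord0 i) => [j|]; last first.
    by exists (wave_amp w), (wave_damp w), (wave_dir w); split=> //; left.
  case: (unlift ord0 j) => [k //|].
  by exists (wave_amp w), (wave_damp w), (wave_dir w); split=> //; right.
apply/funext => t; apply/funext => x; rewrite !big_ord_recl /= !unlift_none.
rewrite liftK unlift_none addrA; congr (_ + _).
  by rewrite /wave_fun /wave_arg cosD /f0 /f1; ring.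
by apply: eq_bigr => i _; rewrite !liftK.
Qed.

End waves.

(** * Monotone classes *)

Section smoothstep.
Context {R : realType}.
Implicit Types x : R.

(** This cubic maps [[0, 1]] to itself, increases, and fixes [0], [1/2] and [1], of which [0] and
    [1] attract. Its iterates are polynomials tending to a step function with jump at [1/2]. *)
Definition smoothstep : {poly R} := 3 *: 'X^2 - 2 *: 'X^3.

Fixpoint smoothsteps (n : nat) (p : {poly R}) : {poly R} :=
  if n is m.+1 then smoothstep \Po smoothsteps m p else p.

Lemma smoothstepE x : smoothstep.[x] = x ^+ 2 * (3 - 2 * x).
Proof. by rewrite /smoothstep hornerD hornerN !hornerZ !hornerXn; ring. Qed.

Lemma smoothsteps0E n p x : (smoothsteps n.+1 p).[x] = smoothstep.[(smoothsteps n p).[x]].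
Proof. by rewrite /= horner_comp. Qed.

Lemma smoothsteps_itv n p x : 0 <= p.[x] <= 1 -> 0 <= (smoothsteps n p).[x] <= 1.
Proof.
elim: n => [//|n ih] /ih; rewrite smoothsteps0E smoothstepE.
move: (_.[x]) => y /andP[y0 y1]; apply/andP; split.
  by rewrite mulr_ge0 ?sqr_ge0//; lra.
have : 0 <= (1 - y) ^+ 2 * (1 + 2 * y) by rewrite mulr_ge0 ?sqr_ge0//; lra.
by rewrite !expr2; nra.
Qed.

Lemma smoothstepsC n p q x : q.[x] = 1 - p.[x] ->
  (smoothsteps n q).[x] = 1 - (smoothsteps n p).[x].
Proof.
move=> pq; elim: n => [//|n ih].
by rewrite !smoothsteps0E !smoothstepE ih; ring.
Qed.

Lemma smoothsteps_half n p x : p.[x] = 2^-1 -> (smoothsteps n p).[x] = 2^-1.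
Proof. by move=> px; elim: n => [//|n ih]; rewrite smoothsteps0E ih smoothstepE; field. Qed.

Lemma smoothsteps_cvg0 p x : 0 <= p.[x] < 2^-1 ->
  (fun n => (smoothsteps n p).[x]) @ \oo --> 0.
Proof.
move=> /andP[p0 p2]; set q := p.[x] in p0 p2.
(* The iterates stay below [q < 1/2], where one step multiplies by at most [r < 1]; the decay is
   geometric. *)
pose r := q * (3 - 2 * q).
have r1 : 0 <= r < 1 by rewrite /r; apply/andP; split; nra.
have h n : 0 <= (smoothsteps n p).[x] <= q * r ^+ n /\ (smoothsteps n p).[x] <= q.
  elim: n => [|n [/andP[i1 i2] i3]]; first by rewrite /= expr0 mulr1 -/q p0 lexx.
  rewrite smoothsteps0E smoothstepE; move: (_.[x]) i1 i2 i3 => y i1 i2 i3.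
  have yr : y * (3 - 2 * y) <= r by rewrite /r; nra.
  have yr0 : 0 <= y * (3 - 2 * y) by nra.
  have e : y ^+ 2 * (3 - 2 * y) = y * (y * (3 - 2 * y)) by ring.
  have le1 : y ^+ 2 * (3 - 2 * y) <= y * r by rewrite e ler_wpM2l.
  case/andP: r1 => r0 r1; split; last first.
    by apply: (le_trans le1); rewrite -[leRHS]mulr1 ler_pM// ltW.
  rewrite {1}e mulr_ge0//=; apply: (le_trans le1).
  by rewrite exprSr mulrA ler_wpM2r.
apply: (@squeeze_cvgr _ _ _ _ (cst 0) (fun n => q * r ^+ n)).
- by near=> n; have [] := h n.
- exact: cvg_cst.
- rewrite -(mulr0 q); apply: cvgM; first exact: cvg_cst.
  by apply: cvg_expr; case/andP: r1 => r0 r1; rewrite ger0_norm.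
Unshelve. all: by end_near.
Qed.

Lemma smoothsteps_cvg1 p x : 2^-1 < p.[x] <= 1 ->
  (fun n => (smoothsteps n p).[x]) @ \oo --> (1 : R).
Proof.
move=> /andP[p2 p1]; have e n := @smoothstepsC n (1 - p) p x.
have -> : (fun n => (smoothsteps n p).[x]) = (fun n => 1 - (smoothsteps n (1 - p)).[x]).
  by apply/funext => n; apply: e; rewrite !hornerE; ring.
rewrite -[X in _ --> X]subr0; apply: cvgB; first exact: cvg_cst.
by apply: smoothsteps_cvg0; rewrite !hornerE; lra.
Qed.

Lemma smoothsteps_deriv n p x : 0 <= p.[x] <= 1 -> 0 <= p^`().[x] ->
  0 <= (smoothsteps n p)^`().[x].
Proof.
move=> p01 dp; elim: n => [//|n ih]; rewrite /= deriv_comp hornerM mulr_ge0//.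
rewrite horner_comp /smoothstep derivB !derivZ !derivXn.
rewrite hornerD hornerN !hornerZ !hornerMn !hornerXn.
have := smoothsteps_itv n p01; move: (_.[x]) => y /andP[y0 y1].
by rewrite /= expr1 expr2; nra.
Qed.

End smoothstep.

Lemma addr_half_itv {R : realType} (z : R) : `|z| <= 2^-1 -> 0 <= z + 2^-1 <= 1.
Proof. by rewrite ler_norml => /andP[a b]; apply/andP; split; lra. Qed.

Section functional_monotone_class.
Context {R : realType} d (Y : measurableType d).
Variables (P : (Y -> R) -> Prop) (G : set (Y -> R)).
Hypothesis PD : forall f g, P f -> P g -> P (fun y => f y + g y).
Hypothesis PZ : forall (c : R) f, P f -> P (fun y => c * f y).
Hypothesis Plim : forall (f_ : nat -> Y -> R) f, (forall n, P (f_ n)) ->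
  (exists M : R, forall n y, `|f_ n y| <= M) ->
  (forall y, (fun n => f_ n y) @ \oo --> f y) -> P f.
Hypothesis GP : G `<=` P.
Hypothesis G1 : G (fun=> 1).
Hypothesis GD : forall f g, G f -> G g -> G (fun y => f y + g y).
Hypothesis GZ : forall (c : R) f, G f -> G (fun y => c * f y).
Hypothesis GM : forall f g, G f -> G g -> G (fun y => f y * g y).
Hypothesis Gb : forall g, G g -> exists M : R, forall y, `|g y| <= M.

Let G_horner (p : {poly R}) (g : Y -> R) : G g -> G (fun y => p.[g y]).
Proof.
move=> Gg; elim/poly_ind: p => [|p c ih].
  by have := GZ 0 G1; congr G; apply/funext => y; rewrite horner0 mul0r.
have := GD (GM ih Gg) (GZ c G1); congr G; apply/funext => y.
by rewrite !hornerE.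
Qed.

(* Sets whose indicator is an iterated pointwise limit of functions in G with
   values in [0,1] form a pi-system. *)
Let Q (A : set Y) := exists s : nat -> nat -> Y -> R, exists t : nat -> Y -> R,
  [/\ forall m n, G (s m n), forall m n y, 0 <= s m n y <= 1,
      forall m y, s m ^~ y @ \oo --> t m y & forall y, t ^~ y @ \oo --> (\1_A y : R)].

Let QI : setI_closed Q.
Proof.
move=> A B [s [t [sG s01 st tA]]] [s' [t' [sG' s01' st' tB]]].
exists (fun m n y => s m n y * s' m n y), (fun m y => t m y * t' m y); split.
- by move=> m n; exact: GM.
- move=> m n y; have /andP[a b] := s01 m n y; have /andP[a' b'] := s01' m n y.
  by rewrite mulr_ge0//= mulr_ile1.
- by move=> m y; exact: cvgM.
- by move=> y; rewrite indicI; exact: cvgM.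
Qed.

Let QP A : Q A -> P (\1_A).
Proof.
move=> [s [t [sG s01 st tA]]].
have t1 m y : `|t m y| <= 1.
  have h : (fun n => `|s m n y|) @ \oo --> `|t m y| by apply: cvg_norm; exact: st.
  rewrite -(cvg_lim _ h)//; apply: limr_le; first by apply/cvg_ex; exists `|t m y|.
  by near=> n; have /andP[a b] := s01 m n y; rewrite ger0_norm.
apply: (Plim (f_ := t)) => // [m|]; last by exists 1.
apply: (Plim (f_ := s m)) => [n||y]; [exact: GP|exists 1 => n y|exact: st].
by have /andP[a b] := s01 m n y; rewrite ger0_norm.
Unshelve. all: by end_near.
Qed.

(** Rescale [g] affinely into [[0, 1]] so that the threshold [a + 1/(m+1)] goes to [1/2], and
    iterate [smoothstep]. The limit is [1], [1/2] or [0]; the value [1/2] on the threshold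
    disappears as [m] grows. *)
Let Q_gt g a : G g -> Q [set y | a < g y].
Proof.
move=> Gg; have [M gM] := Gb Gg.
pose K := `|M| + `|a| + 2.
have K0 : 0 < K by rewrite /K ltr_wpDl// addr_ge0.
pose h m y := (g y - (a + m.+1%:R^-1)) / (2 * K) + 2^-1.
have Gh m : G (h m).
  have := GD (GZ (2 * K)^-1 Gg) (GZ (2^-1 - (a + m.+1%:R^-1) / (2 * K)) G1).
  by congr G; apply/funext => y; rewrite /h; ring.
pose s m n y := (smoothsteps n 'X).[h m y].
pose b m := a + m.+1%:R^-1.
have h01 m y : 0 <= 'X.[h m y] <= 1.
  rewrite hornerX /h.
  have i0 : 0 < m.+1%:R^-1 :> R by rewrite invr_gt0.
  have i1 : m.+1%:R^-1 <= 1 :> R by rewrite invf_le1// ler1n.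
  have gM' : `|g y| <= `|M| by rewrite (le_trans (gM y))// ler_norm.
  have hK : `|g y - (a + m.+1%:R^-1)| <= K.
    apply: (le_trans (ler_normB _ _)); rewrite /K -addrA lerD//.
    by apply: (le_trans (ler_normD _ _)); rewrite lerD2l gtr0_norm// (le_trans i1)// ler1n.
  have : `|(g y - (a + m.+1%:R^-1)) / (2 * K)| <= 2^-1.
    by rewrite normrM normfV (@gtr0_norm _ (2 * K)) ?mulr_gt0// ler_pdivrMr ?mulr_gt0// mulKf.
  exact: addr_half_itv.
exists s, (fun m y => if b m < g y then 1 else if g y == b m then 2^-1 else 0); split.
- by move=> m n; exact: G_horner.
- by move=> m n y; exact: smoothsteps_itv.
- move=> m y; have := h01 m y; rewrite hornerX => /andP[h0 h1].
  have hb : (h m y - 2^-1) * (2 * K) = g y - b m by rewrite /h /b addrK divfK// gt_eqF// mulr_gt0.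
  have K2 : 0 < 2 * K by rewrite mulr_gt0.
  case: ifPn => [bg|]; [|case: ifPn => [/eqP gb _|gb]].
  + apply: smoothsteps_cvg1; rewrite hornerX h1 andbT -subr_gt0 -(pmulr_lgt0 _ K2) hb.
    by rewrite subr_gt0.
  + rewrite (_ : (fun n => s m n y) = cst 2^-1); first exact: cvg_cst.
    apply/funext => n; apply: smoothsteps_half; rewrite hornerX.
    by rewrite /h gb subrr mul0r add0r.
  + rewrite -leNgt le_eqVlt (negbTE gb) /= => bg.
    apply: smoothsteps_cvg0; rewrite hornerX h0 /= -subr_lt0 -(pmulr_llt0 _ K2) hb.
    by rewrite subr_lt0.
- move=> y; rewrite indicE; have [ag|ga] := ltP a (g y).
    rewrite mem_set//; apply: cvg_near_cst.
    have [m mP] := near_inv_succ_lt (etrans (subr_gt0 _ _) ag).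
    exists m => // n /= mn; rewrite ifT// /b.
    by rewrite -ltrBrDl mP.
  rewrite memNset; last by move=> /=; rewrite ltNge ga.
  apply: cvg_near_cst; near=> n; have n0 : 0 < n.+1%:R^-1 :> R by rewrite invr_gt0.
  have gb : g y < b n by rewrite (le_lt_trans ga)// ltrDl.
  by rewrite ltNge (ltW gb) /= lt_eqF.
Unshelve. all: by end_near.
Qed.

Import HBNNSimple.

Hypothesis Gmeas : @measurable d Y `<=` <<s [set A | exists g a, G g /\ A = [set y | a < g y]] >>.

(** The pi-lambda theorem applied to the class [Q]. As [G] is only an algebra, polynomials of its
    members take the place of the usual lattice operations. *)
Lemma functional_monotone_class (f : Y -> R) : measurable_fun setT f ->
  (exists M : R, forall y, `|f y| <= M) -> P f.
Proof.
have P1 A : measurable A -> P (\1_A).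
  have lam : lambda_system setT [set A | P (\1_A)].
    split=> //=.
    - by rewrite indicT; exact: GP.
    - move=> A1 B BA /= PA PB; have := PD PA (PZ (-1) PB).
      congr P; apply/funext => y.
      rewrite !indicE in_setD; case: (boolP (y \in B)) => yB /=; last by rewrite mulr0 addr0 andbT.
      have -> : y \in A1 by exact/mem_set/BA/set_mem.
      by rewrite mulr1 subrr.
    - move=> F Fnd PF /=; apply: (Plim (f_ := fun n => \1_(F n))) => //.
        by exists 1 => n y; rewrite indicE; case: (_ \in _); rewrite ?normr1 ?normr0.
      move=> y; apply: cvg_near_cst.
      have [[n _ Fny]|nF] := pselect ((\bigcup_n F n) y).
        exists n => // m /= nm; rewrite !indicE !mem_set//; first by exists n.
        by move/subsetPset : (Fnd _ _ nm); exact.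
      near=> n; rewrite !indicE !memNset// => Fny.
      by apply: nF; exists n.
  have QH : Q `<=` [set A | P (\1_A)] by move=> ? /QP.
  have := @lambda_system_subset _ Q QI setT _ lam QH (fun _ _ _ _ => Logic.I).
  move=> + mA; move=> /(_ A); apply; move: (Gmeas mA); apply: sub_sigma_algebra2.
  by move=> _ [g [a [Gg ->]]]; exact: Q_gt.
have P0 : P (fun=> 0).
  by have := PZ 0 (GP G1); congr P; apply/funext => y; rewrite mul0r.
have Psum n (c : nat -> R) (A : nat -> set Y) : (forall i, measurable (A i)) ->
    P (fun y => \sum_(i < n) c i * \1_(A i) y).
  move=> mA; elim: n => [|n ih].
    by move: P0; congr P; apply/funext => y; rewrite big_ord0.
  have := PD ih (PZ (c n) (P1 _ (mA n))); congr P; apply/funext => y.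
  by rewrite big_ord_recr.
have Ppos (f' : Y -> R) M : measurable_fun setT f' -> (forall y, 0 <= f' y <= M) -> P f'.
  move=> mf fM; have mf' : measurable_fun setT (EFin \o f') by exact/measurable_EFinP.
  pose g := nnsfun_approx measurableT mf'.
  have gf (y : Y) : EFin \o g^~ y @ \oo --> (f' y)%:E.
    by apply: (cvg_nnsfun_approx measurableT mf') => // z _; rewrite lee_fin; have /andP[] := fM z.
  have fE (y : Y) : g^~ y @ \oo --> f' y by exact: (fine_cvg (gf y)).
  apply: (Plim (f_ := fun n => g n)) => // [n|].
    have := Psum (size (finmap.enum_fset (fset_set (range (g n))))) (fun i => (finmap.enum_fset (fset_set (range (g n))))`_i)
      (fun i => g n @^-1` [set (finmap.enum_fset (fset_set (range (g n))))`_i]) _.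
    move=> h; have := h (fun i => measurable_funPTI (g n) (measurable_set1 _)).
    by congr P; apply/funext => y; rewrite fimfunEord.
  exists M => n y; rewrite ger0_norm//; have /andP[_] := fM y; apply: le_trans.
  rewrite -(cvg_lim _ (fE y))//; apply: (nondecreasing_cvgn_le (u_ := g^~ y)).
    by move=> a b ab; have /lefP/(_ y) := nd_nnsfun_approx measurableT mf' ab.
  by apply/cvg_ex; exists (f' y).
move=> mf [M fM].
have := PD (Ppos (fun y => f y + M) (M + M) _ _) (PZ (- M) (GP G1)).
have h1 : measurable_fun setT (fun y => f y + M) by apply: measurable_funD.
have h2 y : 0 <= f y + M <= M + M.
  by have := fM y; rewrite ler_norml => /andP[a b]; apply/andP; split; lra.
move=> /(_ h1 h2); congr P; apply/funext => y; ring.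
Unshelve. all: by end_near.
Qed.

End functional_monotone_class.

Section integral_congruence.
Context {R : realType} d (X : measurableType d) (mu : {measure set X -> \bar R}).
Import HBNNSimple.
Local Open Scope ereal_scope.

Let ge0_integral_le_off (f g : X -> \bar R) (N : set X) : measurable N -> mu N = 0 ->
  (forall x, 0 <= f x) -> (forall x, 0 <= g x) -> (forall x, ~ N x -> f x = g x) ->
  \int[mu]_x f x <= \int[mu]_x g x.
Proof.
move=> mN N0 f0 g0 fg; rewrite ge0_integralE//.
apply: ge_ereal_sup => _ [h /= hf <-].
rewrite -integralT_nnsfun.
have mh : measurable_fun setT (EFin \o h) by exact/measurable_EFinP.
have -> : \int[mu]_x (h x)%:E = \int[mu]_x (proj_nnsfun h (measurableC mN) x)%:E.
  apply: ae_eq_integral => //; first exact/measurable_EFinP.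
  exists N; split=> // x /= hx; apply: contrapT => Nx; apply: hx => _.
  by rewrite /= /mindic indicE mem_set// mulr1.
rewrite integralT_nnsfun ge0_integralE//; apply: ereal_sup_ubound.
exists (proj_nnsfun h (measurableC mN)) => // x.
rewrite patch_setT /= /mindic indicE; case: (boolP (x \in ~` N)) => [/set_mem Nx|_].
  by rewrite mulr1 -fg//; have := hf x; rewrite patch_setT.
by rewrite mulr0.
Qed.

(** Measurability of [f] and [g] is not asked for, because [L0] is defined by derivatives and
    choices. The nonnegative integral is a supremum over simple functions, and these can be cut off
    on a null set. *)
Lemma integral_ae_congr (D : set X) (f g : X -> \bar R) :
  {ae mu, forall x, D x -> f x = g x} -> \int[mu]_(x in D) f x = \int[mu]_(x in D) g x.
Proof.
move=> [N [mN N0 hN]].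
have fg x : ~ N x -> (f \_ D) x = (g \_ D) x.
  move=> Nx; rewrite /patch; case: ifPn => // /set_mem Dx.
  by apply: contrapT => nfg; apply: Nx; apply: hN => /= h; exact/nfg/h.
rewrite integral_mkcond [RHS]integral_mkcond integralE [RHS]integralE.
have e (F G : X -> \bar R) : (forall x, 0 <= F x) -> (forall x, 0 <= G x) ->
    (forall x, ~ N x -> F x = G x) -> \int[mu]_x F x = \int[mu]_x G x.
  move=> F0 G0 FG; apply/eqP; rewrite eq_le.
  by rewrite (ge0_integral_le_off mN)// (ge0_integral_le_off mN)// => x /FG.
congr (_ - _); apply: e => x.
- exact: funepos_ge0.
- exact: funepos_ge0.
- by move=> Nx; rewrite !funeposE fg.
- exact: funeneg_ge0.
- exact: funeneg_ge0.
- by move=> Nx; rewrite !funenegE fg.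
Qed.

End integral_congruence.

Section borel_functions.
Context {R : realType} {H : hilbertType R}.

Lemma measurable_borel_continuous (X : normedModType R) (f : X -> R) : continuous f ->
  measurable_fun setT (f : borel X -> measurableTypeR R).
Proof.
move=> cf; apply: (measurability _ (RGenOInfty.measurableE R)) => _ [_ [a ->] <-].
rewrite setTI set_itvE; apply: sub_sigma_algebra; apply: open_comp; last exact: open_gt.
by move=> x _; exact: cf.
Qed.

Lemma measurable_fun_open d (X : measurableType d) (E : normedModType R) (D : set X) (f : X -> E) :
  (forall U : set E, open U -> measurable (D `&` f @^-1` U)) ->
  measurable_fun D (f : X -> borel E).
Proof. by move=> h; apply: (@measurability _ _ _ (borel E) D f (@open E)) => // _ [U oU <-]; exact: h. Qed.

Lemma within_continuous_measurable (E : normedModType R) (a b : R) (f : R -> E) :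
  {within `[a, b], continuous f} ->
  measurable_fun (`[a, b]%classic : set (measurableTypeR R)) (f : measurableTypeR R -> borel E).
Proof.
move=> cf; apply: measurable_fun_open => U oU.
have /open_subspaceP[V oV VE] : open (f @^-1` U : set (subspace `[a, b]%classic)).
  by move/continuousP : cf; exact.
rewrite setIC -VE setIC; apply: measurableI; first exact: measurable_itv.
exact: open_measurable.
Qed.

Lemma within_continuous_measurableR (a b : R) (f : R -> R) :
  {within `[a, b], continuous f} ->
  measurable_fun (`[a, b]%classic : set (measurableTypeR R)) (f : measurableTypeR R -> measurableTypeR R).
Proof.
move=> cf mD B mB; apply: (within_continuous_measurable cf mD).
exact: measurable_borel.
Qed.

Hypothesis sH : separable H.

Lemma measurable_dotp d (X : measurableType d) (D : set X) (f g : X -> H) :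
  measurable_fun D (f : X -> borel H) -> measurable_fun D (g : X -> borel H) ->
  measurable_fun D (fun z => dotp (f z) (g z) : measurableTypeR R).
Proof.
move=> mf mg; have [e [eo e1 eb]] := orthonormal_basis_ex sH.
have me n (h : X -> H) : measurable_fun D (h : X -> borel H) ->
    measurable_fun D (fun z => dotp (h z) (e n) : measurableTypeR R).
  move=> mh; apply: (measurableT_comp (measurable_borel_continuous (@continuous_dotpl _ _ (e n))) mh).
apply: (@measurable_fun_cvg _ _ _ _ (fun n z => \sum_(k < n) dotp (f z) (e k) * dotp (g z) (e k))).
  by move=> n; apply: measurable_sum => k; apply: measurable_funM; exact: me.
move=> z _; have -> : (fun n => \sum_(k < n) dotp (f z) (e k) * dotp (g z) (e k)) =
    (fun n => dotp ([series dotp (f z) (e k) *: e k]_k n) (g z)).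
  apply/funext => n; rewrite /series /= big_mkord dotp_suml; apply: eq_bigr => k _.
  by rewrite dotpZl [dotp (e k) _]dotpC.
by apply: cvg_dotp; [exact: eb|exact: cvg_cst].
Qed.

Lemma measurable_norm_borel d (X : measurableType d) (D : set X) (f : X -> H) :
  measurable_fun D (f : X -> borel H) -> measurable_fun D (fun z => `|f z| : measurableTypeR R).
Proof.
move=> mf; apply: (measurableT_comp (f := fun x : borel H => `|x : H|) _ mf).
exact: (measurable_borel_continuous (@norm_continuous _ H)).
Qed.

(** Parseval's series makes the distance to a point measurable for the sigma-algebra of half-spaces,
    and an open set is a countable union of balls with dense centres. *)
Lemma borel_half_spaces : @measurable _ (borel H) `<=`
  <<s [set A | exists h a, A = [set y | a < dotp y h]] >>.
Proof.
set G := [set A | _].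
pose Y := g_sigma_algebraType G.
have mh (h : H) : measurable_fun setT (fun y : Y => dotp (y : H) h : measurableTypeR R).
  apply: (measurability _ (RGenOInfty.measurableE R)) => _ [_ [a ->] <-].
  rewrite setTI; apply: sub_sigma_algebra; exists h, a.
  by apply/seteqP; split=> y /=; rewrite in_itv/= andbT.
have [e [eo e1 eb]] := orthonormal_basis_ex sH.
have mn (c : H) : measurable_fun setT (fun y : Y => `|(y : H) - c| ^+ 2 : measurableTypeR R).
  apply: (@measurable_fun_cvg _ _ _ _ (fun n (y : Y) => \sum_(k < n) (dotp (y : H) (e k) - dotp c (e k)) ^+ 2)).
    move=> n; apply: measurable_sum => k; apply: measurable_funX.
    by apply: measurable_funB => //; exact: mh.
  move=> y _; rewrite -dotpp.
  have -> : (fun n => \sum_(k < n) (dotp y (e k) - dotp c (e k)) ^+ 2) =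
      (fun n => dotp ([series dotp (y - c) (e k) *: e k]_k n) (y - c)).
    apply/funext => n; rewrite /series /= big_mkord dotp_suml; apply: eq_bigr => k _.
    by rewrite dotpZl [dotp (e k) _]dotpC dotpBl expr2.
  by apply: cvg_dotp; [exact: eb|exact: cvg_cst].
suff h : @open H `<=` <<s G >>.
  by apply: smallest_sub => //; exact: smallest_sigma_algebra.
move=> U oU; have [d dd] := separable_dense_seq sH.
have -> : U = \bigcup_(p in [set p : nat * nat | [set y | `|y - d p.1| < p.2.+1%:R^-1] `<=` U])
    [set y | `|y - d p.1| < p.2.+1%:R^-1].
  apply/seteqP; split=> [y Uy|y [p /= pU]]; last exact: pU.
  have /nbhs_ballP[r /= r0 rU] : nbhs y U by exact: open_nbhs_nbhs.
  have [m mr] := near_inv_succ_lt (divr_gt0 r0 (ltr0n _ 2)).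
  have [i yi] : exists i, `|y - d i| < m.+1%:R^-1 by apply: dd; rewrite invr_gt0.
  exists (i, m) => // z /= zi; apply: rU; rewrite -ball_normE /=.
  have := mr m (leqnn m); have := ler_distD (d i) y z; rewrite (distrC (d i) z).
  move: yi zi; move: (`|y - d i|) (`|z - d i|) (`|y - z|) (m.+1%:R^-1) => ? ? ? ? *; lra.
have mb (p : nat * nat) : measurable ([set y | `|(y : H) - d p.1| < p.2.+1%:R^-1] : set Y).
  have := measurable_fun_ltr (mn (d p.1)) (measurable_cst ((p.2.+1%:R^-1 : R) ^+ 2)).
  move=> /(_ measurableT [set true] Logic.I); rewrite setTI.
  congr (measurable (_ : set Y)); apply/seteqP; split=> y /=.
    by rewrite ltr_pXn2r ?nnegrE ?invr_ge0.
  by rewrite ltr_pXn2r ?nnegrE ?invr_ge0.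
rewrite bigcup_mkcond; apply: (@countable_bigcupT_measurable _ Y); first exact: countableP.
by move=> p; case: ifPn => _; [exact: mb|exact: measurable0].
Qed.

End borel_functions.

Lemma cvg_sin_scaled {R : realType} (z : R) :
  (fun n => sin (z * n.+1%:R^-1) * n.+1%:R) @ \oo --> z.
Proof.
have hz : is_derive (0 : R) 1 ( *%R z) z.
  have := is_deriveM (is_derive_cst z (0 : R) (1 : R)) (is_derive_id (0 : R) (1 : R)).
  by rewrite [X in is_derive _ _ _ X](_ : _ = z)// scaler0 addr0 /GRing.scale /= mulr1.
have hs : is_derive (z * 0) 1 sin (cos (z * 0)) by exact: is_derive_sin.
have [df dE] := @is_derive1_comp _ sin ( *%R z) 0 _ _ hs hz.
have h0 : (fun n => n.+1%:R^-1 : R) @ \oo --> (0 : R)^'.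
  move=> B hB.
  have h1 : \forall n \near \oo, (n.+1%:R^-1 : R) != 0 -> B (n.+1%:R^-1) by exact: (@cvg_harmonic R _ hB).
  suff : \forall n \near \oo, B (n.+1%:R^-1) by [].
  by apply: filterS h1 => n; apply; rewrite invr_neq0// pnatr_eq0.
have : (fun h => h^-1 *: ((sin \o *%R z) (h *: 1 + 0) - (sin \o *%R z) 0)) @ (0 : R)^' --> z.
  move/cvg_ex : df => [l hl].
  have lz : l = z; last by rewrite lz in hl; exact: hl.
  by rewrite -(cvg_lim _ hl)//; apply: (etrans dE); rewrite mulr0 cos0 mul1r.
move=> h1; have h2 := cvg_comp _ _ h0 h1.
rewrite (_ : (fun n => _) = (fun h => h^-1 *: ((sin \o *%R z) (h *: 1 + 0) - (sin \o *%R z) 0))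
  \o (fun n => n.+1%:R^-1))//.
apply/funext => n /=.
by rewrite mulr0 sin0 subr0 addr0 invrK /GRing.scale /= mulr1 mulrC.
Qed.

Section trig_monotone_class.
Context {R : realType} d (Y : measurableType d).
Variables (P : (Y -> R) -> Prop) (L : set (Y -> R)).
Hypothesis PD : forall f g, P f -> P g -> P (fun y => f y + g y).
Hypothesis PZ : forall (c : R) f, P f -> P (fun y => c * f y).
Hypothesis Plim : forall (f_ : nat -> Y -> R) f, (forall n, P (f_ n)) ->
  (exists M : R, forall n y, `|f_ n y| <= M) ->
  (forall y, (fun n => f_ n y) @ \oo --> f y) -> P f.
Hypothesis LD : forall f g, L f -> L g -> L (fun y => f y + g y).
Hypothesis LZ : forall (c : R) f, L f -> L (fun y => c * f y).
Hypothesis L0 : L (fun=> 0).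
Hypothesis LP : forall l th, L l -> P (fun y => cos (l y + th)).
Hypothesis Lmeas : @measurable d Y `<=`
  <<s [set A | exists l a, L l /\ A = [set y | a < l y]] >>.

Inductive trig_span : (Y -> R) -> Prop :=
| trig_span0 : trig_span (fun=> 0)
| trig_spanD c l th f : L l -> trig_span f -> trig_span (fun y => c * cos (l y + th) + f y).

Let tD f g : trig_span f -> trig_span g -> trig_span (fun y => f y + g y).
Proof.
move=> tf tg; elim: tf => [|c l th f' Ll _ ih].
  by congr trig_span: tg; apply/funext => y; rewrite add0r.
by have := trig_spanD c th Ll ih; congr trig_span; apply/funext => y; rewrite addrA.
Qed.

Let tcos c l th : L l -> trig_span (fun y => c * cos (l y + th)).
Proof.
move=> Ll; have := trig_spanD c th Ll trig_span0.
by congr trig_span; apply/funext => y; rewrite addr0.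
Qed.

Let tZ c f : trig_span f -> trig_span (fun y => c * f y).
Proof.
elim=> [|c' l th f' Ll _ ih].
  by have := trig_span0; congr trig_span; apply/funext => y; rewrite mulr0.
by have := trig_spanD (c * c') th Ll ih; congr trig_span; apply/funext => y; ring.
Qed.

Let tM f g : trig_span f -> trig_span g -> trig_span (fun y => f y * g y).
Proof.
move=> tf tg; elim: tf => [|c l th f' Ll _ ih].
  by have := trig_span0; congr trig_span; apply/funext => y; rewrite mul0r.
suff h : trig_span (fun y => c * cos (l y + th) * g y).
  by have := tD h ih; congr trig_span; apply/funext => y; ring.
elim: tg => [|c' l' th' g' Ll' _ ih'].
  by have := trig_span0; congr trig_span; apply/funext => y; rewrite mulr0.
have L1 := tcos (2^-1 * (c * c')) (th + th') (LD Ll Ll').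
have L2 := tcos (2^-1 * (c * c')) (th - th') (LD Ll (LZ (-1) Ll')).
have := tD (tD L1 L2) ih'; congr trig_span; apply/funext => y.
have -> : l y + l' y + (th + th') = (l y + th) + (l' y + th') by ring.
have -> : l y + -1 * l' y + (th - th') = (l y + th) - (l' y + th') by ring.
by rewrite !(cosD, cosN, sinN); field.
Qed.

(** Cosines of members of [L] span an algebra by the product formula. They generate the
    sigma-algebra of [L], because [l] is the limit of [n sin (l/n)]. *)
Lemma trig_monotone_class (f : Y -> R) : measurable_fun setT f ->
  (exists M : R, forall y, `|f y| <= M) -> P f.
Proof.
apply: (functional_monotone_class (G := trig_span)) => //.
- move=> g; elim=> [|c l th f' Ll _ ih].
    by have := PZ 0 (LP 0 L0); congr P; apply/funext => y; rewrite mul0r.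
  by apply: PD => //; apply: PZ; exact: LP.
- by have := tcos 1 0 L0; congr trig_span; apply/funext => y; rewrite addr0 cos0 mulr1.
- move=> g; elim=> [|c l th f' Ll _ [M ih]]; first by exists 0 => y; rewrite normr0.
  exists (`|c| + M) => y; rewrite (le_trans (ler_normD _ _))// lerD// normrM ler_piMr//.
  by rewrite ler_norml cos_geN1 cos_le1.
- move=> A /Lmeas; apply: (@smallest_sub _ _ _ _ _ _); first exact: smallest_sigma_algebra.
  move=> _ [l [a [Ll ->]]].
  set GG := [set A | _].
  pose Y' := g_sigma_algebraType GG.
  have mg g : trig_span g -> measurable_fun setT (g : Y' -> measurableTypeR R).
    move=> tg; apply: (measurability _ (RGenOInfty.measurableE R)) => _ [_ [b ->] <-].
    rewrite setTI; apply: sub_sigma_algebra; exists g, b; split=> //.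
    by apply/seteqP; split=> y /=; rewrite in_itv/= andbT.
  have ml : measurable_fun setT (l : Y' -> measurableTypeR R).
    apply: (@measurable_fun_cvg _ _ _ _ (fun n (y : Y') => n.+1%:R * cos (n.+1%:R^-1 * l y + - (pi / 2)) : R)).
      by move=> n; apply: mg; apply: tcos; exact: LZ.
    by move=> y _; under eq_fun do rewrite cosBpihalf mulrC [_^-1 * _]mulrC; exact: cvg_sin_scaled.
  have : measurable ((l : Y' -> measurableTypeR R) @^-1` `]a, +oo[).
    by rewrite -[X in measurable X]setTI; apply: ml => //; exact: measurable_itv.
  by congr (measurable (_ : set Y')); apply/seteqP; split=> y /=; rewrite in_itv/= andbT.
Qed.

End trig_monotone_class.

(** * Domination from convex inequalities *)

Lemma poly_primitive {R : realFieldType} (q : {poly R}) :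
  exists p : {poly R}, p^`() = q /\ p.[0] = 0.
Proof.
exists (\poly_(i < (size q).+1) (q`_i.-1 *+ (i != 0%N) / i%:R)); split.
  apply/polyP => i; rewrite coef_deriv coef_poly ltnS /=.
  case: ltnP => h; last by rewrite mul0rn nth_default.
  by rewrite mulr1n -[LHS]mulr_natr divfK// pnatr_eq0.
by rewrite horner_coef0 coef_poly /= mulr0n mul0r.
Qed.

(* A polynomial analogue of the convex function z |-> max(-z, 0). *)
Lemma negpart_poly {R : realType} (M e : R) : 0 < M -> 0 < e -> exists p : {poly R},
  [/\ p.[0] = 0, forall z, `|z| <= M -> -1 <= p^`().[z] <= 0,
      forall z, `|z| <= M -> 0 <= p^`()^`().[z]
    & forall z, `|z| <= M -> Num.max (- z) 0 - e <= p.[z]].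
Proof.
move=> M0 e0.
(* The affine map taking [[-M, M]] to [[0, 1]] and [0] to [1/2]. *)
pose g : {poly R} := (2 * M)^-1 *: 'X + 2^-1%:P.
have gE z : g.[z] = (2 * M)^-1 * z + 2^-1 by rewrite /g !hornerE.
have g'E z : g^`().[z] = (2 * M)^-1 by rewrite /g derivD derivZ derivX derivC !hornerE.
have iM : 0 < (2 * M)^-1 by rewrite invr_gt0 mulr_gt0.
have iMM : (2 * M)^-1 * M = 2^-1 by field; rewrite gt_eqF.
have g01 z : `|z| <= M -> 0 <= g.[z] <= 1.
  rewrite gE ler_norml => /andP[z1 z2].
  have h1 : (2 * M)^-1 * z <= (2 * M)^-1 * M by rewrite ler_wpM2l// ltW.
  have h2 : (2 * M)^-1 * (- M) <= (2 * M)^-1 * z by rewrite ler_wpM2l// ltW.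
  by move: h1 h2; rewrite mulrN iMM; move: (_ * z) => y h1 h2; lra.
(* The error budget [e] is spent as [dl <= e/4] near the kink and [2 * M * eta = e/2] for the slopes
   at distance up to [2 * M]. *)
pose dl := Num.min (e / 4) (M / 2).
have dl0 : 0 < dl by rewrite lt_min !divr_gt0.
have dle : dl <= e / 4 by rewrite ge_min lexx.
have dlM : dl <= M / 2 by rewrite ge_min lexx orbT.
have dlM' : dl <= M by lra.
have dn : `|dl| <= M by rewrite gtr0_norm.
have dn' : `|- dl| <= M by rewrite normrN.
pose eta := e / (4 * M).
have eta0 : 0 < eta by rewrite divr_gt0// mulr_gt0.
have etaE : 2 * M * eta = e / 2 by rewrite /eta; field; rewrite gt_eqF.
have gd : 0 < (2 * M)^-1 * dl by rewrite mulr_gt0.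
have [n [n1 n2]] : exists n : nat, 1 - eta <= (smoothsteps n g).[dl] /\ (smoothsteps n g).[- dl] <= eta.
  have c1 : (fun n => (smoothsteps n g).[dl]) @ \oo --> (1 : R).
    apply: smoothsteps_cvg1; have /andP[_ ->] := g01 _ dn.
    by rewrite gE andbT ltrDr.
  have c0 : (fun n => (smoothsteps n g).[- dl]) @ \oo --> (0 : R).
    apply: smoothsteps_cvg0; have /andP[-> _] := g01 _ dn'.
    by rewrite gE /= gtrDr mulrN oppr_lt0.
  have h1 : \forall n \near \oo, 1 - eta <= (smoothsteps n g).[dl].
    by move: c1 => /cvgrPdist_le/(_ _ eta0); apply: filterS => n; rewrite ler_distl; lra.
  have h0 : \forall n \near \oo, (smoothsteps n g).[- dl] <= eta.
    by move: c0 => /cvgrPdist_le/(_ _ eta0); apply: filterS => n; rewrite ler_distl; lra.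
  exact: (filter_ex (filterI h1 h0)).
(* The derivative is a smoothed step from [-1] on the negative side to [0] on the positive side; it
   increases, so [p] is convex. *)
have [p [pE p0]] := poly_primitive (smoothsteps n g - 1).
have dE z : p^`().[z] = (smoothsteps n g).[z] - 1 by rewrite pE !hornerE.
have d01 z : `|z| <= M -> -1 <= p^`().[z] <= 0.
  by move=> /g01/(smoothsteps_itv n)/andP[a b]; rewrite dE; apply/andP; split; lra.
have dd z : `|z| <= M -> 0 <= p^`()^`().[z].
  move=> zM; rewrite pE derivB derivC subr0; apply: smoothsteps_deriv; first exact: g01.
  by rewrite g'E ltW.
have between a b c : `|a| <= M -> `|b| <= M -> c \in `]a, b[ -> `|c| <= M.
  by rewrite !ler_norml in_itv/=; lra.
have mono a b : `|a| <= M -> `|b| <= M -> a <= b -> p^`().[a] <= p^`().[b].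
  move=> aM bM ab; apply: (@polyrcf.ler_hornerW _ a b) => //; last 2 first.
  - by rewrite in_itv/= lexx.
  - by rewrite in_itv/= lexx ab.
  by move=> x xab; apply: dd; exact: (between a b).
have tangent a z : `|a| <= M -> `|z| <= M -> p^`().[a] * (z - a) <= p.[z] - p.[a].
  move=> aM zM; have [az|za|->] := ltgtP a z; last by rewrite !subrr mulr0.
    have [c cI ->] := polyrcf.poly_mvt p az.
    rewrite ler_wpM2r ?subr_ge0 ?(ltW az)//; apply: mono => //; first exact: (between a z).
    by move: cI; rewrite in_itv => /andP[/ltW].
  have [c cI h] := polyrcf.poly_mvt p za.
  rewrite -(opprB p.[a]) h -mulrN opprB ler_wnM2r ?subr_le0 ?(ltW za)//; apply: mono => //.
    exact: (between z a).
  by move: cI; rewrite in_itv => /andP[_ /ltW].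
exists p; split=> // z zM.
have n0 : `|0 : R| <= M by rewrite normr0 ltW.
(* By convexity [p] lies above its tangents. Those at [0] give [p dl >= -dl] and [p (-dl) >= 0];
   from there the tangents at [dl] and [-dl] bound [p] from below by [0] and by [-z], up to [e]. *)
have t1 := tangent _ _ n0 dn; have t2 := tangent _ _ dn zM; have t3 := tangent _ _ dn' zM.
have t4 := tangent _ _ n0 dn'.
have e1 := d01 _ n0; have e2 := d01 _ dn; have e3 := d01 _ dn'.
have f2 : - eta <= p^`().[dl] by rewrite dE; lra.
have f3 : p^`().[- dl] <= -1 + eta by rewrite dE; lra.
rewrite p0 in t1 t4; move: t1 t2 t3 t4 e1 e2 e3 f2 f3.
move: (p.[z]) (p.[dl]) (p.[- dl]) (p^`().[0]) (p^`().[dl]) (p^`().[- dl]) => y y1 y2 d0 d1 d2.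
move=> t1 t2 t3 t4 /andP[e1 e1'] /andP[e2 e2'] /andP[e3 e3'] f2 f3.
have /andP[z1 z2] : - M <= z <= M by rewrite -ler_norml.
have y1l : - dl <= y1 by nra.
have y2l : 0 <= y2 by nra.
rewrite lerBlDr ge_max; apply/andP; split; nra.
Qed.

(** The difference is realized as the measure of density [1 - f], where [f] is the density of [m1];
    it is then a measure by construction. *)
Lemma measure_sub_ex {R : realType} d (Y : measurableType d)
    (mu : {finite_measure set Y -> \bar R}) (m1 : {measure set Y -> \bar R}) :
  (forall E, measurable E -> m1 E <= mu E)%E ->
  exists n1 n2 : {finite_measure set Y -> \bar R}, (forall E, n1 E = m1 E) /\
    forall E, measurable E -> (mu E = n1 E + n2 E)%E.
Proof.
move=> m1mu; have muoo : (mu setT < +oo)%E by rewrite -ge0_fin_numE// fin_num_measure.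
have m1oo : (m1 setT < +oo)%E by apply: le_lt_trans muoo; exact: m1mu.
have [n1 n1E] := finite_measure_ex m1oo.
have n1mu A : measurable A -> (n1 A <= mu A)%E by move=> mA; rewrite n1E m1mu.
have [f [mf f01 fE]] := dominated_density n1mu.
have f0 y : 0 <= 1 - f y by rewrite subr_ge0; case/andP: (f01 y).
pose k (y : Y) : {measure set Y -> \bar R} := mscale (NngNum (f0 y)) (dirac y).
have kE y B : k y B = ((1 - f y) * \1_B y)%:E by rewrite /k /= /mscale /= diracE EFinM indicE.
have mk (B : set Y) : measurable B -> measurable_fun setT (fun y => k y B).
  move=> mB; under eq_fun do rewrite kE; apply/measurable_EFinP.
  by apply: measurable_funM; [exact: measurable_funB|exact: measurable_indic].
have [m2 m2E] := mixture_ex mu measurableT mk.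
have E0 B : measurable B -> (mu B = n1 B + m2 B)%E.
  move=> mB; rewrite fE// m2E.
  have e1 : (\int[mu]_(x in setT) k x B = \int[mu]_(x in B) (1 - f x)%:E)%E.
    rewrite [RHS]integral_mkcond; apply: eq_integral => y _.
    by rewrite kE /patch indicE; case: ifP => _; rewrite ?mulr1 ?mulr0.
  rewrite e1 -ge0_integralD//; last 4 first.
  - by move=> y _; rewrite lee_fin; case/andP: (f01 y).
  - by apply/measurable_EFinP; exact: measurable_funTS.
  - by move=> y _; rewrite lee_fin.
  - by apply/measurable_EFinP; apply: measurable_funTS; exact: measurable_funB.
  under eq_integral do rewrite -EFinD addrC subrK.
  by rewrite integral_cst// mul1e.
have m2oo : (m2 setT < +oo)%E.
  by apply: le_lt_trans muoo; rewrite E0// leeDr.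
have [n2 n2E] := finite_measure_ex m2oo.
by exists n1, n2; split=> // B mB; rewrite E0// n2E.
Qed.

Section moment_domination.
Context (R : realType) d (Y : measurableType d) (mu : {finite_measure set Y -> \bar R}).

Let I (f : Y -> R) : R := fine (\int[mu]_y (f y)%:E).
Let pos (f : Y -> R) : R := I (fun y => Num.max (f y) 0).
Let S (f : Y -> R) := mu.-integrable setT (EFin \o f).

(** [G] is the graph of a linear functional. The graph form avoids proving beforehand that the value
    is determined by the function; this is forced by [Gpos]. *)
Variable G : (Y -> R) -> R -> Prop.
Hypothesis G0 : G 0 0.
Hypothesis GD : forall f g c e, G f c -> G g e -> G (f + g) (c + e).
Hypothesis GZ : forall (a : R) f c, G f c -> G (a *: f) (a * c).
Hypothesis Gi : forall f c, G f c -> S f.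
Hypothesis Gpos : forall f c, G f c ->
  (c%:E <= \int[mu]_y (Num.max (f y) 0)%:E)%E.

Let Smax f : S f -> S (fun y => Num.max (f y) 0).
Proof.
move=> fi; have /integrableP[/measurable_EFinP mf _] := fi.
apply: (le_integrable measurableT _ _ fi) => [|z _].
  by apply/measurable_EFinP; exact: measurable_maxr.
by rewrite /= lee_fin ger0_norm ?le_max ?lexx ?orbT// ge_max ler_norm normr_ge0.
Qed.

Let SD f g : S f -> S g -> S (f + g).
Proof.
move=> Sf Sg; rewrite /S (_ : _ \o _ = (EFin \o f) \+ (EFin \o g))%E//.
exact: integrableD.
Qed.

Let SZ (a : R) f : S f -> S (a *: f).
Proof.
move=> Sf; rewrite /S (_ : _ \o _ = (fun y => a%:E * (EFin \o f) y))%E//.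
exact: integrableZl.
Qed.

Let IE f : S f -> (\int[mu]_y (f y)%:E = (I f)%:E)%E.
Proof. by move=> Sf; rewrite /I fineK//; exact: integrable_fin_num. Qed.

Let le_I f g : S f -> S g -> (forall y, f y <= g y) -> I f <= I g.
Proof.
move=> Sf Sg fg; rewrite -lee_fin -!IE//; apply: le_integral => // y _.
by rewrite lee_fin.
Qed.

Let ID f g : S f -> S g -> I (fun y => f y + g y) = I f + I g.
Proof.
move=> Sf Sg; apply: EFin_inj; rewrite EFinD -!IE//; last exact: SD.
exact: integralD_EFin.
Qed.

Let IZ (c : R) f : S f -> I (fun y => c * f y) = c * I f.
Proof.
move=> Sf; apply: EFin_inj; rewrite EFinM -!IE//; last exact: SZ.
by rewrite -integralZl.
Qed.

Let posD f g : S f -> S g -> pos (f + g) <= pos f + pos g.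
Proof.
move=> Sf Sg; rewrite -ID; [|exact: Smax|exact: Smax].
apply: le_I => [||y]; first by apply: Smax; exact: SD.
  by apply: SD; exact: Smax.
by rewrite ge_max; apply/andP; split; rewrite ?lerD ?addr_ge0// ?le_max ?lexx ?orbT.
Qed.

Let posZ (a : R) f : 0 <= a -> S f -> pos (a *: f) = a * pos f.
Proof.
move=> a0 Sf; rewrite -IZ; last exact: Smax.
by congr I; apply/funext => y; rewrite maxr_pMr// mulr0.
Qed.

Let A f := [set q | exists2 g, exists2 c, G g c & q = pos (f + g) - c & True].

(** The largest sublinear functional one can hope for: a linear [l] lies below [p] exactly when
    [l <= pos] and [l] takes the prescribed values on [G]. The constraint thus becomes part of the
    bound. *)
Let p f := inf (A f).

Let A_mem f g c : G g c -> A f (pos (f + g) - c).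
Proof. by move=> Gg; exists g => //; exists c. Qed.

Let A0 f : A f !=set0.
Proof. by exists (pos (f + 0) - 0); exact: A_mem. Qed.

Let SN f : S f -> S (- f). Proof. by rewrite -scaleN1r; exact: SZ. Qed.

Let A_lb f : S f -> lbound (A f) (- pos (- f)).
Proof.
move=> Sf _ [g [c Gg ->] _].
have Sg := Gi Gg; have := Gpos Gg; rewrite IE; last exact: Smax.
rewrite lee_fin => cg.
have := posD (SD Sf Sg) (SN Sf); rewrite [f + g]addrC addrK => h.
have := le_trans cg h; move: (pos _) (pos _) => q1 q2; lra.
Qed.

Let p_le f q : S f -> A f q -> p f <= q.
Proof. by move=> Sf Aq; apply: ge_inf => //; exists (- pos (- f)); exact: A_lb. Qed.

Let le_p f b : (forall q, A f q -> b <= q) -> b <= p f.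
Proof. by move=> h; apply: lb_le_inf; [exact: A0|exact: h]. Qed.

Let p_sublinear : sublinear_on S p.
Proof.
have pZle (a : R) f : 0 < a -> S f -> p (a *: f) <= a * p f.
  move=> a0 Sf; rewrite -ler_pdivrMl//; apply: le_p => _ [g [c Gg ->] _].
  rewrite ler_pdivrMl// mulrBr -(posZ (ltW a0)); last by apply: SD => //; exact: Gi Gg.
  by rewrite scalerDr; apply: p_le; [exact: SZ|apply: A_mem; exact: GZ].
split=> [f g Sf Sg|a f].
  rewrite -lerBlDr; apply: le_p => _ [g1 [c1 Gg1 ->] _]; rewrite lerBlDr.
  rewrite -lerBlDl; apply: le_p => _ [g2 [c2 Gg2 ->] _]; rewrite lerBlDl.
  apply: (le_trans (p_le (SD Sf Sg) (A_mem _ (GD Gg1 Gg2)))).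
  have := posD (SD Sf (Gi Gg1)) (SD Sg (Gi Gg2)).
  have -> : f + g1 + (g + g2) = f + g + (g1 + g2) by rewrite addrACA.
  by move: (pos _) (pos _) (pos _) => q1 q2 q3; lra.
rewrite le_eqVlt => /predU1P[<- Sf|a0 Sf].
  have S0 : S 0 by exact: Gi G0.
  rewrite scale0r mul0r; apply/eqP; rewrite eq_le; apply/andP; split.
    have := p_le S0 (A_mem 0 G0); rewrite addr0 subr0 -(scale0r (0 : Y -> R)) posZ//.
    by rewrite mul0r scale0r.
  apply: le_p => _ [g [c Gg ->] _]; rewrite add0r subr_ge0.
  by have := Gpos Gg; rewrite IE ?lee_fin//; apply: Smax; exact: Gi Gg.
apply/eqP; rewrite eq_le pZle//= -ler_pdivlMl//.
have := pZle a^-1 (a *: f); rewrite invr_gt0 scalerA mulVf ?gt_eqF// scale1r.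
by apply=> //; exact: SZ.
Qed.

(** Taking [- g] in [p] with the pair [(g, c)] gives [l (- g) <= - c]. The same for the opposite
    pair yields [l g = c], and [l <= pos] makes [l] a measure below [mu]. *)
Lemma moment_domination : exists m1 : {measure set Y -> \bar R},
  (forall B, measurable B -> (m1 B <= mu B)%E) /\
  forall f c, G f c -> m1.-integrable setT (EFin \o f) /\ (\int[m1]_y (f y)%:E = c%:E)%E.
Proof.
have [l [lD lZ lp]] := hahn_banach_sublinear SD SZ p_sublinear.
have lI f : S f -> l f <= pos f.
  move=> Sf; apply: (le_trans (lp f Sf)); have := p_le Sf (A_mem f G0).
  by rewrite addr0 subr0.
have [m1 [m1mu m1P]] := dominated_functional_measure lD lZ lI.
exists m1; split=> // f c Gf; have Sf := Gi Gf; have [fi ->] := m1P f Sf; split=> //.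
have lge g e : G g e -> e <= l g.
  move=> Gg; have Sg := Gi Gg.
  have h := le_trans (lp _ (SN Sg)) (p_le (SN Sg) (A_mem (- g) Gg)).
  have p0 : pos 0 = 0 by rewrite -(scale0r (0 : Y -> R)) posZ ?mul0r//; exact: Gi G0.
  move: h; rewrite addNr p0 sub0r -scaleN1r lZ// mulN1r lerN2//.
congr (_%:E); apply/eqP; rewrite eq_le (lge _ _ Gf) andbT.
by have := lge _ _ (GZ (-1) Gf); rewrite lZ// !mulN1r lerN2.
Qed.

End moment_domination.

(** * Separability of a family of continuous paths *)

Section separable_paths.
Context (R : realType) (T : R) (E W : Type) (d : E -> E -> R) (P : nat -> E) (g : W -> R -> E).
Hypothesis dC : forall x y, d x y = d y x.
Hypothesis dD : forall x y z, d x z <= d x y + d y z.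
Hypothesis dP : forall x e, 0 < e -> exists n, d x (P n) < e.
Hypothesis gc : forall w x e, x \in `[0, T] -> 0 < e ->
  \forall y \near x, y \in `[0, T] -> d (g w x) (g w y) < e.

Let pt (i : nat) (x : R) : R := (Num.truncn (x * i.+1%:R))%:R / i.+1%:R.

Let pt_itv i x : 0 <= x -> pt i x <= x < pt i x + i.+1%:R^-1.
Proof.
move=> x0; have i0 : 0 < i.+1%:R :> R by rewrite ltr0n.
have := truncn_itv (mulr_ge0 x0 (ltW i0)).
by rewrite /pt -[X in _ + X]mul1r -mulrDl ler_pdivrMr// ltr_pdivlMr// natr1.
Qed.

Let pt_in i x : x \in `[0, T] -> pt i x \in `[0, T].
Proof.
rewrite !in_itv/= => /andP[x0 xT]; have /andP[h _] := pt_itv i x0.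
by rewrite (le_trans h xT) andbT divr_ge0.
Qed.

Let steps w e : 0 < e -> exists i, forall x, x \in `[0, T] -> d (g w (pt i x)) (g w x) < e.
Proof.
move=> e0; have := @segment_compact R 0 T => /compact_near_coveringP h.
have [x xT|i _ iP] := h nat \oo (fun i x => x \in `[0, T] -> d (g w (pt i x)) (g w x) < e) _.
  have e20 : 0 < e / 2 by rewrite divr_gt0.
  have /nbhs_ballP[dl /= dl0 dlP] := gc w xT e20.
  have dl20 : 0 < dl / 2 by rewrite divr_gt0.
  exists (ball x (dl / 2), [set i | i.+1%:R^-1 < dl / 2]).
    by split; [exact: nbhsx_ballx|have [m mP] := near_inv_succ_lt dl20; exists m].
  move=> [y i] /= [yx iS] yT.
  have y0 : 0 <= y by move: yT; rewrite in_itv => /andP[].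
  have /andP[p1 p2] := pt_itv i y0.
  apply: (le_lt_trans (dD _ (g w x) _)); rewrite [e]splitr ltrD//.
    rewrite dC; apply: dlP; last exact: pt_in.
    move: yx iS; rewrite /ball /= !ltr_distl; move: p1 p2; move: (pt i y) (_^-1) => q r.
    by move=> *; lra.
  apply: dlP => //; move: yx; rewrite /ball /= => h'; apply: lt_trans h' _.
  by rewrite ltr_pdivrMr// ltr_pMr// ltr1n.
by exists i => x xT; apply: (iP i) => //=.
Qed.

Let step (c : nat * seq nat) (x : R) : E := P (nth 0%N c.2 (Num.truncn (x * c.1.+1%:R))).

Let step_approx w e : 0 < e -> exists c, forall x, x \in `[0, T] -> d (g w x) (step c x) < e.
Proof.
move=> e0; have e20 : 0 < e / 2 by rewrite divr_gt0.
have [i iP] := steps w e20.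
have /choice[a aP] : forall k : nat, exists n, d (g w (k%:R / i.+1%:R)) (P n) < e / 2.
  by move=> k; exact: dP.
exists (i, mkseq a (Num.truncn (T * i.+1%:R)).+1) => x xT.
apply: (le_lt_trans (dD _ (g w (pt i x)) _)); rewrite [e]splitr ltrD//; first by rewrite dC iP.
rewrite /step /= nth_mkseq; first exact: aP.
rewrite ltnS; apply: le_truncn; rewrite ler_wpM2r//.
by move: xT; rewrite in_itv => /andP[].
Qed.

(** Step functions with values in the dense sequence form a countable family, uniformly dense by
    compactness of [[0, T]]. They are not in the family, so for each of them and each tolerance a
    path of the family close to it is chosen, when there is one. *)
Lemma separable_paths (w0 : W) : exists w_ : nat -> W, forall w e, 0 < e ->
  exists n, forall t, t \in `[0, T] -> d (g w t) (g (w_ n) t) < e.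
Proof.
pose good (c : nat * seq nat) (m : nat) w :=
  forall x, x \in `[0, T] -> d (g w x) (step c x) < m.+1%:R^-1.
have /choice[f fP] : forall cm : (nat * seq nat) * nat, exists w : W,
    (exists w', good cm.1 cm.2 w') -> good cm.1 cm.2 w.
  by move=> cm; have [[w' h]|h] := pselect (exists w', good cm.1 cm.2 w'); [exists w'|exists w0].
exists (fun n => if choice.unpickle n is Some cm then f cm else w0) => w e e0.
have e20 : 0 < e / 2 by rewrite divr_gt0.
have [m /(_ m (leqnn m)) me] := near_inv_succ_lt e20.
have m0 : 0 < m.+1%:R^-1 :> R by rewrite invr_gt0 ltr0n.
have [c cP] := step_approx w m0.
exists (choice.pickle (c, m)) => t tT; rewrite choice.pickleK.
have fg : good c m (f (c, m)) by apply: (fP (c, m)); exists w.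
apply: (le_lt_trans (dD _ (step c t) _)); rewrite [e]splitr ltrD//.
  exact: lt_trans (cP t tT) me.
by rewrite dC; exact: lt_trans (fg t tT) me.
Qed.

End separable_paths.

Lemma within_continuous_near {R : realType} {E : normedModType R} (a b : R) (f : R -> E) x e :
  {within `[a, b], continuous f} -> x \in `[a, b] -> 0 < e ->
  \forall y \near x, y \in `[a, b] -> `|f x - f y| < e.
Proof.
move=> cf xT e0; have := cf x; rewrite /continuous_at => /cvgrPdist_lt/(_ e e0).
by rewrite {1}/nbhs /= -nbhs_subspace_in.
Qed.

(** * Composition of kernels *)

Section composition_property.
Context {R : realType} {H : hilbertType R}.
Variables (D : set H) (zeta pi : probability (borel H) R) (kap : H -> probability (borel H) R).
Hypothesis mD : measurable (D : set (borel H)).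

(** Measurability of the inner integral is part of the property: it is not known in advance and has
    to be carried along sums and limits together with the identity. *)
Definition composes (f : H -> R) :=
  [/\ measurable_fun setT (f : borel H -> R), exists M : R, forall y, `|f y| <= M,
      measurable_fun (D : set (borel H)) (fun x : borel H => \int[kap x]_y f y)
    & (\int[zeta]_(x in D) (\int[kap x]_y f y)%:E = (\int[pi]_y f y)%:E)%E].

Let bounded_integrable (Q : probability (borel H) R) (E : set (borel H)) (f : H -> R) :
  measurable E -> measurable_fun E (f : borel H -> R) -> (exists M : R, forall y, E y -> `|f y| <= M) ->
  Q.-integrable E (EFin \o f).
Proof.
move=> mE mf [M fM]; apply: (@le_integrable _ _ _ Q E mE _ (cst M%:E)).
- exact/measurable_EFinP.
- by move=> y Ey; rewrite /= lee_fin (le_trans (fM y Ey))// ler_norm.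
- exact: finite_measure_integrable_cst.
Qed.

Let IE (Q : probability (borel H) R) (f : H -> R) : measurable_fun setT (f : borel H -> R) ->
  (exists M : R, forall y, `|f y| <= M) -> (\int[Q]_y (f y)%:E = (\int[Q]_y f y)%:E)%E.
Proof.
move=> mf [M fM]; rewrite /Rintegral fineK//; apply: integrable_fin_num => //.
by apply: bounded_integrable => //; exists M.
Qed.

Let I_bound (Q : probability (borel H) R) (f : H -> R) (M : R) : measurable_fun setT (f : borel H -> R) ->
  (forall y, `|f y| <= M) -> `|\int[Q]_y f y| <= M.
Proof.
move=> mf fM; rewrite -lee_fin.
have -> : `|\int[Q]_y f y|%:E = `|\int[Q]_y (f y)%:E|%E by rewrite IE//; exists M.
apply: (le_trans (le_abse_integral Q measurableT _)); first exact/measurable_EFinP.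
apply: (@le_trans _ _ (\int[Q]_y M%:E)%E).
  apply: ge0_le_integral => //.
  - by apply/measurable_EFinP; exact: measurableT_comp.
  - by move=> y _; rewrite lee_fin.
rewrite (_ : (\int[Q]_y M%:E)%E = M%:E)//.
transitivity (M%:E * Q setT)%E; first exact: integral_cst.
by rewrite probability_setT mule1.
Qed.

Let kap_integrable (f : H -> R) : composes f ->
  zeta.-integrable D (fun x => (\int[kap x]_y f y)%:E).
Proof.
move=> [mf [M fM] mk _]; apply: bounded_integrable => //; exists M => x _; exact: I_bound.
Qed.

Let RD (Q : probability (borel H) R) f g : composes f -> composes g ->
  \int[Q]_y (f y + g y) = \int[Q]_y f y + \int[Q]_y g y.
Proof.
move=> [mf [Mf fM] _ _] [mg [Mg gM] _ _]; rewrite RintegralD//.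
  by apply: bounded_integrable => //; exists Mf.
by apply: bounded_integrable => //; exists Mg.
Qed.

Let RZ (Q : probability (borel H) R) (c : R) f : composes f ->
  \int[Q]_y (c * f y) = c * \int[Q]_y f y.
Proof.
move=> [mf [Mf fM] _ _]; rewrite RintegralZl//.
by apply: bounded_integrable => //; exists Mf.
Qed.

Lemma composesD f g : composes f -> composes g -> composes (fun y => f y + g y).
Proof.
move=> cf cg; have [mf [Mf fM] kf ef] := cf; have [mg [Mg gM] kg eg] := cg; split.
- exact: measurable_funD.
- by exists (Mf + Mg) => y; rewrite (le_trans (ler_normD _ _))// lerD.
- by under eq_fun do rewrite RD//; exact: measurable_funD.
- under eq_integral do rewrite RD// EFinD.
  rewrite RD// integralD// ?ef ?eg ?EFinD//; exact: kap_integrable.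
Qed.

Lemma composesZ (c : R) f : composes f -> composes (fun y => c * f y).
Proof.
move=> cf; have [mf [Mf fM] kf ef] := cf; split.
- exact: measurable_funM.
- by exists (`|c| * Mf) => y; rewrite normrM ler_wpM2l.
- by under eq_fun do rewrite RZ//; exact: measurable_funM.
- under eq_integral do rewrite RZ// EFinM.
  by rewrite RZ// integralZl// ?ef ?EFinM//; exact: kap_integrable.
Qed.

Let Rcvg (Q : probability (borel H) R) (f_ : nat -> H -> R) (f : H -> R) :
  (forall n, measurable_fun setT (f_ n : borel H -> R)) ->
  (exists M : R, forall n y, `|f_ n y| <= M) -> (forall y, f_ n y @[n --> \oo] --> f y) ->
  (\int[Q]_y f_ n y) @[n --> \oo] --> \int[Q]_y f y.
Proof.
move=> mf_ [M fM] cf.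
have mf : measurable_fun setT (f : borel H -> R).
  by apply: (@measurable_fun_cvg _ (borel H) R setT f_) => // y _; exact: cf.
have fMl y : `|f y| <= M.
  have h : (fun n => `|f_ n y|) @ \oo --> `|f y| by exact: (cvg_norm (cf y)).
  rewrite -(cvg_lim _ h)//; apply: limr_le; first by apply/cvg_ex; exists `|f y|.
  by apply: nearW => n; exact: fM.
have c : (\int[Q]_y (f_ n y)%:E)%E @[n --> \oo] --> (\int[Q]_y (f y)%:E)%E.
  apply: (@dominated_cvg _ _ _ Q setT measurableT (fun n y => (f_ n y)%:E) _ (fun=> M%:E)) => //.
  - by move=> n; exact/measurable_EFinP.
  - by move=> y _; apply: cvg_EFin; [exact: nearW|exact: cf].
  - exact: finite_measure_integrable_cst.
  - by move=> n y _; rewrite /= lee_fin.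
apply: fine_cvg; rewrite -/(Rintegral Q setT f) -IE//; by exists M.
Qed.

Lemma composes_lim (f_ : nat -> H -> R) f : (forall n, composes (f_ n)) ->
  (exists M : R, forall n y, `|f_ n y| <= M) -> (forall y, f_ n y @[n --> \oo] --> f y) ->
  composes f.
Proof.
move=> cf_ [M fM] cf.
have mf_ n : measurable_fun setT (f_ n : borel H -> R) by case: (cf_ n).
have fMl y : `|f y| <= M.
  have h : (fun n => `|f_ n y|) @ \oo --> `|f y| by exact: (cvg_norm (cf y)).
  rewrite -(cvg_lim _ h)//; apply: limr_le; first by apply/cvg_ex; exists `|f y|.
  by apply: nearW => n; exact: fM.
have kc (Q : probability (borel H) R) : (\int[Q]_y f_ n y) @[n --> \oo] --> \int[Q]_y f y.
  by apply: Rcvg => //; exists M.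
have mk n : measurable_fun (D : set (borel H)) (fun x : borel H => \int[kap x]_y f_ n y).
  by case: (cf_ n).
split.
- by apply: (@measurable_fun_cvg _ (borel H) R setT f_) => // y _; exact: cf.
- by exists M.
- by apply: (@measurable_fun_cvg _ (borel H) R D (fun n x => \int[kap x]_y f_ n y)) => // x _; exact: kc.
- have c1 : (\int[zeta]_(x in D) (\int[kap x]_y f_ n y)%:E)%E @[n --> \oo] -->
      (\int[zeta]_(x in D) (\int[kap x]_y f y)%:E)%E.
    apply: (@dominated_cvg _ _ _ zeta D mD (fun n x => (\int[kap x]_y f_ n y)%:E) _ (fun=> M%:E)) => //.
    - by move=> n; exact/measurable_EFinP.
    - by move=> x _; apply: cvg_EFin; [exact: nearW|exact: kc].
    - exact: finite_measure_integrable_cst.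
    - by move=> n x _; rewrite /= lee_fin; exact: I_bound.
  have c2 : (\int[zeta]_(x in D) (\int[kap x]_y f_ n y)%:E)%E @[n --> \oo] --> (\int[pi]_y f y)%:E.
    rewrite (_ : (fun n => _) = (fun n => (\int[pi]_y f_ n y)%:E)); last first.
      by apply/funext => n; case: (cf_ n).
    by apply: cvg_EFin; [exact: nearW|exact: kc].
  exact: (cvg_unique _ c1 c2).
Qed.

Hypothesis sH : separable H.

Lemma continuous_cos_dotp (h : H) (th : R) : continuous (fun y : H => cos (dotp y h + th)).
Proof.
move=> y; apply: continuous_comp; last exact: continuous_cos.
by apply: cvgD; [exact: continuous_dotpl|exact: cvg_cst].
Qed.

Lemma composes_of_trig : (forall h th, composes (fun y => cos (dotp y h + th))) ->
  forall f : borel H -> R, measurable_fun setT f -> (exists M : R, forall y, `|f y| <= M) -> composes f.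
Proof.
move=> ct; apply: (@trig_monotone_class R _ (borel H) composes [set l | exists h, l = dotp ^~ h]).
- exact: composesD.
- exact: composesZ.
- exact: composes_lim.
- by move=> l l' [h ->] [h' ->]; exists (h + h'); apply/funext => y; rewrite dotpDr.
- by move=> c l [h ->]; exists (c *: h); apply/funext => y; rewrite dotpZr.
- by exists 0; apply/funext => y; rewrite dotp0r.
- by move=> l th [h ->]; exact: ct.
- move=> E mE; have := borel_half_spaces sH mE; apply: sub_sigma_algebra2 => _ [h [a ->]].
  by exists (dotp ^~ h), a; split=> //; exists h.
Qed.

Lemma composes_trig_dense (DA : set H) : dense DA ->
  (forall h th, DA h -> composes (fun y => cos (dotp y h + th))) ->
  forall h th, composes (fun y => cos (dotp y h + th)).
Proof.
move=> dDA ct h th.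
have /choice[k kP] : forall n : nat, exists h', DA h' /\ `|h - h'| < n.+1%:R^-1.
  move=> n; have n0 : 0 < n.+1%:R^-1 :> R by rewrite invr_gt0 ltr0n.
  have [h' [h'b Dh']] := dDA (ball h n.+1%:R^-1) (ex_intro _ h (ballxx h n0)) (ball_open h _).
  by exists h'; split=> //; move: h'b; rewrite -ball_normE.
have kh : k @ \oo --> h.
  apply/cvgrPdist_lt => e e0; have [m mP] := near_inv_succ_lt e0.
  by exists m => // n mn; apply: lt_trans (kP n).2 (mP n mn).
apply: (composes_lim (f_ := fun n y => cos (dotp y (k n) + th))).
- by move=> n; apply: ct; case: (kP n).
- by exists 1 => n y; rewrite ler_norml cos_geN1 cos_le1.
- move=> y; apply: (@cvg_comp _ _ _ (fun n => dotp y (k n) + th) cos); last exact: continuous_cos.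
  by apply: cvgD; [apply: cvg_dotp => //; exact: cvg_cst|exact: cvg_cst].
Qed.

End composition_property.

Lemma ae_imply {R : realType} d (X : measurableType d) (mu : {measure set X -> \bar R})
    (P Q : X -> Prop) :
  {ae mu, forall x, P x} -> (forall x, P x -> Q x) -> {ae mu, forall x, Q x}.
Proof. by move=> aP PQ; exact: filterS PQ aP. Qed.

Lemma ae_imply2 {R : realType} d (X : measurableType d) (mu : {measure set X -> \bar R})
    (P Q S : X -> Prop) :
  {ae mu, forall x, P x} -> {ae mu, forall x, Q x} -> (forall x, P x -> Q x -> S x) ->
  {ae mu, forall x, S x}.
Proof. by move=> aP aQ PQS; exact: filterS2 PQS aP aQ. Qed.

(** * The equation integrated in time *)

Lemma measurable_comp_in d1 d2 d3 (X1 : measurableType d1) (X2 : measurableType d2)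
    (X3 : measurableType d3) (D : set X1) (E : set X2) (f : X1 -> X2) (g : X2 -> X3) :
  measurable E -> (forall x, D x -> E (f x)) -> measurable_fun E g -> measurable_fun D f ->
  measurable_fun D (fun x => g (f x)).
Proof.
move=> mE DE mg mf mD B mB.
have -> : D `&` (fun x => g (f x)) @^-1` B = D `&` f @^-1` (E `&` g @^-1` B).
  by apply/seteqP; split=> x [Dx gB]; split=> //; [split=> //; exact: DE|case: gB].
by apply: mf => //; exact: mg.
Qed.

Lemma integrable_fine_ae {R : realType} d (X : measurableType d) (mu : {measure set X -> \bar R})
    (D : set X) (g : X -> \bar R) : measurable D -> mu.-integrable D g ->
  exists2 b : X -> R, mu.-integrable D (EFin \o b) & {ae mu, forall x, D x -> g x = (b x)%:E}.
Proof.
move=> mD gi; exists (fine \o g); last first.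
  by apply: filterS (integrable_ae mD gi) => x h Dx; rewrite /= fineK// h.
have /integrableP[mg _] := gi.
apply: (le_integrable mD _ _ gi).
  by apply/measurable_EFinP; apply: measurableT_comp mg.
move=> x Dx; rewrite /=; by case: (g x) => [r| |] //=; rewrite normr0 leey.
Qed.

Section disintegration_integrals.
Context {R : realType} {H : hilbertType R}.
Variables (T s : R) (N : {finite_measure set (borel_prod R H) -> \bar R}).
Variable nu : R -> probability (borel H) R.
Hypothesis dN : disintegration T s N nu.

Let mpair (t : R) : measurable_fun setT (pair t : borel H -> borel_prod R H).
Proof. exact: pair1_measurable. Qed.

Let slice_ex : exists k : measurableTypeR R -> {measure set (borel_prod R H) -> \bar R},
  forall t B, k t B = nu t (pair t @^-1` B).
Proof.
have /choice[k kP] : forall t : measurableTypeR R,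
    exists nut : {measure set (borel_prod R H) -> \bar R},
    forall B, nut B = nu t (pair t @^-1` B).
  by move=> t; exact: pushforward_ex.
by exists k.
Qed.

(** [N] is the mixture over [t] of the images of [nu t] under [y |-> (t, y)]; the results on
    mixtures then give Fubini's theorem for disintegrations. *)
Let mE_ex : exists k : measurableTypeR R -> {measure set (borel_prod R H) -> \bar R},
  [/\ forall E, measurable E -> measurable_fun `[s, T]%classic (fun t => k t E),
      forall E, measurable E -> N E = (\int[lebesgue_measure]_(t in `[s, T]) k t E)%E,
      forall t (f : borel_prod R H -> \bar R), measurable_fun setT f -> (forall z, 0 <= f z)%E ->
        (\int[k t]_z f z = \int[nu t]_y f (t, y))%E
    & forall t (f : borel_prod R H -> R), measurable_fun setT f ->
        (k t).-integrable setT (EFin \o f) ->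
        (nu t).-integrable setT (fun y => (f (t, y))%:E) /\
        (\int[k t]_z (f z)%:E = \int[nu t]_y (f (t, y))%:E)%E].
Proof.
have [k kP] := slice_ex; exists k.
have kx t E : k t E = nu t (xsection E t).
  by rewrite kP; congr (nu t _); apply/seteqP; split=> y; [move=> Ey; exact: mem_set|move/set_mem].
have [mnu NE] := dN.
have ge0 t (f : borel_prod R H -> \bar R) : measurable_fun setT f -> (forall z, 0 <= f z)%E ->
    (\int[k t]_z f z = \int[nu t]_y f (t, y))%E.
  move=> mf f0; rewrite (eq_measure_integral (pushforward (nu t) (pair t))) => [|B mB _]; last exact: kP.
  by rewrite ge0_integral_pushforward// preimage_setT.
split=> //.
- move=> E mE; rewrite (_ : (fun t => k t E) = (fun t => nu t (xsection E t))); last by apply/funext.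
  exact: measurable_fun_xsection_prob.
- by move=> E mE; rewrite NE//; apply: eq_integral => t _; rewrite kx.
- move=> t f mf fi; have mf' : measurable_fun setT (EFin \o f) by exact/measurable_EFinP.
  have fi' : (nu t).-integrable setT (fun y => (f (t, y))%:E).
    apply/integrableP; split.
      exact: (measurableT_comp mf' (mpair t)).
    have /integrableP[_] := fi; rewrite ge0//; first exact: measurableT_comp.
  split=> //.
  rewrite (eq_measure_integral (pushforward (nu t) (pair t))) => [|B mB _]; last exact: kP.
  by rewrite integral_pushforward// preimage_setT.
Qed.

Lemma ge0_disintegration_integral (f : borel_prod R H -> \bar R) :
  measurable_fun setT f -> (forall z, 0 <= f z)%E ->
  (\int[N]_z f z = \int[lebesgue_measure]_(t in `[s, T]) \int[nu t]_y f (t, y))%E.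
Proof.
move=> mf f0; have [k [mk NE kge kint]] := mE_ex.
rewrite (@ge0_mixture_integral R _ _ (measurableTypeR R) (borel_prod R H) lebesgue_measure _ (measurable_itv _) k mk N f NE)//.
by apply: eq_integral => t _; exact: kge.
Qed.

Lemma disintegration_integral (f : borel_prod R H -> R) :
  N.-integrable setT (EFin \o f) ->
  [/\ {ae lebesgue_measure, forall t, t \in `[s, T] ->
        (nu t).-integrable setT (fun y => (f (t, y))%:E)},
      exists2 b : R -> R, lebesgue_measure.-integrable `[s, T] (EFin \o b) &
        {ae lebesgue_measure, forall t, t \in `[s, T] ->
          (\int[nu t]_y (f (t, y))%:E = (b t)%:E)%E}
    & (\int[N]_z (f z)%:E = \int[lebesgue_measure]_(t in `[s, T]) \int[nu t]_y (f (t, y))%:E)%E].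
Proof.
move=> fi; have [k [mk NE kge kint]] := mE_ex.
have mf : measurable_fun setT f by case/integrableP: fi => /measurable_EFinP.
have [ae1 int1 e1] := @mixture_integral R _ _ (measurableTypeR R) (borel_prod R H) lebesgue_measure _ (measurable_itv _) k mk N f NE fi.
have ae2 : {ae lebesgue_measure, forall t, t \in `[s, T] ->
    (\int[k t]_z (f z)%:E = \int[nu t]_y (f (t, y))%:E)%E}.
  by apply: filterS ae1 => t h tT; have [] := kint t f mf (h tT).
split.
- by apply: filterS ae1 => t h tT; have [] := kint t f mf (h tT).
- have [b bi bE] := @integrable_fine_ae R _ (measurableTypeR R) lebesgue_measure _ _ (measurable_itv _) int1.
  exists b => //; apply: ae_imply2 ae2 bE _ => t h1 h2 tT.
  by rewrite -h1// -h2.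
- by rewrite e1; apply: integral_ae_congr; exact: ae2.
Qed.

End disintegration_integrals.

Section weak_form.
Context {R : realType} {H : hilbertType R}.
Variables (T : R) (DA : set H) (A C : H -> H) (DF : set (R * H)) (F : R -> H -> H).
Hypothesis sH : separable H.
Hypothesis T0 : 0 < T.
Hypothesis DFc : DF `<=` cylinder T.
Hypothesis mDF : measurable (DF : set (borel_prod R H)).
Hypothesis mF : measurable_fun (DF : set (borel_prod R H)) (fun z => F z.1 z.2 : borel H).

Let Y : measurableType _ := borel_prod R H.

(** Outside [DF] the values of [F] are arbitrary and possibly not measurable. Extension by [0] gives
    a function measurable on the whole product. *)
Definition lift (g : R -> H -> R) (z : borel_prod R H) : R :=
  if z \in DF then g z.1 z.2 else 0.

Lemma measurable_extend d' (Z : measurableType d') (g : borel_prod R H -> Z) (c : Z) :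
  measurable_fun (DF : set (borel_prod R H)) g ->
  measurable_fun setT (fun z : borel_prod R H => if z \in DF then g z else c).
Proof.
move=> mg _ B mB; rewrite setTI.
have -> : (fun z : borel_prod R H => if z \in DF then g z else c) @^-1` B =
    (DF `&` g @^-1` B) `|` (if `[< B c >] then ~` DF else set0).
  apply/seteqP; split=> z /=.
    case: ifPn => [/set_mem Dz Bz|/negP zD B0]; first by left.
    by right; rewrite asboolT// => Dz; apply: zD; exact: mem_set.
  move=> [[Dz Bz]|]; first by rewrite mem_set.
  by case: ifPn => // /asboolP B0 zD; rewrite memNset.
apply: measurableU; first exact: mg.
by case: ifP => _; [exact: measurableC|exact: measurable0].
Qed.

Lemma measurable_lift (g : R -> H -> R) :
  measurable_fun (DF : set (borel_prod R H)) (fun z => g z.1 z.2) -> measurable_fun setT (lift g).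
Proof. exact: (@measurable_extend _ R). Qed.

Lemma lift_in g z : DF z -> lift g z = g z.1 z.2.
Proof. by move=> Dz; rewrite /lift mem_set. Qed.

Lemma within_continuous_bounded {E : normedModType R} (g : R -> E) :
  {within `[0, T], continuous g} -> exists2 c : R, 0 <= c & forall t, t \in `[0, T] -> `|g t| <= c.
Proof.
move=> cg; have cn : {within `[0, T], continuous (fun t => `|g t|)}.
  by move=> t; apply: cvg_norm; exact: cg.
have [c c01 cP] := EVT_max (ltW T0) cn.
by exists `|g c| => // t /cP.
Qed.

Hypothesis Cc : continuous C.

Let wave_bound w : wave_good T DA A w -> exists2 c : R, 0 <= c &
  forall t x, t \in `[0, T] -> `|wave_fun w t x| <= c /\
    `|wave_L C F w t x| <= c * (1 + `|x| + `|F t x|).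
Proof.
move=> [[ca cda _] _ hd [ch cdh _] [cah _ _]].
have cC : {within `[0, T], continuous (C \o wave_dir w)}.
  by move=> t; apply: (cvg_comp _ _ (ch t)); exact: Cc.
have [c1 c10 c1P] := within_continuous_bounded ca.
have [c2 c20 c2P] := within_continuous_bounded cda.
have [c3 c30 c3P] := within_continuous_bounded ch.
have [c4 c40 c4P] := within_continuous_bounded cdh.
have [c5 c50 c5P] := within_continuous_bounded cah.
have [c6 c60 c6P] := within_continuous_bounded cC.
have cos1 (z : R) : `|cos z| <= 1 by rewrite ler_norml cos_geN1 cos_le1.
have sin1 (z : R) : `|sin z| <= 1 by rewrite ler_norml sin_geN1 sin_le1.
exists (c1 + c2 + c1 * c4 + c1 * (c6 * c3) + c1 * c5 + c1 * c3).
  by rewrite !addr_ge0 ?mulr_ge0.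
move=> t x tT.
have [_ _ adirE] := hd t tT.
have x1 := c1P t tT; have x2 := c2P t tT; have x3 := c3P t tT.
have x4 := c4P t tT; have x5 := c5P t tT; have x6 := c6P t tT.
have n0 := normr_ge0 x; have f0 := normr_ge0 (F t x).
have b1 (p q z : R) c : `|p| <= c -> `|q| <= 1 -> `|p * q| <= c.
  move=> pc q1; rewrite normrM (le_trans (ler_wpM2l (normr_ge0 _) q1))// mulr1//.
split.
  apply: (le_trans (b1 _ _ 0 c1 x1 (cos1 _))); rewrite -!addrA lerDl !addr_ge0 ?mulr_ge0//.
have t1 := b1 _ _ 0 _ x2 (cos1 (wave_arg w t x)).
have t2 : `|wave_amp w t * dotp x (wave_ddir w t) * sin (wave_arg w t x)| <= c1 * (`|x| * c4).
  apply: (b1 _ _ 0 _ _ (sin1 _)); rewrite normrM ler_pM//.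
  by rewrite (le_trans (dotp_le _ _))// ler_wpM2l.
have t3 : `|2^-1 * wave_amp w t * dotp (C (wave_dir w t)) (wave_dir w t) * cos (wave_arg w t x)| <= 1 * c1 * (c6 * c3).
  apply: (b1 _ _ 0 _ _ (cos1 _)); rewrite !normrM ler_pM ?mulr_ge0//.
    by rewrite ler_pM// ger0_norm; lra.
  by rewrite (le_trans (dotp_le _ _))// ler_pM.
have t4 : `|wave_amp w t * (dotp x (wave_adir w t) + dotp (F t x) (wave_dir w t)) * sin (wave_arg w t x)| <= c1 * (`|x| * c5 + `|F t x| * c3).
  apply: (b1 _ _ 0 _ _ (sin1 _)); rewrite normrM ler_pM// (le_trans (ler_normD _ _))// lerD//.
    by rewrite (le_trans (dotp_le _ _))// adirE ler_wpM2l.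
  by rewrite (le_trans (dotp_le _ _))// ler_wpM2l.
rewrite /wave_L /wave_dt.
apply: (le_trans (ler_normB _ _)); apply: (le_trans (lerD (ler_normB _ _) (lexx _))).
apply: (le_trans (lerD (lerD (ler_normB _ _) (lexx _)) (lexx _))).
apply: (le_trans (lerD (lerD (lerD t1 t2) t3) t4)).
rewrite mul1r -subr_ge0.
set X := `|x| in n0 *; set Y' := `|F t x| in f0 *.
rewrite (_ : _ - _ = c1 + c1 * c4 + c1 * c5 + c1 * c3 + X * (c1 + c2 + c1 * (c6 * c3) + c1 * c3)
  + Y' * (c1 + c2 + c1 * c4 + c1 * (c6 * c3) + c1 * c5)); last by ring.
by rewrite !addr_ge0 ?mulr_ge0 ?addr_ge0 ?mulr_ge0.
Qed.

Lemma test_fun_bound u Lu Gu : test_fun T DA A C F u Lu Gu -> exists2 c : R, 0 <= c &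
  forall t x, t \in `[0, T] -> `|u t x| <= c /\ `|Lu t x| <= c * (1 + `|x| + `|F t x|).
Proof.
elim=> [|w u' Lu' Gu' gw _ [c c0 cP]].
  by exists 0 => // t x _; rewrite normr0 mul0r.
have [c' c'0 c'P] := wave_bound gw.
exists (c' + c) => [|t x tT]; first exact: addr_ge0.
have [a1 a2] := cP t x tT; have [b1 b2] := c'P t x tT; split.
  by rewrite (le_trans (ler_normD _ _))// lerD.
by rewrite mulrDl (le_trans (ler_normD _ _))// lerD.
Qed.

Let mcyl : measurable (cylinder T : set (borel_prod R H)).
Proof. by apply: measurableX => //; exact: measurable_itv. Qed.

Let fst_in (z : Y) : cylinder T z -> `[0, T]%classic z.1.
Proof. by case. Qed.

Let measurable_time (E : normedModType R) (h : R -> E) : {within `[0, T], continuous h} ->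
  measurable_fun (cylinder T : set (borel_prod R H)) (fun z => h z.1 : borel E).
Proof.
move=> ch; have mh := within_continuous_measurable ch.
have m1 : measurable_fun (cylinder T : set (borel_prod R H)) (fst : borel_prod R H -> measurableTypeR R).
  by apply: measurable_funTS; exact: measurable_fst.
have mI : measurable (`[0, T]%classic : set (measurableTypeR R)) by exact: measurable_itv.
exact: (@measurable_comp_in _ _ _ Y (measurableTypeR R) (borel E) _ _ _ h mI fst_in mh m1).
Qed.

Let measurable_timeR (h : R -> R) : {within `[0, T], continuous h} ->
  measurable_fun (cylinder T : set (borel_prod R H)) (fun z => h z.1 : measurableTypeR R).
Proof.
move=> ch; have mh := within_continuous_measurableR ch.
have m1 : measurable_fun (cylinder T : set (borel_prod R H)) (fst : borel_prod R H -> measurableTypeR R).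
  by apply: measurable_funTS; exact: measurable_fst.
have mI : measurable (`[0, T]%classic : set (measurableTypeR R)) by exact: measurable_itv.
exact: (@measurable_comp_in _ _ _ Y (measurableTypeR R) (measurableTypeR R) _ _ _ h mI fst_in mh m1).
Qed.

Let measurable_space D : measurable_fun (D : set (borel_prod R H)) (fun z => z.2 : borel H).
Proof. by apply: measurable_funTS; exact: measurable_snd. Qed.

Let wave_measurable w : wave_good T DA A w ->
  measurable_fun (cylinder T : set (borel_prod R H)) (fun z => wave_fun w z.1 z.2) /\
  measurable_fun (DF : set (borel_prod R H)) (fun z => wave_L C F w z.1 z.2).
Proof.
move=> [[ca cda _] _ hd [ch cdh _] [cah _ _]].
have cC : {within `[0, T], continuous (C \o wave_dir w)}.
  by move=> t; apply: (cvg_comp _ _ (ch t)); exact: Cc.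
have marg : measurable_fun (cylinder T : set (borel_prod R H)) (fun z => wave_arg w z.1 z.2 : measurableTypeR R).
  have h := measurable_dotp sH (@measurable_space (cylinder T)) (measurable_time ch).
  exact: (measurable_funD h (measurable_cst (wave_phase w))).
have mcos := measurableT_comp (continuous_measurable_fun (@continuous_cos R)) marg.
have msin := measurableT_comp (continuous_measurable_fun (@continuous_sin R)) marg.
have ma := measurable_timeR ca; have mda := measurable_timeR cda.
have mW := measurable_funM ma mcos.
split; first exact: mW.
have onDF (f : Y -> R) : measurable_fun (cylinder T : set Y) f -> measurable_fun (DF : set Y) f.
  by apply: measurable_funS.
have mdh := measurable_dotp sH (@measurable_space (cylinder T)) (measurable_time cdh).
have madir : measurable_fun (DF : set (borel_prod R H)) (fun z => dotp z.2 (wave_adir w z.1) : measurableTypeR R).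
  have h := measurable_dotp sH (@measurable_space DF) (measurable_funS mcyl DFc (measurable_time cah)).
  apply: (eq_measurable_fun _ _ h) => z /set_mem Dz.
  by have [_ _ ->] := hd z.1 (DFc Dz).1.
have mFd := measurable_dotp sH mF (measurable_funS mcyl DFc (measurable_time ch)).
have mCh := measurable_dotp sH (measurable_time cC) (measurable_time ch).
have p1 := onDF _ (measurable_funM mda mcos).
have p2 := onDF _ (measurable_funM (measurable_funM ma mdh) msin).
have p3 := onDF _ (measurable_funM (measurable_funM
  (measurable_funM (measurable_cst (2^-1 : R)) ma) mCh) mcos).
have p4 := measurable_funM (measurable_funM (onDF _ ma) (measurable_funD madir mFd)) (onDF _ msin).
exact: (measurable_funB (measurable_funB (measurable_funB p1 p2) p3) p4).
Qed.

Lemma test_fun_measurable u Lu Gu : test_fun T DA A C F u Lu Gu ->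
  measurable_fun (cylinder T : set (borel_prod R H)) (fun z => u z.1 z.2) /\
  measurable_fun (DF : set (borel_prod R H)) (fun z => Lu z.1 z.2).
Proof.
elim=> [|w u' Lu' Gu' gw _ [m1 m2]]; first by split; exact: measurable_cst.
by have [m3 m4] := wave_measurable gw; split; apply: measurable_funD.
Qed.

Lemma test_fun_section_measurable u Lu Gu t : test_fun T DA A C F u Lu Gu -> t \in `[0, T] ->
  measurable_fun setT (u t : borel H -> R).
Proof.
move=> tu tT; have [mu _] := test_fun_measurable tu.
have mp : measurable_fun setT (pair t : borel H -> borel_prod R H) by exact: pair1_measurable.
have mc : measurable (cylinder T : set (borel_prod R H)).
  by apply: measurableX => //; exact: measurable_itv.
have sub : (pair t : borel H -> borel_prod R H) @` setT `<=` cylinder T by move=> _ [y _ <-].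
exact: (measurable_comp mc sub mu mp).
Qed.

Lemma test_fun_final u Lu Gu : test_fun T DA A C F u Lu Gu -> forall x, u T x = 0.
Proof.
elim=> [//|w u' Lu' Gu' [_ wT _ _ _] _ ih] x.
by rewrite ih addr0 /wave_fun wT mul0r.
Qed.

(** The integrand of condition (ii) of the class plus [1]. It controls [1 + |x| + |F|], hence every
    [Lu], and being at least [1] it also controls the mass. *)
Definition theta t x := 1 + `|x| ^+ 2 + `|F t x| + `|x| ^+ 2 * `|F t x|.

Lemma theta_ge1 t x : 1 <= theta t x.
Proof. by rewrite /theta -!addrA lerDl !addr_ge0 ?mulr_ge0. Qed.

Lemma measurable_theta : measurable_fun setT (lift theta).
Proof.
apply: measurable_lift.
have mx : measurable_fun (DF : set (borel_prod R H)) (fun z => `|z.2| : measurableTypeR R).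
  apply: (@measurable_norm_borel _ _ _ Y).
  by apply: measurable_funTS; exact: measurable_snd.
have mFn : measurable_fun (DF : set (borel_prod R H)) (fun z => `|F z.1 z.2| : measurableTypeR R).
  exact: (@measurable_norm_borel _ _ _ Y).
have mx2 : measurable_fun (DF : set (borel_prod R H)) (fun z => `|z.2| ^+ 2 : measurableTypeR R).
  exact: measurable_funX.
apply: measurable_funD; last exact: measurable_funM.
apply: measurable_funD; last exact: mFn.
by apply: measurable_funD.
Qed.

Lemma lift_theta_ge0 z : 0 <= lift theta z.
Proof. by rewrite /lift; case: ifP => // _; rewrite (le_trans _ (theta_ge1 _ _)). Qed.

Lemma test_fun_theta u Lu Gu : test_fun T DA A C F u Lu Gu -> exists2 c : R, 0 <= c &
  forall z, `|lift Lu z| <= c * lift theta z.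
Proof.
move=> /test_fun_bound[c c0 cP]; exists (2 * c) => [|z]; first exact: mulr_ge0.
rewrite /lift; case: ifPn => [/set_mem Dz|_]; last by rewrite normr0 mulr0.
have [t01 _] := DFc Dz; have [_ h] := cP z.1 z.2 t01.
apply: (le_trans h); rewrite [2 * c]mulrC -mulrA ler_wpM2l// /theta.
have := normr_ge0 z.2; have := normr_ge0 (F z.1 z.2).
move: `|z.2| `|F z.1 z.2| => a b b0 a0.
by have := mulr_ge0 (sqr_ge0 a) b0; have := sqr_ge0 (a - 1); rewrite !expr2 => ? ?; nra.
Qed.

(* The conditions defining M_class, integrated in time up to T (where test
   functions vanish) and without reference to a disintegration. *)
Definition weak_sol (s : R) (x : H) (N : {measure set (borel_prod R H) -> \bar R}) :=
  [/\ N (~` (DF `&` (`[s, T]%classic `*` setT))) = 0%E,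
      (\int[N]_z (lift theta z)%:E < +oo)%E
    & forall u Lu Gu, test_fun T DA A C F u Lu Gu ->
        (\int[N]_z (lift Lu z)%:E = (- u s x)%:E)%E].

Lemma lift_integrable (N : {measure set (borel_prod R H) -> \bar R}) (g : R -> H -> R) (c : R) :
  (\int[N]_z (lift theta z)%:E < +oo)%E ->
  measurable_fun (DF : set (borel_prod R H)) (fun z => g z.1 z.2) ->
  (forall z, `|lift g z| <= c * lift theta z) -> N.-integrable setT (EFin \o lift g).
Proof.
move=> Noo mg cP.
have ti : N.-integrable setT (EFin \o lift theta).
  apply/integrableP; split; first by apply/measurable_EFinP; exact: measurable_theta.
  by under eq_integral do rewrite /= ger0_norm ?lift_theta_ge0//.
apply: (@le_integrable _ _ _ _ _ _ _ (fun z => c%:E * (EFin \o lift theta) z)%E) => //.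
- by apply/measurable_EFinP; apply: measurable_lift.
- move=> z _; rewrite /= lee_fin (le_trans (cP z))//.
  by rewrite ler_norm.
- exact: integrableZl.
Qed.

Lemma test_fun_integrable (N : {measure set (borel_prod R H) -> \bar R}) u Lu Gu :
  (\int[N]_z (lift theta z)%:E < +oo)%E -> test_fun T DA A C F u Lu Gu ->
  N.-integrable setT (EFin \o lift Lu).
Proof.
move=> Noo tu; have [c c0 cP] := test_fun_theta tu.
by apply: (lift_integrable Noo _ cP); case: (test_fun_measurable tu).
Qed.

Lemma test_fun_integrable0 (N : {measure set (borel_prod R H) -> \bar R}) u Lu Gu :
  (\int[N]_z (lift theta z)%:E < +oo)%E -> test_fun T DA A C F u Lu Gu ->
  N.-integrable setT (EFin \o lift u).
Proof.
move=> Noo tu; have [c c0 cP] := test_fun_bound tu.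
apply: (@lift_integrable _ u c Noo).
  by have [mu _] := test_fun_measurable tu; exact: (measurable_funS mcyl DFc mu).
move=> z; rewrite /lift; case: ifPn => [/set_mem Dz|_]; last by rewrite normr0 mulr0.
have [h _] := cP z.1 z.2 (DFc Dz).1; apply: (le_trans h).
by rewrite ler_peMr// theta_ge1.
Qed.

Definition live_set s := DF `&` (`[s, T]%classic `*` setT).

Lemma measurable_live_set s : measurable (live_set s : set (borel_prod R H)).
Proof.
by apply: measurableI => //; apply: measurableX => //; exact: measurable_itv.
Qed.

Lemma measurable_slice t : measurable (slice DF t : set (borel H)).
Proof.
have -> : slice DF t = xsection (DF : set (borel_prod R H)) t.
  by apply/seteqP; split=> y; [move=> Dy; exact: mem_set|move/set_mem].
exact: measurable_xsection.
Qed.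

Lemma disintegration_slice s (N : {finite_measure set (borel_prod R H) -> \bar R})
    (nu : R -> probability (borel H) R) : disintegration T s N nu ->
  N (~` live_set s) = 0%E <-> {ae lebesgue_measure, forall t, t \in `[s, T] -> nu t (slice DF t) = 1%E}.
Proof.
move=> [mnu NE].
have xE t : t \in `[s, T] -> xsection (~` live_set s : set (borel_prod R H)) t = ~` slice DF t.
  move=> tT; apply/seteqP; split=> y.
    by move=> /set_mem /= h Dy; apply: h; split.
  by move=> Dy; apply: mem_set => -[].
have mf : measurable_fun (`[s, T]%classic : set (measurableTypeR R))
    (fun t => nu t (xsection (~` live_set s : set (borel_prod R H)) t)).
  by apply: measurable_fun_xsection_prob => //; apply: measurableC; exact: measurable_live_set.
have NDs : N (~` live_set s) = (\int[lebesgue_measure]_(t in `[s, T]) `|nu t (xsection (~` live_set s : set (borel_prod R H)) t)|)%E.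
  rewrite NE; last by apply: measurableC; exact: measurable_live_set.
  by apply: eq_integral => t _; rewrite gee0_abs.
have h := @ae_eq_integral_abs _ (measurableTypeR R) R lebesgue_measure _ (measurable_itv _) _ mf.
rewrite NDs; split.
  move=> /h; apply: filterS => t /= ht tT.
  have := ht tT; rewrite xE// => /eqP; rewrite (probability_setC _ (measurable_slice t)) sube_eq ?fin_num_measure//.
  by rewrite add0e => /eqP ->.
move=> ae1; apply/h; apply: ae_imply ae1 _ => t ht tT.
by rewrite xE// (probability_setC _ (measurable_slice t)) ht// subee.
Qed.

Lemma ae_neq (c : R) : {ae lebesgue_measure, forall t : R, t != c}.
Proof.
exists [set c]; split; [exact: measurable_set1|exact: lebesgue_measure_set1|].
by move=> t /= /negP; rewrite negbK => /eqP.
Qed.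

(** The operator and the expression [Lu] agree at interior times and on [DF]; the two endpoints and
    the complement of the slices are null. *)
Lemma ae_inner_L0 s (nu : R -> probability (borel H) R) u Lu Gu : dense DA -> linear C -> 0 <= s ->
  test_fun T DA A C F u Lu Gu ->
  {ae lebesgue_measure, forall t, t \in `[s, T] -> nu t (slice DF t) = 1%E} ->
  {ae lebesgue_measure, forall t, t \in `[s, T] ->
    (\int[nu t]_y (L0 DA A C F u t y)%:E = \int[nu t]_y (lift Lu (t, y))%:E)%E}.
Proof.
move=> dDA Cl s0 tu ae1.
apply: ae_imply2 (ae_imply2 (ae_neq 0) (ae_neq T) (fun t a b => conj a b)) ae1 _.
move=> t [t0 tT] sl tsT; have := sl tsT => st.
have t0T : t \in `]0, T[.
  move: tsT; rewrite !in_itv/= => /andP[st' tT']; rewrite !lt_neqAle tT tT' eq_sym t0.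
  by rewrite (le_trans s0).
apply: integral_ae_congr; exists (~` slice DF t); split.
- by apply: measurableC; exact: measurable_slice.
- have := probability_setC (nu t) (measurable_slice t); rewrite st subee// => h; exact: h.
- move=> y /= h Dy; apply: h => _.
  by rewrite lift_in// (test_fun_L0 dDA Cl _ sH tu t0T).
Qed.

Definition growth (z : borel_prod R H) : \bar R :=
  ((`|z.2| ^+ 2)%:E + normF DF F z.1 z.2 + (`|z.2| ^+ 2)%:E * normF DF F z.1 z.2)%E.

Lemma normF_ge0 t x : (0 <= normF DF F t x)%E.
Proof. by rewrite /normF; case: ifP => _; rewrite ?lee_fin. Qed.

Lemma growth_ge0 z : (0 <= growth z)%E.
Proof.
have x20 : (0 <= (`|z.2| ^+ 2)%:E :> \bar R)%E by rewrite lee_fin sqr_ge0.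
by rewrite !adde_ge0 ?mule_ge0 ?normF_ge0.
Qed.

Lemma measurable_growth : measurable_fun setT growth.
Proof.
have mnF : measurable_fun setT (fun z : Y => normF DF F z.1 z.2).
  have h : measurable_fun (DF : set Y) (fun z : Y => `|F z.1 z.2|%:E).
    by apply/measurable_EFinP; exact: (@measurable_norm_borel _ _ _ Y).
  rewrite (_ : (fun z : Y => normF DF F z.1 z.2) = (fun z : Y => if z \in DF then `|F z.1 z.2|%:E else +oo%E)).
    exact: measurable_extend.
  by apply/funext => -[t y].
have mx : measurable_fun setT (fun z : Y => (`|z.2| ^+ 2)%:E).
  apply/measurable_EFinP; apply: measurable_funX.
  by apply: (@measurable_norm_borel _ _ _ Y); exact: measurable_snd.
by apply: emeasurable_funD; [exact: emeasurable_funD|exact: emeasurable_funM].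
Qed.

Lemma growth_in z : DF z -> (1 + growth z = (lift theta z)%:E)%E.
Proof.
move=> Dz; rewrite lift_in// /growth /normF -surjective_pairing mem_set//.
by rewrite /theta -EFinM -!EFinD !addrA.
Qed.

(** The equation is used at the single time [T], where test functions vanish, so that only [N]
    remains. The disintegration inside [M_class] may differ from [nu]; information passes from one
    to the other through [N]. *)
Lemma weak_sol_of_FP s x (N : {finite_measure set (borel_prod R H) -> \bar R})
    (nu : R -> probability (borel H) R) :
  dense DA -> linear C -> 0 <= s < T ->
  disintegration T s N nu -> M_class T DA A C DF F s (dirac (x : borel H)) N ->
  (forall u, D_L0 T DA A u -> FP_at DA A C F s (dirac (x : borel H)) nu u T) ->
  weak_sol s x N.
Proof.
move=> dDA Cl s0T dN [nu' [dN' ae' int' _]] FP.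
have N0 : N (~` live_set s) = 0%E by exact/(disintegration_slice dN').
have thetaoo : (\int[N]_z (lift theta z)%:E < +oo)%E.
  have Goo : (\int[N]_z growth z < +oo)%E.
    by rewrite (ge0_disintegration_integral dN' measurable_growth growth_ge0).
  have mG := measurable_growth; have G0 := growth_ge0.
  apply: (@le_lt_trans _ _ (\int[N]_z (1 + growth z))%E); last first.
    rewrite ge0_integralD// integral_cst// mul1e lte_add_pinfty//.
    by rewrite -ge0_fin_numE// fin_num_measure.
  apply: ge0_le_integral => //.
  - by move=> z _; rewrite lee_fin lift_theta_ge0.
  - by apply/measurable_EFinP; exact: measurable_theta.
  - by apply: emeasurable_funD.
  - move=> z _; have [Dz|nDz] := boolP (z \in DF).
      by rewrite growth_in//; exact: set_mem.
    by rewrite /lift (negbTE nDz) adde_ge0.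
split=> // u Lu Gu tu.
have aenu : {ae lebesgue_measure, forall t, t \in `[s, T] -> nu t (slice DF t) = 1%E}.
  exact/(disintegration_slice dN).
have := FP u (test_fun_D_L0 tu); rewrite /FP_at.
have -> : (\int[nu T]_y (u T y)%:E = 0)%E.
  by under eq_integral do rewrite (test_fun_final tu); rewrite integral0.
have s01 : s \in `[0, T] by case/andP: s0T => s0 sT; rewrite in_itv/= s0 ltW.
rewrite integral_dirac//; last by apply/measurable_EFinP; exact: (test_fun_section_measurable tu s01).
rewrite diracT mul1e.
have Ni := test_fun_integrable thetaoo tu.
have [_ _ NE] := disintegration_integral dN Ni.
have -> : (\int[lebesgue_measure]_(r in `[s, T]) \int[nu r]_y (L0 DA A C F u r y)%:E =
    \int[N]_z (lift Lu z)%:E)%E.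
  rewrite NE; apply: integral_ae_congr; apply: (ae_inner_L0 dDA Cl _ tu aenu).
  by case/andP: s0T.
have := integrable_fin_num measurableT Ni.
case: (\int[N]_z _)%E => //= r _ /eqP; rewrite -EFinD eqe => /eqP h.
by congr (_%:E); apply/eqP; rewrite -subr_eq0 opprK addrC -h.
Qed.

Lemma cvg_norm_le (u : nat -> R) (l M : R) : u @ \oo --> l -> (forall n, `|u n| <= M) -> `|l| <= M.
Proof.
move=> ul uM; have h : (fun n => `|u n|) @ \oo --> `|l| by exact: cvg_norm.
rewrite -(cvg_lim _ h)//; apply: limr_le; first by apply/cvg_ex; exists `|l|.
exact: nearW.
Qed.

Lemma cos_primitive (a th : R) :
  exists phi : R -> R, forall t : R, is_derive t 1 phi (cos (a * t + th)).
Proof.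
have hl t : is_derive (t : R) 1 (fun t => a * t + th) a.
  have := is_deriveD (is_deriveM (is_derive_cst a t (1 : R)) (is_derive_id t (1 : R))) (is_derive_cst th t (1 : R)).
  by rewrite [X in is_derive _ _ _ X](_ : _ = a)// scaler0 !addr0 /GRing.scale /= mulr1.
have [a0|a0] := eqVneq a 0.
  exists (fun t => cos th * t) => t.
  have := is_deriveM (is_derive_cst (cos th) t (1 : R)) (is_derive_id t (1 : R)).
  by rewrite [X in is_derive _ _ _ X](_ : _ = cos (a * t + th))// scaler0 addr0 a0 mul0r add0r /GRing.scale /= mulr1.
exists (fun t => a^-1 * sin (a * t + th)) => t.
have h := @is_derive1_comp _ sin (fun t => a * t + th) t _ _ (is_derive_sin _) (hl t).
have := is_deriveM (is_derive_cst a^-1 t (1 : R)) h.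
rewrite [X in is_derive _ _ _ X](_ : _ = cos (a * t + th))//.
by rewrite scaler0 addr0 /GRing.scale /= mulrC mulfK.
Qed.

Lemma is_derive_C1_with (phi dphi : R -> R) : continuous dphi ->
  (forall t : R, is_derive t 1 phi (dphi t)) -> C1_with T (phi : R -> R^o) (dphi : R -> R^o).
Proof.
move=> cd pd; split=> //; apply: continuous_subspaceT => // t.
by apply: differentiable_continuous; apply/derivable1_diffP; have [] := pd t.
Qed.

Lemma integral_derive (phi dphi : R -> R) (a b : R) : a < b -> continuous dphi ->
  (forall t : R, is_derive t 1 phi (dphi t)) ->
  (\int[lebesgue_measure]_(t in `[a, b]) (dphi t)%:E = (phi b - phi a)%:E)%E.
Proof.
move=> ab cd pd.
have cp : continuous phi.
  by move=> t; apply: differentiable_continuous; apply/derivable1_diffP; have [] := pd t.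
rewrite (@continuous_FTC2 _ dphi phi)// ?EFinB//.
- exact: continuous_subspaceT.
- split.
  + by move=> t _; have [] := pd t.
  + by apply: cvg_at_right_filter; exact: cp.
  + by apply: cvg_at_left_filter; exact: cp.
- by move=> t _; rewrite derive1E; have [_ ->] := pd t.
Qed.

Lemma continuous_cos_affine (a th : R) : continuous (fun t => cos (a * t + th)).
Proof.
move=> t; apply: continuous_comp; last exact: continuous_cos.
by apply: cvgD; [apply: cvgM; [exact: cvg_cst|exact: cvg_id]|exact: cvg_cst].
Qed.

Hypothesis dDA : dense DA.
Hypothesis Cl : linear C.

(* h = 0: a function of time alone is a test function. *)
Lemma test_fun_time (chi dchi : R -> R) : continuous dchi ->
  (forall t : R, is_derive t 1 chi (dchi t)) ->
  test_fun T DA A C F (fun t _ => chi t - chi T) (fun t _ => dchi t) (fun _ _ => 0).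
Proof.
move=> cd pd.
have z0 t : {within `[0, T], continuous (fun _ : R => (0 : H))} by exact: cst_continuous.
have adj0 : adj DA A 0 = 0 by apply: (adj_unique dDA) => y _; rewrite !dotp0r.
have c0 : C1_with T (fun _ : R => (0 : H)) (fun _ => 0).
  split; [by apply: continuous_subspaceT; exact: cst_continuous..|].
  by move=> t _; exact: is_derive_cst.
pose w := Wave (fun t => chi t - chi T) dchi (fun=> 0 : H) (fun=> 0) (fun=> 0) 0.
have gw : wave_good T DA A w.
  split=> /=.
  - apply: is_derive_C1_with => // t; have := is_deriveB (pd t) (is_derive_cst (chi T) t (1 : R)).
    by rewrite subr0.
  - by rewrite subrr.
  - move=> t _; split; [by exists 0 => y _; rewrite !dotp0r..|].
    by rewrite adj0.
  - exact: c0.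
  - by apply: (C1_with_eq _ _ c0) => t _ /=; rewrite adj0.
have := test_fun_wave C F gw; congr test_fun; apply/funext => t; apply/funext => x.
- by rewrite /wave_fun /wave_arg /= dotp0r addr0 cos0 mulr1.
- by rewrite /wave_L /wave_dt /wave_arg /= !dotp0r !addr0 cos0 sin0; ring.
- by rewrite /wave_grad /= scaler0.
Qed.

Lemma test_fun_timeM (chi dchi : R -> R) u Lu Gu : continuous dchi ->
  (forall t : R, is_derive t 1 chi (dchi t)) -> test_fun T DA A C F u Lu Gu ->
  test_fun T DA A C F (fun t x => chi t * u t x) (fun t x => dchi t * u t x + chi t * Lu t x)
    (fun t x => chi t *: Gu t x).
Proof.
move=> cd pd; elim=> [|w u' Lu' Gu' gw _ ih].
  have := test_fun0 T DA A C F; congr test_fun; apply/funext => t; apply/funext => x.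
  - by rewrite mulr0.
  - by rewrite !mulr0 addr0.
  - by rewrite scaler0.
have [a z d h k] := gw.
pose w' := Wave (fun t => chi t * wave_amp w t)
  (fun t => dchi t * wave_amp w t + chi t * wave_damp w t) (wave_dir w) (wave_ddir w)
  (wave_adir w) (wave_phase w).
have gw' : wave_good T DA A w'.
  split=> //=; last by rewrite z mulr0.
  by apply: C1_withM => //; exact: is_derive_C1_with.
have := test_fun_cons gw' ih; congr test_fun; apply/funext => t; apply/funext => x.
- by rewrite /wave_fun /wave_arg /=; ring.
- by rewrite /wave_L /wave_dt /wave_fun /wave_arg /=; ring.
- by rewrite /wave_grad /wave_arg /= scalerDr scalerA mulrN mulrA.
Qed.

Lemma integral_lift (N : {measure set (borel_prod R H) -> \bar R}) s (g : R -> H -> R) :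
  N (~` live_set s) = 0%E -> (\int[N]_z (lift g z)%:E = \int[N]_z (g z.1 z.2)%:E)%E.
Proof.
move=> N0; apply: integral_ae_congr; exists (~` live_set s); split=> //.
  by apply: measurableC; exact: measurable_live_set.
by move=> z /= h [Dz _]; apply: h => _; rewrite lift_in.
Qed.

Lemma weak_sol_finite s x (N : {measure set (borel_prod R H) -> \bar R}) :
  weak_sol s x N -> (N setT < +oo)%E.
Proof.
move=> [N0 Noo _]; apply: le_lt_trans Noo.
rewrite -(mul1e (N setT)) -integral_cst//.
have -> : (\int[N]_z cst 1 z = \int[N]_z (lift (fun _ _ => 1) z)%:E)%E.
  by rewrite (integral_lift _ N0).
apply: ge0_le_integral => //.
- by move=> z _; rewrite lee_fin /lift; case: ifP.
- by apply/measurable_EFinP; apply: measurable_lift; exact: measurable_cst.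
- by apply/measurable_EFinP; exact: measurable_theta.
- by move=> z _; rewrite lee_fin /lift; case: ifP => // _; exact: theta_ge1.
Qed.

(** Test functions of time alone have arbitrary trigonometric functions as time derivative. They
    determine the time marginal, which must be Lebesgue measure on [[s, T]]. *)
Lemma weak_sol_marginal s x (N : {measure set (borel_prod R H) -> \bar R}) : 0 <= s < T ->
  weak_sol s x N -> forall B : set (measurableTypeR R), measurable B ->
  N (B `*` setT) = lebesgue_measure (B `&` `[s, T]).
Proof.
move=> /andP[s0 sT] wN; have [N0 Noo Nt] := wN; have Nfin := weak_sol_finite wN.
pose D : set (measurableTypeR R) := `[s, T]%classic.
have mD : measurable D by exact: measurable_itv.
have D0 : (lebesgue_measure D < +oo)%E.
  by rewrite /D lebesgue_measure_itv /= lte_fin sT -EFinB ltry.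
pose P (f : measurableTypeR R -> R) := [/\ measurable_fun setT f, exists M : R, forall t, `|f t| <= M
  & (\int[N]_z (f z.1)%:E = \int[lebesgue_measure]_(t in `[s, T]) (f t)%:E)%E].
have mfst (f : measurableTypeR R -> R) : measurable_fun setT f -> measurable_fun setT (fun z : Y => f z.1).
  by move=> mf; exact: (measurableT_comp mf measurable_fst).
have bnd d' (X : measurableType d') (mu : {measure set X -> \bar R}) (E : set X) (f : X -> R) :
    measurable E -> (mu E < +oo)%E -> measurable_fun setT f -> (exists M : R, forall t, `|f t| <= M) ->
    mu.-integrable E (EFin \o f).
  move=> mE Eoo mf [M fM]; apply: (@le_integrable _ _ _ mu E mE _ (cst M%:E)).
  - by apply/measurable_EFinP; exact: measurable_funTS.
  - by move=> t _; rewrite /= lee_fin (le_trans (fM t))// ler_norm.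
  - apply/integrableP; split; first exact: measurable_cst.
    by under eq_integral do rewrite /=; rewrite integral_cst// lte_mul_pinfty ?lee_fin.
suff h : forall f : measurableTypeR R -> R, measurable_fun setT f ->
    (exists M : R, forall t, `|f t| <= M) -> P f.
  move=> B mB; have [||_ _] := h (\1_B); first exact: measurable_indic.
    by exists 1 => t; rewrite indicE; case: (_ \in _); rewrite ?normr1 ?normr0.
  rewrite [RHS]integral_indic// => <-.
  have mB2 : measurable (B `*` setT : set (borel_prod R H)) by exact: measurableX.
  transitivity (\int[N]_z (\1_(B `*` setT : set Y) z)%:E)%E; first by rewrite integral_indic// setIT.
  apply: eq_integral => z _; congr (_%:E).
  by rewrite !indicE; congr ((nat_of_bool _)%:R); apply/idP/idP => /set_mem h'; apply: mem_set; [case: h'|split].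
apply: (@trig_monotone_class R _ (measurableTypeR R) P [set f | exists a, f = fun t => a * t]).
- move=> f g [mf [Mf fM] ef] [mg [Mg gM] eg]; split.
  + exact: measurable_funD.
  + by exists (Mf + Mg) => t; rewrite (le_trans (ler_normD _ _))// lerD.
  + rewrite [LHS](@integralD_EFin _ _ _ N setT _ (fun z => f z.1) (fun z => g z.1))//; last 2 first.
    * by apply: bnd => //; [exact: mfst|exists Mf].
    * by apply: bnd => //; [exact: mfst|exists Mg].
    rewrite ef eg [RHS](@integralD_EFin _ _ _ lebesgue_measure D mD f g)//.
    * by apply: bnd => //; exists Mf.
    * by apply: bnd => //; exists Mg.
- move=> c f [mf [Mf fM] ef]; split.
  + exact: measurable_funM.
  + by exists (`|c| * Mf) => t; rewrite normrM ler_wpM2l.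
  + under eq_integral do rewrite EFinM; rewrite integralZl//; last first.
      by apply: bnd => //; [exact: mfst|exists Mf].
    rewrite ef; under [RHS]eq_integral do rewrite EFinM; rewrite [RHS]integralZl//.
    by apply: bnd => //; exists Mf.
- move=> f_ f Pf [M fM] cf; split.
  + by apply: (measurable_fun_cvg (h := f_)) => [n|t _]; [case: (Pf n)|exact: cf].
  + exists M => t; apply: (cvg_norm_le (cf t)) => n; exact: fM.
  + have ef_ n : (\int[N]_z (f_ n z.1)%:E = \int[lebesgue_measure]_(t in `[s, T]) (f_ n t)%:E)%E.
      by case: (Pf n).
    have mf_ n : measurable_fun setT (f_ n) by case: (Pf n).
    have iM d' (X : measurableType d') (mu : {measure set X -> \bar R}) (E : set X) :
        measurable E -> (mu E < +oo)%E -> mu.-integrable E (fun=> M%:E).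
      move=> mE Eoo; apply: (@bnd _ X mu E (fun=> M)) => //.
      by exists `|M|.
    have c1 : (\int[N]_z (f_ n z.1)%:E)%E @[n --> \oo] --> (\int[N]_z (f z.1)%:E)%E.
      apply: (@dominated_cvg _ _ _ N setT measurableT (fun n z => (f_ n z.1)%:E) _ (fun=> M%:E)) => //.
      - by move=> n; apply/measurable_EFinP; exact: mfst.
      - by move=> z _; apply: cvg_EFin; [exact: nearW|exact: cf].
      - exact: iM.
      - by move=> n z _; rewrite /= lee_fin.
    have c2 : (\int[lebesgue_measure]_(t in D) (f_ n t)%:E)%E @[n --> \oo] -->
        (\int[lebesgue_measure]_(t in D) (f t)%:E)%E.
      apply: (@dominated_cvg _ (measurableTypeR R) _ lebesgue_measure D mD (fun n t => (f_ n t)%:E) _ (fun=> M%:E)) => //.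
      - by move=> n; apply/measurable_EFinP; exact: measurable_funTS.
      - by move=> z _; apply: cvg_EFin; [exact: nearW|exact: cf].
      - exact: iM.
      - by move=> n z _; rewrite /= lee_fin.
    have c1' : (\int[lebesgue_measure]_(t in D) (f_ n t)%:E)%E @[n --> \oo] --> (\int[N]_z (f z.1)%:E)%E.
      rewrite (_ : (fun n => _) = (fun n => \int[N]_z (f_ n z.1)%:E)%E)//.
      by apply/funext => n; rewrite ef_.
    exact: (cvg_unique _ c1' c2).
- by move=> f g [a ->] [b ->]; exists (a + b); apply/funext => t; rewrite mulrDl.
- by move=> c f [a ->]; exists (c * a); apply/funext => t; rewrite mulrA.
- by exists 0; apply/funext => t; rewrite mul0r.
- move=> l th [a ->]; split.
  + by apply: continuous_measurable_fun; exact: continuous_cos_affine.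
  + by exists 1 => t; rewrite ler_norml cos_geN1 cos_le1.
  + have [phi pd] := cos_primitive a th.
    have cc := @continuous_cos_affine a th.
    have := Nt _ _ _ (test_fun_time cc pd); rewrite (integral_lift _ N0) => ->.
    by rewrite (integral_derive sT cc pd) opprB.
- rewrite RGenOInfty.measurableE => B; apply: sub_sigma_algebra2 => _ [a ->].
  exists ( *%R 1), a; split; first by exists 1.
  by apply/seteqP; split=> t /=; rewrite in_itv/= andbT mul1r.
Qed.

Lemma weak_sol_disintegration s x (N : {finite_measure set (borel_prod R H) -> \bar R}) :
  0 <= s < T -> weak_sol s x N -> exists nu, disintegration T s N nu.
Proof.
move=> s0T wN; have [s0 sT] := andP s0T.
pose D : set (measurableTypeR R) := `[s, T]%classic.
have mD : measurable D by exact: measurable_itv.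
have D0 : (lebesgue_measure D < +oo)%E.
  by rewrite /D lebesgue_measure_itv /= lte_fin sT -EFinB ltry.
have [m mE] : exists m : {finite_measure set (measurableTypeR R) -> \bar R},
    forall B, m B = lebesgue_measure (B `&` D) by exists (mfrestr mD D0).
have Nm B : measurable B -> N (B `*` setT) = m B.
  by move=> mB; rewrite mE (weak_sol_marginal s0T wN).
have [nu mnu NE] := cantor_coded_disintegration (cantor_coded_borel sH) Nm.
exists nu; split.
  by move=> B mB; apply: measurable_funTS; exact: mnu.
move=> E mE'; rewrite NE//.
have mf : measurable_fun setT (fun t : measurableTypeR R => nu t (xsection E t)).
  exact: measurable_fun_xsection_prob.
have mdirac (B : set (measurableTypeR R)) : measurable B ->
    measurable_fun D (fun t : measurableTypeR R => dirac t B : \bar R).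
  move=> mB; rewrite (_ : (fun t => _) = EFin \o (\1_B : measurableTypeR R -> R)).
    by apply/measurable_EFinP; apply: measurable_funTS; exact: measurable_indic.
  by apply/funext => t; rewrite /= diracE indicE.
have mix (B : set (measurableTypeR R)) : measurable B ->
    m B = (\int[lebesgue_measure]_(t in D) dirac t B)%E.
  by move=> mB; rewrite mE -integral_indic.
rewrite (@ge0_mixture_integral R _ _ (measurableTypeR R) (measurableTypeR R) lebesgue_measure D mD
  (fun t => dirac t) mdirac m _ mix)//.
apply: eq_integral => t _; rewrite integral_dirac// diracT mul1e//.
Qed.

(** Integration by parts for the primitive [B] of a merely integrable [b], obtained by exchanging
    the integrals over a triangle. *)
Lemma fubini_primitive s (b : R -> R) : s < T ->
  lebesgue_measure.-integrable `[s, T] (EFin \o b) ->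
  exists B : R -> R,
    (forall t, t \in `[s, T] -> (\int[lebesgue_measure]_(r in `[s, t]) (b r)%:E = (B t)%:E)%E) /\
  forall g chi : R -> R, continuous g -> (forall t : R, is_derive t 1 chi (g t)) ->
    lebesgue_measure.-integrable `[s, T] (fun t => (g t * B t)%:E) /\
    (\int[lebesgue_measure]_(t in `[s, T]) (g t * B t)%:E =
       \int[lebesgue_measure]_(t in `[s, T]) (b t * (chi T - chi t))%:E)%E.
Proof.
move=> sT bi.
pose X := measurableTypeR R; pose mu : {sigma_finite_measure set X -> \bar R} := lebesgue_measure.
pose D : set X := `[s, T]%classic.
have mD : measurable D by exact: measurable_itv.
have D0 : (lebesgue_measure D < +oo)%E by rewrite /D lebesgue_measure_itv /= lte_fin sT -EFinB ltry.
pose b1 : X -> R := fun t => if t \in D then b t else 0.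
have b1E : (EFin \o b) \_ D = EFin \o b1.
  by apply/funext => t; rewrite /patch /b1 /=; case: ifP.
have b1i : mu.-integrable setT (EFin \o b1) by rewrite -b1E -integrable_mkcond.
have mb1 : measurable_fun setT b1 by case/integrableP: b1i => /measurable_EFinP.
have subD t : t \in `[s, T] -> `[s, t]%classic `<=` D.
  move=> tT r; rewrite /D /= !in_itv/= => /andP[-> rt].
  by rewrite (le_trans rt)//; move: tT; rewrite in_itv => /andP[].
pose B t : R := fine (\int[mu]_(r in `[s, t]) (b r)%:E).
have BE t : t \in `[s, T] -> (\int[mu]_(r in `[s, t]) (b r)%:E = (B t)%:E)%E.
  move=> tT; rewrite /B fineK//; apply: integrable_fin_num; first exact: measurable_itv.
  by apply: (integrableS mD _ (subD t tT) bi); exact: measurable_itv.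
exists B; split=> // g chi cg pd.
have mg : measurable_fun setT (g : X -> R) by exact: continuous_measurable_fun.
have [c c0 cP] : exists2 c : R, 0 <= c & forall t, t \in D -> `|g t| <= c.
  have cn : {within `[s, T], continuous (fun t => `|g t|)}.
    by apply: continuous_subspaceT => t; apply: cvg_norm; exact: cg.
  have [t0 t0D tP] := EVT_max (ltW sT) cn.
  by exists `|g t0| => // t /set_mem; exact: tP.
pose g1 : X -> R := fun t => g t * \1_D t.
have mg1 : measurable_fun setT g1 by apply: measurable_funM => //; exact: measurable_indic.
have g1c t : `|g1 t| <= c * \1_D t.
  rewrite /g1 indicE; case: (boolP (t \in D)) => tD; last by rewrite !mulr0 normr0.
  by rewrite !mulr1 cP.
pose E : set (X * X) := [set p | p.2 <= p.1].
have mE : measurable E.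
  have := measurable_fun_ler (@measurable_snd _ _ X X) (@measurable_fst _ _ X X).
  by move=> /(_ measurableT [set true] Logic.I); rewrite setTI.
pose f (p : X * X) : \bar R := (g1 p.1 * (b1 p.2 * \1_E p))%:E.
have mf : measurable_fun setT f.
  apply/measurable_EFinP; apply: measurable_funM.
    exact: (measurableT_comp mg1 measurable_fst).
  apply: measurable_funM; last exact: measurable_indic.
  exact: (measurableT_comp mb1 measurable_snd).
have fi : (mu \x mu)%E.-integrable setT f.
  apply/integrable12ltyP => //.
  pose K := (\int[mu]_t `|b1 t|%:E)%E.
  have K0 : (0 <= K)%E by apply: integral_ge0 => t _; rewrite lee_fin.
  have Koo : (K < +oo)%E by have /integrableP[_] := b1i.
  apply: (@le_lt_trans _ _ (\int[mu]_r ((c * \1_D r)%:E * K))%E); last first.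
    rewrite ge0_integralZr//; last 2 first.
    - by apply/measurable_EFinP; apply: measurable_funM => //; exact: measurable_indic.
    - by move=> r _; rewrite lee_fin mulr_ge0// indicE.
    under eq_integral do rewrite EFinM.
    rewrite ge0_integralZl//; last first.
      by apply/measurable_EFinP; exact: measurable_indic.
    rewrite integral_indic// setIT.
    by rewrite lte_mul_pinfty// ?mule_ge0 ?lee_fin// ge0_fin_numE// ?lte_mul_pinfty ?mule_ge0 ?lee_fin.
  apply: ge0_le_integral => //.
  - by move=> r _; exact: integral_ge0.
  - apply: (@measurable_fun_fubini_tonelli_F _ _ X X R mu (fun p => `|f p|%E)) => //.
    exact: measurableT_comp.
  - apply: emeasurable_funM => //; apply/measurable_EFinP.
    by apply: measurable_funM => //; exact: measurable_indic.
  - move=> r _; rewrite /K -ge0_integralZl//; last 2 first.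
    + by apply/measurable_EFinP; exact: measurableT_comp.
    + by rewrite lee_fin mulr_ge0// indicE.
    apply: ge0_le_integral => //.
    + apply: measurableT_comp => //; exact: (measurableT_comp mf (pair1_measurable r)).
    + apply: emeasurable_funM => //; apply/measurable_EFinP; exact: measurableT_comp.
    + move=> t _; rewrite /f /= lee_fin normrM ler_pM//.
      rewrite normrM indicE; case: (_ \in _) => /=; first by rewrite normr1 mulr1.
      by rewrite normr0 mulr0.
have FE r : (fubini_F mu f r = ((g r * B r)%:E * (\1_D r)%:E))%E.
  rewrite /fubini_F /f /g1 /= indicE; case: (boolP (r \in D)) => [rD|_]; last first.
    by under eq_integral do rewrite mulr0 mul0r; rewrite integral0 mule0.
  have rD' : r \in `[s, T] by exact: set_mem rD.
  have brE t : (b1 t * \1_E (r, t))%:E = ((EFin \o b) \_ `[s, r]) t.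
    rewrite /patch indicE /b1; case: (boolP (t \in (`[s, r]%classic : set X))) => tr.
      have tD : t \in D by apply: mem_set; exact: (subD r rD' t (set_mem tr)).
      rewrite tD mem_set ?mulr1//= /E /=.
      by have := set_mem tr; rewrite /= in_itv/= => /andP[].
    case: ifPn => tD; last by rewrite mul0r.
    rewrite memNset ?mulr0// /E /= => tr'; move/negP : tr; apply; apply: mem_set.
    by have := set_mem tD; rewrite /D /= !in_itv/= => /andP[-> _].
  under eq_integral do rewrite mulr1 EFinM brE.
  rewrite integralZl//; last first.
    apply/(@integrable_mkcond _ _ _ mu _ _ (measurable_itv _)).
    by apply: (integrableS mD _ (subD r rD') bi); exact: measurable_itv.
  by rewrite -integral_mkcond BE// mule1 EFinM.
have GE t : (fubini_G mu f t = ((b1 t) * (chi T - chi t))%:E)%E.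
  rewrite /fubini_G /f /=; have [tD|tD] := boolP (t \in D); last first.
    by under eq_integral do rewrite /b1 (negbTE tD) mul0r mulr0; rewrite integral0 /b1 (negbTE tD) mul0r.
  have tD' : t \in `[s, T] by exact: set_mem tD.
  have grE r : (g1 r * (b1 t * \1_E (r, t)))%:E = ((b1 t)%:E * ((EFin \o g) \_ `[t, T]) r)%E.
    rewrite /patch !indicE /g1 indicE; case: (boolP (r \in (`[t, T]%classic : set X))) => tr.
      have /andP[tr' rT] : t <= r <= T by have := set_mem tr; rewrite /= in_itv.
      have rD : r \in D.
        apply: mem_set; rewrite /D /= in_itv/= rT andbT (le_trans _ tr')//.
        by move: tD'; rewrite in_itv => /andP[].
      by rewrite rD mem_set// !mulr1 mulrC EFinM.
    rewrite mule0; case: (boolP (r \in D)) => rD; last by rewrite mulr0 mul0r.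
    rewrite memNset ?mulr0// /E /= => tr'; move/negP : tr; apply; apply: mem_set.
    by have := set_mem rD; rewrite /D /= !in_itv/= tr' => /andP[_ ->].
  under eq_integral do rewrite grE.
  have gi : mu.-integrable `[t, T]%classic (EFin \o g).
    by apply: continuous_compact_integrable; [exact: segment_compact|exact: continuous_subspaceT].
  rewrite integralZl//; last by apply/(@integrable_mkcond _ _ _ mu _ _ (measurable_itv _)).
  rewrite -integral_mkcond EFinM; congr (_ * _)%E.
  move: tD'; rewrite in_itv/= => /andP[_]; rewrite le_eqVlt => /predU1P[->|tT].
    by rewrite set_itv1 integral_set1 subrr.
  exact: integral_derive.
split.
  apply/(@integrable_mkcond _ _ _ mu _ _ mD).
  have := integrable_fubini_F fi; congr (_.-integrable _ _); apply/funext => r.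
  rewrite FE /patch indicE; case: ifP => _; first by rewrite mule1.
  by rewrite mule0.
transitivity (\int[mu]_r fubini_F mu f r)%E.
  rewrite integral_mkcond; apply: eq_integral => r _.
  rewrite FE /patch indicE; case: ifP => _; first by rewrite mule1.
  by rewrite mule0.
rewrite integral12_prod_meas1// -integral21_prod_meas1// [RHS]integral_mkcond.
apply: eq_integral => t _; rewrite GE /patch /b1; case: ifP => // _.
by rewrite mul0r.
Qed.

(** The converse of the integration in time: testing with [chi(t) u(t,x)] for all trigonometric
    [chi'] recovers the equation for almost every time. *)
Lemma weak_sol_FP s x (N : {finite_measure set (borel_prod R H) -> \bar R})
    (nu : R -> probability (borel H) R) u : 0 <= s < T -> weak_sol s x N ->
  disintegration T s N nu -> D_L0 T DA A u ->
  {ae lebesgue_measure, forall t, t \in `[s, T] ->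
     FP_at DA A C F s (dirac (x : borel H)) nu u t}.
Proof.
move=> s0T wN dN du; have [s0 sT] := andP s0T.
have [N0 Noo Nt] := wN.
have [Lu [Gu tu]] := D_L0_test_fun C F du.
have aenu := (disintegration_slice dN).1 N0.
have Ni := test_fun_integrable Noo tu.
have [_ [b bi bE] Nb] := disintegration_integral dN Ni.
pose D : set (measurableTypeR R) := `[s, T]%classic.
have mD : measurable D by exact: measurable_itv.
have D0 : (lebesgue_measure D < +oo)%E.
  by rewrite /D lebesgue_measure_itv /= lte_fin sT -EFinB ltry.
have Nui := test_fun_integrable0 Noo tu.
have [_ [a ai aE] Na] := disintegration_integral dN Nui.
have aeL := ae_inner_L0 dDA Cl s0 tu aenu.
have Bex (t : R) : t \in `[s, T] ->
    (\int[lebesgue_measure]_(r in `[s, t]) \int[nu r]_y (L0 DA A C F u r y)%:E =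
     \int[lebesgue_measure]_(r in `[s, t]) (b r)%:E)%E.
  move=> tT; apply: integral_ae_congr; apply: ae_imply2 aeL bE _ => r h1 h2 /= rt.
  have rT : r \in `[s, T].
    by move: rt tT; rewrite /= !in_itv/= => /andP[-> rt] /andP[_ tT]; exact: le_trans tT.
  by rewrite h1// h2.
have [B [BE fub]] := fubini_primitive sT bi.
pose u0 := u s x.
suff key : {ae lebesgue_measure, forall t, D t -> a t - B t - u0 = 0}.
  have aeu : {ae lebesgue_measure, forall t, t \in `[s, T] ->
      (\int[nu t]_y (u t y)%:E = \int[nu t]_y (lift u (t, y))%:E)%E}.
    apply: ae_imply aenu _ => t h tT; apply: integral_ae_congr.
    exists (~` slice DF t); split.
    - by apply: measurableC; exact: measurable_slice.
    - have := probability_setC (nu t) (measurable_slice t); rewrite h// subee// => h'; exact: h'.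
    - by move=> y /= h' Dy; apply: h' => _; rewrite lift_in.
  apply: ae_imply2 (ae_imply2 key aE (fun t p q => conj p q)) aeu _ => t [h1 h2] h3 tT.
  rewrite /FP_at h3// h2// Bex// BE// integral_dirac//; last first.
    apply/measurable_EFinP; apply: (test_fun_section_measurable tu).
    by rewrite in_itv/= s0 ltW.
  rewrite diracT mul1e -EFinD; congr (_%:E); have := h1 tT; rewrite /u0; lra.
pose mu : {measure set (measurableTypeR R) -> \bar R} := lebesgue_measure.
pose Sg (f : R -> R) := mu.-integrable D (EFin \o f).
pose I (f : R -> R) : R := fine (\int[mu]_(t in D) (f t)%:E).
have IE f : Sg f -> (\int[mu]_(t in D) (f t)%:E = (I f)%:E)%E.
  by move=> Sf; rewrite /I fineK//; exact: integrable_fin_num.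
have SD f g : Sg f -> Sg g -> Sg (fun t => f t + g t).
  move=> Sf Sg'; rewrite /Sg (_ : _ \o _ = (EFin \o f) \+ (EFin \o g))%E//.
  exact: integrableD.
have SZ (c : R) f : Sg f -> Sg (fun t => c * f t).
  move=> Sf; rewrite /Sg (_ : _ \o _ = (fun y => c%:E * (EFin \o f) y))%E//.
  exact: integrableZl.
have ID f g : Sg f -> Sg g -> I (fun t => f t + g t) = I f + I g.
  move=> Sf Sg'; apply: EFin_inj; rewrite EFinD -!IE//; last exact: SD.
  exact: integralD_EFin.
have IZ (c : R) f : Sg f -> I (fun t => c * f t) = c * I f.
  move=> Sf; apply: EFin_inj; rewrite EFinM -!IE//; last exact: SZ.
  rewrite (_ : (fun y => _) = (fun y => c%:E * (f y)%:E))%E//; exact: integralZl.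
have Sa : Sg a by exact: ai.
have Sb : Sg b by exact: bi.
have SB : Sg B.
  have [h _] := fub _ _ (@cst_continuous R R 1) (fun t => is_derive_id t 1).
  by move: h; rewrite /Sg; congr (_.-integrable _ _); apply/funext => t /=; rewrite mul1r.
have SbdD (g : R -> R) (M : R) : measurable_fun D (g : measurableTypeR R -> R) ->
    (forall t, D t -> `|g t| <= M) -> forall f, Sg f -> Sg (fun t => g t * f t).
  move=> mg gM f Sf; have mf : measurable_fun D (f : measurableTypeR R -> R).
    by case/integrableP: Sf => /measurable_EFinP.
  apply: (@le_integrable _ _ _ mu D mD _ (fun t => (`|M| * f t)%:E)) => //.
  - by apply/measurable_EFinP; exact: measurable_funM.
  - move=> t Dt; rewrite /= lee_fin !normrM normr_id ler_wpM2r//.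
    by rewrite (le_trans (gM t Dt))// ler_norm.
  - exact: SZ.
have Sbd (g : R -> R) : measurable_fun D (g : measurableTypeR R -> R) ->
    (exists M : R, forall t, `|g t| <= M) -> forall f, Sg f -> Sg (fun t => g t * f t).
  by move=> mg [M gM]; apply: (SbdD _ M).
(* The defect of the equation at time [t], to be shown orthogonal to all bounded measurable
   functions. It is written with sums and multiples only, so that the linearity of [I] applies. *)
pose d t := a t + -1 * (B t + u0 * 1).
have S1 : Sg (fun=> 1).
  apply/integrableP; split; first exact: measurable_cst.
  by under eq_integral do rewrite /= normr1; rewrite integral_cst// mul1e.
have Sd : Sg d by apply: (SD) => //; apply: (SZ); apply: (SD) => //; exact: (SZ).
have Ib : I b = - u0.
  apply: EFin_inj; rewrite -IE// -(Nt _ _ _ tu) Nb; apply: integral_ae_congr.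
  by apply: ae_imply bE _ => t h tT; rewrite h.
suff key : forall g : measurableTypeR R -> R, measurable_fun setT g -> (exists M : R, forall t, `|g t| <= M) ->
    I (fun t => g t * d t) = 0.
  have d0 : {ae mu, forall t, D t -> (EFin \o d) t = 0%E}.
    apply: (@integral_ae_eq _ _ _ mu D mD (cst 0%E) (EFin \o d)) => // E ED mE.
    rewrite integral0; have h : I (fun t => \1_E t * d t) = 0.
      apply: key; first exact: measurable_indic.
      by exists 1 => t; rewrite indicE; case: (_ \in _); rewrite ?normr1 ?normr0.
    have SE : Sg (fun t => \1_E t * d t).
      apply: Sbd => //.
      by exists 1 => t; rewrite indicE; case: (_ \in _); rewrite ?normr1 ?normr0.
    transitivity (\int[mu]_(t in D) (\1_E t * d t)%:E)%E; last by rewrite IE// h.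
    rewrite [RHS]integral_mkcond [LHS]integral_mkcond; apply: eq_integral => t _.
    rewrite /patch indicE; case: (boolP (t \in E)) => tE.
      by rewrite mem_set ?mul1r//; apply: ED; exact: set_mem.
    by rewrite mul0r; case: ifP.
  apply: ae_imply d0 _ => t h Dt; have := h Dt => /= -[]; rewrite /d => <-; ring.
pose P (g : measurableTypeR R -> R) := [/\ measurable_fun setT g, exists M : R, forall t, `|g t| <= M
  & I (fun t => g t * d t) = 0].
suff h : forall g : measurableTypeR R -> R, measurable_fun setT g -> (exists M : R, forall t, `|g t| <= M) -> P g.
  by move=> g mg gb; have [] := h g mg gb.
apply: (@trig_monotone_class R _ (measurableTypeR R) P [set f | exists a, f = fun t => a * t]).
- move=> f g [mf [Mf fM] ef] [mg [Mg gM] eg]; split.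
  + exact: measurable_funD.
  + by exists (Mf + Mg) => t; rewrite (le_trans (ler_normD _ _))// lerD.
  + rewrite (_ : (fun t => _) = (fun t => f t * d t + g t * d t)); last first.
      by apply/funext => t; rewrite mulrDl.
    rewrite ID ?ef ?eg ?addr0//.
    * by apply: Sbd => //; [exact: measurable_funTS|exists Mf].
    * by apply: Sbd => //; [exact: measurable_funTS|exists Mg].
- move=> c f [mf [Mf fM] ef]; split.
  + exact: measurable_funM.
  + by exists (`|c| * Mf) => t; rewrite normrM ler_wpM2l.
  + rewrite (_ : (fun t => _) = (fun t => c * (f t * d t))); last first.
      by apply/funext => t; rewrite mulrA.
    rewrite IZ ?ef ?mulr0//.
    by apply: Sbd => //; [exact: measurable_funTS|exists Mf].
- move=> f_ f Pf [M fM] cf; split.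
  + by apply: (measurable_fun_cvg (h := f_)) => [n|t _]; [case: (Pf n)|exact: cf].
  + by exists M => t; apply: (cvg_norm_le (cf t)) => n; exact: fM.
  + have mf_ n : measurable_fun D (f_ n) by apply: measurable_funTS; case: (Pf n).
    have md : measurable_fun D (d : measurableTypeR R -> R).
      by case/integrableP: Sd => /measurable_EFinP.
    have c1 : (\int[mu]_(t in D) (f_ n t * d t)%:E)%E @[n --> \oo] --> (\int[mu]_(t in D) (f t * d t)%:E)%E.
      apply: (@dominated_cvg _ (measurableTypeR R) _ mu D mD (fun n t => (f_ n t * d t)%:E) _ (fun t => (M * `|d t|)%:E)) => //.
      - by move=> n; apply/measurable_EFinP; exact: measurable_funM.
      - move=> z _; apply: cvg_EFin; first exact: nearW.
        by apply: cvgM; [exact: cf|exact: cvg_cst].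
      - apply: (SZ M (fun t => `|d t|)); exact: (integrable_abse Sd).
      - by move=> n z _; rewrite /= lee_fin normrM ler_wpM2r.
    have c0 : (\int[mu]_(t in D) (f_ n t * d t)%:E)%E @[n --> \oo] --> (0 : \bar R)%E.
      rewrite (_ : (fun n => _) = (fun _ => 0%E)); first exact: cvg_cst.
      apply/funext => n; have [mn bn e] := Pf n.
      rewrite IE ?e//; apply: Sbd => //; exact: measurable_funTS.
    by rewrite /I (cvg_unique _ c1 c0).
- by move=> f g [a1 ->] [a2 ->]; exists (a1 + a2); apply/funext => t; rewrite mulrDl.
- by move=> c f [a1 ->]; exists (c * a1); apply/funext => t; rewrite mulrA.
- by exists 0; apply/funext => t; rewrite mul0r.
- move=> l th [a1 ->]; split.
  + by apply: continuous_measurable_fun; exact: continuous_cos_affine.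
  + by exists 1 => t; rewrite ler_norml cos_geN1 cos_le1.
  + have [chi pd] := cos_primitive a1 th.
    have cc := @continuous_cos_affine a1 th.
    have [gBi gBE] := fub _ _ cc pd.
    pose g (t : R) := cos (a1 * t + th).
    have mg : measurable_fun D (g : measurableTypeR R -> R).
      by apply: measurable_funTS; apply: continuous_measurable_fun.
    have gb : exists M : R, forall t, `|g t| <= M.
      by exists 1 => t; rewrite ler_norml cos_geN1 cos_le1.
    have cchi : continuous chi.
      by move=> t; apply: differentiable_continuous; apply/derivable1_diffP; have [] := pd t.
    have mchi : measurable_fun D (chi : measurableTypeR R -> R).
      by apply: measurable_funTS; apply: continuous_measurable_fun.
    have [M chiM] : exists M : R, forall t, D t -> `|chi t| <= M.
      have cn : {within `[s, T], continuous (fun t => `|chi t|)}.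
        by apply: continuous_subspaceT => t; apply: cvg_norm; exact: cchi.
      have [t0 t0D tP] := EVT_max (ltW sT) cn.
      by exists `|chi t0| => t; exact: tP.
    have Sga : Sg (fun t => g t * a t) by exact: Sbd.
    have Scb : Sg (fun t => chi t * b t) by exact: (SbdD _ M).
    have SgB : Sg (fun t => g t * B t) by exact: Sbd.
    have Sg1 : Sg (fun t => g t * 1) by exact: Sbd.
    have e1 : I (fun t => g t * 1) = chi T - chi s.
      apply: EFin_inj; rewrite -IE// -(integral_derive sT cc pd).
      by apply: eq_integral => t _; rewrite mulr1.
    (* The total integral of [b] is [- u0], as [u] vanishes at [T]; this is the boundary term at
       [T]. *)
    have e2 : I (fun t => g t * B t) = - u0 * chi T - I (fun t => chi t * b t).
      have -> : I (fun t => g t * B t) = I (fun t => chi T * b t + -1 * (chi t * b t)).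
        by rewrite /I gBE; congr fine; apply: eq_integral => t _; congr (_%:E); ring.
      rewrite ID ?IZ ?Ib//; [ring|exact: SZ|exact: SZ].
    (* The equation for the test function [chi u]. Together with [e1] and [e2], all boundary terms
       cancel. *)
    have e3 : I (fun t => g t * a t) + I (fun t => chi t * b t) = - (chi s * u0).
      have tuM := test_fun_timeM cc pd tu.
      have NiM := test_fun_integrable Noo tuM.
      have [_ _ NM] := disintegration_integral dN NiM.
      rewrite -ID//; apply: EFin_inj; rewrite -IE; last exact: SD.
      rewrite -(Nt _ _ _ tuM) NM; apply: integral_ae_congr.
      have [ia _ _] := disintegration_integral dN Nui.
      have [ib _ _] := disintegration_integral dN Ni.
      apply: ae_imply2 (ae_imply2 ia ib (fun t p q => conj p q))
        (ae_imply2 aE bE (fun t p q => conj p q)) _ => t [h1 h2] [h3 h4] tT.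
      have h1' := h1 tT; have h2' := h2 tT.
      rewrite EFinD !EFinM -h3// -h4// -!integralZl//.
      rewrite -integralD//; last 2 first.
      - exact: integrableZl.
      - exact: integrableZl.
      apply: eq_integral => y _; rewrite /lift; case: ifP => _; first by rewrite -!EFinM -EFinD.
      by rewrite !mule0 adde0.
    rewrite (_ : (fun t => _) = (fun t => g t * a t + -1 * (g t * B t + u0 * (g t * 1)))); last first.
      by apply/funext => t; rewrite /d /g; ring.
    rewrite ID ?IZ ?ID ?IZ ?e1 ?e2//.
    + by move: e3; set p := I _; set q := I _ => h; have -> : p = - (chi s * u0) - q by [rewrite -h; ring]; ring.
    + exact: SZ.
    + by apply: (SD) => //; exact: SZ.
    + by apply: (SZ); apply: (SD) => //; exact: SZ.
- rewrite RGenOInfty.measurableE => E; apply: sub_sigma_algebra2 => _ [a1 ->].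
  exists ( *%R 1), a1; split; first by exists 1.
  by apply/seteqP; split=> t /=; rewrite in_itv/= andbT mul1r.
Qed.

Lemma M_class_of_weak_sol s x (N : {finite_measure set (borel_prod R H) -> \bar R}) :
  0 <= s < T -> weak_sol s x N -> M_class T DA A C DF F s (dirac (x : borel H)) N.
Proof.
move=> s0T wN; have [nu dN] := weak_sol_disintegration s0T wN.
have [N0 Noo Nt] := wN.
exists nu; split=> //.
- exact/(disintegration_slice dN).
- rewrite -(ge0_disintegration_integral dN measurable_growth growth_ge0).
  apply: le_lt_trans Noo.
  have -> : (\int[N]_z (lift theta z)%:E = \int[N]_z (1 + growth z))%E.
    apply: integral_ae_congr; exists (~` live_set s); split=> //.
      by apply: measurableC; exact: measurable_live_set.
    by move=> z /= h [Dz _]; apply: h => _; rewrite growth_in.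
  apply: ge0_le_integral => //.
  + by move=> z _; exact: growth_ge0.
  + exact: measurable_growth.
  + by apply: emeasurable_funD => //; exact: measurable_growth.
  + by move=> z _; rewrite leeDr.
- by move=> u du; exact: (weak_sol_FP s0T wN dN du).
Qed.

(** * Kato's inequality and splitting of the initial law *)

Lemma eq_mrestr_integrable (N mu : {measure set Y -> \bar R}) (E : set Y) (f : Y -> R) :
  measurable E -> (forall B, measurable B -> mu B = N (B `&` E)) ->
  N.-integrable setT (EFin \o f) ->
  mu.-integrable setT (EFin \o f) /\
  (\int[mu]_z (f z)%:E = \int[N]_(z in E) (f z)%:E)%E.
Proof.
move=> mE muE fi.
have ge0 (g : Y -> \bar R) : measurable_fun setT g -> (forall z, 0 <= g z)%E ->
    (\int[mu]_z g z = \int[N]_(z in E) g z)%E.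
  move=> mg g0.
  pose k (z : Y) : {measure set Y -> \bar R} := dirac z.
  have mk (B : set Y) : measurable B -> measurable_fun E (fun z => k z B).
    move=> mB; rewrite (_ : (fun z => _) = EFin \o (\1_B : Y -> R)).
      by apply/measurable_EFinP; apply: measurable_funTS; exact: measurable_indic.
    by apply/funext => z; rewrite /k /= diracE indicE.
  have mix (B : set Y) : measurable B -> mu B = (\int[N]_(z in E) k z B)%E.
    by move=> mB; rewrite muE// -integral_indic.
  rewrite (@ge0_mixture_integral R _ _ Y Y N E mE k mk mu g mix)//.
  by apply: eq_integral => z _; rewrite integral_dirac// diracT mul1e.
have /integrableP[mf foo] := fi; have mfR : measurable_fun setT f by apply/measurable_EFinP.
have fiE := integrableS measurableT mE (@subsetT _ E) fi.
have fi' : mu.-integrable setT (EFin \o f).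
  apply/integrableP; split=> //; rewrite ge0//; last exact: measurableT_comp.
  by have /integrableP[] := fiE.
split=> //; rewrite integralE [RHS]integralE !ge0//.
- exact: measurable_funeneg.
- exact: measurable_funepos.
Qed.

(* weak_sol with a general initial law. *)
Definition weak_evo (s : R) (zeta : probability (borel H) R)
    (mu : {measure set (borel_prod R H) -> \bar R}) :=
  [/\ mu (~` live_set s) = 0%E, (\int[mu]_z (lift theta z)%:E < +oo)%E
    & forall u Lu Gu, test_fun T DA A C F u Lu Gu ->
        (\int[mu]_z (lift Lu z)%:E = - \int[zeta]_y (u s y)%:E)%E].

Lemma test_fun_initial_integrable (zeta : probability (borel H) R) s u Lu Gu :
  s \in `[0, T] -> test_fun T DA A C F u Lu Gu ->
  zeta.-integrable setT (fun y => (u s y)%:E).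
Proof.
move=> s0T tu; have [c c0 cP] := test_fun_bound tu.
apply: (@le_integrable _ _ _ zeta setT measurableT _ (cst c%:E)) => //.
- by apply/measurable_EFinP; exact: (test_fun_section_measurable tu s0T).
- by move=> y _; rewrite /= lee_fin (ger0_norm c0); case: (cP s y s0T).
- exact: finite_measure_integrable_cst.
Qed.

Lemma integral_itv_split (f : R -> \bar R) (a b c : R) : a <= b <= c ->
  measurable_fun (`[a, c] : set (measurableTypeR R)) f ->
  (\int[lebesgue_measure]_(t in `[a, c]) f t =
   \int[lebesgue_measure]_(t in `[a, b]) f t + \int[lebesgue_measure]_(t in `[b, c]) f t)%E.
Proof.
move=> /andP[ab bc] mf.
have ioE : `[a, c]%classic = `[a, b]%classic `|` `]b, c]%classic :> set (measurableTypeR R).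
  by apply: itv_bndbnd_setU; rewrite bnd_simp.
rewrite ioE integral_setU//=; last 2 first.
- by rewrite -ioE.
- apply/disj_set2P; rewrite -subset0 => t [] /=; rewrite !in_itv/= => /andP[_ tb] /andP[bt _].
  by move: tb; rewrite leNgt bt.
congr (_ + _)%E; apply: integral_itv_obnd_cbnd.
by apply: (measurable_funS _ _ mf) => //; rewrite ioE => t; right.
Qed.

(** The integral of [Lu] over [[r, T]] is [- u r x], and the equation at time [s] gives its part
    over [[r, s]]; the difference is the part over [[s, T]]. *)
Lemma weak_evo_of_FP r s x (N mu : {finite_measure set (borel_prod R H) -> \bar R})
    (nu : R -> probability (borel H) R) : 0 <= r -> r < s < T ->
  disintegration T r N nu -> weak_sol r x N ->
  (forall B, measurable B -> mu B = N (B `&` (`[s, T]%classic `*` setT))) ->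
  (forall u, D_L0 T DA A u -> FP_at DA A C F r (dirac (x : borel H)) nu u s) ->
  weak_evo s (nu s) mu.
Proof.
move=> r0 /andP[rs sT] dN wN muE FPs; have [N0 Noo Nt] := wN.
pose E : set Y := `[s, T]%classic `*` setT.
have mE : measurable E by apply: measurableX => //; exact: measurable_itv.
have theta_i : N.-integrable setT (EFin \o lift theta).
  apply/integrableP; split; first by apply/measurable_EFinP; exact: measurable_theta.
  by under eq_integral do rewrite /= ger0_norm ?lift_theta_ge0//.
split.
- have mL : measurable (~` live_set s : set Y) by apply: measurableC; exact: measurable_live_set.
  transitivity (N (~` live_set s `&` E)); first exact: muE.
  apply/eqP; rewrite eq_le measure_ge0 andbT -N0 le_measure//.
  + by apply/mem_set; exact: measurableI.
  + by apply/mem_set; apply: measurableC; exact: measurable_live_set.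
  + by move=> z [h [z1 _]] [Dz _]; apply: h; split.
- have [/integrableP[_ +] _] := eq_mrestr_integrable mE muE theta_i.
  by under eq_integral do rewrite /= ger0_norm ?lift_theta_ge0//.
- move=> u Lu Gu tu.
  have Ni := test_fun_integrable Noo tu.
  have [mui ->] := eq_mrestr_integrable mE muE Ni.
  have := FPs u (test_fun_D_L0 tu); rewrite /FP_at.
  have aenu := (disintegration_slice dN).1 N0.
  have rT : r < T by exact: lt_trans sT.
  have aeL := ae_inner_L0 dDA Cl r0 tu aenu.
  have [_ [b bi bE] Nb] := disintegration_integral dN Ni.
  pose f1 z := \1_E z * lift Lu z.
  have EE : (\int[N]_(z in E) (lift Lu z)%:E = \int[N]_z (f1 z)%:E)%E.
    rewrite integral_mkcond; apply: eq_integral => z _.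
    by rewrite /f1 /patch indicE; case: ifP => _; rewrite ?mul1r ?mul0r.
  have f1i : N.-integrable setT (EFin \o f1).
    apply: (le_integrable measurableT _ _ Ni) => [|z _].
      have /integrableP[/measurable_EFinP mL _] := Ni.
      by apply/measurable_EFinP; apply: measurable_funM => //; exact: measurable_indic.
    rewrite /= lee_fin /f1 indicE; case: (_ \in _); first by rewrite mul1r.
    by rewrite mul0r normr0.
  have [_ _ Nf1] := disintegration_integral dN f1i.
  have -> : (\int[N]_(z in E) (lift Lu z)%:E = \int[lebesgue_measure]_(t in `[s, T]) (b t)%:E)%E.
    rewrite EE Nf1 [RHS]integral_mkcond [LHS]integral_mkcond; apply: integral_ae_congr.
    apply: ae_imply bE _ => t h _; rewrite /patch; case: (boolP (t \in (`[s, T]%classic : set R))) => tT.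
      have tT' := set_mem tT.
      have trT : t \in `[r, T].
        by move: tT'; rewrite /= !in_itv/= => /andP[st ->]; rewrite (le_trans (ltW rs)).
      rewrite mem_set// -h//; apply: eq_integral => y _.
      by rewrite /f1 indicE mem_set ?mul1r.
    case: ifP => // _; under eq_integral => y _.
      rewrite /f1 indicE memNset ?mul0r; last by move=> -[h' _]; move/negP : tT; apply; exact: mem_set.
      over.
    by rewrite integral0.
  have b1 : (\int[lebesgue_measure]_(t in `[r, s]) \int[nu t]_y (L0 DA A C F u t y)%:E =
      \int[lebesgue_measure]_(t in `[r, s]) (b t)%:E)%E.
    apply: integral_ae_congr; apply: ae_imply2 aeL bE _ => t h1 h2 /= tI.
    have tT : t \in `[r, T].
      by move: tI; rewrite /= !in_itv/= => /andP[-> ts]; rewrite (le_trans ts)// ltW.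
    by rewrite h1// h2.
  have b2 : (\int[lebesgue_measure]_(t in `[r, T]) (b t)%:E = (- u r x)%:E)%E.
    rewrite -(Nt _ _ _ tu) Nb; apply: integral_ae_congr.
    by apply: ae_imply bE _ => t h tT; rewrite h.
  have r0T : r \in `[0, T] by rewrite in_itv/= r0 ltW.
  rewrite b1 integral_dirac//; last by apply/measurable_EFinP; exact: (test_fun_section_measurable tu r0T).
  rewrite diracT mul1e => ->.
  have sI : r <= s <= T by rewrite !ltW.
  have mb : measurable_fun (`[r, T] : set (measurableTypeR R)) (EFin \o b) by case/integrableP: bi.
  have := integral_itv_split sI mb; rewrite b2.
  have sub1 : `[r, s]%classic `<=` `[r, T]%classic.
    by move=> t /=; rewrite !in_itv/= => /andP[-> ts]; rewrite (le_trans ts)// ltW.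
  have sub2 : `[s, T]%classic `<=` `[r, T]%classic.
    by move=> t /=; rewrite !in_itv/= => /andP[st ->]; rewrite (le_trans (ltW rs)).
  have mrT : measurable (`[r, T]%classic : set (measurableTypeR R)) by exact: measurable_itv.
  have : (\int[lebesgue_measure]_(t in `[r, s]) (b t)%:E)%E \is a fin_num.
    apply: integrable_fin_num; first exact: measurable_itv.
    by apply: (integrableS mrT _ sub1 bi); exact: measurable_itv.
  have : (\int[lebesgue_measure]_(t in `[s, T]) (b t)%:E)%E \is a fin_num.
    apply: integrable_fin_num; first exact: measurable_itv.
    by apply: (integrableS mrT _ sub2 bi); exact: measurable_itv.
  have E3 (a c : \bar R) (v : R) : a \is a fin_num -> c \is a fin_num ->
      ((- v)%:E = c + a -> a = - (v%:E + c))%E.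
    case: a c => [a| |] // [c| |] // _ _ [h]; rewrite -EFinD -EFinN; congr (_%:E); lra.
  by move=> h1 h2 h3; exact: E3 h1 h2 h3.
Qed.

Hypothesis Cs : symmetric_op C.
Hypothesis C0 : nonneg_op C.

(** Apply the identity to [p(u)] with [p] a polynomial approximation of the negative part. Convexity
    and [C >= 0] make the second-order term nonnegative, and [-1 <= p' <= 0] bounds [- p'(u) Lu] by
    the positive part of [Lu]. *)
Lemma kato s (zeta : probability (borel H) R) (mu : {measure set Y -> \bar R}) u Lu Gu :
  0 <= s < T -> weak_evo s zeta mu ->
  test_fun T DA A C F u Lu Gu ->
  (\int[zeta]_y (Num.max (- u s y) 0)%:E <= \int[mu]_z (Num.max (lift Lu z) 0)%:E)%E.
Proof.
move=> /andP[s0 sT] [mu0 muoo mut] tu.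
have s0T : s \in `[0, T] by rewrite in_itv/= s0 ltW.
have [M0 M00 MP] := test_fun_bound tu; pose M := M0 + 1.
have M_gt0 : 0 < M by rewrite /M ltr_wpDl.
have uM t x : t \in `[0, T] -> `|u t x| <= M.
  by move=> tT; have [h _] := MP t x tT; rewrite (le_trans h)// lerDl.
have mui := test_fun_integrable muoo tu.
have max_i d' (X : measurableType d') (m : {measure set X -> \bar R}) (f : X -> R) :
    m.-integrable setT (EFin \o f) -> m.-integrable setT (fun z => (Num.max (f z) 0)%:E).
  move=> fi; have /integrableP[/measurable_EFinP mf _] := fi.
  apply: (le_integrable measurableT _ _ fi) => [|z _].
    by apply/measurable_EFinP; exact: measurable_maxr.
  by rewrite /= lee_fin ger0_norm ?le_max ?lexx ?orbT// ge_max ler_norm normr_ge0.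
have posi : mu.-integrable setT (fun z => (Num.max (lift Lu z) 0)%:E) by exact: max_i.
have uzi := test_fun_initial_integrable zeta s0T tu.
have negi : zeta.-integrable setT (fun y => (Num.max (- u s y) 0)%:E).
  by apply: (max_i _ _ zeta (fun y => - u s y)); exact: integrableN uzi.
(* The approximation costs [e] times the mass of [zeta], which is [1]. *)
suff key : forall e : R, 0 < e ->
    (\int[zeta]_y (Num.max (- u s y) 0 - e)%:E <= \int[mu]_z (Num.max (lift Lu z) 0)%:E)%E.
  apply/lee_addgt0Pr => e e0; rewrite -leeBlDr//; apply: le_trans (key e e0).
  under [leRHS]eq_integral do rewrite EFinB.
  rewrite integralB_EFin//; last exact: finite_measure_integrable_cst.
  by rewrite integral_cst//= probability_setT mule1.
move=> e e0; have [p [p0 p1 p2 pl]] := negpart_poly M_gt0 e0.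
have tp := test_fun_horner dDA Cl Cs p0 tu.
have pi := test_fun_integrable muoo tp.
have pz := test_fun_initial_integrable zeta s0T tp.
apply: (@le_trans _ _ (\int[zeta]_y (p.[u s y])%:E)%E).
  apply: le_integral => //.
    have := integrableB measurableT negi (finite_measure_integrable_cst zeta e measurableT).
    by congr (_.-integrable _ _); apply/funext => y; rewrite /= EFinB.
  by move=> y _; rewrite lee_fin pl// uM.
have -> : (\int[zeta]_y (p.[u s y])%:E = - \int[mu]_z (lift (fun t x => p^`().[u t x] * Lu t x
       + 2^-1 * p^`()^`().[u t x] * dotp (C (Gu t x)) (Gu t x)) z)%:E)%E.
  by rewrite (mut _ _ _ tp) oppeK.
rewrite -integralN//; last by exact: integrable_add_def.
apply: le_integral => //; first exact: integrableN.
move=> z _; rewrite -EFinN lee_fin /lift; case: ifPn => [/set_mem Dz|_]; last first.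
  by rewrite oppr0 le_max lexx orbT.
have [tT _] := DFc Dz; have uz := uM z.1 z.2 tT.
have := p1 _ uz; have := p2 _ uz; have := C0 (Gu z.1 z.2).
move: (p^`().[_]) (p^`()^`().[_]) (dotp _ _) (Lu _ _) => a b c l c0 b0 /andP[a1 a2].
have h : 0 <= 2^-1 * b * c by rewrite !mulr_ge0.
rewrite opprD -[X in _ <= X]addr0 lerD ?oppr_le0//.
rewrite le_max; case: (leP 0 l) => l0; apply/orP; [left|right]; nra.
Qed.

Lemma test_fun_K_integral (zeta : probability (borel H) R) (K : set (borel H)) s u Lu Gu :
  measurable K -> s \in `[0, T] -> test_fun T DA A C F u Lu Gu ->
  zeta.-integrable K (fun y => (u s y)%:E).
Proof.
move=> mK s0T tu; apply: integrableS (test_fun_initial_integrable zeta s0T tu) => //.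
Qed.

(** Over [K] one has [- int u(s,.) <= int (-u(s,.))^+], and enlarging [K] to the whole space
    increases the right side. Kato's inequality then supplies the positivity condition of
    [moment_domination]. *)
Lemma weak_evo_split s (zeta : probability (borel H) R)
    (mu : {finite_measure set (borel_prod R H) -> \bar R}) (K : set (borel H)) :
  0 <= s < T -> measurable K -> weak_evo s zeta mu ->
  exists m1 m2 : {finite_measure set (borel_prod R H) -> \bar R},
    (forall E, measurable E -> mu E = m1 E + m2 E)%E /\
    forall u Lu Gu, test_fun T DA A C F u Lu Gu ->
      (\int[m1]_z (lift Lu z)%:E = - \int[zeta]_(y in K) (u s y)%:E)%E.
Proof.
move=> s0T mK wm; have [mu0 muoo mut] := wm.
have s01 : s \in `[0, T] by case/andP: s0T => s0 sT; rewrite in_itv/= s0 ltW.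
pose J (u : R -> H -> R) : R := fine (\int[zeta]_(y in K) (u s y)%:E).
have JE u Lu Gu : test_fun T DA A C F u Lu Gu -> (\int[zeta]_(y in K) (u s y)%:E = (J u)%:E)%E.
  move=> tu; rewrite /J fineK//; apply: integrable_fin_num => //.
  exact: (test_fun_K_integral zeta mK s01 tu).
pose G (f : Y -> R) (c : R) := exists u Lu Gu,
  [/\ test_fun T DA A C F u Lu Gu, f = lift Lu & c = - J u].
have [||||| m1 [m1mu m1P]] := @moment_domination R _ Y mu G.
- exists (fun _ _ => 0), (fun _ _ => 0), (fun _ _ => 0); split; first exact: test_fun0.
    by apply/funext => z; rewrite /lift if_same.
  by rewrite /J; under eq_integral do rewrite /=; rewrite integral0 oppr0.
- move=> _ _ _ _ [u [Lu [Gu [tu -> ->]]]] [v [Lv [Gv [tv -> ->]]]].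
  exists (fun t x => u t x + v t x), (fun t x => Lu t x + Lv t x), (fun t x => Gu t x + Gv t x).
  split; first exact: test_funD.
    apply/funext => z; rewrite (_ : (lift Lu + lift Lv) z = lift Lu z + lift Lv z)//.
    by rewrite /lift; case: ifP => // _; rewrite addr0.
  rewrite -opprD; congr (- _); apply: EFin_inj.
  rewrite EFinD -(JE _ _ _ tu) -(JE _ _ _ tv) -(JE _ _ _ (test_funD tu tv)).
  rewrite (integralD_EFin mK (test_fun_K_integral zeta mK s01 tu))//.
  exact: (test_fun_K_integral zeta mK s01 tv).
- move=> a _ _ [u [Lu [Gu [tu -> ->]]]].
  exists (fun t x => a * u t x), (fun t x => a * Lu t x), (fun t x => a *: Gu t x).
  split; first exact: test_funZ.
    apply/funext => z; rewrite (_ : (a *: lift Lu) z = a * lift Lu z)//.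
    by rewrite /lift; case: ifP => // _; rewrite mulr0.
  rewrite mulrN; congr (- _); apply: EFin_inj.
  rewrite EFinM -(JE _ _ _ tu) -(JE _ _ _ (test_funZ a tu)).
  under [RHS]eq_integral do rewrite EFinM.
  by rewrite integralZl//; exact: (test_fun_K_integral zeta mK s01 tu).
- by move=> _ _ [u [Lu [Gu [tu -> _]]]]; exact: (test_fun_integrable muoo tu).
- move=> _ _ [u [Lu [Gu [tu -> ->]]]].
  apply: (le_trans _ (kato s0T wm tu)).
  rewrite EFinN -(JE _ _ _ tu) -integralN; last first.
    exact: integrable_add_def (test_fun_K_integral zeta mK s01 tu).
  have mus : measurable_fun setT (u s : borel H -> R) by exact: test_fun_section_measurable tu s01.
  apply: (@le_trans _ _ (\int[zeta]_(y in K) (Num.max (- u s y) 0)%:E)%E).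
    apply: le_integral => //.
    + exact: integrableN (test_fun_K_integral zeta mK s01 tu).
    + apply: (le_integrable mK _ _ (test_fun_K_integral zeta mK s01 tu)) => [|y _].
        apply/measurable_EFinP; apply: measurable_funTS; apply: measurable_maxr => //.
        exact: measurable_funN.
      by rewrite /= lee_fin ger0_norm ?le_max ?lexx ?orbT// ge_max -normrN ler_norm normr_ge0.
    + by move=> y _; rewrite -EFinN lee_fin le_max lexx.
  apply: ge0_subset_integral => //.
  + apply/measurable_EFinP; apply: measurable_maxr => //; exact: measurable_funN.
  + by move=> y _; rewrite lee_fin le_max lexx orbT.
- have [n1 [n2 [n1E muE]]] := measure_sub_ex m1mu.
  exists n1, n2; split=> // u Lu Gu tu; rewrite (JE _ _ _ tu) -EFinN.
  have [|_ <-] := m1P (lift Lu) (- J u); first by exists u, Lu, Gu.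
  by apply: eq_measure_integral => B _ _; exact: n1E.
Qed.

(** * Measurable dependence on the initial point *)

(** All that determines the wave and [wave_L] at time [t]. The images of the direction under the
    adjoint and under [C] are listed separately, since the adjoint is unbounded and closeness of
    directions would not control them. *)
Let wave_data (w : @wave R H) (t : R) :=
  ((wave_amp w t, wave_damp w t, wave_phase w),
   (wave_dir w t, wave_ddir w t, adj DA A (wave_dir w t), C (wave_dir w t))).

Let dist (x y : (R * R * R) * (H * H * H * H)) : R :=
  let: ((a1, b1, c1), (h1, k1, l1, m1)) := x in
  let: ((a2, b2, c2), (h2, k2, l2, m2)) := y in
  `|a1 - a2| + `|b1 - b2| + `|c1 - c2| + `|h1 - h2| + `|k1 - k2| + `|l1 - l2| + `|m1 - m2|.

Let dense_seq (E : normedModType R) (s : nat -> E) := forall x e, 0 < e -> exists n, `|x - s n| < e.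

Let dist_dense : exists P, forall x e, 0 < e -> exists n : nat, dist x (P n) < e.
Proof.
have [q qP] : exists q : nat -> R, dense_seq (q : nat -> R^o).
  exists (fun n => if choice.unpickle n is Some z then ratr (z : rat) else 0) => x e e0.
  have : x - e < x + e by lra.
  move=> /rat_in_itvoo[z]; rewrite in_itv/= => zx.
  by exists (choice.pickle z); rewrite choice.pickleK ltr_distlC.
have [h hP] : exists h : nat -> H, dense_seq h by exact: separable_dense_seq.
exists (fun n => if choice.unpickle n is Some (a, b, c, (k, l, m, o)) then
  ((q a, q b, q c), (h k, h l, h m, h o)) else ((0, 0, 0), (0, 0, 0, 0))).
move=> [[[a b] c] [[[k l] m] o]] e e0; have e7 : 0 < e / 7 by rewrite divr_gt0.
have [na] := qP a _ e7; have [nb] := qP b _ e7; have [nc] := qP c _ e7.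
have [nk] := hP k _ e7; have [nl] := hP l _ e7; have [nm] := hP m _ e7; have [no] := hP o _ e7.
move=> o_ m_ l_ k_ c_ b_ a_; exists (choice.pickle (na, nb, nc, (nk, nl, nm, no))).
rewrite choice.pickleK /dist.
have -> : e = e / 7 + e / 7 + e / 7 + e / 7 + e / 7 + e / 7 + e / 7 by field.
by rewrite !ltrD.
Qed.

Lemma wave_L_le w t x (c : R) : t \in `[0, T] -> wave_good T DA A w -> 0 <= c ->
  [/\ `|wave_amp w t| <= c, `|wave_damp w t| <= c & `|wave_dir w t| <= c] ->
  [/\ `|wave_ddir w t| <= c, `|adj DA A (wave_dir w t)| <= c & `|C (wave_dir w t)| <= c] ->
  `|wave_L C F w t x| <= (c + 2 * c ^+ 2 + c ^+ 3) * (1 + `|x| + `|F t x|).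
Proof.
move=> tT [_ _ hd _ _] c0 [ha hda hh] [hdh had hC].
have [_ _ adirE] := hd t tT.
have cos1 (z : R) : `|cos z| <= 1 by rewrite ler_norml cos_geN1 cos_le1.
have sin1 (z : R) : `|sin z| <= 1 by rewrite ler_norml sin_geN1 sin_le1.
have b1 (p q k : R) : `|p| <= k -> `|q| <= 1 -> `|p * q| <= k.
  move=> pc q1; rewrite normrM (le_trans (ler_wpM2l (normr_ge0 _) q1))// mulr1//.
have t1 := b1 _ _ _ hda (cos1 (wave_arg w t x)).
have t2 : `|wave_amp w t * dotp x (wave_ddir w t) * sin (wave_arg w t x)| <= c * (`|x| * c).
  apply: (b1 _ _ _ _ (sin1 _)); rewrite normrM ler_pM//.
  by rewrite (le_trans (dotp_le _ _))// ler_wpM2l.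
have t3 : `|2^-1 * wave_amp w t * dotp (C (wave_dir w t)) (wave_dir w t) * cos (wave_arg w t x)| <= 1 * c * (c * c).
  apply: (b1 _ _ _ _ (cos1 _)); rewrite !normrM ler_pM ?mulr_ge0//.
    by rewrite ler_pM// ger0_norm; lra.
  by rewrite (le_trans (dotp_le _ _))// ler_pM.
have t4 : `|wave_amp w t * (dotp x (wave_adir w t) + dotp (F t x) (wave_dir w t)) * sin (wave_arg w t x)| <= c * (`|x| * c + `|F t x| * c).
  apply: (b1 _ _ _ _ (sin1 _)); rewrite normrM ler_pM// (le_trans (ler_normD _ _))// lerD//.
    by rewrite (le_trans (dotp_le _ _))// adirE ler_wpM2l.
  by rewrite (le_trans (dotp_le _ _))// ler_wpM2l.
rewrite /wave_L /wave_dt.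
apply: (le_trans (ler_normB _ _)); apply: (le_trans (lerD (ler_normB _ _) (lexx _))).
apply: (le_trans (lerD (lerD (ler_normB _ _) (lexx _)) (lexx _))).
apply: (le_trans (lerD (lerD (lerD t1 t2) t3) t4)).
rewrite -subr_ge0; have n0 := normr_ge0 x; have f0 := normr_ge0 (F t x).
set X := `|x| in n0 *; set Y' := `|F t x| in f0 *.
rewrite (_ : _ - _ = 2 * c ^+ 2 + X * (c + c ^+ 3) + Y' * (c + c ^+ 2 + c ^+ 3)); last by ring.
by rewrite !addr_ge0 ?mulr_ge0 ?addr_ge0 ?mulr_ge0 ?exprn_ge0.
Qed.

(* The data of the waves form a separable space for uniform convergence. *)
Lemma countable_waves (w0 : @wave R H) : wave_good T DA A w0 -> exists w_ : nat -> @wave R H,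
  (forall n, wave_good T DA A (w_ n)) /\
  forall w, wave_good T DA A w -> exists (k : nat -> nat) (c : R),
    [/\ 0 <= c, forall j t x, t \in `[0, T] ->
          `|wave_L C F (w_ (k j)) t x| <= c * (1 + `|x| + `|F t x|),
        forall t x, t \in `[0, T] ->
          (fun j => wave_L C F (w_ (k j)) t x) @ \oo --> wave_L C F w t x
      & forall t x, t \in `[0, T] ->
          (fun j => wave_fun (w_ (k j)) t x) @ \oo --> wave_fun w t x].
Proof.
move=> gw0.
pose W := {w : @wave R H | wave_good T DA A w}.
pose g (w : W) := wave_data (proj1_sig w).
have dC x y : dist x y = dist y x.
  case: x => [[[a b] c] [[[k l] m] o]]; case: y => [[[a' b'] c'] [[[k' l'] m'] o']] /=.
  by rewrite (distrC a) (distrC b) (distrC c) (distrC k) (distrC l) (distrC m) (distrC o).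
have dD x y z : dist x z <= dist x y + dist y z.
  case: x => [[[a b] c] [[[k l] m] o]]; case: y => [[[a' b'] c'] [[[k' l'] m'] o']].
  case: z => [[[a2 b2] c2] [[[k2 l2] m2] o2]] /=.
  have h1 := ler_distD a' a a2; have h2 := ler_distD b' b b2; have h3 := ler_distD c' c c2.
  have h4 := ler_distD k' k k2; have h5 := ler_distD l' l l2; have h6 := ler_distD m' m m2.
  have h7 := ler_distD o' o o2.
  apply: (le_trans (lerD (lerD (lerD (lerD (lerD (lerD h1 h2) h3) h4) h5) h6) h7)).
  rewrite le_eqVlt; apply/orP; left; apply/eqP; ring.
have [P PP] := dist_dense.
have gc (w : W) x e : x \in `[0, T] -> 0 < e -> \forall y \near x, y \in `[0, T] -> dist (g w x) (g w y) < e.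
  move=> xT e0; have [[ca cda _] _ hd [ch cdh _] [cah _ _]] := proj2_sig w.
  have cC : {within `[0, T], continuous (C \o wave_dir (proj1_sig w))}.
    by move=> t; apply: (cvg_comp _ _ (ch t)); exact: Cc.
  have e7 : 0 < e / 7 by rewrite divr_gt0.
  have n1 := within_continuous_near ca xT e7; have n2 := within_continuous_near cda xT e7.
  have n4 := within_continuous_near ch xT e7; have n5 := within_continuous_near cdh xT e7.
  have n6 := within_continuous_near cah xT e7; have n7 := within_continuous_near cC xT e7.
  pose fI P1 P2 := @filterI _ _ (nbhs_filter x) P1 P2.
  have := fI _ _ (fI _ _ (fI _ _ n1 n2) (fI _ _ n4 n5)) (fI _ _ n6 n7).
  apply: filterS => y [[[m1 m2] [m4 m5]] [m6 m7]] yT.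
  rewrite /g /wave_data /dist subrr normr0.
  have -> : e = e / 7 + e / 7 + e / 7 + e / 7 + e / 7 + e / 7 + e / 7 by field.
  by rewrite !ltrD ?m1 ?m2 ?m4 ?m5 ?m6 ?m7.
have [w_ wP] := separable_paths dC dD PP gc (exist _ w0 gw0 : W).
exists (fun n => proj1_sig (w_ n)); split=> [n|w gw]; first exact: proj2_sig.
have /choice[k kP] : forall j : nat, exists n, forall t, t \in `[0, T] ->
    dist (wave_data w t) (wave_data (proj1_sig (w_ n)) t) < j.+1%:R^-1.
  by move=> j; apply: (wP (exist _ w gw : W)); rewrite invr_gt0 ltr0n.
pose wk j := proj1_sig (w_ (k j)).
have ineq (a b c h l m o e : R) : 0 <= a -> 0 <= b -> 0 <= c -> 0 <= h -> 0 <= l -> 0 <= m -> 0 <= o ->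
    a + b + c + h + l + m + o < e ->
    [/\ a < e, b < e, c < e & h < e] /\ [/\ l < e, m < e & o < e].
  by move=> *; split; split; lra.
have near j t : t \in `[0, T] ->
   [/\ `|wave_amp w t - wave_amp (wk j) t| < j.+1%:R^-1,
      `|wave_damp w t - wave_damp (wk j) t| < j.+1%:R^-1,
      `|wave_phase w - wave_phase (wk j)| < j.+1%:R^-1
    & `|wave_dir w t - wave_dir (wk j) t| < j.+1%:R^-1] /\
   [/\ `|wave_ddir w t - wave_ddir (wk j) t| < j.+1%:R^-1,
      `|adj DA A (wave_dir w t) - adj DA A (wave_dir (wk j) t)| < j.+1%:R^-1
    & `|C (wave_dir w t) - C (wave_dir (wk j) t)| < j.+1%:R^-1].
  move=> tT; have := kP j t tT; exact: ineq.
have cv (E : normedModType R) (a : E) (b : nat -> E) : (forall j, `|a - b j| < j.+1%:R^-1) -> b @ \oo --> a.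
  move=> h; apply/cvgrPdist_lt => e e0; have [m mP] := near_inv_succ_lt e0.
  by exists m => // j mj; apply: lt_trans (h j) (mP j mj).
have cvt t : t \in `[0, T] -> [/\ (fun j => wave_amp (wk j) t) @ \oo --> wave_amp w t,
      (fun j => wave_damp (wk j) t) @ \oo --> wave_damp w t,
      (fun j => wave_phase (wk j)) @ \oo --> wave_phase w
    & (fun j => wave_dir (wk j) t) @ \oo --> wave_dir w t] /\
   [/\ (fun j => wave_ddir (wk j) t) @ \oo --> wave_ddir w t,
      (fun j => wave_adir (wk j) t) @ \oo --> wave_adir w t
    & (fun j => C (wave_dir (wk j) t)) @ \oo --> C (wave_dir w t)].
  move=> tT.
  have adE w' : wave_good T DA A w' -> wave_adir w' t = adj DA A (wave_dir w' t).
    by move=> [_ _ h _ _]; have [_ _ ->] := h t tT.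
  split; split; try by apply: (cv R^o) => j; have [[]] := near j t tT.
  - by apply: cv => j; have [[]] := near j t tT.
  - by apply: cv => j; have [_ []] := near j t tT.
  - rewrite adE// (_ : (fun j => _) = (fun j => adj DA A (wave_dir (wk j) t))).
      by apply: cv => j; have [_ []] := near j t tT.
    by apply/funext => j; rewrite adE//; exact: proj2_sig.
  - by apply: cv => j; have [_ []] := near j t tT.
have carg t x : t \in `[0, T] -> (fun j => wave_arg (wk j) t x) @ \oo --> wave_arg w t x.
  move=> tT; have [[_ _ cp cd] _] := cvt t tT.
  by apply: cvgD => //; apply: cvg_dotp => //; exact: cvg_cst.
have ccos t x : t \in `[0, T] -> (fun j => cos (wave_arg (wk j) t x)) @ \oo --> cos (wave_arg w t x).
  by move=> tT; apply: (cvg_comp _ _ (carg t x tT)); exact: continuous_cos.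
have csin t x : t \in `[0, T] -> (fun j => sin (wave_arg (wk j) t x)) @ \oo --> sin (wave_arg w t x).
  by move=> tT; apply: (cvg_comp _ _ (carg t x tT)); exact: continuous_sin.
have [[ca cda _] _ hd [ch cdh _] [cah _ _]] := gw.
have cC : {within `[0, T], continuous (C \o wave_dir w)}.
  by move=> t; apply: (cvg_comp _ _ (ch t)); exact: Cc.
have [c1 c10 c1P] := within_continuous_bounded ca.
have [c2 c20 c2P] := within_continuous_bounded cda.
have [c3 c30 c3P] := within_continuous_bounded ch.
have [c4 c40 c4P] := within_continuous_bounded cdh.
have [c5 c50 c5P] := within_continuous_bounded cah.
have [c6 c60 c6P] := within_continuous_bounded cC.
(* The summand [1] covers the approximating waves, whose data are within [1/(j+1) <= 1] of those of
   [w]. *)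
pose c := c1 + c2 + c3 + c4 + c5 + c6 + 1.
have c0 : 0 <= c by rewrite !addr_ge0.
have bd (E : normedModType R) (a b : E) (e : R) j : `|a| <= e -> `|a - b| < j.+1%:R^-1 -> `|b| <= e + 1.
  move=> ae ab; have j1 : j.+1%:R^-1 <= 1 :> R by rewrite invf_le1 ?ler1n ?ltr0n.
  rewrite -(subrK a b) addrC (le_trans (ler_normD _ _))// lerD// distrC.
  exact: ltW (lt_le_trans ab j1).
exists k, (c + 2 * c ^+ 2 + c ^+ 3); split.
- by rewrite !addr_ge0 ?mulr_ge0 ?exprn_ge0.
- move=> j t x tT; have [[n1 n2 _ n4] [n5 n6 n7]] := near j t tT.
  apply: wave_L_le => //; first exact: proj2_sig.
  + split.
    * by apply: (le_trans (bd R^o _ _ _ _ (c1P t tT) n1)); rewrite /c; lra.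
    * by apply: (le_trans (bd R^o _ _ _ _ (c2P t tT) n2)); rewrite /c; lra.
    * by apply: (le_trans (bd _ _ _ _ _ (c3P t tT) n4)); rewrite /c; lra.
  + split.
    * by apply: (le_trans (bd _ _ _ _ _ (c4P t tT) n5)); rewrite /c; lra.
    * by apply: (le_trans (bd _ _ _ _ _ (c5P t tT) n6)); rewrite /c; lra.
    * by apply: (le_trans (bd _ _ _ _ _ (c6P t tT) n7)); rewrite /c; lra.
- move=> t x tT; have [[ka kda _ kd] [kdd kad kC]] := cvt t tT.
  have kcos := ccos t x tT; have ksin := csin t x tT.
  have dl (b : nat -> H) (h y : H) : b @ \oo --> h -> (fun j => dotp y (b j)) @ \oo --> dotp y h.
    by move=> bh; apply: cvg_dotp => //; exact: cvg_cst.
  rewrite /wave_L /wave_dt; apply: cvgB; last first.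
    apply: cvgM => //; apply: cvgM => //; apply: cvgD; exact: dl.
  apply: cvgB; last first.
    apply: cvgM => //; apply: cvgM; last exact: cvg_dotp.
    by apply: cvgM => //; exact: cvg_cst.
  apply: cvgB; first exact: cvgM.
  by apply: cvgM => //; apply: cvgM => //; exact: dl.
- by move=> t x tT; have [[ka _ _ _] _] := cvt t tT; apply: cvgM => //; exact: ccos.
Qed.

Lemma theta_bound t x : 1 + `|x| + `|F t x| <= 2 * theta t x.
Proof.
rewrite /theta; have := normr_ge0 x; have := normr_ge0 (F t x).
move: `|x| `|F t x| => a b b0 a0.
by have := mulr_ge0 (sqr_ge0 a) b0; have := sqr_ge0 (a - 1); rewrite !expr2 => ? ?; nra.
Qed.

Lemma lift_le_theta (g : R -> H -> R) (c : R) : 0 <= c ->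
  (forall t x, t \in `[0, T] -> `|g t x| <= c * (1 + `|x| + `|F t x|)) ->
  forall z, `|lift g z| <= 2 * c * lift theta z.
Proof.
move=> c0 gc z; rewrite /lift; case: ifPn => [/set_mem Dz|_]; last by rewrite normr0 mulr0.
have [t01 _] := DFc Dz; apply: (le_trans (gc _ _ t01)).
by rewrite [2 * c]mulrC -mulrA ler_wpM2l// theta_bound.
Qed.

Section determining_waves.
Variable w_ : nat -> @wave R H.
Hypothesis w_good : forall n, wave_good T DA A (w_ n).
Hypothesis w_dense : forall w, wave_good T DA A w -> exists (k : nat -> nat) (c : R),
  [/\ 0 <= c, forall j t x, t \in `[0, T] ->
          `|wave_L C F (w_ (k j)) t x| <= c * (1 + `|x| + `|F t x|),
        forall t x, t \in `[0, T] ->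
          (fun j => wave_L C F (w_ (k j)) t x) @ \oo --> wave_L C F w t x
      & forall t x, t \in `[0, T] ->
          (fun j => wave_fun (w_ (k j)) t x) @ \oo --> wave_fun w t x].

(** Dominated convergence along the approximating waves, with a multiple of [theta] as bound; this
    reduces the equation to countably many test functions. *)
Lemma weak_sol_of_waves s x (N : {measure set (borel_prod R H) -> \bar R}) : s \in `[0, T] ->
  N (~` live_set s) = 0%E -> (\int[N]_z (lift theta z)%:E < +oo)%E ->
  (forall n, \int[N]_z (lift (wave_L C F (w_ n)) z)%:E = (- wave_fun (w_ n) s x)%:E)%E ->
  weak_sol s x N.
Proof.
move=> s0T N0 Noo Nw; split=> //.
have theta_i : N.-integrable setT (EFin \o lift theta).
  apply/integrableP; split; first by apply/measurable_EFinP; exact: measurable_theta.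
  by under eq_integral do rewrite /= ger0_norm ?lift_theta_ge0//.
have mL w : wave_good T DA A w -> measurable_fun setT (lift (wave_L C F w)).
  by move=> /(test_fun_wave C F)/test_fun_measurable[_ m]; exact: measurable_lift.
have wP w : wave_good T DA A w ->
    (\int[N]_z (lift (wave_L C F w) z)%:E = (- wave_fun w s x)%:E)%E.
  move=> gw; have [k [c [c0 cL cvL cvw]]] := w_dense gw.
  have c1 : (\int[N]_z (lift (wave_L C F (w_ (k j))) z)%:E)%E @[j --> \oo] -->
      (\int[N]_z (lift (wave_L C F w) z)%:E)%E.
    apply: (@dominated_cvg _ _ _ N setT measurableT (fun j z => (lift (wave_L C F (w_ (k j))) z)%:E) _
      (fun z => (2 * c)%:E * (EFin \o lift theta) z)%E) => //.
    - by move=> j; apply/measurable_EFinP; exact: mL.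
    - move=> z _; apply: cvg_EFin; first exact: nearW.
      rewrite /lift; case: ifPn => [/set_mem Dz|_]; last exact: cvg_cst.
      by apply: cvL; have [] := DFc Dz.
    - exact: integrableZl.
    - by move=> j z _; rewrite /= lee_fin; apply: lift_le_theta => //; exact: cL.
  have c2 : (\int[N]_z (lift (wave_L C F (w_ (k j))) z)%:E)%E @[j --> \oo] --> (- wave_fun w s x)%:E.
    rewrite (_ : (fun j => _) = (fun j => (- wave_fun (w_ (k j)) s x)%:E)); last first.
      by apply/funext => j; rewrite Nw.
    by apply: cvg_EFin; [exact: nearW|apply: cvgN; exact: cvw].
  exact: (cvg_unique _ c1 c2).
move=> u Lu Gu; elim=> [|w u' Lu' Gu' gw tu ih].
  under eq_integral do rewrite /lift if_same.
  by rewrite integral0 oppr0.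
have -> : (\int[N]_z (lift (fun t y => (wave_L C F w t y + Lu' t y)%R) z)%:E =
    \int[N]_z ((lift (wave_L C F w) z)%:E + (lift Lu' z)%:E))%E.
  by apply: eq_integral => z _; rewrite /lift; case: ifP; rewrite -EFinD ?addr0.
rewrite integralD//; last 2 first.
- exact: (test_fun_integrable Noo (test_fun_wave C F gw)).
- exact: (test_fun_integrable Noo tu).
by rewrite wP// ih -EFinD opprD.
Qed.

End determining_waves.

Lemma countable_range_rat : countable (range (ratr : rat -> R)).
Proof. exact: (card_le_trans (card_image_le _ _) (countableP _)). Qed.

Let prod_coded : cantor_coded R (borel_prod R H).
Proof.
apply: cantor_coded_prod; last exact: cantor_coded_borel.
have sR : separable R^o by exists (range ratr); [exact: countable_range_rat|exact: dense_rat].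
have [b [k [mb mk bK]]] := cantor_coded_borel sR.
have mid : measurable_fun setT (id : measurableTypeR R -> borel R^o).
  by apply: measurable_fun_open => U oU; rewrite setTI; exact: open_measurable.
exists b, k; split=> //.
- by move=> n; exact: (measurableT_comp (mb n) mid).
- by move=> _ B mB; apply: mk => //; exact: measurable_borel.
Qed.

(** Every solution from time [s] has mass [T - s], so its normalization is a law with some code [z],
    and the rescaled decoded measure [Q z] is the solution again. By uniqueness [N x E = Q z E] for
    every code of a solution from [x]. *)
Lemma measurable_weak_sol s (D : set H) (N : H -> {finite_measure set (borel_prod R H) -> \bar R}) :
  0 <= s < T -> (forall x, D x -> weak_sol s x (N x)) ->
  (forall x (N' : {finite_measure set (borel_prod R H) -> \bar R}), D x -> weak_sol s x N' ->
    forall E, measurable E -> N' E = N x E) ->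
  forall E, measurable E -> measurable_fun (D : set (borel H)) (fun x : borel H => N x E).
Proof.
move=> s0T Nsol Nuniq E mE; have [s0 sT] := andP s0T.
have s01 : s \in `[0, T] by rewrite in_itv/= s0 ltW.
have sT0 : 0 <= T - s by rewrite subr_ge0 ltW.
have sTn0 : T - s != 0 by rewrite subr_eq0 gt_eqF.
have [w0 gw0] : exists w0 : @wave R H, wave_good T DA A w0.
  have adj0 : adj DA A 0 = 0 by apply: (adj_unique dDA) => y _; rewrite !dotp0r.
  have c0 (E' : normedModType R) : C1_with T (fun _ : R => (0 : E')) (fun=> 0).
    split; [by apply: continuous_subspaceT; exact: cst_continuous..|].
    by move=> t _; exact: is_derive_cst.
  exists (Wave (fun=> 0) (fun=> 0) (fun=> 0) (fun=> 0) (fun=> 0) 0); split=> //=.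
  - by move=> t _; split; [by exists 0 => y _; rewrite !dotp0r..|rewrite adj0].
  - by apply: (C1_with_eq _ _ (c0 H)) => t _ /=; rewrite adj0.
have [w_ [w_good w_dense]] := countable_waves gw0.
have [Psi mPsi PsiP] := cantor_coded_law prod_coded.
have mPz (z : R) : measurable_fun setT (fun w : measurableTypeR R => Psi z w : borel_prod R H).
  exact: (measurableT_comp mPsi (pair1_measurable z)).
have /choice[Q QE] : forall z : measurableTypeR R, exists q : {finite_measure set (borel_prod R H) -> \bar R},
    forall B, q B = ((T - s)%:E * unit_law [set w | B (Psi z w)])%E.
  move=> z; have [q qE] := pushforward_ex (@unit_law R) (mPz z).
  have [|q' q'E] := @finite_measure_ex R _ _ (mscale (NngNum sT0) q).
    have qT : q setT = 1%E by rewrite qE; exact: (@probability_setT _ _ _ (@unit_law R)).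
    by rewrite /= /mscale /= qT mule1 ltry.
  by exists q' => B; rewrite q'E /= /mscale /= qE.
have mQ B : measurable B -> measurable_fun setT (fun z : measurableTypeR R => Q z B).
  move=> mB; under eq_fun do rewrite QE; apply: measurable_funeM.
  exact: (measurable_unit_law_section mPsi mB).
have mQi (f : Y -> \bar R) : measurable_fun setT f -> (forall y, 0 <= f y)%E ->
    measurable_fun setT (fun z : measurableTypeR R => \int[Q z]_y f y)%E.
  by move=> mf f0; exact: (measurable_mixture_integral mQ mf f0).
pose L n : Y -> R := lift (wave_L C F (w_ n)).
have mL n : measurable_fun setT (EFin \o L n).
  have [_ m] := test_fun_measurable (test_fun_wave C F (w_good n)).
  by apply/measurable_EFinP; exact: measurable_lift.
(* [G1] gathers the conditions on the measure alone; [G2 n] is the equation for wave [n], in which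
   point and code are coupled. *)
pose G1 : set (measurableTypeR R) := [set z | Q z (~` live_set s) = 0%E /\ (\int[Q z]_y (lift theta y)%:E < +oo)%E].
pose G2 n : set (borel H * measurableTypeR R) := [set xz |
  (\int[Q xz.2]_y (L n y)%:E = (- wave_fun (w_ n) s xz.1)%:E)%E].
pose G : set (borel H * measurableTypeR R) := snd @^-1` G1 `&` \bigcap_n G2 n.
have mG1 : measurable G1.
  apply: measurableI.
    have mB : measurable (~` live_set s : set Y) by apply: measurableC; exact: measurable_live_set.
    by rewrite -[X in measurable X]setTI; exact: (mQ _ mB measurableT _ (emeasurable_set1 0%E)).
  rewrite (_ : (fun z => _) = setT `&` (fun z => \int[Q z]_y (lift theta y)%:E)%E @^-1` (~` [set +oo%E])).
    apply: mQi => //; first by apply/measurable_EFinP; exact: measurable_theta.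
      by move=> y; rewrite lee_fin lift_theta_ge0.
    by apply: measurableC; exact: emeasurable_set1.
  by rewrite setTI; apply/seteqP; split=> z /=; rewrite ltey; [move/eqP|move=> h; apply/eqP].
have mG2 n : measurable (G2 n).
  pose a (xz : borel H * measurableTypeR R) := (\int[Q xz.2]_y (L n y)%:E + (wave_fun (w_ n) s xz.1)%:E)%E.
  have -> : G2 n = setT `&` a @^-1` [set 0%E].
    rewrite setTI; apply/seteqP; split=> -[x z]; rewrite /G2 /a /=.
      by move=> ->; rewrite -EFinD addNr.
    case: (\int[_]_ _ _)%E => [q| |] //= [q0]; congr (_%:E).
    by apply/eqP; rewrite -subr_eq0 opprK q0.
  have ma : measurable_fun setT a.
    have mz : measurable_fun setT (fun z : measurableTypeR R => \int[Q z]_y (L n y)%:E)%E.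
      under eq_fun do rewrite integralE.
      apply: emeasurable_funB.
        by apply: mQi; [apply: measurable_funepos; exact: mL|move=> y; exact: funepos_ge0].
      by apply: mQi; [apply: measurable_funeneg; exact: mL|move=> y; exact: funeneg_ge0].
    apply: emeasurable_funD; first exact: (measurableT_comp mz measurable_snd).
    apply/measurable_EFinP.
    have mw := test_fun_section_measurable (test_fun_wave C F (w_good n)) s01.
    exact: (measurableT_comp mw measurable_fst).
  by apply: ma => //; exact: emeasurable_set1.
apply: (@measurable_fun_unique_code R H D _ G (fun z => Q z E) sH).
- apply: measurableI; last exact: bigcapT_measurable.
  by rewrite -[X in measurable X]setTI; exact: measurable_snd.
- exact: mQ.
- move=> x Dx; have [P PE] : exists P : probability (borel_prod R H) R, forall B, P B = ((T - s)^-1%:E * N x B)%E.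
    pose P : probability (borel_prod R H) R := mnormalize (N x) (dirac (((0 : R), (0 : H)) : borel_prod R H)).
    have mass : N x setT = (T - s)%:E.
      have := weak_sol_marginal s0T (Nsol x Dx) measurableT; rewrite setXTT => ->.
      by rewrite setTI lebesgue_measure_itv /= lte_fin sT -EFinB.
    by exists P => B; rewrite /P /= /mnormalize /= mass eqe (negbTE sTn0) /= muleC.
  have [z z01 zP] := PsiP P; exists z => //.
  have NQ B : measurable B -> Q z B = N x B.
    move=> mB; rewrite QE -zP// PE muleA -EFinM mulfV// mul1e//.
  have [N0 Noo Nt] := Nsol x Dx.
  have iQ f : (\int[Q z]_y f y = \int[N x]_y f y)%E by apply: eq_measure_integral => B mB _; exact: NQ.
  split; first split.
  + by rewrite /= NQ//; apply: measurableC; exact: measurable_live_set.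
  + by rewrite /= iQ.
  + by move=> n _; rewrite /G2 /= iQ; apply: Nt; exact: test_fun_wave.
- move=> x z Dx z01 [[/= q1 q2] q3]; apply/esym; apply: Nuniq => //.
  apply: (weak_sol_of_waves w_good w_dense s01 q1 q2) => n; exact: q3.
Qed.

(** * Chapman-Kolmogorov on space-time *)

Lemma ge0_integral_sum_measure (N m1 m2 : {measure set Y -> \bar R}) (f : Y -> \bar R) :
  (forall B, measurable B -> N B = m1 B + m2 B)%E ->
  measurable_fun setT f -> (forall z, 0 <= f z)%E ->
  (\int[N]_z f z = \int[m1]_z f z + \int[m2]_z f z)%E.
Proof.
move=> NE mf f0; rewrite -ge0_integral_measure_add//.
apply: eq_measure_integral => B mB _; rewrite NE//.
exact: esym (measure_addE m1 m2 B).
Qed.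

Lemma integral_sum_measure (N m1 m2 : {measure set Y -> \bar R}) (f : Y -> \bar R) :
  (forall B, measurable B -> N B = m1 B + m2 B)%E ->
  m1.-integrable setT f -> m2.-integrable setT f ->
  (\int[N]_z f z = \int[m1]_z f z + \int[m2]_z f z)%E.
Proof.
move=> NE f1 f2; rewrite -integral_measure_add//.
apply: eq_measure_integral => B mB _; rewrite NE//.
exact: esym (measure_addE m1 m2 B).
Qed.

Lemma measurable_kernel_sublevel (s : R) (D : set H) (N : H -> {measure set Y -> \bar R}) (n : nat) :
  measurable (D : set (borel H)) ->
  (forall E, measurable E -> measurable_fun (D : set (borel H)) (fun x : borel H => N x E)) ->
  measurable (D `&` [set x | (\int[N x]_z (lift theta z)%:E <= n%:R%:E)%E] : set (borel H)).
Proof.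
move=> mD mN.
have mt : measurable_fun setT (fun z : Y => (lift theta z)%:E).
  by apply/measurable_EFinP; exact: measurable_theta.
have t0 (z : Y) : (0 <= (lift theta z)%:E)%E by rewrite lee_fin lift_theta_ge0.
exact: (emeasurable_fun_infty_c mD (measurable_mixture_integral mN mt t0) n%:R%:E).
Qed.

(** The competitor [M'] consists of [N] before [s], the mixture over [K] and the second part [m2] of
    [mu]. It solves the equation from [(r, x)], so it equals [N]; cancelling the common parts gives
    [Mix = m1 <= mu]. *)
Lemma ck_truncated r s x (D : set H) (N mu : {finite_measure set Y -> \bar R})
    (zeta : probability (borel H) R) (Nf : H -> {finite_measure set Y -> \bar R}) (n : nat) :
  0 <= r -> r < s < T ->
  weak_sol r x N ->
  (forall N' : {finite_measure set Y -> \bar R}, weak_sol r x N' ->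
    forall E, measurable E -> N' E = N E) ->
  (forall B, measurable B -> mu B = N (B `&` (`[s, T]%classic `*` setT))) ->
  weak_evo s zeta mu ->
  measurable (D : set (borel H)) ->
  (forall y, D y -> weak_sol s y (Nf y)) ->
  (forall E, measurable E -> measurable_fun (D : set (borel H)) (fun y : borel H => Nf y E)) ->
  forall E, measurable E ->
    (\int[zeta]_(y in D `&` [set y | (\int[Nf y]_z (lift theta z)%:E <= n%:R%:E)%E]) Nf y E <= mu E)%E.
Proof.
move=> r0 /andP[rs sT] wN uniq muE wmu mD Nsol mNf E mE.
have s0T : 0 <= s < T by rewrite sT (le_trans r0 (ltW rs)).
set K := D `&` _; have mK : measurable (K : set (borel H)) by exact: measurable_kernel_sublevel.
have KD : K `<=` D by move=> y [].
have s01 : s \in `[0, T] by case/andP: s0T => s0 _; rewrite in_itv/= s0 ltW.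
have [m1 [m2 [muE12 m1P]]] := weak_evo_split s0T mK wmu.
have mk B : measurable B -> measurable_fun (K : set (borel H)) (fun y : borel H => Nf y B).
  by move=> mB; apply: (measurable_funS mD KD); exact: mNf.
have [Mix MixE] := mixture_ex zeta mK mk.
have mt : measurable_fun setT (fun z : Y => (lift theta z)%:E).
  by apply/measurable_EFinP; exact: measurable_theta.
have t0 (z : Y) : (0 <= (lift theta z)%:E)%E by rewrite lee_fin lift_theta_ge0.
(* The truncation at level [n] serves here: without it the mixture might fail to integrate
   [theta]. *)
have Mix_theta : (\int[Mix]_z (lift theta z)%:E < +oo)%E.
  rewrite (ge0_mixture_integral mK mk (fun B _ => MixE B) mt t0).
  apply: (@le_lt_trans _ _ (\int[zeta]_(y in K) n%:R%:E)%E).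
    apply: ge0_le_integral => //.
    - by move=> y _; apply: integral_ge0.
    - exact: (measurable_mixture_integral mk mt t0).
    - by move=> y [].
  rewrite integral_cst// (@le_lt_trans _ _ (n%:R%:E * 1))%E ?mule1 ?ltry//.
  by rewrite -[leRHS]mule1 lee_wpmul2l ?lee_fin// probability_le1.
pose E0 : set Y := `[s, T]%classic `*` setT.
have mE0 : measurable E0 by apply: measurableX => //; exact: measurable_itv.
have mE0c : measurable (~` E0) by exact: measurableC.
pose rho : {measure set Y -> \bar R} := mrestr N mE0c.
have NE B : measurable B -> (N B = rho B + mu B)%E.
  move=> mB; rewrite muE// /rho /= /mrestr -measureU//.
  - by rewrite -setIUr setUC setUv setIT.
  - exact: measurableI.
  - exact: measurableI.
  - by rewrite setIACA setICl setI0.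
have [N0 Noo Nt] := wN; have [mu0 muoo _] := wmu.
have rhoN B : measurable B -> (rho B <= N B)%E by move=> mB; rewrite NE// leeDl.
have muN B : measurable B -> (mu B <= N B)%E by move=> mB; rewrite NE// leeDr.
have m1mu B : measurable B -> (m1 B <= mu B)%E by move=> mB; rewrite muE12// leeDl.
have m2mu B : measurable B -> (m2 B <= mu B)%E by move=> mB; rewrite muE12// leeDr.
have le_theta (a b : {measure set Y -> \bar R}) : (forall B, measurable B -> a B <= b B)%E ->
    (\int[b]_z (lift theta z)%:E < +oo)%E -> (\int[a]_z (lift theta z)%:E < +oo)%E.
  by move=> ab; apply: le_lt_trans; apply: ge0_le_measure_integral.
have rho_theta := le_theta _ _ rhoN Noo.
have m1_theta := le_theta _ _ m1mu muoo.
have m2_theta := le_theta _ _ m2mu muoo.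
pose M' : {measure set Y -> \bar R} := measure_add (measure_add rho Mix) m2.
have M'E B : M' B = (rho B + Mix B + m2 B)%E.
  exact: (etrans (measure_addE (measure_add rho Mix) m2 B) (congr1 (fun q => q + m2 B)%E (measure_addE rho Mix B))).
have M'_theta : (\int[M']_z (lift theta z)%:E < +oo)%E.
  rewrite (@ge0_integral_sum_measure M' (measure_add rho Mix) m2)//; last first.
    by move=> B _; exact: measure_addE.
  rewrite lte_add_pinfty// (@ge0_integral_sum_measure (measure_add rho Mix) rho Mix)//.
    by rewrite lte_add_pinfty.
  by move=> B _; exact: measure_addE.
have Mix0 : Mix (~` live_set s) = 0%E.
  rewrite MixE; apply: integral0_eq => y Ky.
  by have [-> _ _] := Nsol y (KD y Ky).
have live_sub : ~` live_set r `<=` ~` live_set s.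
  move=> z h [Dz [zt _]]; apply: h; split=> //; split=> //.
  by move: zt; rewrite /= !in_itv/= => /andP[sz ->]; rewrite (le_trans (ltW rs)).
have mL t : measurable (~` live_set t : set Y) by apply: measurableC; exact: measurable_live_set.
have M'sol : weak_sol r x M'.
  split=> //.
    rewrite M'E.
    have -> : rho (~` live_set r) = 0%E.
      by apply/eqP; rewrite eq_le measure_ge0 andbT -N0 rhoN//; exact: (mL r).
    have -> : m2 (~` live_set r) = 0%E.
      apply/eqP; rewrite eq_le measure_ge0 andbT -N0 (le_trans (m2mu _ (mL r)))// muN//; exact: (mL r).
    have -> : Mix (~` live_set r) = 0%E.
      by apply/eqP; rewrite eq_le measure_ge0 andbT -Mix0 le_measure//; apply: mem_set; exact: mL.
    by rewrite !adde0.
  move=> u Lu Gu tu.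
  have i_rho := test_fun_integrable rho_theta tu.
  have i_m1 := test_fun_integrable m1_theta tu.
  have i_m2 := test_fun_integrable m2_theta tu.
  have i_mu := test_fun_integrable muoo tu.
  have i_Mix := test_fun_integrable Mix_theta tu.
  rewrite (@integral_sum_measure M' (measure_add rho Mix) m2)//; last 2 first.
  - by move=> B _; exact: measure_addE.
  - apply: (test_fun_integrable _ tu).
    rewrite (@ge0_integral_sum_measure (measure_add rho Mix) rho Mix)//.
      by rewrite lte_add_pinfty.
    by move=> B _; exact: measure_addE.
  rewrite (@integral_sum_measure (measure_add rho Mix) rho Mix)//; last first.
    by move=> B _; exact: measure_addE.
  (* For test functions the exchange is neutral: mixture and [m1] have the same initial data [zeta]
     restricted to [K]. *)
  have -> : (\int[Mix]_z (lift Lu z)%:E = \int[m1]_z (lift Lu z)%:E)%E.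
    have [_ _ ->] := mixture_integral mK mk (fun B _ => MixE B) i_Mix.
    rewrite (m1P _ _ _ tu) -integralN; last first.
      exact: integrable_add_def (test_fun_K_integral zeta mK s01 tu).
    by apply: eq_integral => y /set_mem Ky; have [_ _ h] := Nsol y (KD y Ky); rewrite (h _ _ _ tu).
  by rewrite -addeA -(integral_sum_measure muE12)// -(integral_sum_measure NE)// (Nt _ _ _ tu).
have M'oo := weak_sol_finite M'sol.
have [N' N'E] := finite_measure_ex M'oo.
have N'sol : weak_sol r x N'.
  have iN f : (\int[N']_z f z = \int[M']_z f z)%E by apply: eq_measure_integral => B _ _; exact: N'E.
  have [a b c] := M'sol; split.
  - by have := N'E (~` (DF `&` (`[r, T]%classic `*` setT))); rewrite a.
  - by rewrite iN.
  - by move=> u Lu Gu tu; rewrite iN; exact: c tu.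
have := uniq N' N'sol E mE; rewrite N'E M'E NE// muE12// -!addeA => h.
have rf : rho E \is a fin_num.
  by rewrite ge0_fin_numE// (le_lt_trans (rhoN E mE))// -ge0_fin_numE// fin_num_measure.
have m2f : m2 E \is a fin_num by rewrite fin_num_measure.
have : Mix E = m1 E.
  have cancel (a b c e : \bar R) : a \is a fin_num -> c \is a fin_num ->
      (a + (b + c) = a + (e + c) -> b = e)%E.
    case: a => [a| |] // _; case: c => [c| |] // _; case: b => [b| |]; case: e => [e| |] //= [h'].
    by congr (_%:E); lra.
  exact: cancel rf m2f h.
by rewrite MixE => ->; rewrite leeDl.
Qed.

(** The sets [K n] exhaust [D] because each single solution integrates [theta], so the mixture over
    [D] is at most [mu]. Equal total mass excludes strict inequality on any set. *)
Lemma chapman_kolmogorov_spacetime r s x (D : set H) (N mu : {finite_measure set Y -> \bar R})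
    (zeta : probability (borel H) R) (Nf : H -> {finite_measure set Y -> \bar R}) :
  0 <= r -> r < s < T ->
  weak_sol r x N ->
  (forall N' : {finite_measure set Y -> \bar R}, weak_sol r x N' ->
    forall E, measurable E -> N' E = N E) ->
  (forall B, measurable B -> mu B = N (B `&` (`[s, T]%classic `*` setT))) ->
  weak_evo s zeta mu ->
  measurable (D : set (borel H)) -> zeta D = 1%E ->
  (forall y, D y -> weak_sol s y (Nf y)) ->
  (forall E, measurable E -> measurable_fun (D : set (borel H)) (fun y : borel H => Nf y E)) ->
  forall E, measurable E -> (mu E = \int[zeta]_(y in D) Nf y E)%E.
Proof.
move=> r0 rsT wN uniq muE wmu mD zD Nsol mNf; have [rs sT] := andP rsT.
have s0T : 0 <= s < T by rewrite sT (le_trans r0 (ltW rs)).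
have r0T : 0 <= r < T by rewrite r0 (lt_trans rs sT).
pose K n : set (borel H) := D `&` [set y | (\int[Nf y]_z (lift theta z)%:E <= n%:R%:E)%E].
have mK n : measurable (K n) by exact: measurable_kernel_sublevel.
have KD n : K n `<=` D by move=> y [].
have Kmono : {homo K : n m / (n <= m)%N >-> (n <= m)%O}.
  move=> n m nm; rewrite subsetEset => y [Dy yn]; split=> //.
  by apply: le_trans yn _; rewrite /= lee_fin ler_nat.
have KU : \bigcup_n K n = D.
  apply/seteqP; split=> [y [n _ []]//|y Dy].
  have [_ yoo _] := Nsol y Dy.
  have y0 : (0 <= \int[Nf y]_z (lift theta z)%:E)%E.
    by apply: integral_ge0 => z _; rewrite lee_fin lift_theta_ge0.
  exists (Num.truncn (fine (\int[Nf y]_z (lift theta z)%:E))).+1 => //; split=> //=.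
  have yfin : (\int[Nf y]_z (lift theta z)%:E)%E \is a fin_num by rewrite ge0_fin_numE.
  by rewrite -[leLHS]fineK// lee_fin ltW// truncnS_gt.
have le_mu E : measurable E -> (\int[zeta]_(y in D) Nf y E <= mu E)%E.
  move=> mE; rewrite -KU.
  have c := @ge0_nondecreasing_set_cvg_integral _ (borel H) R K (fun y => Nf y E) zeta Kmono mK
    (fun n => measurable_funS mD (@KD n) (mNf E mE)) (fun n y _ => measure_ge0 _ _).
  rewrite -(cvg_lim _ c)//; apply: lime_le; first by apply/cvg_ex; eexists; exact: c.
  by apply: nearW => n; apply: (ck_truncated n r0 rsT wN uniq muE wmu mD Nsol mNf).
have massN t y (N' : {finite_measure set Y -> \bar R}) : 0 <= t < T -> weak_sol t y N' ->
    N' setT = (T - t)%:E.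
  move=> /andP[t0 tT] wN'; have t0T : 0 <= t < T by rewrite t0.
  have := weak_sol_marginal t0T wN' measurableT; rewrite setXTT => ->.
  by rewrite setTI lebesgue_measure_itv /= lte_fin tT -EFinB.
have mass_mu : mu setT = (T - s)%:E.
  rewrite muE// setTI.
  have := weak_sol_marginal r0T wN (measurable_itv `[s, T]); move=> ->.
  rewrite setIidl; first by rewrite lebesgue_measure_itv /= lte_fin sT -EFinB.
  by move=> t /=; rewrite !in_itv/= => /andP[st ->]; rewrite (le_trans (ltW rs)).
have mass_int : (\int[zeta]_(y in D) Nf y setT = (T - s)%:E)%E.
  have -> : (\int[zeta]_(y in D) Nf y setT = \int[zeta]_(y in D) (T - s)%:E)%E.
    by apply: eq_integral => y /set_mem Dy; rewrite (massN s y)//; exact: Nsol.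
  transitivity ((T - s)%:E * zeta D)%E; last by rewrite zD mule1.
  exact: integral_cst.
move=> E mE; apply/eqP; rewrite eq_le le_mu// andbT leNgt; apply/negP => lt.
have mEc : measurable (~` E) by exact: measurableC.
have muU : (mu setT = mu E + mu (~` E))%E by rewrite -measureU// ?setICr// setUv.
have intU : (\int[zeta]_(y in D) Nf y setT = \int[zeta]_(y in D) Nf y E + \int[zeta]_(y in D) Nf y (~` E))%E.
  rewrite -ge0_integralD//; [|exact: mNf|exact: mNf].
  by apply: eq_integral => y _; rewrite -measureU// ?setICr// setUv.
have : (mu setT > \int[zeta]_(y in D) Nf y setT)%E.
  rewrite muU intU; apply: lte_leD => //; last exact: le_mu.
  rewrite ge0_fin_numE; last by apply: integral_ge0.
  by apply: le_lt_trans (le_mu _ mEc) _; rewrite -ge0_fin_numE// fin_num_measure.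
by rewrite mass_mu mass_int ltxx.
Qed.

(** * Fixed times *)

(** The window opens to the right, as [t] may be the initial time; its length is a fraction of
    [T - t], so that it stays inside the time interval. *)
Let J (t : R) (n : nat) : set (measurableTypeR R) := `[t, t + (T - t) / n.+1%:R]%classic.

Let window (u : R -> H -> R) (t : R) (n : nat) (z : Y) : R :=
  \1_(J t n `*` setT : set Y) z * lift u z.

Let mJ t n : measurable (J t n). Proof. exact: measurable_itv. Qed.

Let J_len t n : t < T -> lebesgue_measure (J t n) = ((T - t) / n.+1%:R)%:E.
Proof.
move=> tT; have l0 : 0 < (T - t) / n.+1%:R by rewrite divr_gt0 ?subr_gt0 ?ltr0n.
rewrite /J lebesgue_measure_itv /= lte_fin ltrDl l0 -EFinB; congr (_%:E).
by rewrite addrC addKr.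
Qed.

Let J_sub s t n : s <= t < T -> J t n `<=` `[s, T]%classic.
Proof.
move=> /andP[st tT] q; rewrite /J /= !in_itv/= => /andP[tq q1].
rewrite (le_trans st tq) (le_trans q1)//= -lerBrDl ler_pdivrMr ?ltr0n//.
by rewrite ler_peMr ?ler1n// subr_ge0 ltW.
Qed.

Lemma average_cvg (g : R -> R) (c s t : R) : s <= t < T ->
  {within `[s, T], continuous g} -> (forall q, q \in `[s, T] -> `|g q| <= c) ->
  exists m : nat -> R,
  [/\ forall n, ((n.+1%:R / (T - t))%:E * \int[lebesgue_measure]_(q in J t n) (g q)%:E = (m n)%:E)%E,
    forall n, `|m n| <= c & m @ \oo --> g t].
Proof.
move=> stT cg gc; have [st tT] := andP stT.
pose mu : {measure set (measurableTypeR R) -> \bar R} := lebesgue_measure.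
have gi n : mu.-integrable (J t n) (EFin \o g).
  apply: continuous_compact_integrable; first exact: segment_compact.
  have sub : (`[t, t + (T - t) / n.+1%:R]%classic : set R) `<=` `[s, T]%classic by exact: J_sub.
  exact: (continuous_subspaceW sub cg).
pose m n : R := n.+1%:R / (T - t) * fine (\int[mu]_(q in J t n) (g q)%:E).
have mE n : (\int[mu]_(q in J t n) (g q)%:E = (fine (\int[mu]_(q in J t n) (g q)%:E))%:E)%E.
  by rewrite fineK//; apply: integrable_fin_num => //; exact: gi.
have Tt0 : 0 < T - t by rewrite subr_gt0.
have bnd n a e : (forall q, J t n q -> `|g q - a| <= e) -> `|m n - a| <= e.
  move=> h; have l0 : 0 < (T - t) / n.+1%:R by rewrite divr_gt0 ?ltr0n.
  have cst_i (k : R) : mu.-integrable (J t n) (EFin \o cst k).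
    apply: continuous_compact_integrable; first exact: segment_compact.
    by apply: continuous_subspaceT; exact: cst_continuous.
  have cst_e (k : R) : (\int[mu]_(q in J t n) k%:E = (k * ((T - t) / n.+1%:R))%:E)%E.
    have len : mu (J t n) = ((T - t) / n.+1%:R)%:E by exact: J_len.
    transitivity (k%:E * mu (J t n))%E; first exact: integral_cst.
    by rewrite len -EFinM.
  have up : (\int[mu]_(q in J t n) (g q)%:E <= ((a + e) * ((T - t) / n.+1%:R))%:E)%E.
    rewrite -cst_e; apply: (le_integral (mJ t n) (gi n) (cst_i (a + e))) => q Jq; rewrite lee_fin.
    by have := h q (set_mem Jq); rewrite ler_distl /=; lra.
  have lo : (((a - e) * ((T - t) / n.+1%:R))%:E <= \int[mu]_(q in J t n) (g q)%:E)%E.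
    rewrite -cst_e; apply: (le_integral (mJ t n) (cst_i (a - e)) (gi n)) => q Jq; rewrite lee_fin.
    by have := h q (set_mem Jq); rewrite ler_distl /=; lra.
  have mI : m n = fine (\int[mu]_(q in J t n) (g q)%:E) / ((T - t) / n.+1%:R) by rewrite /m mulrC invf_div.
  by rewrite ler_distl mI ler_pdivrMr// ler_pdivlMr// -!lee_fin -mE up lo.
exists m; split=> [n|n|].
- by rewrite mE -EFinM.
- rewrite -[m n]subr0; apply: bnd => q Jq; rewrite subr0; apply: gc.
  exact: (J_sub stT Jq).
- apply/cvgrPdist_le => e e0.
  have tsT : t \in `[s, T] by rewrite in_itv/= st ltW.
  have /nbhs_ballP[d /= d0 dP] := within_continuous_near cg tsT e0.
  have dT : 0 < d / (T - t) by rewrite divr_gt0.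
  have [k kP] := near_inv_succ_lt dT.
  exists k => // n kn; rewrite distrC; apply: bnd => q Jq; rewrite distrC ltW//.
  apply: dP; last exact: (J_sub stT Jq).
  move: Jq; rewrite /J /ball /= in_itv/= => /andP[q1 q2].
  rewrite distrC ger0_norm ?subr_ge0// ltrBlDl (le_lt_trans q2)// ltrD2l.
  by rewrite mulrC -ltr_pdivlMr//; exact: kP.
Qed.

(** The averages are integrals against [N], so the value at the fixed time [t] of the continuous map
    is determined by the space-time measure. *)
Lemma time_average s (N : {finite_measure set Y -> \bar R}) (nu : R -> probability (borel H) R)
    u Lu Gu (c t : R) : 0 <= s -> s <= t < T -> disintegration T s N nu ->
  N (~` live_set s) = 0%E -> (\int[N]_z (lift theta z)%:E < +oo)%E ->
  test_fun T DA A C F u Lu Gu ->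
  (forall q y, q \in `[0, T] -> `|u q y| <= c) ->
  {within `[s, T], continuous (fun q => \int[nu q]_y u q y)} ->
  exists m : nat -> R,
  [/\ forall n, ((n.+1%:R / (T - t))%:E * \int[N]_z (window u t n z)%:E = (m n)%:E)%E,
    forall n, `|m n| <= c & m @ \oo --> \int[nu t]_y u t y].
Proof.
move=> s0 stT dN N0 Noo tu uc cu; have [st tT] := andP stT.
have sub0 q : q \in `[s, T] -> q \in `[0, T].
  by rewrite !in_itv/= => /andP[sq ->]; rewrite (le_trans s0).
have ui q : q \in `[s, T] -> (nu q).-integrable setT (fun y => (u q y)%:E).
  by move=> qT; apply: (test_fun_initial_integrable (nu q) (sub0 q qT) tu).
have [|m [mE mc mcv]] := average_cvg stT cu (c := c).
  move=> q qT; rewrite -lee_fin.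
  have -> : `|\int[nu q]_y u q y|%:E = `|\int[nu q]_y (u q y)%:E|%E.
    by rewrite /Rintegral -[in RHS](fineK (integrable_fin_num measurableT (ui q qT))).
  have mq := test_fun_section_measurable tu (sub0 q qT).
  apply: (le_trans (le_abse_integral (nu q) measurableT _)).
    by apply/measurable_EFinP.
  apply: (@le_trans _ _ (\int[nu q]_y c%:E)%E).
    apply: ge0_le_integral => //.
    - by apply/measurable_EFinP; exact: measurableT_comp.
    - by move=> y _; rewrite lee_fin uc// sub0.
  rewrite (_ : (\int[nu q]_y c%:E)%E = c%:E)//.
  transitivity (c%:E * nu q setT)%E; first exact: integral_cst.
  by rewrite probability_setT mule1.
exists m; split=> // n; rewrite -mE; congr (_ * _)%E.
have Nui := test_fun_integrable0 Noo tu.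
have wi : N.-integrable setT (EFin \o window u t n).
  apply: (le_integrable measurableT _ _ Nui) => [|z _].
    have /integrableP[/measurable_EFinP mL _] := Nui.
    apply/measurable_EFinP; apply: measurable_funM => //; apply: measurable_indic.
    exact: measurableX.
  rewrite /= lee_fin /window indicE; case: (_ \in _); first by rewrite mul1r.
  by rewrite mul0r normr0.
have [_ _ ->] := disintegration_integral dN wi.
rewrite [RHS]integral_mkcond [LHS]integral_mkcond; apply: integral_ae_congr.
have aenu := (disintegration_slice dN).1 N0.
apply: ae_imply aenu _ => q h _; rewrite /patch.
case: (boolP (q \in J t n)) => qJ; last first.
  case: ifP => // _; under eq_integral => y _.
    rewrite /window indicE memNset ?mul0r; last by move=> -[h' _]; move/negP : qJ; apply; exact: mem_set.
    over.
  by rewrite integral0.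
have qT : q \in `[s, T] by exact: (J_sub stT (set_mem qJ)).
rewrite mem_set//; transitivity (\int[nu q]_y (u q y)%:E)%E.
  apply: integral_ae_congr; exists (~` slice DF q); split.
  - by apply: measurableC; exact: measurable_slice.
  - have := probability_setC (nu q) (measurable_slice q); rewrite h// subee// => h'; exact: h'.
  - move=> y /= h' Dy; apply: h' => _; rewrite /window lift_in//= indicE mem_set ?mul1r//.
    by split=> //; exact: set_mem.
rewrite /Rintegral fineK//; apply: integrable_fin_num => //; exact: ui.
Qed.

(** The space-time identity holds for each window average, and bounded convergence in [y] passes to
    time [t]. Measurability of the inner integral comes out as a limit of measurable averages. *)
Lemma ck_test_fun r s t x (D : set H) (N mu : {finite_measure set Y -> \bar R})
    (zeta : probability (borel H) R) (nu : R -> probability (borel H) R)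
    (Nf : H -> {finite_measure set Y -> \bar R}) (kap : H -> R -> probability (borel H) R)
    u Lu Gu : 0 <= r -> r < s < T -> s <= t < T ->
  disintegration T r N nu -> weak_sol r x N ->
  (forall B, measurable B -> mu B = N (B `&` (`[s, T]%classic `*` setT))) ->
  measurable (D : set (borel H)) ->
  (forall y, D y -> disintegration T s (Nf y) (kap y)) ->
  (forall y, D y -> weak_sol s y (Nf y)) ->
  (forall E, measurable E -> measurable_fun (D : set (borel H)) (fun y : borel H => Nf y E)) ->
  (forall E, measurable E -> mu E = \int[zeta]_(y in D) Nf y E)%E ->
  test_fun T DA A C F u Lu Gu ->
  {within `[r, T], continuous (fun q => \int[nu q]_y u q y)} ->
  (forall y, D y -> {within `[s, T], continuous (fun q => \int[kap y q]_z u q z)}) ->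
  measurable_fun (D : set (borel H)) (fun y : borel H => \int[kap y t]_z u t z) /\
  (\int[zeta]_(y in D) (\int[kap y t]_z u t z)%:E = (\int[nu t]_y u t y)%:E)%E.
Proof.
move=> r0 /andP[rs sT] stT dN wN muE mD dNf Nsol mNf ck tu cu cuf; have [st tT] := andP stT.
have s0 : 0 <= s by rewrite (le_trans r0) ?ltW.
have rtT : r <= t < T by rewrite tT (le_trans (ltW rs)).
have [c c0 cP] := test_fun_bound tu.
have uc q y : q \in `[0, T] -> `|u q y| <= c by move=> qT; case: (cP q y qT).
have [N0 Noo _] := wN.
have [m0 [m0E m0c m0l]] := time_average r0 rtT dN N0 Noo tu uc cu.
have /choice[m mP] : forall y, exists m : nat -> R, D y ->
   [/\ forall n, ((n.+1%:R / (T - t))%:E * \int[Nf y]_z (window u t n z)%:E = (m n)%:E)%E,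
    forall n, `|m n| <= c & m @ \oo --> \int[kap y t]_z u t z].
  move=> y; have [Dy|nDy] := pselect (D y); last by exists (fun=> 0).
  have [Ny0 Nyoo _] := Nsol y Dy.
  by have [m mP] := time_average s0 stT (dNf y Dy) Ny0 Nyoo tu uc (cuf y Dy); exists m.
have mw n : measurable_fun setT (fun z => (window u t n z)%:E).
  apply/measurable_EFinP; apply: measurable_funM; first by apply: measurable_indic; exact: measurableX.
  have [mu' _] := test_fun_measurable tu; apply: measurable_lift.
  exact: (measurable_funS mcyl DFc mu').
have mm n : measurable_fun (D : set (borel H)) (fun y : borel H => (m y n)%:E).
  have : measurable_fun (D : set (borel H)) (fun y : borel H => (n.+1%:R / (T - t))%:E * \int[Nf y]_z (window u t n z)%:E)%E.
    apply: measurable_funeM; under eq_fun do rewrite integralE.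
    apply: emeasurable_funB; apply: (measurable_mixture_integral mNf).
    - exact: measurable_funepos.
    - by move=> z; exact: funepos_ge0.
    - exact: measurable_funeneg.
    - by move=> z; exact: funeneg_ge0.
  apply: eq_measurable_fun => y /set_mem Dy.
  by have [-> _ _] := mP y Dy.
have mmR n : measurable_fun (D : set (borel H)) (fun y : borel H => m y n).
  by apply/measurable_EFinP; exact: mm.
have mlim y : D y -> m y n @[n --> \oo] --> \int[kap y t]_z u t z by move=> /mP[].
split; first by apply: (@measurable_fun_cvg _ (borel H) R D (fun n y => m y n)).
have avg n : (\int[zeta]_(y in D) (m y n)%:E = (m0 n)%:E)%E.
  have wc z : `|window u t n z| <= c * 1.
    rewrite /window normrM mulrC ler_pM//; last by rewrite indicE; case: (_ \in _); rewrite ?normr1 ?normr0.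
    rewrite /lift; case: ifPn => [/set_mem Dz|_]; last by rewrite normr0.
    by apply: uc; case: (DFc Dz).
  have wi (Q : {finite_measure set Y -> \bar R}) : Q.-integrable setT (fun z => (window u t n z)%:E).
    apply: (@le_integrable _ _ _ Q setT measurableT _ (cst (c * 1)%:E)) => //.
    - by move=> z _; rewrite /= lee_fin (le_trans (wc z))// ler_norm.
    - exact: finite_measure_integrable_cst.
  have [_ _ e] := mixture_integral mD mNf ck (wi mu).
  have e2 : (\int[mu]_z (window u t n z)%:E = \int[N]_z (window u t n z)%:E)%E.
    have mE : measurable (`[s, T]%classic `*` setT : set Y) by apply: measurableX => //; exact: measurable_itv.
    have [_ ->] := eq_mrestr_integrable mE muE (wi N).
    rewrite integral_mkcond; apply: eq_integral => z _; rewrite /patch; case: ifPn => // zE.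
    rewrite /window indicE memNset ?mul0r// => -[zJ _]; move/negP : zE; apply; apply: mem_set.
    by split=> //; exact: (J_sub stT zJ).
  rewrite -m0E -e2 e -integralZl//; last first.
    have [_ h _] := mixture_integral mD mNf ck (wi mu); exact: h.
  by apply: eq_integral => y /set_mem Dy; have [h _ _] := mP y Dy; rewrite h.
have c1 : (\int[zeta]_(y in D) (m y n)%:E)%E @[n --> \oo] --> (\int[zeta]_(y in D) (\int[kap y t]_z u t z)%:E)%E.
  apply: (@dominated_cvg _ _ _ zeta D mD (fun n y => (m y n)%:E) _ (fun=> c%:E)) => //.
  - by move=> y Dy; apply: cvg_EFin; [exact: nearW|exact: mlim].
  - exact: finite_measure_integrable_cst.
  - by move=> n y Dy; rewrite /= lee_fin; have [_ h _] := mP y Dy.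
have c2 : (\int[zeta]_(y in D) (m y n)%:E)%E @[n --> \oo] --> (\int[nu t]_y u t y)%:E.
  rewrite (_ : (fun n => _) = (fun n => (m0 n)%:E)); last by apply/funext.
  by apply: cvg_EFin; [exact: nearW|].
exact: (cvg_unique _ c1 c2).
Qed.

End weak_form.

(** * Wiener integrals *)

Lemma ge0_integral_image {R : realType} d1 d2 (X : measurableType d1) (Y : measurableType d2)
    (P : {measure set X -> \bar R}) (m : {measure set Y -> \bar R}) (f : X -> Y) (g : Y -> \bar R) :
  measurable_fun setT f -> (forall B, measurable B -> m B = P (f @^-1` B)) ->
  measurable_fun setT g -> (forall y, 0 <= g y)%E ->
  (\int[m]_y g y = \int[P]_x g (f x))%E.
Proof.
move=> mf mE mg g0.
pose k (x : X) : {measure set Y -> \bar R} := dirac (f x).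
have kE x B : k x B = (\1_(f @^-1` B) x)%:E by rewrite /k /= diracE !indicE.
have mfB B : measurable B -> measurable (f @^-1` B).
  by move=> mB; rewrite -[X in measurable X]setTI; exact: mf.
have mk B : measurable B -> measurable_fun setT (fun x => k x B).
  move=> mB; under eq_fun do rewrite kE; apply/measurable_EFinP.
  by apply: measurable_indic; exact: mfB.
have mix B : measurable B -> m B = (\int[P]_(x in setT) k x B)%E.
  move=> mB; rewrite mE//; under eq_integral do rewrite kE.
  by rewrite integral_indic ?setIT//; exact: mfB.
rewrite (ge0_mixture_integral measurableT mk mix mg g0).
by apply: eq_integral => x _; rewrite integral_dirac// diracT mul1e.
Qed.

Lemma integral_image {R : realType} d1 d2 (X : measurableType d1) (Y : measurableType d2)
    (P : {measure set X -> \bar R}) (m : {measure set Y -> \bar R}) (f : X -> Y) (g : Y -> \bar R) :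
  measurable_fun setT f -> (forall B, measurable B -> m B = P (f @^-1` B)) ->
  measurable_fun setT g -> (\int[m]_y g y = \int[P]_x g (f x))%E.
Proof.
move=> mf mE mg; rewrite integralE [RHS]integralE; congr (_ - _)%E.
- have g0 y : (0 <= g^\+ y)%E by exact: funepos_ge0.
  by rewrite (ge0_integral_image mf mE (measurable_funepos mg) g0); apply: eq_integral => x _; rewrite !funepos.unlock.
- have g0 y : (0 <= g^\- y)%E by exact: funeneg_ge0.
  by rewrite (ge0_integral_image mf mE (measurable_funeneg mg) g0); apply: eq_integral => x _; rewrite !funeneg.unlock.
Qed.

(** A crude second moment, by comparison with the density of deviation [2 * sigma]. With
    [y = x^2 / (2 sigma^2)], the constant [8] is [2] from [x^2], [2] from the ratio of the peaks and
    [2] from [y exp(-3y/4) <= 2]. *)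
Lemma normal_prob_sqr {R : realType} (sigma : R) : 0 < sigma ->
  (\int[normal_prob 0 sigma]_x (x ^+ 2)%:E <= (8 * sigma ^+ 2)%:E)%E.
Proof.
move=> s0; have s20 : 0 < 2 * sigma by rewrite mulr_gt0.
have sn : sigma != 0 by rewrite gt_eqF.
have sn2 : 2 * sigma != 0 by rewrite gt_eqF.
have msq : measurable_fun setT (fun x : measurableTypeR R => (x ^+ 2)%:E).
  by apply/measurable_EFinP; exact: measurable_funX.
have mpdf (q : R) : measurable_fun setT (fun x : measurableTypeR R => (normal_pdf 0 q x)%:E).
  by apply/measurable_EFinP; exact: measurable_normal_pdf.
have pk : normal_peak sigma = 2 * normal_peak (2 * sigma).
  rewrite /normal_peak (_ : (2 * sigma) ^+ 2 * pi *+ 2 = 2 ^+ 2 * (sigma ^+ 2 * pi *+ 2)); last by ring.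
  by rewrite [in RHS]sqrtrM ?exprn_ge0// sqrtr_sqr ger0_norm// invfM mulrA mulfV// mul1r.
have E : (\int[normal_prob 0 sigma]_x (x ^+ 2)%:E =
    \int[lebesgue_measure]_x (x ^+ 2 * normal_pdf 0 sigma x)%:E)%E.
  pose k (x : measurableTypeR R) : {measure set (measurableTypeR R) -> \bar R} :=
    mscale (NngNum (normal_pdf_ge0 0 sigma x)) (dirac x).
  have kE x B : k x B = (normal_pdf 0 sigma x * \1_B x)%:E by rewrite /k /= /mscale /= diracE EFinM indicE.
  have mk (B : set (measurableTypeR R)) : measurable B -> measurable_fun setT (fun x => k x B).
    move=> mB; under eq_fun do rewrite kE; apply/measurable_EFinP.
    by apply: measurable_funM; [exact: measurable_normal_pdf|exact: measurable_indic].
  have mix (B : set (measurableTypeR R)) : measurable B ->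
      normal_prob 0 sigma B = (\int[lebesgue_measure]_(x in setT) k x B)%E.
    move=> mB; rewrite /normal_prob /= /normal_prob integral_mkcond; apply: eq_integral => x _.
    by rewrite kE /patch indicE; case: ifP => _; rewrite ?mulr1 ?mulr0.
  rewrite (ge0_mixture_integral measurableT mk mix msq)//; last first.
    by move=> x; rewrite lee_fin sqr_ge0.
  apply: eq_integral => x _; rewrite /k ge0_integral_mscale//; last first.
    by move=> y _; rewrite lee_fin sqr_ge0.
  by rewrite integral_dirac// diracT mul1e /= -EFinM mulrC.
rewrite E; apply: (@le_trans _ _ (\int[lebesgue_measure]_x ((8 * sigma ^+ 2)%:E * (normal_pdf 0 (2 * sigma) x)%:E))%E).
  apply: ge0_le_integral => //.
  - by move=> x _; rewrite lee_fin mulr_ge0 ?sqr_ge0 ?normal_pdf_ge0.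
  - by apply/measurable_EFinP; apply: measurable_funM; [exact: measurable_funX|exact: measurable_normal_pdf].
  - by apply: measurable_funeM.
  move=> x _; rewrite -EFinM lee_fin !normal_pdfE// pk /normal_fun subr0.
  pose y := x ^+ 2 / (sigma ^+ 2 *+ 2).
  have y0 : 0 <= y by rewrite divr_ge0 ?sqr_ge0// mulrn_wge0 ?sqr_ge0.
  have xy : x ^+ 2 = 2 * sigma ^+ 2 * y by rewrite /y -mulr_natl; field.
  have -> : - x ^+ 2 / ((2 * sigma) ^+ 2 *+ 2) = - (y / 4) by rewrite /y; field.
  have -> : - x ^+ 2 / (sigma ^+ 2 *+ 2) = - (y / 4) - 3 / 4 * y by rewrite /y; field.
  rewrite expRD [expR (- (y / 4))]expRN.
  have e1 : y * expR (- (3 / 4 * y)) <= 2.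
    rewrite expRN -ler_pdivlMr ?invr_gt0 ?expR_gt0// invrK.
    by have := expR_ge1Dx (3 / 4 * y); lra.
  have p0 : 0 <= normal_peak (2 * sigma) * (expR (y / 4))^-1.
    by rewrite mulr_ge0 ?normal_peak_ge0// invr_ge0 expR_ge0.
  rewrite xy (_ : _ * (_ * _) = 4 * sigma ^+ 2 * (normal_peak (2 * sigma) * (expR (y / 4))^-1) * (y * expR (- (3 / 4 * y)))); last first.
    ring.
  rewrite (_ : 8 * _ * _ = 4 * sigma ^+ 2 * (normal_peak (2 * sigma) * (expR (y / 4))^-1) * 2); last by ring.
  by rewrite ler_wpM2l// mulr_ge0// mulr_ge0 ?sqr_ge0.
rewrite ge0_integralZl//; last 2 first.
- by move=> x _; rewrite lee_fin normal_pdf_ge0.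
- by rewrite lee_fin mulr_ge0 ?sqr_ge0.
by rewrite integral_normal_pdf mule1.
Qed.

Section cylindrical_wiener.
Context {R : realType} {H : hilbertType R} d (Om : measurableType d) (P : probability Om R).
Variables (G : R -> set (set Om)) (W : R -> H -> Om -> R).
Hypothesis fG : filtration G.
Hypothesis cW : cylindrical_wiener P G W.

Let GS t : 0 <= t -> sigma_algebra setT (G t). Proof. by case: fG => h _ _; exact: h. Qed.
Let Gm t : 0 <= t -> G t `<=` measurable. Proof. by case: fG => _ h _; exact: h. Qed.
Let Gle r t : 0 <= r -> r <= t -> G r `<=` G t. Proof. by case: fG => _ _ h; exact: h. Qed.

(* Measurability with respect to G t, through the sigma-algebra type. *)
Let adapted (t : R) (Z : Om -> R) := measurable_fun setT (Z : g_sigma_algebraType (G t) -> R).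

Let adaptedE t Z : 0 <= t -> adapted t Z -> forall B : set (measurableTypeR R), measurable B -> G t (Z @^-1` B).
Proof.
move=> t0 aZ B mB; have := aZ measurableT B mB; rewrite setTI.
by rewrite /measurable /= (sigma_algebra_id (GS t0)).
Qed.

Let adapted_measurable t Z : 0 <= t -> adapted t Z -> measurable_fun setT Z.
Proof. by move=> t0 aZ _ B mB; rewrite setTI; apply: (Gm t0); exact: adaptedE. Qed.

Let adapted_le r t Z : 0 <= r -> r <= t -> adapted r Z -> adapted t Z.
Proof.
move=> r0 rt aZ _ B mB; rewrite setTI /measurable /= (sigma_algebra_id (GS (le_trans r0 rt))).
by apply: (Gle r0 rt); exact: adaptedE.
Qed.

Let W_adapted t h : 0 <= t -> adapted t (W t h).
Proof.
case: cW => h1 _ _ _ _ t0 _ B mB.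
by rewrite setTI /measurable /= (sigma_algebra_id (GS t0)); exact: h1.
Qed.

Let incr_adapted r t h : 0 <= r -> r <= t -> adapted t (increment W r t h).
Proof.
move=> r0 rt; apply: measurable_funB; first by apply: W_adapted; exact: le_trans rt.
exact: (adapted_le r0 rt (W_adapted h r0)).
Qed.

Let m_incr r t h : 0 <= r -> r <= t -> measurable_fun setT (increment W r t h).
Proof. by move=> r0 rt; apply: (@adapted_measurable t); [exact: le_trans rt|exact: incr_adapted]. Qed.

Lemma ae_W0 t : 0 <= t -> {ae P, forall w, W t 0 w = 0}.
Proof.
case: cW => _ lin _ _ _ t0; apply: ae_imply (lin t 1 0 0 t0) _ => w.
by rewrite scaler0 addr0 mul1r => h; apply/eqP; rewrite -(inj_eq (addrI (W t 0 w))) addr0 -h.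
Qed.

Lemma ae_increment_lin r t (a : R) h k : 0 <= r -> r <= t ->
  {ae P, forall w, increment W r t (a *: h + k) w = a * increment W r t h w + increment W r t k w}.
Proof.
case: cW => _ lin _ _ _ r0 rt.
apply: ae_imply2 (lin r a h k r0) (lin t a h k (le_trans r0 rt)) _ => w h1 h2.
by rewrite /increment h1 h2; ring.
Qed.

Lemma ae_increment0 r t : 0 <= r -> r <= t -> {ae P, forall w, increment W r t 0 w = 0}.
Proof.
move=> r0 rt; apply: ae_imply2 (ae_W0 r0) (ae_W0 (le_trans r0 rt)) _ => w h1 h2.
by rewrite /increment h1 h2 subr0.
Qed.

Lemma increment_sqr r t h : 0 <= r -> r <= t ->
  (\int[P]_w (increment W r t h w ^+ 2)%:E <= (8 * ((t - r) * `|h| ^+ 2))%:E)%E.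
Proof.
move=> r0; rewrite le_eqVlt => /predU1P[->|rt].
  under eq_integral do rewrite /increment subrr expr0n /=.
  by rewrite integral0 subrr mul0r mulr0.
have [->|h0] := eqVneq h 0.
  have -> : (\int[P]_w (increment W r t 0 w ^+ 2)%:E = \int[P]_w 0)%E.
    apply: integral_ae_congr; apply: ae_imply (ae_increment0 r0 (ltW rt)) _ => w -> _.
    by rewrite expr0n.
  by rewrite integral0 normr0 expr0n /= !mulr0.
have [_ _ _ law _] := cW.
have m := m_incr h r0 (ltW rt).
have msq : measurable_fun setT (fun x : measurableTypeR R => (x ^+ 2)%:E).
  by apply/measurable_EFinP; exact: measurable_funX.
have E : (\int[P]_w (increment W r t h w ^+ 2)%:E =
    \int[normal_prob 0 (Num.sqrt (t - r) * `|h|)]_x (x ^+ 2)%:E)%E.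
  have sq0 (x : measurableTypeR R) : (0 <= (x ^+ 2)%:E :> \bar R)%E by rewrite lee_fin sqr_ge0.
  have lawE (B : set (measurableTypeR R)) : measurable B ->
      normal_prob 0 (Num.sqrt (t - r) * `|h|) B = P (increment W r t h @^-1` B).
    by move=> mB; rewrite law.
  apply/esym; exact: (@ge0_integral_image R _ _ Om (measurableTypeR R) P (normal_prob 0 (Num.sqrt (t - r) * `|h|)) _ _ m lawE msq sq0).
have tr : 0 < t - r by rewrite subr_gt0.
rewrite E; apply: le_trans (normal_prob_sqr _) _.
  by rewrite mulr_gt0 ?sqrtr_gt0 ?normr_gt0.
by rewrite exprMn sqr_sqrtr// ltW.
Qed.

Let sqr_integrable (Z : Om -> R) := measurable_fun setT Z /\ (\int[P]_w (Z w ^+ 2)%:E < +oo)%E.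

Let prod_integrable Z X : sqr_integrable Z -> sqr_integrable X ->
  P.-integrable setT (fun w => (Z w * X w)%:E).
Proof.
move=> [mZ Zoo] [mX Xoo]; apply/integrableP; split.
  by apply/measurable_EFinP; exact: measurable_funM.
apply: (@le_lt_trans _ _ (\int[P]_w ((Z w ^+ 2)%:E + (X w ^+ 2)%:E))%E).
  apply: ge0_le_integral => //.
  - by apply/measurable_EFinP; apply: measurableT_comp => //; exact: measurable_funM.
  - by apply: emeasurable_funD; apply/measurable_EFinP; exact: measurable_funX.
  move=> w _; rewrite /= -EFinD lee_fin normrM -(real_normK (num_real (Z w))) -(real_normK (num_real (X w))).
  have := normr_ge0 (Z w); have := normr_ge0 (X w); move: `|Z w| `|X w| => a b a0 b0.
  by have := sqr_ge0 (a - b); nra.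
rewrite ge0_integralD//; last 4 first.
- by move=> w _; rewrite lee_fin sqr_ge0.
- by apply/measurable_EFinP; exact: measurable_funX.
- by move=> w _; rewrite lee_fin sqr_ge0.
- by apply/measurable_EFinP; exact: measurable_funX.
exact: lte_add_pinfty.
Qed.

Let sqr_incr r t h : 0 <= r -> r <= t -> sqr_integrable (increment W r t h).
Proof.
move=> r0 rt; split; first exact: m_incr.
by apply: le_lt_trans (increment_sqr h r0 rt) _; rewrite ltry.
Qed.

(* (Z, X) and (Z, -X) have the same law when X is an increment after r. *)
Let incr_ortho r t h Z : 0 <= r -> r <= t -> adapted r Z -> sqr_integrable Z ->
  (\int[P]_w (Z w * increment W r t h w)%:E = 0)%E.
Proof.
move=> r0; rewrite le_eqVlt => /predU1P[->|rt] aZ sZ.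
  under eq_integral do rewrite /increment subrr mulr0.
  by rewrite integral0.
have [->|h0] := eqVneq h 0.
  transitivity (\int[P]_w (cst 0%E w))%E; last exact: integral0.
  apply: integral_ae_congr; apply: ae_imply (ae_increment0 r0 (ltW rt)) _ => w -> _.
  by rewrite mulr0.
have [_ _ _ law ind] := cW.
have mZ : measurable_fun setT Z by case: sZ.
pose X k := increment W r t k.
have mX k : measurable_fun setT (X k) by exact: m_incr (ltW rt).
have mp k : measurable_fun setT (fun w => (Z w, X k w) : measurableTypeR R * measurableTypeR R).
  by apply/measurable_fun_pairP; split; [exact: mZ|exact: mX].
have rect k A B : k != 0 -> measurable A -> measurable B ->
    P ((fun w => (Z w, X k w)) @^-1` (A `*` B)) = (P (Z @^-1` A) * normal_prob 0 (Num.sqrt (t - r) * `|k|) B)%E.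
  move=> k0 mA mB; rewrite -(law r t k B r0 rt k0 mB) -(ind r t k B (Z @^-1` A) r0 (ltW rt) mB (adaptedE r0 aZ mA)).
  by congr (P _); apply/seteqP; split.
have [m1 m1E] := pushforward_ex P (mp h).
have [m2 m2E] := pushforward_ex P (mp (- h)).
have m12 : forall E, measurable E -> m1 E = m2 E.
  apply: eq_measure_prod.
    by rewrite m1E preimage_setT (le_lt_trans (probability_le1 _ _)) ?ltry.
  move=> A B mA mB; rewrite m1E m2E.
  transitivity (P (Z @^-1` A) * normal_prob 0 (Num.sqrt (t - r) * `|h|) B)%E; first exact: rect.
  by rewrite -(normrN h); apply/esym; apply: rect => //; rewrite oppr_eq0.
have mmul : measurable_fun setT (fun zx : measurableTypeR R * measurableTypeR R => (zx.1 * zx.2)%:E).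
  by apply/measurable_EFinP; apply: measurable_funM; [exact: measurable_fst|exact: measurable_snd].
have push k (m : {measure set (measurableTypeR R * measurableTypeR R) -> \bar R}) :
    (forall B, m B = P ((fun w => (Z w, X k w)) @^-1` B)) ->
    (\int[m]_zx (zx.1 * zx.2)%:E = \int[P]_w (Z w * X k w)%:E)%E.
  by move=> mE; rewrite (integral_image (mp k) (fun B _ => mE B)).
have e : (\int[P]_w (Z w * X h w)%:E = \int[P]_w (Z w * X (- h) w)%:E)%E.
  rewrite -(push _ _ m1E) -(push _ _ m2E).
  by apply: eq_measure_integral => B mB _; exact: m12.
have neg : (\int[P]_w (Z w * X (- h) w)%:E = - \int[P]_w (Z w * X h w)%:E)%E.
  rewrite -integralN; last first.
    by apply: integrable_add_def => //; exact: (prod_integrable sZ (sqr_incr h r0 (ltW rt))).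
  apply: integral_ae_congr.
  apply: ae_imply2 (ae_increment_lin (-1) h 0 r0 (ltW rt)) (ae_increment0 r0 (ltW rt)) _ => w e1 e2 _.
  by rewrite /X -EFinN -mulrN; congr (_ * _)%:E; rewrite -scaleN1r -[_ *: h]addr0 e1 e2 mulN1r addr0.
have fin := integrable_fin_num measurableT (prod_integrable sZ (sqr_incr h r0 (ltW rt))).
move: e; rewrite neg -/(X h); move: fin; rewrite -/(X h).
case: (\int[P]_w (Z w * X h w)%:E)%E => // q _ [] /eqP; rewrite -subr_eq0 opprK -mulr2n mulrn_eq0 /= => /eqP ->.
by [].
Qed.

(** The partial sum up to [tau n] is adapted, hence orthogonal to the next increment, and the second
    moments add up. *)
Lemma increments_sqr (tau : nat -> R) (v : nat -> H) n : 0 <= tau 0%N ->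
  (forall i, tau i <= tau i.+1) ->
  measurable_fun setT (fun w => \sum_(i < n) increment W (tau i) (tau i.+1) (v i) w) /\
  (\int[P]_w ((\sum_(i < n) increment W (tau i) (tau i.+1) (v i) w) ^+ 2)%:E <=
    (8 * \sum_(i < n) (tau i.+1 - tau i) * `|v i| ^+ 2)%:E)%E.
Proof.
move=> t0 tS; have t0n i : 0 <= tau i by elim: i => [//|i /le_trans]; apply.
pose Z n w := \sum_(i < n) increment W (tau i) (tau i.+1) (v i) w.
suff h : adapted (tau n) (Z n) /\
    (\int[P]_w (Z n w ^+ 2)%:E <= (8 * \sum_(i < n) (tau i.+1 - tau i) * `|v i| ^+ 2)%:E)%E.
  by case: h => h1 h2; split=> //; exact: (adapted_measurable (t0n n) h1).
elim: n => [|n [aZ Zle]].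
  split; first by rewrite /adapted /Z; under eq_fun do rewrite big_ord0; exact: measurable_cst.
  by under eq_integral do rewrite /Z big_ord0 expr0n /=; rewrite integral0 big_ord0 mulr0.
have sZ : sqr_integrable (Z n).
  by split; [exact: (adapted_measurable (t0n n) aZ)|apply: le_lt_trans Zle _; rewrite ltry].
pose X := increment W (tau n) (tau n.+1) (v n).
have sX : sqr_integrable X by exact: sqr_incr.
have ZS w : Z n.+1 w = Z n w + X w by rewrite /Z big_ord_recr.
split.
  rewrite /adapted (_ : Z n.+1 = fun w => Z n w + X w); last exact/funext.
  apply: measurable_funD; first exact: (adapted_le (t0n n) (tS n) aZ).
  exact: incr_adapted.
have sqr_i Z' : sqr_integrable Z' -> P.-integrable setT (fun w => (Z' w ^+ 2)%:E).
  move=> [mZ' Z'oo]; apply/integrableP; split; first by apply/measurable_EFinP; exact: measurable_funX.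
  by under eq_integral do rewrite /= ger0_norm ?sqr_ge0//.
have pi := prod_integrable sZ sX.
have -> : (\int[P]_w (Z n.+1 w ^+ 2)%:E =
    \int[P]_w ((Z n w ^+ 2)%:E + (X w ^+ 2)%:E + 2%:E * (Z n w * X w)%:E))%E.
  by apply: eq_integral => w _; rewrite ZS -EFinM -!EFinD; congr (_%:E); ring.
rewrite integralD//; last 2 first.
- by apply: integrableD => //; exact: sqr_i.
- exact: integrableZl.
rewrite integralD//; [|exact: sqr_i|exact: sqr_i].
rewrite integralZl// (incr_ortho (v n) (t0n n) (tS n) aZ sZ) mule0 adde0.
rewrite big_ord_recr /= mulrDr EFinD leeD//; exact: increment_sqr.
Qed.

Let sum_double (f : nat -> R) n : \sum_(i < n.*2) f i = \sum_(k < n) (f k.*2 + f k.*2.+1).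
Proof. by elim: n => [|n ih]; rewrite ?big_ord0// doubleS !big_ord_recr /= ih addrA. Qed.

Let grid_step (s T : R) n k : grid s T n k.+1 - grid s T n k = (T - s) / n%:R.
Proof. by rewrite /grid -natr1; ring. Qed.

Let grid_last (s T : R) n : (0 < n)%N -> grid s T n n = T.
Proof. by move=> n0; rewrite /grid mulfV ?pnatr_eq0 -?lt0n// mulr1 addrC subrK. Qed.

Definition riemann_sum (s t : R) (g : R -> H) n (w : Om) : R :=
  \sum_(k < n) increment W (grid s t n k) (grid s t n k.+1) (g (grid s t n k)) w.

(* The grids of [s, T] and [s, t] are chosen to interleave: a k <= b k <= a k.+1. *)
Lemma riemann_sum_diff (s t T M L : R) (g : R -> H) n (p := Num.truncn (n%:R * ((t - s) / (T - s)))) :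
  0 <= s -> s < t < T -> (0 < p)%N -> 0 <= L ->
  (forall q, q \in `[s, T] -> `|g q| <= M) ->
  (forall q q', q \in `[s, T] -> q' \in `[s, T] -> q <= q' -> `|g q' - g q| <= L * (q' - q)) ->
  [/\ measurable_fun setT (riemann_sum s T g n), measurable_fun setT (riemann_sum s t g p)
    & (\int[P]_w ((riemann_sum s T g n w - riemann_sum s t g p w) ^+ 2)%:E <=
      (8 * (L ^+ 2 * ((T - s) / n%:R) ^+ 2 * (T - s) + M ^+ 2 * (T - t)))%:E)%E].
Proof.
move=> s0 /andP[st tT] p0 L0 gM gL.
have Ts : 0 < T - s by rewrite subr_gt0 (lt_trans st).
have ts : 0 < t - s by rewrite subr_gt0.
have n0 : (0 < n)%N by rewrite lt0n; apply/eqP => n0; move: p0; rewrite /p n0 mul0r truncn0.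
have nR : 0 < n%:R :> R by rewrite ltr0n.
have pR : 0 < p%:R :> R by rewrite ltr0n.
pose Dl := (T - s) / n%:R.
have Dl0 : 0 < Dl by rewrite divr_gt0.
have /andP[p1 p2] : p%:R * (T - s) <= n%:R * (t - s) < p.+1%:R * (T - s).
  have /truncn_itv : 0 <= n%:R * ((t - s) / (T - s)) by rewrite mulr_ge0// divr_ge0 ?ltW.
  by rewrite -/p mulrA ler_pdivlMr// ltr_pdivrMr.
have pn : (p < n)%N.
  rewrite -(ltr_nat R) -(ltr_pM2r Ts) (le_lt_trans p1)// ltr_pM2l// ltrD2r//.
pose a k := grid s T n k.
pose b k := if (k <= p)%N then grid s t p k else a k.
have aS k : a k.+1 = a k + Dl by rewrite /Dl -(grid_step s T n k) -/(a k) -/(a k.+1); ring.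
have a0 : a 0%N = s by rewrite /a /grid mul0r mulr0 addr0.
have b0 : b 0%N = s by rewrite /b leq0n /grid mul0r mulr0 addr0.
have an : a n = T by exact: grid_last.
have bp : b p = t by rewrite /b leqnn; exact: grid_last.
have ab k : a k <= b k.
  rewrite /b; case: ifP => // kp; rewrite /a /grid lerD2l !mulrA ler_pdivrMr// mulrAC ler_pdivlMr//.
  rewrite -![_ * k%:R * _]mulrA ![k%:R * _]mulrC !mulrA ler_wpM2r//.
  by rewrite mulrC [leRHS]mulrC.
have ba k : b k <= a k.+1.
  rewrite /b; case: ifP => kp; last by rewrite aS lerDl ltW.
  rewrite /a /grid lerD2l !mulrA ler_pdivrMr// mulrAC ler_pdivlMr//.
  have k0 : 0 <= k%:R :> R by [].
  have kpR : k%:R <= p%:R :> R by rewrite ler_nat.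
  apply: (@le_trans _ _ (k%:R * (p.+1%:R * (T - s)))).
    by rewrite [leLHS](_ : _ = k%:R * (n%:R * (t - s))); [rewrite ler_wpM2l// ltW|ring].
  rewrite -subr_ge0 -!natr1 (_ : _ - _ = (p%:R - k%:R) * (T - s)); last by ring.
  by rewrite mulr_ge0 ?(ltW Ts)// subr_ge0.
have am k m : (k <= m)%N -> a k <= a m.
  by move=> km; rewrite /a /grid lerD2l ler_wpM2l ?(ltW Ts)// ler_wpM2r ?invr_ge0// ler_nat.
have aI k : (k <= n)%N -> a k \in `[s, T] by move=> kn; rewrite in_itv/= -{1}a0 -an !am.
have bI k : (k <= p)%N -> b k \in `[s, T].
  move=> kp; rewrite in_itv/= -{1}a0 (le_trans (am 0%N k _) (ab k))//= (le_trans (ba k))//.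
  by rewrite -an am// (leq_ltn_trans kp).
(* The integrand of the sum on [[s, t]]: [ck k] on [[a k, b k]], which belongs to the step from
   [b (k-1)], and [ek k] on [[b k, a (k+1)]]; both are [0] after [t]. So [v] and [u] are the
   differences of the two integrands on the common refinement. *)
pose ck k := if (0 < k <= p)%N then g (b k.-1) else 0.
pose ek k := if (k < p)%N then g (b k) else 0.
pose v k := -1 *: ck k + g (a k).
pose u k := -1 *: ek k + g (a k).
pose tau i := if odd i then b i./2 else a i./2.
pose V i := if odd i then u i./2 else v i./2.
have tau2 k : tau k.*2 = a k by rewrite /tau odd_double doubleK.
have tau21 k : tau k.*2.+1 = b k by rewrite /tau /= odd_double /= uphalf_double.
have V2 k : V k.*2 = v k by rewrite /V odd_double doubleK.
have V21 k : V k.*2.+1 = u k by rewrite /V /= odd_double /= uphalf_double.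
have tau22 k : tau k.*2.+2 = a k.+1 by rewrite -doubleS tau2.
have tauS i : tau i <= tau i.+1.
  rewrite -(odd_double_half i); case: (odd i); rewrite /= ?add0n ?add1n.
    by rewrite tau21 tau22.
  by rewrite tau2 tau21.
have tau0 : 0 <= tau 0%N by rewrite /tau /= a0.
have [mZ Zle] := increments_sqr V n.*2 tau0 tauS.
have a_ge0 k : 0 <= a k by rewrite (le_trans s0)// -a0 am.
have b_ge0 k : 0 <= b k by exact: le_trans (ab k).
have m_rs (q : R) m : s < q -> measurable_fun setT (riemann_sum s q g m).
  move=> sq; have gS k : grid s q m k <= grid s q m k.+1.
    by rewrite -subr_ge0 grid_step divr_ge0// subr_ge0 ltW.
  have g0 : 0 <= grid s q m 0 by rewrite /grid mul0r mulr0 addr0.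
  by have [] := increments_sqr (fun k => g (grid s q m k)) m g0 gS.
split; [by apply: m_rs; exact: lt_trans tT|exact: m_rs|].
have key : {ae P, forall w, riemann_sum s T g n w - riemann_sum s t g p w =
    \sum_(i < n.*2) increment W (tau i) (tau i.+1) (V i) w}.
  have l1 : {ae P, forall w k, increment W (a k) (b k) (v k) w = -1 * increment W (a k) (b k) (ck k) w + increment W (a k) (b k) (g (a k)) w}.
    by apply/ae_foralln => k; exact: ae_increment_lin.
  have l2 : {ae P, forall w k, increment W (b k) (a k.+1) (u k) w = -1 * increment W (b k) (a k.+1) (ek k) w + increment W (b k) (a k.+1) (g (a k)) w}.
    by apply/ae_foralln => k; exact: ae_increment_lin.
  have l3 : {ae P, forall w k, increment W (a k) (b k) 0 w = 0}.
    by apply/ae_foralln => k; exact: ae_increment0.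
  have l4 : {ae P, forall w k, increment W (b k) (a k.+1) 0 w = 0}.
    by apply/ae_foralln => k; exact: ae_increment0.
  apply: ae_imply2 (ae_imply2 l1 l2 (fun w x y => conj x y)) (ae_imply2 l3 l4 (fun w x y => conj x y)) _.
  move=> w [e1 e2] [e3 e4].
  rewrite (sum_double (fun i => increment W (tau i) (tau i.+1) (V i) w)); under eq_bigr => k _ do rewrite tau2 tau21 tau22 V2 V21 e1 e2.
  pose corr k := increment W (a k) (b k) (ck k) w.
  pose first k := increment W (b k) (a k.+1) (ek k) w.
  pose term k := if (k < p)%N then increment W (b k) (b k.+1) (g (b k)) w else 0.
  have step k : first k + corr k.+1 = term k.
    rewrite /first /corr /term /ek /ck /=; case: ifP => kp; last by rewrite e3 e4 addr0.
    by rewrite /increment; ring.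
  (* Regroups the refined pieces into the steps of the smaller grid, each of which straddles a point
     [a k.+1]. *)
  have tele m : \sum_(k < m) (first k + corr k) + corr m = \sum_(k < m) term k + corr 0%N.
    elim: m => [|m ih]; first by rewrite !big_ord0.
    by rewrite !big_ord_recr /=; have := step m; move: ih; lra.
  have c0 : corr 0%N = 0 by rewrite /corr /ck /= e3.
  have cn : corr n = 0 by rewrite /corr /ck (leqNgt n p) pn andbF e3.
  have R' : riemann_sum s t g p w = \sum_(k < n) (first k + corr k).
    have := tele n; rewrite c0 cn !addr0 => ->.
    rewrite /riemann_sum (big_ord_widen n (fun k => increment W (grid s t p k) (grid s t p k.+1) (g (grid s t p k)) w) (ltnW pn)).
    rewrite big_mkcond; apply: eq_bigr => k _; rewrite /term /b; case: ifP => // kp.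
    by rewrite ltnW// kp.
  rewrite R' /riemann_sum -sumrB; apply: eq_bigr => k _.
  by rewrite /first /corr -/(a k) -/(a k.+1) /increment; ring.
have -> : (\int[P]_w ((riemann_sum s T g n w - riemann_sum s t g p w) ^+ 2)%:E =
    \int[P]_w ((\sum_(i < n.*2) increment W (tau i) (tau i.+1) (V i) w) ^+ 2)%:E)%E.
  by apply: integral_ae_congr; apply: ae_imply key _ => w -> _.
apply: (le_trans Zle); rewrite lee_fin ler_wpM2l//.
rewrite (sum_double (fun i => (tau i.+1 - tau i) * `|V i| ^+ 2)).
(* A clock standing still at [t] until step [p]. Before [t] the integrands differ by at most [L]
   times one mesh; after [t] the whole integrand counts, and is charged to the clock. *)
pose c k := if (k <= p)%N then t else a k.
have c0 : c 0%N = t by [].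
have cn : c n = T by rewrite /c leqNgt pn /= an.
have bound (k : 'I_n) : true -> (tau k.*2.+1 - tau k.*2) * `|V k.*2| ^+ 2 + (tau k.*2.+2 - tau k.*2.+1) * `|V k.*2.+1| ^+ 2
    <= L ^+ 2 * Dl ^+ 2 * (a k.+1 - a k) + M ^+ 2 * (c k.+1 - c k).
  move=> _; rewrite tau2 tau21 tau22 V2 V21.
  have abk := ab k; have bak := ba k.
  have LD : 0 <= L * Dl by rewrite mulr_ge0// ltW.
  have sqle (x : H) : `|x| <= L * Dl -> `|x| ^+ 2 <= L ^+ 2 * Dl ^+ 2.
    by move=> h; rewrite -exprMn lerXn2r ?nnegrE.
  have h1 : (b k - a k) * `|v k| ^+ 2 <= L ^+ 2 * Dl ^+ 2 * (b k - a k).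
    have [k0|k0] := posnP k; first by rewrite k0 a0 b0 subrr mul0r mulr0.
    have [kp|kp] := leqP k p; last by rewrite /b leqNgt kp /= subrr mul0r mulr0.
    rewrite mulrC ler_wpM2r ?subr_ge0// sqle// /v /ck k0 kp /= scaleN1r addrC.
    have k1 : k.-1.+1 = k by rewrite prednK.
    have bk1 := ba k.-1; rewrite k1 in bk1.
    have kp1 : (k.-1 <= p)%N by rewrite (leq_trans (leq_pred _)).
    apply: (le_trans (gL _ _ (bI _ kp1) (aI _ (ltnW (ltn_ord k))) bk1)); rewrite ler_wpM2l//.
    by have := ab k.-1; have := aS k.-1; rewrite k1; lra.
  have h2 : (a k.+1 - b k) * `|u k| ^+ 2 <= L ^+ 2 * Dl ^+ 2 * (a k.+1 - b k) + M ^+ 2 * (c k.+1 - c k).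
    have [kp|kp] := ltnP k p.
      rewrite /c kp (ltnW kp) subrr mulr0 addr0 mulrC ler_wpM2r ?subr_ge0// sqle// /u /ek kp scaleN1r addrC -normrN opprB.
      apply: (le_trans (gL _ _ (aI _ (ltnW (ltn_ord k))) (bI _ (ltnW kp)) abk)); rewrite ler_wpM2l//.
      by have := aS k; lra.
    have cE : c k.+1 - c k = a k.+1 - b k.
      rewrite /c ltnNge kp /=; case: (ltngtP k p) kp => // [kp _|-> _]; last by rewrite bp.
      by rewrite /b leqNgt kp.
    rewrite cE /u /ek ltnNge kp /= scaler0 add0r [leRHS]addrC -[leLHS]addr0 lerD//; last first.
      by rewrite mulr_ge0 ?subr_ge0// mulr_ge0 ?sqr_ge0.
    rewrite mulrC ler_wpM2r ?subr_ge0//.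
    have gk := gM _ (aI _ (ltnW (ltn_ord k))).
    by rewrite lerXn2r ?nnegrE// (le_trans _ gk).
  apply: (le_trans (lerD h1 h2)); rewrite le_eqVlt; apply/orP; left; apply/eqP; ring.
apply: (le_trans (ler_sum _ bound)); rewrite big_split /= -!mulr_sumr.
have tsum (f : nat -> R) : \sum_(k < n) (f k.+1 - f k) = f n - f 0%N.
  by rewrite -(big_mkord xpredT (fun k => f k.+1 - f k)) telescope_sumr.
by rewrite (tsum a) (tsum c) an a0 cn c0.
Qed.

(** Pass through the Riemann sums and use that the square of a sum of three terms is at most three
    times the sum of squares, whence [24 = 3 * 8]. The Lipschitz term vanishes with the mesh. *)
Lemma wiener_integral_diff (s t T M L : R) (g g' : R -> H) (I I' : Om -> R) :
  0 <= s -> s < t < T -> 0 <= L ->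
  (forall q, q \in `[s, T] -> `|g q| <= M) ->
  (forall q q', q \in `[s, T] -> q' \in `[s, T] -> q <= q' -> `|g q' - g q| <= L * (q' - q)) ->
  (forall q, q \in `[s, t] -> g' q = g q) ->
  wiener_integral P W s T g I -> wiener_integral P W s t g' I' ->
  (\int[P]_w ((I w - I' w) ^+ 2)%:E <= (24 * (M ^+ 2 * (T - t)))%:E)%E.
Proof.
move=> s0 stT L0 gM gL gg [mI cI] [mI' cI']; have [st tT] := andP stT.
have Ts : 0 < T - s by rewrite subr_gt0 (lt_trans st).
have ts : 0 < t - s by rewrite subr_gt0.
pose e1 n := (\int[P]_w ((I w - riemann_sum s T g n w) ^+ 2)%:E)%E.
pose e2 n := (\int[P]_w ((I' w - riemann_sum s t g n w) ^+ 2)%:E)%E.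
have ce1 : e1 n @[n --> \oo] --> 0%E by exact: cI.
have ce2 : e2 n @[n --> \oo] --> 0%E.
  rewrite (_ : (fun n => e2 n) = (fun n => \int[P]_w ((I' w - riemann_sum s t g' n w) ^+ 2)%:E)%E)//.
  apply/funext => n; apply: eq_integral => w _.
  congr (((_ - _) ^+ 2)%:E); apply: eq_bigr => k _; rewrite gg//.
  rewrite /grid in_itv/= lerDl mulr_ge0 ?divr_ge0 ?(ltW ts)//=.
  have n0 : (0 < n)%N by exact: leq_ltn_trans (ltn_ord k).
  rewrite -lerBrDl ler_piMr ?(ltW ts)// ler_pdivrMr ?ltr0n// mul1r ler_nat.
  exact: ltnW.
apply/lee_addgt0Pr => e ep.
(* The two approximation errors contribute [3 * (e/9 + e/9)], and the Lipschitz term the remaining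
   [e/3]. *)
have e9 : 0 < e / 9 by rewrite divr_gt0.
have small (f : nat -> \bar R) : f n @[n --> \oo] --> 0%E -> exists N, forall n, (N <= n)%N -> (f n <= (e / 9)%:E)%E.
  move=> cf; have : \forall n \near \oo, (f n < (e / 9)%:E)%E.
    have nb : nbhs (0%E : \bar R) [set x | (x < (e / 9)%:E)%E].
      by apply: open_nbhs_nbhs; split; [exact: open_ereal_lt_ereal|rewrite /= lte_fin].
    exact: (cf _ nb).
  by move=> [N _ h]; exists N => n Nn; apply: ltW; exact: h.
have [N1 h1] := small _ ce1; have [N2 h2] := small _ ce2.
pose cc := 24 * L ^+ 2 * (T - s) ^+ 3.
have cc0 : 0 <= cc by rewrite /cc !mulr_ge0 ?sqr_ge0 ?exprn_ge0// ltW.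
pose x3 := Num.truncn (N2.+1%:R / ((t - s) / (T - s))).
pose x4 := Num.truncn (3 * cc / e).
pose n := (N1 + x3 + x4).+1.
have n1 : (N1 <= n)%N by rewrite /n leqW// -addnA leq_addr.
have nx3 : (x3.+1 <= n)%N by rewrite /n ltnS addnAC leq_addl.
have nx4 : (x4.+1 <= n)%N by rewrite /n ltnS leq_addl.
pose p := Num.truncn (n%:R * ((t - s) / (T - s))).
have np : (N2.+1 <= p)%N.
  rewrite truncn_ge_nat; last by rewrite mulr_ge0// divr_ge0// ltW.
  rewrite -ler_pdivrMr ?divr_gt0// ltW// (lt_le_trans (truncnS_gt _))// ler_nat//.
have [mR mR' Rle] := @riemann_sum_diff s t T M L g n s0 stT (leq_ltn_trans (leq0n N2) np) L0 gM gL.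
have nR : 0 < n%:R :> R by rewrite ltr0n.
have small4 : 3 * (8 * (L ^+ 2 * ((T - s) / n%:R) ^+ 2 * (T - s))) <= e / 3.
  rewrite [leLHS](_ : _ = cc / n%:R ^+ 2); last by rewrite /cc; field; rewrite gt_eqF.
  rewrite ler_pdivrMr ?exprn_gt0//.
  have : 3 * cc / e <= n%:R by rewrite (le_trans (ltW (truncnS_gt _)))// ler_nat.
  rewrite ler_pdivrMr// => h.
  have n1R : 1 <= n%:R :> R by rewrite ler1n.
  have : n%:R * e <= n%:R ^+ 2 * e by rewrite ler_pM2r// expr2 ler_peMr// ltW.
  by lra.
pose Z w := 3 * ((I w - riemann_sum s T g n w) ^+ 2 + (riemann_sum s T g n w - riemann_sum s t g p w) ^+ 2 + (I' w - riemann_sum s t g p w) ^+ 2).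
have mf1 : measurable_fun setT (fun w => ((I w - riemann_sum s T g n w) ^+ 2)%:E).
  by apply/measurable_EFinP; apply: measurable_funX; exact: measurable_funB.
have mf2 : measurable_fun setT (fun w => ((riemann_sum s T g n w - riemann_sum s t g p w) ^+ 2)%:E).
  by apply/measurable_EFinP; apply: measurable_funX; exact: measurable_funB.
have mf3 : measurable_fun setT (fun w => ((I' w - riemann_sum s t g p w) ^+ 2)%:E).
  by apply/measurable_EFinP; apply: measurable_funX; exact: measurable_funB.
apply: (@le_trans _ _ (\int[P]_w (3%:E * (((I w - riemann_sum s T g n w) ^+ 2)%:E + ((riemann_sum s T g n w - riemann_sum s t g p w) ^+ 2)%:E + ((I' w - riemann_sum s t g p w) ^+ 2)%:E)))%E).
  apply: ge0_le_integral => //.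
  - by move=> w _; rewrite lee_fin sqr_ge0.
  - by apply/measurable_EFinP; apply: measurable_funX; exact: measurable_funB.
  - by apply: measurable_funeM; apply: emeasurable_funD => //; exact: emeasurable_funD.
  move=> w _; rewrite -!EFinD -EFinM lee_fin.
  move: (I w) (I' w) (riemann_sum _ _ _ n w) (riemann_sum _ _ _ p w) => x y x' y'.
  rewrite -subr_ge0 (_ : _ - _ = (x - x' - (x' - y')) ^+ 2 + (x' - y' + (y - y')) ^+ 2 + (x - x' + (y - y')) ^+ 2); last by ring.
  by rewrite !addr_ge0 ?sqr_ge0.
have ge0s (f : Om -> R) w : setT w -> (0 <= ((f w) ^+ 2)%:E :> \bar R)%E by rewrite lee_fin sqr_ge0.
rewrite ge0_integralZl//; last 2 first.
- by apply: emeasurable_funD => //; exact: emeasurable_funD.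
- by move=> w _; rewrite -!EFinD lee_fin !addr_ge0 ?sqr_ge0.
rewrite ge0_integralD//; last 3 first.
- by move=> w _; rewrite -!EFinD lee_fin !addr_ge0 ?sqr_ge0.
- exact: emeasurable_funD.
- by move=> w _; rewrite lee_fin sqr_ge0.
rewrite ge0_integralD//; last 2 first.
- by move=> w _; rewrite lee_fin sqr_ge0.
- by move=> w _; rewrite lee_fin sqr_ge0.
have q1 := h1 n n1; have q2 := h2 p (ltnW np).
apply: (@le_trans _ _ (3%:E * ((e / 9)%:E + (8 * (L ^+ 2 * ((T - s) / n%:R) ^+ 2 * (T - s) + M ^+ 2 * (T - t)))%:E + (e / 9)%:E))%E).
  by rewrite lee_wpmul2l ?lee_fin// leeD// leeD.
rewrite -!EFinD -EFinM lee_fin; move: small4.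
by move: (L ^+ 2 * _ * _) (M ^+ 2 * _) => y1 y2; lra.
Qed.

End cylindrical_wiener.

(** * The adjoint semigroup *)

Lemma bounded_op_le {R : realType} {H : hilbertType R} (B : H -> H) : bounded_op B ->
  exists2 c : R, 0 <= c & forall x, `|B x| <= c * `|x|.
Proof.
move=> [lB cB].
pose l : {linear H -> H} := HB.pack B (GRing.isLinear.Build _ _ _ _ _ lB).
have [c [_ cP]] : \forall r \near +oo, forall x : H, `|B x| <= r * `|x|.
  by apply: (proj1 (linear_boundedP l)); apply: continuous_linear_bounded; exact: cB.
have cc : c < `|c| + 1 by rewrite (le_lt_trans (ler_norm c))// ltrDl.
by exists (`|c| + 1); [rewrite addr_ge0|exact: cP].
Qed.

Lemma dotp_eq {R : realType} {H : hilbertType R} (y z : H) : (forall x, dotp x y = dotp x z) -> y = z.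
Proof.
move=> h; apply/eqP; rewrite -subr_eq0 -normr_eq0 -[_ == _](expf_eq0 _ 2) -dotpp.
by rewrite dotpBr h subrr.
Qed.

Section semigroup.
Context {R : realType} {H : hilbertType R} (DA : set H) (A : H -> H) (S : R -> H -> H).
Hypothesis sH : separable H.
Hypothesis gen : generates DA A S.

Let SB t : 0 <= t -> bounded_op (S t). Proof. by case: gen => [[h _ _ _] _ _]; exact: h. Qed.
Let S0 x : S 0 x = x. Proof. by case: gen => [[_ h _ _] _ _]. Qed.
Let SD t r x : 0 <= t -> 0 <= r -> S (t + r) x = S t (S r x).
Proof. by case: gen => [[_ _ h _] _ _]; exact: h. Qed.
Let S_cvg x : S t x @[t --> 0^'+] --> x. Proof. by case: gen => [[_ _ _ h] _ _]. Qed.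
Let Slin t a x y : 0 <= t -> S t (a *: x + y) = a *: S t x + S t y.
Proof. by move=> t0; have [h _] := SB t0; rewrite h. Qed.
Let Sz t : 0 <= t -> S t 0 = 0.
Proof. by move=> t0; have := Slin (-1) 0 0 t0; rewrite !scaleN1r !addNr. Qed.
Let SsubE t x y : 0 <= t -> S t (x - y) = S t x - S t y.
Proof. by move=> t0; rewrite -scaleN1r addrC Slin// scaleN1r addrC. Qed.
Let SZ t a x : 0 <= t -> S t (a *: x) = a *: S t x.
Proof. by move=> t0; have := Slin a x 0 t0; rewrite !addr0 Sz// addr0. Qed.

Let near0 (P : R -> Prop) : (\forall t \near 0^'+, P t) -> exists2 e, 0 < e & forall t, 0 < t < e -> P t.
Proof.
rewrite near_withinE => -[e e0 h]; exists e => // t /andP[t0 te].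
by apply: h => //=; rewrite sub0r normrN gtr0_norm.
Qed.

(* Banach-Steinhaus along a sequence t_n -> 0 on which the norms would blow up. *)
Let locally_bounded : exists2 dl, 0 < dl & exists M : R, forall t x, 0 <= t <= dl -> `|S t x| <= M * `|x|.
Proof.
apply: contrapT => no.
have bad n : exists tx : R * H, 0 <= tx.1 <= n.+1%:R^-1 /\ n.+1%:R * `|tx.2| < `|S tx.1 tx.2|.
  apply: contrapT => h; apply: no; exists n.+1%:R^-1; first by rewrite invr_gt0.
  exists n.+1%:R => t x tn; rewrite leNgt; apply/negP => lt; apply: h; by exists (t, x).
have [tx txP] := choice bad.
pose t n := (tx n).1.
have t0 n : 0 < t n.
  have [/andP[]] := txP n; rewrite le_eqVlt => /predU1P[<- _|//].
  by rewrite S0 ltNge ler_peMl// ler1n.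
have tle n : t n <= n.+1%:R^-1 by have [/andP[]] := txP n.
pose FF : set (H -> H) := [set S (t n) | n in [set: nat]].
have FB f : FF f -> bounded_fun_norm f /\ linear f.
  move=> [n _ <-]; have [c c0 cP] := bounded_op_le (SB (ltW (t0 n))); have [lS _] := SB (ltW (t0 n)).
  split => // r; exists (c * r) => x xr; exact: le_trans (cP x) (ler_wpM2l c0 xr).
have ptw : pointwise_bounded FF.
  move=> x; have /cvgrPdist_lt/(_ 1 ltr01)/near0[e e0 he] := @S_cvg x.
  pose N := Num.truncn e^-1.
  exists (`|x| + 1 + \sum_(n < N) `|S (t n) x|) => _ [n _ <-].
  have s0 : 0 <= \sum_(n < N) `|S (t n) x| by apply: sumr_ge0.
  have [nN|nN] := ltnP n N.
    rewrite (bigD1 (Ordinal nN))//=; apply: (@le_trans _ _ (0 + (`|S (t n) x| + 0))); first by rewrite addr0 add0r.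
    by rewrite lerD ?addr_ge0// lerD2l sumr_ge0.
  rewrite -[leLHS]addr0 lerD// -[S _ x](subrK x) addrC (le_trans (ler_normD _ _))// lerD2l.
  rewrite distrC ltW// he// t0 /= (le_lt_trans (tle n))// -[ltRHS]invrK ltf_pV2 ?posrE ?invr_gt0//.
  by rewrite (lt_le_trans (truncnS_gt _))// ler_nat.
have [M hM] := Banach_Steinhauss FB ptw 1.
pose n := Num.truncn M.
have [_ lt] := txP n; have x0 : 0 < `|(tx n).2|.
  rewrite normr_gt0; apply/eqP => e; move: lt; rewrite e normr0 mulr0 Sz ?normr0 ?ltxx//.
  exact: (ltW (t0 n)).
have := hM (S (t n)) (ex_intro2 _ _ n I erefl) (`|(tx n).2|^-1 *: (tx n).2).
rewrite normrZ normfV normr_id mulVf ?gt_eqF// lexx => /(_ isT).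
rewrite SZ ?(ltW (t0 n))// normrZ normfV normr_id mulrC ler_pdivrMr// leNgt => /negP; apply.
by apply: le_lt_trans lt; rewrite ler_wpM2r// ltW// truncnS_gt.
Qed.

Lemma semigroup_bounded (T : R) : exists2 M : R, 0 <= M & forall t x, 0 <= t <= T -> `|S t x| <= M * `|x|.
Proof.
have [dl dl0 [M0 hM0]] := locally_bounded.
pose M := `|M0| + 1; have M1 : 1 <= M by rewrite lerDr.
have hM t x : 0 <= t <= dl -> `|S t x| <= M * `|x|.
  move=> /hM0/le_trans; apply; rewrite ler_wpM2r// (le_trans (ler_norm _))// lerDl//.
have Mn n : 1 <= M ^+ n by exact: exprn_ege1.
suff h : forall n t x, 0 <= t <= n%:R * dl -> `|S t x| <= M ^+ n * `|x|.
  pose n := (Num.truncn (T / dl)).+1; exists (M ^+ n); first by rewrite (le_trans ler01).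
  move=> t x /andP[t0 tT]; apply: h; rewrite t0 /= (le_trans tT)// -ler_pdivrMr// ltW//.
  exact: truncnS_gt.
elim=> [t x|n ih t x /andP[t0 tn]].
  by rewrite mul0r => t0; rewrite -(le_anti t0) S0 mul1r.
have [tdl|dlt] := leP t dl.
  by rewrite (le_trans (hM t x _)) ?t0// ler_wpM2r// exprS ler_peMr// (le_trans ler01).
have td0 : 0 <= t - dl by rewrite subr_ge0 ltW.
rewrite -(subrK dl t) SD// ?(ltW dl0)// (le_trans (ih _ _ _))//.
  by rewrite td0/= lerBlDr; move: tn; rewrite -natr1 mulrDl mul1r.
rewrite exprSr -mulrA ler_wpM2l ?(le_trans ler01)// hM//.
by rewrite lexx ltW.
Qed.

Let S_DA t z : 0 <= t -> DA z -> DA (S t z) /\ A (S t z) = S t (A z).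
Proof.
move=> t0 Dz; have [_ g1 g2] := gen.
have c : r^-1 *: (S r (S t z) - S t z) @[r --> 0^'+] --> S t (A z).
  apply: (@cvg_trans _ (S t (r^-1 *: (S r z - z)) @[r --> 0^'+])).
    apply: near_eq_cvg; near=> r.
    have r0 : 0 <= r by apply: ltW; near: r; exact: nbhs_right_gt.
    by rewrite SZ// SsubE// -!SD// [r + t]addrC.
  apply: continuous_cvg; last exact: g1.
  by have [_ h] := SB t0; exact: h.
have Dt := g2 _ _ c; split => //.
exact: (cvg_unique _ (g1 _ Dt) c).
Unshelve. all: by end_near. Qed.

(** Telescope [S t z - z] over small steps [q]; each summand is [S (k q)] applied to [S q z - z],
    whose norm is at most [q] times [|A z|] plus a small error by the definition of the
    generator. *)
Let lipschitz_DA (T M : R) : (forall t x, 0 <= t <= T -> `|S t x| <= M * `|x|) ->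
  forall t z, 0 <= t <= T -> DA z -> `|S t z - z| <= M * (t * `|A z|).
Proof.
move=> hM t z /andP[]; rewrite le_eqVlt => /predU1P[<- _ _|t0 tT Dz].
  by rewrite S0 subrr normr0 mul0r mulr0.
have M0 : 0 <= M * `|A z| by rewrite (le_trans _ (hM 0 _ _)) ?lexx// (le_trans (ltW t0)).
have [_ g1 _] := gen.
apply/ler_addgt0Pr => e e0.
have M1 : 0 < `|M| * t + 1 by rewrite ltr_wpDl// mulr_ge0// ltW.
have /near0[dl dl0 hd] : \forall r \near 0^'+, `|A z - r^-1 *: (S r z - z)| < e / (`|M| * t + 1).
  by move/cvgrPdist_lt: (g1 _ Dz); apply; rewrite divr_gt0.
pose n := (Num.truncn (t / dl)).+1.
have nR : 0 < n%:R :> R by [].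
pose q := t / n%:R; have q0 : 0 < q by rewrite divr_gt0.
have qd : q < dl by rewrite ltr_pdivrMr// mulrC -ltr_pdivrMr// truncnS_gt.
have tele : S t z - z = \sum_(k < n) S (k%:R * q) (S q z - z).
  rewrite (eq_bigr (fun k : 'I_n => S (k.+1%:R * q) z - S (k%:R * q) z)); last first.
    move=> k _; have kq : 0 <= k%:R * q by rewrite mulr_ge0// ltW.
    by rewrite SsubE// -SD// ?(ltW q0)// -natr1 mulrDl mul1r.
  rewrite -(big_mkord xpredT (fun k => S (k.+1%:R * q) z - S (k%:R * q) z)) telescope_sumr//.
  by rewrite mul0r S0 /q mulrC divfK ?gt_eqF.
have qz : `|S q z - z| <= q * (`|A z| + e / (`|M| * t + 1)).
  have -> : S q z - z = q *: (q^-1 *: (S q z - z)) by rewrite scalerA mulfV ?scale1r// gt_eqF.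
  rewrite normrZ gtr0_norm// ler_wpM2l ?(ltW q0)//.
  rewrite -[X in `|X|](subrK (A z)) addrC (le_trans (ler_normD _ _))// lerD2l distrC ltW// hd//.
  by rewrite q0.
have M0' : 0 <= `|M| * (q * (`|A z| + e / (`|M| * t + 1))).
  by rewrite mulr_ge0// mulr_ge0 ?(ltW q0)// addr_ge0// divr_ge0// ltW.
have bnd : `|S t z - z| <= n%:R * (M * `|S q z - z|).
  rewrite tele (le_trans (ler_norm_sum _ _ _))// mulr_natl -[X in _ *+ X]card_ord -sumr_const ler_sum// => k _.
  apply: hM; rewrite mulr_ge0 ?(ltW q0)//= (le_trans _ tT)// /q mulrC mulrAC ler_pdivrMr// ler_wpM2l ?(ltW t0)//.
  by rewrite ler_nat ltnW.
have Mpos x : 0 <= M * `|x : H| by rewrite (le_trans _ (hM 0 _ _)) ?lexx// (le_trans (ltW t0)).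
apply: (le_trans bnd).
(* A negative [M] is compatible with the bound on [S] only if all vectors vanish. *)
have [M00|Mn] := ltP M 0.
  have y0 : S q z - z = 0.
    by apply/eqP; rewrite -normr_eq0; have := Mpos (S q z - z); rewrite nmulr_rge0// => h; rewrite eq_le h normr_ge0.
  rewrite y0 normr0 !mulr0 addr_ge0 ?(ltW e0)// mulrCA mulr_ge0// ltW//.
have h1 : M * `|S q z - z| <= M * (q * (`|A z| + e / (`|M| * t + 1))) by rewrite ler_wpM2l.
apply: (le_trans (ler_wpM2l (ltW nR) h1)).
rewrite (ger0_norm Mn) in M1 *.
have -> : n%:R * (M * (q * (`|A z| + e / (M * t + 1)))) = M * (t * `|A z|) + (M * t) / (M * t + 1) * e.
  by rewrite /q; field; rewrite (gt_eqF nR) (gt_eqF M1).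
by rewrite lerD2l ler_piMl ?(ltW e0)// ler_pdivrMr// mul1r lerDl.
Qed.

(** [adj] is defined by choice; Riesz's theorem shows that there is something to choose. *)
Lemma adj_semigroup t h x : 0 <= t -> dotp (S t x) h = dotp x (adj setT (S t) h).
Proof.
move=> t0; have [c c0 cP] := bounded_op_le (SB t0).
have [z zP] : exists z, forall x, dotp (S t x) h = dotp x z.
  apply: (@riesz _ _ (fun x => dotp (S t x) h) (c * `|h|)) => //.
    by move=> a u v; rewrite Slin// dotpDl dotpZl.
  by move=> u; rewrite (le_trans (dotp_le _ _))// mulrAC ler_wpM2r.
have := @xgetPex _ 0 [set z | forall x, setT x -> dotp (S t x) h = dotp x z] (ex_intro _ z (fun x _ => zP x)).
by move=> /(_ x I).
Qed.

Lemma adj_semigroupD t r h : 0 <= t -> 0 <= r ->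
  adj setT (S r) (adj setT (S t) h) = adj setT (S (t + r)) h.
Proof.
move=> t0 r0; apply: dotp_eq => x.
by rewrite -!adj_semigroup ?addr_ge0// SD.
Qed.

Lemma adj_semigroup_le (T M : R) : (forall t x, 0 <= t <= T -> `|S t x| <= M * `|x|) ->
  forall t h, 0 <= t <= T -> `|adj setT (S t) h| <= M * `|h|.
Proof.
move=> hM t h tT; have t0 : 0 <= t by case/andP: tT.
set z := adj _ _ _; have [->|z0] := eqVneq z 0.
  by rewrite normr0 (le_trans _ (hM t h tT)).
rewrite -(ler_pM2l (_ : 0 < `|z|)) ?normr_gt0// -expr2 -dotpp -[X in dotp _ X]/(adj setT (S t) h) -adj_semigroup//.
rewrite (le_trans (ler_norm _))// (le_trans (dotp_le _ _))// mulrA [X in _ <= X * _]mulrC ler_wpM2r//.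
exact: hM.
Qed.

(* <S t x - x, B k> = <S t (B x) - B x, k> for the inverse B of -A, since B is
   symmetric and commutes with S. *)
Lemma adj_semigroup_lipschitz (T M : R) : self_adjoint DA A ->
  (exists B, bounded_inverse DA (fun x => - A x) B) ->
  (forall t x, 0 <= t <= T -> `|S t x| <= M * `|x|) ->
  forall t r h, 0 <= t -> t <= r -> r <= T -> DA h ->
    `|adj setT (S r) h - adj setT (S t) h| <= M ^+ 2 * `|A h| * (r - t).
Proof.
move=> [dDA domE AE] [B [_ B1 B2]] hM t r h t0 tr rT Dh.
have Asym x y : DA x -> DA y -> dotp (A x) y = dotp x (A y).
  by move=> Dx Dy; rewrite -(AE y Dy); apply: adjE => //; rewrite domE.
have Bsym x y : dotp (B x) y = dotp x (B y).
  have [Dx Ax] := B2 x; have [Dy Ay] := B2 y.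
  by rewrite -{1}Ay -{2}Ax dotpNl dotpNr Asym.
have BS q x : 0 <= q -> B (S q x) = S q (B x).
  move=> q0; have [Dx Ax] := B2 x; have [DS AS] := S_DA q0 Dx.
  by rewrite -{1}Ax -scaleN1r SZ// scaleN1r -AS B1.
pose q := r - t; have q0 : 0 <= q by rewrite subr_ge0.
have qT : q <= T by rewrite (le_trans _ rT)// lerBlDr lerDl.
have Mh y : 0 <= M * `|y : H| by rewrite (le_trans _ (hM 0 _ _)) ?lexx// (le_trans q0).
set z := _ - _; have [->|z0] := eqVneq z 0.
  by rewrite normr0; apply: mulr_ge0 => //; apply: mulr_ge0 => //; exact: sqr_ge0.
rewrite -(ler_pM2l (_ : 0 < `|z|)) ?normr_gt0// -expr2 -dotpp.
have -> : dotp z z = dotp (S q (S t z) - S t z) h.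
  rewrite {2}/z dotpBr -!adj_semigroup ?(le_trans t0)// dotpBl -SD// /q addrNK//.
have hB : h = B (- A h) by rewrite B1.
rewrite hB -Bsym (_ : B _ = S q (B (S t z)) - B (S t z)); last first.
  have Blin a b : B (a - b) = B a - B b.
    by apply: dotp_eq => y; rewrite -Bsym !dotpBr -!Bsym.
  by rewrite Blin BS.
have [DB AB] := B2 (S t z).
rewrite (le_trans (ler_norm _))// (le_trans (dotp_le _ _))//.
have hq : 0 <= q <= T by rewrite q0.
have l1 := lipschitz_DA hM hq DB.
have l2 : `|S t z| <= M * `|z| by apply: hM; rewrite t0 (le_trans tr).
rewrite -(normrN (A (B _))) AB in l1.
rewrite -hB normrN.
apply: (le_trans (ler_wpM2r (normr_ge0 _) l1)).
have M00 : 0 <= M by have := Mh z; rewrite pmulr_lge0// normr_gt0.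
have : M * (q * `|S t z|) <= M * (q * (M * `|z|)) by rewrite ler_wpM2l// ler_wpM2l.
move=> /(ler_wpM2r (normr_ge0 (A h)))/le_trans; apply.
rewrite le_eqVlt; apply/orP; left; apply/eqP; rewrite /q; ring.
Qed.

End semigroup.

(** * The weight *)

Section lower_semicontinuous_weight.
Context {R : realType} {H : hilbertType R}.
Variables (T : R) (V : R * H -> \bar R).
Hypothesis sH : separable H.
Hypothesis lV : lower_semicontinuous (V : subspace (cylinder T) -> \bar R).

Lemma measurable_cylinder : measurable (cylinder T : set (borel_prod R H)).
Proof. exact: measurableX. Qed.

(** Superlevel sets are relatively open in the cylinder, and by separability countably many boxes
    with rational times and dense centres cover them; boxes belong to the product sigma-algebra. *)
Lemma measurable_weight : measurable_fun (cylinder T : set (borel_prod R H)) V.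
Proof.
have [dn dnP] := separable_dense_seq sH.
apply: (@measurability _ _ (borel_prod R H) _ (cylinder T) V _ (ErealGenOInfty.measurableE R)) => _ [_ [a ->] <-].
pose box (q : rat) (i n : nat) : set (borel_prod R H) :=
  (ball (ratr q : R) n.+1%:R^-1 : set (measurableTypeR R)) `*` (ball (dn i) n.+1%:R^-1 : set (borel H)).
pose good q i n := forall z, cylinder T z -> box q i n z -> (a%:E < V z)%E.
pose U : set (borel_prod R H) := \bigcup_n \bigcup_i \bigcup_q (if `[< good q i n >] then box q i n else set0).
have -> : cylinder T `&` V @^-1` `]a%:E, +oo[%classic = cylinder T `&` U.
  apply/seteqP; split => z [cz]; rewrite /= in_itv/= andbT => Vz; split => //; last first.
    have [n _ [i _ [q _]]] := Vz; case: ifP => // /asboolP g bz; exact: g.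
  have [B nB hB] := lV Vz.
  move: nB; rewrite /nbhs /= -(nbhs_subspace_in cz) => -[[B1 B2] [/= /nbhs_ballP[e1 /= e10 h1] /nbhs_ballP[e2' /= e20 h2]] he].
  pose e := Num.min e1 e2'; have e0 : 0 < e by rewrite lt_min e10.
  have e_1 : e <= e1 by rewrite ge_min lexx.
  have e_2 : e <= e2' by rewrite ge_min lexx orbT.
  have e2 : 0 < e / 2 by rewrite divr_gt0.
  have [m hm] := near_inv_succ_lt e2; have hmm := hm m (leqnn m).
  pose r : R := m.+1%:R^-1; have r0 : 0 < r by rewrite invr_gt0.
  have [i hi] := dnP z.2 r r0.
  have [q] : exists q : rat, ratr q \in `]z.1 - r, z.1 + r[.
    by apply: rat_in_itvoo; rewrite ltrD2l gtrN.
  rewrite in_itv/= => /andP[q1 q2].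
  have qz : `|z.1 - ratr q| < r by rewrite ltr_norml; apply/andP; split; lra.
  exists m => //; exists i => //; exists q => //; case: asboolP => [_|]; last first.
    case=> -[y1 y2] cy [/= b1 b2]; apply: hB; apply: he => //; split => /=.
      apply: h1; move: b1; rewrite -!ball_normE /= => b1; apply: lt_le_trans e_1.
      rewrite -(subrK (ratr q) z.1) -addrA (le_lt_trans (ler_normD _ _))//.
      by rewrite (splitr e) ltrD// (lt_trans _ hmm).
    apply: h2; move: b2; rewrite -!ball_normE /= => b2; apply: lt_le_trans e_2.
    rewrite -(subrK (dn i) z.2) -addrA (le_lt_trans (ler_normD _ _))//.
    by rewrite (splitr e) ltrD// (lt_trans _ hmm).
  split; rewrite /= -ball_normE /= distrC//.
apply: measurableI; first exact: measurable_cylinder.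
apply: bigcupT_measurable => n; apply: bigcupT_measurable => i; apply: bigcupT_measurable_rat => q.
case: ifP => _; last exact: measurable0.
apply: measurableX; first exact: measurable_ball.
by apply: sub_sigma_algebra; exact: ball_open.
Qed.

Definition weight_sqr (z : borel_prod R H) : \bar R := ((fun z => V z ^+ 2)%E \_ (cylinder T)) z.

Lemma measurable_weight_sqr : measurable_fun setT weight_sqr.
Proof.
apply: (proj1 (measurable_restrictT _ measurable_cylinder)).
by under eq_fun do rewrite expe2; apply: emeasurable_funM; exact: measurable_weight.
Qed.

Lemma weight_sqr_ge0 z : (0 <= weight_sqr z)%E.
Proof. by rewrite /weight_sqr /patch; case: ifP => // _; rewrite expe2; case: (V z) => [r| |];
  rewrite ?mulyy ?mulNyNy// -EFinM lee_fin -expr2 sqr_ge0. Qed.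

Lemma weight_sqrE t x : t \in `[0, T] -> weight_sqr (t, x) = (V (t, x) ^+ 2)%E.
Proof. by move=> tT; rewrite /weight_sqr /patch mem_set. Qed.

Lemma measurable_weight_time x : measurable_fun setT (fun t : measurableTypeR R => weight_sqr (t, x)).
Proof. by apply: (measurableT_comp measurable_weight_sqr); exact: pair2_measurable. Qed.

Lemma H0E x : H0 T V x <-> (\int[lebesgue_measure]_(t in `[0%R, T]) weight_sqr (t, x) < +oo)%E.
Proof.
have e : (\int[lebesgue_measure]_(t in `[0%R, T]) (V (t, x) ^+ 2) = \int[lebesgue_measure]_(t in `[0%R, T]) weight_sqr (t, x))%E.
  by apply: eq_integral => t /set_mem tT; rewrite weight_sqrE.
by rewrite -e.
Qed.

Lemma measurable_H0 : measurable (H0 T V : set (borel H)).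
Proof.
pose J (x : borel H) := (\int[lebesgue_measure]_t weight_sqr (t, x))%E.
have mJ : measurable_fun setT J.
  exact: (measurable_fun_fubini_tonelli_G (m1 := lebesgue_measure) weight_sqr measurable_weight_sqr weight_sqr_ge0).
have JE x : J x = (\int[lebesgue_measure]_(t in `[0%R, T]) weight_sqr (t, x))%E.
  rewrite [RHS]integral_mkcond; apply: eq_integral => t _; rewrite /patch; case: ifPn => // tn.
  by rewrite /weight_sqr /patch memNset// => -[tT _]; move/negP: tn; apply; exact: mem_set.
have -> : H0 T V = J @^-1` [set y | (y < +oo)%E].
  by apply/seteqP; split => x; rewrite /= JE H0E.
rewrite -[X in measurable X]setTI; apply: mJ => //.
have -> : [set y : \bar R | (y < +oo)%E] = ~` [set +oo%E].
  by apply/seteqP; split=> y /=; rewrite ltey => /eqP.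
by apply: measurableC; exact: emeasurable_set1.
Qed.

(* The point T is excluded so that the indicators converge to 0 everywhere. *)
Lemma weight_tail_cvg x (t_ : nat -> R) : H0 T V x -> (forall n, 0 <= t_ n) -> t_ n @[n --> \oo] --> T ->
  (\int[lebesgue_measure]_(t in `[t_ n, T]) weight_sqr (t, x))%E @[n --> \oo] --> 0%E.
Proof.
move=> /H0E xH t0 tT.
have mI (b : R) : measurable (`[b, T[%classic : set (measurableTypeR R)) by [].
pose f n (t : measurableTypeR R) := (weight_sqr (t, x) * (\1_(`[t_ n, T[%classic : set (measurableTypeR R)) t)%:E)%E.
have mf n : measurable_fun (`[0, T[%classic : set (measurableTypeR R)) (f n).
  apply: emeasurable_funM; first exact: measurable_funS (measurable_weight_time x).
  by apply/measurable_EFinP; exact: measurable_indic.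
have E n : (\int[lebesgue_measure]_(t in `[t_ n, T]) weight_sqr (t, x) = \int[lebesgue_measure]_(t in `[0%R, T[) f n t)%E.
  rewrite -integral_itv_bndo_bndc; last exact: measurable_funS (measurable_weight_time x).
  transitivity (\int[lebesgue_measure]_(t in `[0%R, T[%classic `&` `[t_ n, T[%classic) weight_sqr (t, x))%E.
    congr integral; apply/seteqP; split => t /=; rewrite !in_itv/=; last by case.
    by move=> /andP[a1 a2]; rewrite a1 a2 (le_trans (t0 n)).
  rewrite integral_mkcondr; apply: eq_integral => t _; rewrite /f /patch indicE.
  by case: ifP => _; rewrite ?mule1 ?mule0.
rewrite (_ : (fun n => _) = (fun n => \int[lebesgue_measure]_(t in `[0%R, T[) f n t)%E); last exact/funext.
have gi : (lebesgue_measure : {measure set (measurableTypeR R) -> \bar R}).-integrable `[0, T[%classic (fun t => weight_sqr (t, x)).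
  apply/integrableP; split; first exact: measurable_funS (measurable_weight_time x).
  rewrite integral_itv_bndo_bndc; last first.
    by apply: measurableT_comp => //; exact: measurable_funS (measurable_weight_time x).
  by under eq_integral do rewrite gee0_abs ?weight_sqr_ge0//.
have [] := @dominated_convergence _ _ R (lebesgue_measure : {measure set (measurableTypeR R) -> \bar R}) `[0, T[%classic (mI 0) f (cst 0%E) _ mf (measurable_cst _) _ gi _; last 1 first.
- by move=> _ _; rewrite integral0; exact.
- apply/aeW => t /=; rewrite in_itv/= => /andP[_ tT']; apply: cvg_near_cst; near=> n.
  rewrite /f indicE memNset ?mule0//= in_itv/= => /andP[h _]; move: h; rewrite leNgt => /negP; apply.
  near: n; exact: (cvgr_gt T tT).
- apply/aeW => t n _; rewrite /f indicE abseM (gee0_abs (weight_sqr_ge0 _)).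
  by case: (t \in _); rewrite ?abse1 ?abse0 ?mule1 ?mule0 ?weight_sqr_ge0.
Unshelve. all: by end_near. Qed.

End lower_semicontinuous_weight.

(** * The final time *)

Lemma cos_lipschitz {R : realType} (a b : R) : `|cos a - cos b| <= `|a - b|.
Proof.
suff h : forall a b : R, a < b -> `|cos b - cos a| <= `|b - a|.
  by have [ab|ba|->] := ltgtP a b; [rewrite distrC [leRHS]distrC h|exact: h|rewrite !subrr].
move=> {}a {}b ab.
have [c _ ->] := @MVT R cos (fun x => - sin x) a b ab (fun x _ => is_derive_cos x)
  (continuous_subspaceT (@continuous_cos R)).
by rewrite normrM normrN ler_piMl// ler_norml sin_geN1 sin_le1.
Qed.

(** [|Q x|^2 = <C x, x> <= c |x|^2]; the factor [c + 1] avoids a square root. *)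
Lemma op_sqrt_le {R : realType} {H : hilbertType R} (C Q : H -> H) (c : R) : op_sqrt C Q ->
  0 <= c -> (forall x, `|C x| <= c * `|x|) -> forall x, `|Q x| <= (c + 1) * `|x|.
Proof.
move=> [_ Qs _ QC] c0 hC x.
rewrite -ler_sqr ?nnegrE ?mulr_ge0 ?addr_ge0// -dotpp Qs QC dotpC.
rewrite (le_trans (ler_norm _))// (le_trans (dotp_le _ _))// (le_trans (ler_wpM2r (normr_ge0 _) (hC x)))//.
rewrite -mulrA -expr2 exprMn ler_wpM2r ?sqr_ge0// expr2.
by have := mulr_ge0 c0 c0; lra.
Qed.

Section mild_endpoint.
Context {R : realType} {H : hilbertType R} (T : R) (DA : set H) (A : H -> H) (S : R -> H -> H) (C : H -> H).
Hypothesis sH : separable H.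
Hypothesis gen : generates DA A S.
Hypothesis sa : self_adjoint DA A.
Hypothesis binv : exists B, bounded_inverse DA (fun x => - A x) B.
Variables (M c : R).
Hypothesis M0 : 0 <= M.
Hypothesis c0 : 0 <= c.
Hypothesis hM : forall t x, 0 <= t <= T -> `|S t x| <= M * `|x|.
Hypothesis hC : forall x, `|C x| <= c * `|x|.
Variables (s : R) (x : H) (G : R -> H -> H) (Y : stoch_system H) (V2 : borel_prod R H -> \bar R) (MG K : R).
Hypothesis s0T : 0 <= s < T.
Hypothesis mild : mild_solution T S C G s x Y.
Hypothesis GM : forall t y, t \in `[0, T] -> `|G t y| <= MG.
Hypothesis mG : measurable_fun (cylinder T : set (borel_prod R H)) (fun z => G z.1 z.2 : borel H).
Hypothesis mV2 : measurable_fun setT V2.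
Hypothesis V20 : forall z, (0 <= V2 z)%E.
Hypothesis GV : forall t y, t \in `[0, T] -> (`|G t y|%:E <= V2 (t, y))%E.
Hypothesis K0 : 0 <= K.
Hypothesis EV : forall t, t \in `[s, T] -> (\int[ss_prob Y]_w V2 (t, ss_X t w) <= K%:E * V2 (t, x))%E.
Variables (t : R) (h : H).
Hypothesis stT : s < t < T.
Hypothesis Dh : DA h.

Let Om := ss_space Y.
Let P : probability Om R := ss_prob Y.
Let X : R -> Om -> H := @ss_X _ _ Y.
Let cyl : set (measurableTypeR R * Om) := `[s, T] `*` setT.
(** With this direction at time [t], the terms of the mild equations at [t] and [T] have the same
    integrands on [[s, t]], so their difference involves [[t, T]] only. *)
Let ht : H := adj setT (S (T - t)) h.
Let m : {measure set (measurableTypeR R) -> \bar R} := lebesgue_measure.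

Let s0 : 0 <= s. Proof. by case/andP: s0T. Qed.
Let sT : s < T. Proof. by case/andP: s0T. Qed.
Let st : s < t. Proof. by case/andP: stT. Qed.
Let tT : t < T. Proof. by case/andP: stT. Qed.
Let in0T r : r \in `[s, T] -> r \in `[0, T].
Proof. by rewrite !in_itv/= => /andP[a ->]; rewrite (le_trans s0). Qed.

Let mcyl : measurable cyl. Proof. exact: measurableX. Qed.

Let mGX : measurable_fun cyl (fun z => G z.1 (X z.1 z.2) : borel H).
Proof.
have [_ _ _ mX _] := mild.
apply: (@measurable_comp_in _ _ _ _ (borel_prod R H) _ cyl (cylinder T)
  (fun z => (z.1, X z.1 z.2)) (fun z => G z.1 z.2 : borel H)) mG _.
- exact: measurable_cylinder.
- by move=> z [/= z1 _]; split => //=; exact: in0T.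
have mXe := proj1 (measurable_restrictT (fun z => X z.1 z.2 : borel H) mcyl) mX.
apply: (eq_measurable_fun (fun z => (z.1, ((fun z => X z.1 z.2 : borel H) \_ cyl) z))).
  by move=> z zc; rewrite /patch zc.
apply: (measurable_funS measurableT) => //.
by apply: measurable_fun_pair; [exact: measurable_fst|exact: mXe].
Qed.

Let mX_at r : r \in `[s, T] -> measurable_fun setT (X r : Om -> borel H).
Proof.
move=> rI _ B mB; rewrite setTI; have [[_ fm _] _ adap _ _] := mild.
by apply: (fm r); [move: (in0T rI); rewrite in_itv/= => /andP[]|exact: adap].
Qed.

Let fdrift w r := dotp (S (T - r) (G r (X r w))) h.

Let fdriftE w r : r \in `[s, T] -> fdrift w r = dotp (G r (X r w)) (adj setT (S (T - r)) h).
Proof. by rewrite in_itv/= => /andP[_ rT]; rewrite /fdrift (adj_semigroup sH gen)// subr_ge0. Qed.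

Let adj_lip r q : r \in `[s, T] -> q \in `[s, T] -> r <= q ->
  `|adj setT (S (T - q)) h - adj setT (S (T - r)) h| <= M ^+ 2 * `|A h| * (q - r).
Proof.
rewrite !in_itv/= => /andP[sr rT] /andP[sq qT] rq; rewrite distrC.
have -> : q - r = T - r - (T - q) by ring.
apply: (adj_semigroup_lipschitz sH gen sa binv hM) Dh; rewrite ?subr_ge0//; first by rewrite lerB.
by rewrite gerBl (le_trans s0).
Qed.

Let adj_bd r : r \in `[s, T] -> `|adj setT (S (T - r)) h| <= M * `|h|.
Proof.
rewrite in_itv/= => /andP[sr rT]; apply: (adj_semigroup_le sH gen hM).
by rewrite subr_ge0 rT gerBl (le_trans s0).
Qed.

Let m_adj : measurable_fun (`[s, T]%classic : set (measurableTypeR R)) (fun r => adj setT (S (T - r)) h : borel H).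
Proof.
apply: within_continuous_measurable; apply/subspace_continuousP => r rI; apply/cvgrPdist_lt => e e0.
pose L := M ^+ 2 * `|A h| + 1.
have L0 : 0 < L by rewrite ltr_wpDl// mulr_ge0// sqr_ge0.
rewrite near_withinE; exists (e / L); first by rewrite /= divr_gt0.
move=> q /= rq qI.
have : `|adj setT (S (T - r)) h - adj setT (S (T - q)) h| <= M ^+ 2 * `|A h| * `|r - q|.
  have [qr|rq'] := leP q r; first by rewrite (ger0_norm (_ : 0 <= r - q)) ?subr_ge0//; exact: adj_lip.
  by rewrite distrC [in leRHS]distrC (gtr0_norm (_ : 0 < q - r)) ?subr_gt0//; apply: adj_lip => //; exact: ltW.
move=> /le_lt_trans; apply; apply: (@le_lt_trans _ _ (L * `|r - q|)).
  by rewrite ler_wpM2r// lerDl.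
by rewrite mulrC -ltr_pdivlMr.
Qed.

Let msec w : measurable_fun (`[s, T]%classic : set (measurableTypeR R)) (fun r => G r (X r w) : borel H).
Proof.
apply: (@measurable_comp_in _ _ _ _ _ _ `[s, T]%classic cyl (fun r => (r, w)) (fun z => G z.1 (X z.1 z.2) : borel H)) mGX _ => //.
exact: measurable_funS (pair2_measurable w).
Qed.

Let mfdrift w : measurable_fun (`[s, T]%classic : set (measurableTypeR R)) (fdrift w).
Proof.
apply: (eq_measurable_fun (fun r => dotp (G r (X r w)) (adj setT (S (T - r)) h))).
  by move=> r /set_mem rI; rewrite -fdriftE.
exact: measurable_dotp (msec w) m_adj.
Qed.

Let fdrift_le w r : r \in `[s, T] -> `|fdrift w r| <= M * `|h| * `|G r (X r w)|.
Proof.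
move=> rI; rewrite fdriftE// (le_trans (dotp_le _ _))// mulrC ler_wpM2r//.
exact: adj_bd.
Qed.

Let fdrift_int w : m.-integrable `[s, T]%classic (EFin \o fdrift w).
Proof.
apply: (@le_integrable _ _ _ m _ _ _ (cst (M * `|h| * MG)%:E)) => //.
- by apply/measurable_EFinP; exact: mfdrift.
- move=> r rI; rewrite /= lee_fin (le_trans (fdrift_le w rI))// (le_trans _ (ler_norm _))// ler_wpM2l ?mulr_ge0//.
  by apply: GM; exact: in0T.
- apply/integrableP; split; first exact: measurable_cst.
  rewrite integral_cst//= lebesgue_measure_itv/= lte_fin sT -EFinD -EFinM ltry//.
Qed.

(** The integrand is extended by [0] to the whole product, the form in which Tonelli's theorem is
    applied. *)
Let drift (w : Om) : \bar R := (\int[m]_r ((fun z : measurableTypeR R * Om => `|G z.1 (X z.1 z.2)|%:E) \_ (`[t, T] `*` setT)) (r, w))%E.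

Let mPhi : measurable_fun setT ((fun z : measurableTypeR R * Om => `|G z.1 (X z.1 z.2)|%:E) \_ (`[t, T] `*` setT)).
Proof.
apply: (proj1 (measurable_restrictT _ (measurableX _ _))) => //.
apply/measurable_EFinP; apply: measurable_norm_borel; apply: measurable_funS mGX => //.
move=> z [/= + _]; rewrite in_itv/= => /andP[a b]; split => //=; rewrite in_itv/= b andbT.
by rewrite (le_trans (ltW st)).
Qed.

Let Phi0 z : (0 <= ((fun z : measurableTypeR R * Om => `|G z.1 (X z.1 z.2)|%:E) \_ (`[t, T] `*` setT)) z)%E.
Proof. by rewrite /patch; case: ifP. Qed.

Let driftE w : drift w = (\int[m]_(r in `[t, T]) `|G r (X r w)|%:E)%E.
Proof.
rewrite [RHS]integral_mkcond; apply: eq_integral => r _; rewrite /patch.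
case: ifPn => [/set_mem [/= rt _]|/negP rt].
  by rewrite mem_set.
by case: ifPn => // /set_mem rt'; case: rt; apply: mem_set.
Qed.

Let mdrift : measurable_fun setT drift.
Proof. exact: (measurable_fun_fubini_tonelli_G (m1 := lebesgue_measure) _ mPhi Phi0). Qed.

Let drift0 w : (0 <= drift w)%E. Proof. exact: integral_ge0. Qed.

Let Edrift : (\int[P]_w drift w <= K%:E * \int[m]_(r in `[t, T]) V2 (r, x))%E.
Proof.
have mVx : measurable_fun (`[t, T]%classic : set (measurableTypeR R)) (fun r => V2 (r, x)).
  apply: (measurable_funS measurableT) => //; apply: (measurableT_comp mV2).
  exact: pair2_measurable.
rewrite /drift -(fubini_tonelli (m1 := lebesgue_measure) (m2 := P) _ mPhi Phi0).
rewrite -ge0_integralZl// [leRHS]integral_mkcond; apply: ge0_le_integral => //.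
- by move=> r _; exact: integral_ge0.
- exact: (measurable_fun_fubini_tonelli_F (m2 := P) _ mPhi Phi0).
- by apply: (proj1 (measurable_restrictT _ _)) => //; exact: measurable_funeM.
move=> r _; rewrite {2}/patch; case: ifPn => [/set_mem rI|rn]; last first.
  rewrite (eq_integral (cst 0%E)) ?integral0// => w _; rewrite /patch ifF//.
  by apply/negP => /set_mem [/= ri _]; move/negP: rn; apply; exact: mem_set.
have rI' : r \in `[s, T].
  by move: rI; rewrite /= !in_itv/= => /andP[a ->]; rewrite (le_trans (ltW st)).
apply: le_trans (EV rI'); apply: ge0_le_integral => //.
- exact: (measurableT_comp mPhi (pair1_measurable r)).
- apply: (measurableT_comp mV2); apply/measurable_fun_pairP; split; first exact: measurable_cst.
  exact: mX_at.
move=> w _; rewrite /patch mem_set//=; by apply: GV; exact: in0T.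
Qed.

Let ht_semigroup r y : r \in `[s, t] -> dotp (S (t - r) y) ht = dotp (S (T - r) y) h.
Proof.
rewrite in_itv/= => /andP[sr rt]; rewrite -(adj_semigroup sH gen) ?subr_ge0 ?(ltW tT)//.
have [[_ _ SD _] _ _] := gen; rewrite -SD ?subr_ge0// ?(ltW tT)//.
by congr (dotp (S _ _) _); ring.
Qed.

(** In the difference of the two mild equations the initial terms cancel. There remain the drift
    over [[t, T]] and a difference of Wiener integrals, estimated by [wiener_integral_diff] thanks
    to the Lipschitz bound on the adjoint semigroup along [h] in [DA]. *)
Lemma mild_increment : exists I I' : Om -> R,
  [/\ measurable_fun setT I, measurable_fun setT I',
    (\int[P]_w ((I w - I' w) ^+ 2)%:E <= (24 * (((c + 1) * (M * `|h|)) ^+ 2 * (T - t)))%:E)%E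
  & {ae P, forall w, (`|dotp (X T w) h - dotp (X t w) ht|%:E <= (M * `|h|)%:E * drift w + `|I w - I' w|%:E)%E}].
Proof.
have [fG cW _ _ [Q Qs ms]] := mild.
have TI : T \in `[s, T] by rewrite in_itv/= lexx ltW.
have tI : t \in `[s, T] by rewrite in_itv/= !ltW.
have [I wI eI] := ms T h TI; have [I' wI' eI'] := ms t ht tI.
have hQ := op_sqrt_le Qs c0 hC.
have [[Qlin _] _ _ _] := Qs.
have QB a b : Q (a - b) = Q a - Q b by rewrite -scaleN1r addrC Qlin scaleN1r addrC.
have c1 : 0 <= c + 1 by rewrite addr_ge0.
exists I, I'; split; [by case: wI|by case: wI'| |].
  apply: (wiener_integral_diff (M := (c + 1) * (M * `|h|)) (L := (c + 1) * (M ^+ 2 * `|A h|)) fG cW s0 stT _ _ _ _ wI wI').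
  - by rewrite !mulr_ge0// sqr_ge0.
  - by move=> q qI; rewrite (le_trans (hQ _))// ler_wpM2l// adj_bd.
  - move=> q q' qI qI' qq; rewrite -QB (le_trans (hQ _))// -mulrA ler_wpM2l//.
    exact: adj_lip.
  - move=> q; rewrite in_itv/= => /andP[sq qt]; rewrite /ht (adj_semigroupD sH gen) ?subr_ge0 ?(ltW tT)//.
    by congr (Q (adj _ (S _) _)); ring.
apply: ae_imply2 eI eI' _ => w -> ->.
have f1 : measurable_fun (`[t, T]%classic : set (measurableTypeR R)) (EFin \o fdrift w).
  apply/measurable_EFinP; apply: measurable_funS (mfdrift w) => //.
  by apply: subset_itvr; rewrite bnd_simp ltW.
have i1 : m.-integrable `[s, t]%classic (EFin \o fdrift w).
  by apply: integrableS (fdrift_int w) => //; apply: subset_itvl; rewrite bnd_simp ltW.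
have i2 : m.-integrable `[t, T]%classic (EFin \o fdrift w).
  by apply: integrableS (fdrift_int w) => //; apply: subset_itvr; rewrite bnd_simp ltW.
have e1 : \int[m]_(r in `[s, T]) fdrift w r = \int[m]_(r in `[s, t]) fdrift w r + \int[m]_(r in `[t, T]) fdrift w r.
  rewrite /Rintegral (integral_itv_split (b := t)) ?ltW//; last by apply/measurable_EFinP; exact: mfdrift.
  by rewrite fineD//; exact: integrable_fin_num.
have e2 : \int[m]_(r in `[s, t]) dotp (S (t - r) (G r (X r w))) ht = \int[m]_(r in `[s, t]) fdrift w r.
  by apply: eq_Rintegral => r /set_mem rI; rewrite ht_semigroup.
rewrite e2 e1 (ht_semigroup x (_ : s \in `[s, t])); last by rewrite in_itv/= lexx ltW.
set a := dotp _ _; set b := Rintegral _ _ _; set d := Rintegral _ _ _.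
rewrite (_ : _ - _ = d + (I w - I' w)); last by ring.
rewrite (@le_trans _ _ (`|d|%:E + `|I w - I' w|%:E)%E)//; first by rewrite -EFinD lee_fin ler_normD.
rewrite leeD2r//.
have -> : (`|d|%:E = `| \int[m]_(r in `[t, T]) (fdrift w r)%:E |)%E.
  by rewrite /d /Rintegral -abse_EFin fineK//; exact: integrable_fin_num.
apply: (le_trans (le_abse_integral m _ f1)) => //.
rewrite driftE -ge0_integralZl//; last 2 first.
- apply/measurable_EFinP; apply: measurable_norm_borel; apply: measurable_funS (msec w) => //.
  by apply: subset_itvr; rewrite bnd_simp ltW.
- by rewrite lee_fin mulr_ge0.
apply: ge0_le_integral => //.
- by apply: measurableT_comp f1.
- apply: measurable_funeM; apply/measurable_EFinP; apply: measurable_norm_borel; apply: measurable_funS (msec w) => //.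
  by apply: subset_itvr; rewrite bnd_simp ltW.
move=> r rI; rewrite /= lee_fin; apply: fdrift_le.
by move: rI; rewrite /= !in_itv/= => /andP[a1 ->]; rewrite (le_trans (ltW st)).
Qed.

(** Cosine is 1-Lipschitz, and [|y| <= eta + y^2 / eta] reduces the stochastic part to its second
    moment. The parameter [eta] stays free, so that it can be fixed before [t] tends to [T]. *)
Lemma mild_cos_le (th eta J : R) : 0 < eta -> (\int[m]_(r in `[t, T]) V2 (r, x) <= J%:E)%E ->
  `|\int[P]_w cos (dotp (X T w) h + th) - \int[P]_w cos (dotp (X t w) ht + th)| <=
    M * `|h| * (K * J) + eta + 24 * (((c + 1) * (M * `|h|)) ^+ 2 * (T - t)) / eta.
Proof.
move=> eta0 hJ; have [I [I' [mI mI' Isq Iae]]] := mild_increment.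
have TI : T \in `[s, T] by rewrite in_itv/= lexx ltW.
have tI : t \in `[s, T] by rewrite in_itv/= !ltW.
have mcos r k : r \in `[s, T] -> measurable_fun setT (fun w => cos (dotp (X r w) k + th)).
  move=> rI; apply: (measurableT_comp (measurable_borel_continuous (@continuous_cos_dotp _ _ k th))).
  exact: mX_at.
have icos r k : r \in `[s, T] -> P.-integrable setT (EFin \o (fun w => cos (dotp (X r w) k + th))).
  move=> rI; apply: (@le_integrable _ _ _ P _ _ _ (cst 1%:E)) => //.
  - by apply/measurable_EFinP; exact: mcos.
  - by move=> w _; rewrite /= normr1 lee_fin ler_norml cos_geN1 cos_le1.
  - exact: finite_measure_integrable_cst.
have mIE : measurable_fun setT (fun w => ((I w - I' w) ^+ 2)%:E).
  by apply/measurable_EFinP; apply: measurable_funX; exact: measurable_funB.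
have Mh : 0 <= M * `|h| by exact: mulr_ge0.
rewrite -RintegralB//; [|exact: icos|exact: icos].
apply: (le_trans (le_normr_Rintegral _ _)) => //.
  by exact: (integrableB measurableT (icos T h TI) (icos t ht tI)).
rewrite -lee_fin /Rintegral fineK; last first.
  apply: integrable_fin_num => //; apply: integrable_norm => //.
  by exact: (integrableB measurableT (icos T h TI) (icos t ht tI)).
apply: (@le_trans _ _ (\int[P]_w ((M * `|h|)%:E * drift w + eta%:E + (eta^-1)%:E * ((I w - I' w) ^+ 2)%:E))%E).
  apply: ae_ge0_le_integral => //.
  - by apply/measurable_EFinP; apply: measurableT_comp => //; apply: measurable_funB; exact: mcos.
  - by move=> w _; rewrite !adde_ge0 ?mule_ge0 ?lee_fin ?invr_ge0 ?sqr_ge0 ?(ltW eta0).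
  - by apply: emeasurable_funD; [apply: emeasurable_funD => //|]; apply: measurable_funeM.
  apply: ae_imply Iae _ => w Iw _; rewrite -addeA.
  apply: (@le_trans _ _ ((M * `|h|)%:E * drift w + `|I w - I' w|%:E)%E); last first.
    apply: leeD2l; rewrite -EFinM -EFinD lee_fin; set y := I w - I' w.
    rewrite -(ler_pM2r eta0) (_ : (eta + eta^-1 * y ^+ 2) * eta = eta ^+ 2 + y ^+ 2); last first.
      by field; rewrite gt_eqF.
    rewrite -(real_normK (num_real y)); have := sqr_ge0 (eta - `|y| / 2); have := sqr_ge0 `|y|.
    by move: `|y| => z; nra.
  by apply: le_trans Iw; rewrite lee_fin (le_trans (cos_lipschitz _ _))// opprD addrACA subrr addr0.
rewrite ge0_integralD//; last 4 first.
- by move=> w _; rewrite adde_ge0 ?mule_ge0 ?lee_fin ?(ltW eta0).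
- by apply: emeasurable_funD => //; apply: measurable_funeM.
- by move=> w _; rewrite mule_ge0 ?lee_fin ?invr_ge0 ?sqr_ge0 ?(ltW eta0).
- by apply: measurable_funeM.
rewrite ge0_integralD//; last 3 first.
- by move=> w _; rewrite mule_ge0.
- exact: measurable_funeM.
- by move=> w _; rewrite lee_fin ltW.
rewrite ge0_integralZl// ge0_integralZl//; last 2 first.
- by move=> w _; rewrite lee_fin sqr_ge0.
- by rewrite lee_fin invr_ge0 ltW.
have -> : (\int[P]_w eta%:E = eta%:E)%E.
  by transitivity (eta%:E * P setT)%E; [exact: integral_cst|rewrite probability_setT mule1].
rewrite 2!EFinD; apply: leeD; [apply: leeD => //|].
  rewrite [in leRHS]EFinM lee_wpmul2l ?lee_fin// (le_trans Edrift)// EFinM lee_wpmul2l ?lee_fin//.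
by rewrite [leRHS]EFinM [leRHS]muleC lee_wpmul2l ?lee_fin ?invr_ge0 ?(ltW eta0).
Qed.

End mild_endpoint.

Lemma bounded_integralE {R : realType} d (Y : measurableType d) (Q : probability Y R) (f : Y -> R) (M : R) :
  measurable_fun setT f -> (forall y, `|f y| <= M) ->
  (\int[Q]_y (f y)%:E = (\int[Q]_y f y)%:E)%E /\ `|\int[Q]_y f y| <= M.
Proof.
move=> mf fM; have M0 : 0 <= M by exact: le_trans (fM point).
have fi : Q.-integrable setT (EFin \o f).
  apply: (@le_integrable _ _ _ Q _ _ _ (cst M%:E)) => //; first exact/measurable_EFinP.
  - by move=> y _; rewrite /= lee_fin (ger0_norm M0).
  - exact: finite_measure_integrable_cst.
have e : (\int[Q]_y (f y)%:E = (\int[Q]_y f y)%:E)%E.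
  by rewrite /Rintegral fineK//; exact: integrable_fin_num.
split => //; rewrite -lee_fin -abse_EFin -e.
apply: (le_trans (le_abse_integral Q measurableT _)); first exact/measurable_EFinP.
apply: (@le_trans _ _ (\int[Q]_y M%:E)%E); last first.
  have -> // : (\int[Q]_y M%:E = M%:E)%E.
  by transitivity (M%:E * Q setT)%E; [exact: integral_cst|rewrite probability_setT mule1].
apply: ge0_le_integral => //.
- by apply: measurableT_comp => //; exact/measurable_EFinP.
- by move=> y _; rewrite /= lee_fin.
Qed.

Lemma weakly_continuous_cos {R : realType} {H : hilbertType R} (k : H) (th : R) :
  weakly_continuous (fun y : H => cos (dotp y k + th)).
Proof.
have dk : weakly_continuous (fun y : H => dotp y k).
  move=> y; apply: (@continuous_comp (@weak_space R H) _ _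
    (fun x : H => (fun h : H => dotp x h) : prod_topology (fun _ : H => R)) (proj k)).
    exact: initial_continuous.
  exact: proj_continuous.
move=> y; apply: (@continuous_comp (@weak_space R H) R R (fun y : H => dotp y k) (fun z => cos (z + th))).
  exact: dk.
apply: continuous_comp; last exact: continuous_cos.
by apply: continuousD; [exact: cvg_id|exact: cvg_cst].
Qed.

Section transition_measures.
Context {R : realType} {H : hilbertType R} (T : R) (DA : set H) (A : H -> H) (S : R -> H -> H) (C : H -> H).
Variables (DF : set (R * H)) (F : R -> H -> H) (Fa : R -> R -> H -> H).
Variables (X : R -> R -> H -> stoch_system H) (V : R * H -> \bar R) (p : R -> R -> H -> probability (borel H) R).
Hypothesis sH : separable H.
Hypothesis set0 : setting T DA A S C DF F.
Hypothesis cA : condA DA A S C.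
Hypothesis cB : condB T DA DF F Fa.
Hypothesis cX : approximations T S C Fa X.
Hypothesis cC : condC' T DF F X V.
Hypothesis tf : transition_family T DA A C DF F X V p.

Let T0 : 0 < T. Proof. by case: set0. Qed.
Let gen : generates DA A S. Proof. by case: set0. Qed.
Let bC : bounded_op C. Proof. by case: set0 => _ _ []. Qed.
Let Cl : linear C. Proof. by case: bC. Qed.
Let Cc : continuous C. Proof. by case: bC. Qed.
Let Cs : symmetric_op C. Proof. by case: set0 => _ _ []. Qed.
Let C0 : nonneg_op C. Proof. by case: set0 => _ _ []. Qed.
Let DFc : DF `<=` cylinder T. Proof. by case: set0 => _ _ _ []. Qed.
Let mDF : measurable (DF : set (borel_prod R H)). Proof. by case: set0 => _ _ _ []. Qed.
Let mF : measurable_fun (DF : set (borel_prod R H)) (fun z => F z.1 z.2 : borel H).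
Proof. by case: set0. Qed.
Let sa : self_adjoint DA A. Proof. by case: cA. Qed.
Let dDA : dense DA. Proof. by case: sa. Qed.
Let binv : exists B, bounded_inverse DA (fun x => - A x) B. Proof. by case: cA => _ _ _ []. Qed.
Let lV : lower_semicontinuous (V : subspace (cylinder T) -> \bar R). Proof. by case: cC. Qed.
Let mD := measurable_H0 sH lV.

(** On [DF] one has [|F_alpha| <= |F| <= V <= V^2], as [V >= 1]. Off [DF] the convention that [|F|]
    is infinite makes [V] infinite. *)
Let drift_le_weight al t y : 0 < al <= 1 -> t \in `[0, T] -> (`|Fa al t y|%:E <= weight_sqr T V (t, y))%E.
Proof.
move=> al1 tT; rewrite weight_sqrE//; have cz : cylinder T (t, y) by [].
have [_ V1 FV _] := cC; have := V1 _ cz; have := FV t y cz.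
have [Dz|Dz] := pselect (DF (t, y)); last first.
  by rewrite /normF memNset// leye_eq => /eqP -> _; rewrite expe2 mulyy leey.
rewrite /normF mem_set// => h1 h2; have [_ [_ h3 _]] := cB.
apply: (@le_trans _ _ (`|F t y|%:E)); first by rewrite lee_fin h3.
apply: (le_trans h1); rewrite expe2; move: h2; case: (V (t, y)) => [v| |] //.
by rewrite -EFinM !lee_fin => v1; rewrite ler_peMl// (le_trans ler01).
Qed.

(** Off [DF] the right side is infinite, so the bound assumed on [DF] extends to all points. *)
Let weight_propagation s : 0 <= s < T -> exists2 K, 0 < K & forall al x t, 0 < al <= 1 -> t \in `[s, T] ->
  (\int[ss_prob (X al s x)]_w weight_sqr T V (t, ss_X t w) <= K%:E * weight_sqr T V (t, x))%E.
Proof.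
move=> /[dup] sT /andP[s0 _]; have [_ _ FV /(_ s sT)[K K0 hK]] := cC; exists K => // al x t al1 tI.
have tT : t \in `[0, T] by move: tI; rewrite !in_itv/= => /andP[a ->]; rewrite (le_trans s0).
under eq_integral do rewrite weight_sqrE//.
rewrite weight_sqrE//; have [Dz|Dz] := pselect (DF (t, x)).
  by have [] := hK t x al Dz tI al1.
have := FV t x (conj tT I); rewrite /normF memNset// leye_eq => /eqP ->.
by rewrite expe2 mulyy gt0_muley ?lte_fin// leey.
Qed.

(* The martingale part of the approximations on [t, T] and their drift are
   bounded uniformly in alpha, so the estimate survives the weak limit. *)
Let endpoint_le s : 0 <= s < T -> exists2 ab : R * R, 0 <= ab.1 /\ 0 <= ab.2 &
  forall x h t th eta J, H0 T V x -> s < t < T -> DA h -> 0 < eta ->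
  (\int[lebesgue_measure]_(r in `[t, T]) weight_sqr T V (r, x) <= J%:E)%E ->
  `|\int[p s T x]_y cos (dotp y h + th) - \int[p s t x]_y cos (dotp y (adj setT (S (T - t)) h) + th)| <=
    ab.1 * `|h| * J + eta + ab.2 * `|h| ^+ 2 * (T - t) / eta.
Proof.
move=> sT; have [K K0 hK] := weight_propagation sT.
have [M M0 hM] := semigroup_bounded gen T; have [c c0 hC] := bounded_op_le bC.
exists (M * K, 24 * ((c + 1) * M) ^+ 2); first by split=> /=; rewrite mulr_ge0 ?sqr_ge0// ltW.
move=> x h t th eta J xH stT Dh eta0 hJ /=.
have [_ _ _ wk] := tf sT xH.
have wcv q k : q \in `[s, T] -> \int[ss_prob (X al s x)]_w cos (dotp (ss_X q w) k + th) @[al --> 0^'+] -->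
    \int[p s q x]_y cos (dotp y k + th).
  move=> qI; have b1 : bounded_fct (fun y : H => cos (dotp y k + th)).
    by exists 1 => y; rewrite ler_norml cos_geN1 cos_le1.
  exact: (wk q _ qI b1 (@weakly_continuous_cos _ _ k th)).
have TI : T \in `[s, T] by rewrite in_itv/= lexx ltW//; case/andP: sT.
have tI : t \in `[s, T] by case/andP: stT => a b; rewrite in_itv/= !ltW.
apply: (cvgr_to_le (cvg_norm (cvgB (wcv T h TI) (wcv t (adj setT (S (T - t)) h) tI)))).
near=> al.
have al1 : 0 < al <= 1.
  by apply/andP; split; [near: al; exact: nbhs_right_gt|near: al; apply: nbhs_right_le; exact: ltr01].
have s0T : s \in `[0, T] by case/andP: sT => a b; rewrite in_itv/= a ltW.
have [/(_ al al1)[[MG hMG] mG] _] := cB.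
have := mild_cos_le sH gen sa binv M0 c0 hM hC sT (cX x al1 s0T) hMG mG
  (measurable_weight_sqr sH lV) (@weight_sqr_ge0 _ _ T V)
  (fun q y qI => drift_le_weight y al1 qI) (ltW K0) (fun q qI => hK al x q al1 qI) stT Dh th eta0 hJ.
rewrite (_ : M * `|h| * (K * J) = M * K * `|h| * J); last by ring.
by rewrite (_ : 24 * (((c + 1) * (M * `|h|)) ^+ 2 * (T - t)) = 24 * ((c + 1) * M) ^+ 2 * `|h| ^+ 2 * (T - t)); last ring.
Unshelve. all: by end_near. Qed.

(** The three terms of [endpoint_le] are made at most [e/3] in turn: by [eta], then by [J] through
    the vanishing tail of the weight, and last by [T - t_ n] relative to the chosen [eta]. *)
Let endpoint_cvg s x h th (t_ : nat -> R) : 0 <= s < T -> H0 T V x -> DA h -> (forall n, s < t_ n < T) ->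
  t_ n @[n --> \oo] --> T ->
  \int[p s (t_ n) x]_y cos (dotp y (adj setT (S (T - t_ n)) h) + th) @[n --> \oo] -->
    \int[p s T x]_y cos (dotp y h + th).
Proof.
move=> sT xH Dh stT tT; have [[a b] /= [a0 b0] hab] := endpoint_le sT.
apply/cvgrPdist_le => e e0.
pose eta := e / 3; have eta0 : 0 < eta by rewrite divr_gt0.
have ah : 0 <= a * `|h| by exact: mulr_ge0.
have bh : 0 <= b * `|h| ^+ 2 by rewrite mulr_ge0// sqr_ge0.
pose J := eta / (a * `|h| + 1).
have J0 : 0 < J by rewrite divr_gt0// ltr_wpDl.
have t0 n : 0 <= t_ n.
  by case/andP: sT => s0 _; case/andP: (stT n) => st _; rewrite (le_trans s0)// ltW.
have [N _ hN] : \forall n \near \oo, (\int[lebesgue_measure]_(r in `[t_ n, T]) weight_sqr T V (r, x) < J%:E)%E.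
  have nb : nbhs (0%E : \bar R) [set y | (y < J%:E)%E].
    by apply: open_nbhs_nbhs; split; [exact: open_ereal_lt_ereal|rewrite /= lte_fin].
  exact: (weight_tail_cvg sH lV xH t0 tT nb).
have d0 : 0 < eta * eta / (b * `|h| ^+ 2 + 1) by rewrite divr_gt0 ?mulr_gt0// ltr_wpDl.
near=> n.
have hJ : (\int[lebesgue_measure]_(r in `[t_ n, T]) weight_sqr T V (r, x) <= J%:E)%E.
  by apply: ltW; apply: hN; near: n; exists N.
have hd : T - t_ n <= eta * eta / (b * `|h| ^+ 2 + 1).
  rewrite (le_trans (ler_norm _))//; near: n; move/cvgrPdist_le: tT; exact.
apply: (le_trans (hab x h (t_ n) th eta J xH (stT n) Dh eta0 hJ)).
have e1 : a * `|h| * J <= eta.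
  by rewrite /J mulrCA ler_piMr ?(ltW eta0)// ler_pdivrMr ?ltr_wpDl// mul1r lerDl.
have e2 : b * `|h| ^+ 2 * (T - t_ n) / eta <= eta.
  rewrite ler_pdivrMr//; apply: (le_trans (ler_wpM2l bh hd)).
  rewrite [leLHS](_ : _ = eta * eta * (b * `|h| ^+ 2 / (b * `|h| ^+ 2 + 1))); last by ring.
  by apply: ler_piMr; [rewrite mulr_ge0// ltW|rewrite ler_pdivrMr ?ltr_wpDl// mul1r lerDl].
by have := lerD e1 e2; rewrite /eta; lra.
Unshelve. all: by end_near. Qed.

Let final_wave h th : DA h -> wave_good T DA A
  (Wave (fun t => T - t) (fun _ => -1) (fun _ => h) (fun _ => 0) (fun _ => adj DA A h) th).
Proof.
move=> Dh; have [_ domE _] := sa.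
have adj0 : adj DA A 0 = 0 by apply: (adj_unique dDA) => y _; rewrite !dotp0r.
have cst0 (k : H) : C1_with T (fun _ => k) (fun _ => 0).
  by split => [| |t _]; [exact: continuous_subspaceT (fun _ => cvg_cst _)|exact: continuous_subspaceT (fun _ => cvg_cst _)|exact: is_derive_cst].
split => //=.
- split.
  + by apply: continuous_subspaceT => t; apply: cvgB; [exact: cvg_cst|exact: cvg_id].
  + by apply: continuous_subspaceT => t; exact: cvg_cst.
  + move=> t _; have -> : -1 = 0 - 1 :> R by rewrite sub0r.
    exact: is_deriveB.
- by rewrite subrr.
- by move=> t _; split => //; [rewrite domE|exists 0 => y _; rewrite !dotp0r].
- rewrite (_ : adj DA A \o (fun _ => 0) = fun _ => 0); first exact: cst0.
  by apply/funext => t /=.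
Qed.

(** Assembles the space-time identity for the measures of the family. The wave
    [(T - t) cos(<y,h> + th)] has an amplitude that does not vanish before [T], and it is divided
    out at the end. *)
Let composes_interior r s t x h th : 0 <= r -> r < s < T -> s <= t < T -> H0 T V x ->
  p r s x (H0 T V) = 1%E -> DA h ->
  composes (H0 T V) (p r s x) (p r t x) (p s t) (fun y => cos (dotp y h + th)).
Proof.
move=> r0 rsT stT xH p1 Dh.
have [rs sT] := andP rsT; have [st tT] := andP stT.
have rT : 0 <= r < T by rewrite r0 (lt_trans rs).
have s0T : 0 <= s < T by rewrite (le_trans r0 (ltW rs)).
have TI q : q < T -> T \in `[q, T] by move=> qT; rewrite in_itv/= lexx ltW.
have [[Nr [dNr MNr uNr]] cr FPr _] := tf rT xH.
have wr := weak_sol_of_FP sH T0 DFc mDF mF Cc dDA Cl rT dNr MNr (fun u Du => FPr u T Du (TI r (lt_trans rs sT))).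
have [Nf NfP] : exists Nf : H -> {finite_measure set (borel_prod R H) -> \bar R}, forall y, H0 T V y ->
    [/\ disintegration T s (Nf y) (fun q => p s q y),
        M_class T DA A C DF F s (dirac (y : borel H)) (Nf y)
      & forall N', M_class T DA A C DF F s (dirac (y : borel H)) N' -> forall E, measurable E -> N' E = Nf y E].
  suff : forall y, exists N : {finite_measure set (borel_prod R H) -> \bar R}, H0 T V y ->
    [/\ disintegration T s N (fun q => p s q y),
        M_class T DA A C DF F s (dirac (y : borel H)) N
      & forall N', M_class T DA A C DF F s (dirac (y : borel H)) N' -> forall E, measurable E -> N' E = N E].
    by move=> /choice[Nf NfP]; exists Nf.
  move=> y; have [yH|yH] := pselect (H0 T V y); last by exists Nr.
  by have [[N NP] _ _ _] := tf s0T yH; exists N.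
have ws y : H0 T V y -> weak_sol T DA A C DF F s y (Nf y).
  move=> yH; have [d1 d2 _] := NfP y yH; have [_ _ FPs _] := tf s0T yH.
  exact: (weak_sol_of_FP sH T0 DFc mDF mF Cc dDA Cl s0T d1 d2 (fun u Du => FPs u T Du (TI s sT))).
have us y (N' : {finite_measure set (borel_prod R H) -> \bar R}) : H0 T V y -> weak_sol T DA A C DF F s y N' -> forall E, measurable E -> N' E = Nf y E.
  move=> yH wN'; have [_ _ u] := NfP y yH; apply: u.
  exact: (M_class_of_weak_sol sH T0 DFc mDF mF Cc dDA Cl s0T wN').
have mNf := measurable_weak_sol sH T0 DFc mDF mF Cc dDA s0T ws us.
have mE : measurable (`[s, T]%classic `*` setT : set (borel_prod R H)) by exact: measurableX.
have [mu muE] : exists mu : {finite_measure set (borel_prod R H) -> \bar R},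
    forall B, measurable B -> mu B = Nr (B `&` (`[s, T]%classic `*` setT)).
  have [|mu hmu] := @finite_measure_ex R _ _ (mrestr Nr mE).
    rewrite /= /mrestr setTI; apply: le_lt_trans (_ : (Nr setT < +oo)%E).
      by apply: le_measure => //; exact/mem_set.
    by have := fin_num_measure Nr setT measurableT; rewrite ge0_fin_numE.
  by exists mu => B _; exact: hmu.
have sI : s \in `[r, T] by rewrite in_itv/= !ltW.
have ev := weak_evo_of_FP sH T0 DFc mDF mF Cc dDA Cl r0 rsT dNr wr muE (fun u Du => FPr u s Du sI).
have uwr (N' : {finite_measure set (borel_prod R H) -> \bar R}) : weak_sol T DA A C DF F r x N' -> forall E, measurable E -> N' E = Nr E.
  by move=> wN'; apply: uNr; exact: (M_class_of_weak_sol sH T0 DFc mDF mF Cc dDA Cl rT wN').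
have ck := chapman_kolmogorov_spacetime sH T0 DFc mDF mF Cc dDA Cl Cs C0 r0 rsT wr uwr muE ev mD p1 ws mNf.
have tw := test_fun_wave C F (final_wave th Dh).
have [m1 m2] := ck_test_fun sH T0 DFc mDF mF Cc r0 rsT stT dNr wr muE mD
  (fun y yH => let: And3 d _ _ := NfP y yH in d) ws mNf ck tw (cr _ (test_fun_D_L0 tw))
  (fun y yH => let: And4 _ c _ _ := tf s0T yH in c _ (test_fun_D_L0 tw)).
have Tt : T - t != 0 by rewrite subr_eq0 gt_eqF.
have mcos : measurable_fun setT ((fun y => cos (dotp y h + th)) : borel H -> R).
  exact: (measurable_borel_continuous (@continuous_cos_dotp _ _ h th)).
have cT : composes (H0 T V) (p r s x) (p r t x) (p s t) (fun y => (T - t) * cos (dotp y h + th)).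
  split => //; first exact: measurable_funM.
  exists (T - t) => y; rewrite normrM ger0_norm ?subr_ge0 ?(ltW tT)// ler_piMr ?subr_ge0 ?(ltW tT)//.
  by rewrite ler_norml cos_geN1 cos_le1.
have := composesZ mD (T - t)^-1 cT.
by congr composes; apply/funext => y; rewrite mulrA mulVf// mul1r.
Qed.

(** The identity at [T] is the limit of those at [t_ n] for the moving directions [S(T - t_ n)^* h];
    these are covered at interior times by density of [DA]. *)
Let composes_endpoint r s x h th : 0 <= r -> r < s < T -> H0 T V x ->
  p r s x (H0 T V) = 1%E -> DA h ->
  composes (H0 T V) (p r s x) (p r T x) (p s T) (fun y => cos (dotp y h + th)).
Proof.
move=> r0 rsT xH p1 Dh; have [rs sT] := andP rsT.
have rT : 0 <= r < T by rewrite r0 (lt_trans rs).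
have s0T : 0 <= s < T by rewrite (le_trans r0 (ltW rs)).
have Ts : 0 < T - s by rewrite subr_gt0.
(* Times tending to [T]; the factor [1/2] keeps already the first one above [s]. *)
pose t_ n := T - (T - s) / 2 * harmonic n.
have stT n : s < t_ n < T.
  have h0 : 0 < harmonic n :> R by rewrite /harmonic invr_gt0.
  have h1 : harmonic n <= 1 :> R by rewrite /harmonic invf_le1// ler1n.
  have := mulr_gt0 Ts h0; have : (T - s) * harmonic n <= T - s by rewrite ler_piMr// ltW.
  rewrite /t_ mulrAC; move: ((T - s) * harmonic n) Ts => y *; apply/andP; split; lra.
have tT : t_ n @[n --> \oo] --> T.
  rewrite -[X in _ --> X]subr0; apply: cvgB; first exact: cvg_cst.
  rewrite -(mulr0 ((T - s) / 2)); apply: cvgM; first exact: cvg_cst.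
  exact: cvg_harmonic.
pose f_ n (y : H) := cos (dotp y (adj setT (S (T - t_ n)) h) + th).
have cn n : composes (H0 T V) (p r s x) (p r (t_ n) x) (p s (t_ n)) (f_ n).
  apply: (composes_trig_dense mD dDA) => k th' Dk; apply: composes_interior => //.
  by have /andP[a b] := stT n; rewrite (ltW a).
have mf k : measurable_fun setT ((fun y => cos (dotp y k + th)) : borel H -> R).
  exact: (measurable_borel_continuous (@continuous_cos_dotp _ _ k th)).
have c1 k y : `|cos (dotp (y : H) k + th)| <= 1 by rewrite ler_norml cos_geN1 cos_le1.
pose a_ n (y : borel H) := \int[p s (t_ n) y]_z f_ n z.
pose a (y : borel H) := \int[p s T y]_z cos (dotp z h + th).
have cva y : H0 T V y -> a_ n y @[n --> \oo] --> a y.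
  by move=> yH; exact: endpoint_cvg.
have cvaE y : H0 T V y -> (a_ n y)%:E @[n --> \oo] --> (a y)%:E.
  by move=> yH; apply: cvg_EFin; [exact: nearW|exact: cva].
have ma_ n : measurable_fun (H0 T V : set (borel H)) (a_ n) by have [] := cn n.
have ma : measurable_fun (H0 T V : set (borel H)) a.
  exact: (@measurable_fun_cvg _ (borel H) R (H0 T V) a_).
split => //; first by exists 1 => y; exact: c1.
have cvr : (\int[p r (t_ n) x]_y f_ n y) @[n --> \oo] --> \int[p r T x]_y cos (dotp y h + th).
  apply: endpoint_cvg => // n; have /andP[b ->] := stT n; by rewrite (lt_trans rs).
have [|||||_ _ cvi] := @dominated_convergence _ (borel H) R (p r s x) (H0 T V) mD
  (fun n y => (a_ n y)%:E) (fun y => (a y)%:E) (cst 1%:E).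
- by move=> n; exact/measurable_EFinP.
- exact/measurable_EFinP.
- by apply: aeW => y yH; exact: cvaE.
- exact: finite_measure_integrable_cst.
- apply: aeW => y n _; rewrite /= lee_fin.
  by have [] := bounded_integralE (p s (t_ n) y) (mf (adj setT (S (T - t_ n)) h)) (c1 _).
have cvi' : (\int[p r s x]_(y in H0 T V) (a_ n y)%:E)%E @[n --> \oo] --> (\int[p r T x]_y cos (dotp y h + th))%:E.
  rewrite (_ : (fun n => _) = (fun n => (\int[p r (t_ n) x]_y f_ n y)%:E)).
    by apply: cvg_EFin => //; exact: nearW.
  by apply/funext => n; have [] := cn n.
exact: (cvg_unique _ cvi cvi').
Qed.

Lemma transition_composes r t s x (f : borel H -> R) : 0 <= r -> r < t -> t <= T ->
  H0 T V x -> r < s < t -> p r s x (H0 T V) = 1%E -> measurable_fun setT f ->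
  (exists M, forall y, `|f y| <= M) -> composes (H0 T V) (p r s x) (p r t x) (p s t) f.
Proof.
move=> r0 rt tT xH /andP[rs st] p1 mf bf; have sT := lt_le_trans st tT.
have rsT : r < s < T by rewrite rs.
apply: (composes_of_trig mD sH) mf bf => h th; apply: (composes_trig_dense mD dDA) => {}h {}th Dh.
move: tT; rewrite le_eqVlt => /predU1P[->|tT]; first exact: composes_endpoint.
by apply: composes_interior; rewrite ?(ltW st).
Qed.

End transition_measures.

Theorem theorem3p8 (R : realType) (H : hilbertType R) (T : R)
    (DA : set H) (A : H -> H) (S : R -> H -> H) (C : H -> H)
    (DF : set (R * H)) (F : R -> H -> H) (Fa : R -> R -> H -> H)
    (X : R -> R -> H -> stoch_system H) (V : R * H -> \bar R)
    (p : R -> R -> H -> probability (borel H) R) :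
  separable H ->
  setting T DA A S C DF F ->
  condA DA A S C ->
  condB T DA DF F Fa ->
  approximations T S C Fa X ->
  condC' T DF F X V ->
  condD T DF F ->
  (forall h al, DA h -> 0 < al <= 1 ->
     {within cylinder T, continuous (fun z : R * H => dotp h (Fa al z.1 z.2))}) ->
  (forall t x, DF (t, x) -> ((`|x| ^+ 2)%:E <= V (t, x))%E) ->
  transition_family T DA A C DF F X V p ->
  forall r t s x, 0 <= r -> r < t -> t <= T -> H0 T V x -> r < s < t ->
    p r s x (H0 T V) = 1%E ->
    forall f : borel H -> R, measurable_fun setT f -> bounded_fct f ->
      measurable_fun (H0 T V : set (borel H))
        (fun x' : borel H => \int[p s t x']_y (f y)%:E)%E /\
      (\int[p r s x]_(x' in H0 T V) \int[p s t x']_y (f y)%:E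
       = \int[p r t x]_y (f y)%:E)%E.
Proof.
move=> sH set0 cA cB cX cC _ _ _ tf r t s x r0 rt tT xH rst p1 f mf bf.
have [_ [M fM] m e] := transition_composes sH set0 cA cB cX cC tf r0 rt tT xH rst p1 mf bf.
have E (Q : probability (borel H) R) : (\int[Q]_y (f y)%:E = (\int[Q]_y f y)%:E)%E.
  by have [] := bounded_integralE Q mf fM.
rewrite E -e; split.
  by under eq_fun do rewrite E; exact/measurable_EFinP.
by apply: eq_integral => x' _; rewrite E.
Qed.
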